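(* Let $m,r\in\mathbb{N}$ and let $(d,f,\mathbf{T})\in\mathcal{N}^{m,r}$ (with associated $p,q\in\mathbb{N}$, $h\ge 0$). Let $y^0\in C^{r-1}([-h,0],\mathbb{R}^m)$, and let $y_{\rm ref}\in W^{r,\infty}(\mathbb{R}_{\ge 0},\mathbb{R}^m)$, with associated parameter $\hat r\in\{1,\dots,r\}$, be arbitrary. Choose a triple $(\alpha,N,\varphi)$ of funnel control design parameters. Put $e(t)=y(t)-y_{\rm ref}(t)$ and $$\mathbf{e}(t)=\big(e(t),\dot e(t),\dots,e^{(\hat r-1)}(t),y^{(\hat r)}(t),\dots,y^{(r-1)}(t)\big)\in\mathbb{R}^{rm}.$$ Assume that the instantaneous vector $\mathbf{e}(t)$ is available for feedback and that $\varphi(0)\,\mathbf{e}(0)\in\mathcal{D}_r$, where $\mathbf{e}(0)$ is computed from the initial data $y^0$ (this is trivially satisfied if $\varphi(0)=0$). Then the funnel control $$u(t)=(N\circ\alpha)(\|w(t)\|^2)\,w(t),\qquad w(t)=\rho_r\big(\varphi(t)\mathbf{e}(t)\big),$$ applied to $$y^{(r)}(t)=f\big(d(t),\mathbf{T}(y,\dot y,\dots,y^{(r-1)})(t),u(t)\big),\qquad y|_{[-h,0]}=y^0,$$ yields an initial-value problem which has a solution, every solution can be maximally extended, and every maximal solution $y:[-h,\omega)\to\mathbb{R}^m$ has the following properties: (i) $\omega=\infty$ (global existence); (ii) $u\in L^\infty(\mathbb{R}_{\ge 0},\mathbb{R}^m)$ and $y\in W^{r,\infty}([-h,\infty),\mathbb{R}^m)$;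 (iii) the tracking error $e:\mathbb{R}_{\ge 0}\to\mathbb{R}^m$ evolves in the funnel $\mathcal{F}_\varphi=\{(t,\zeta)\in\mathbb{R}_{\ge 0}\times\mathbb{R}^m : \varphi(t)\|\zeta\|<1\}$ and is uniformly bounded away from the funnel boundary $\partial\mathcal{F}_\varphi=\{(t,\zeta)\in\mathbb{R}_{\ge 0}\times\mathbb{R}^m : \varphi(t)\|\zeta\|=1\}$, in the sense that there exists $\varepsilon\in(0,1)$ such that $\varphi(t)\|e(t)\|\le\varepsilon$ for all $t\ge 0$; (iv) if $\hat r=r$ and $\varphi$ is unbounded, then $e^{(k)}(t)\to 0$ as $t\to\infty$ for $k=0,\dots,r-1$; (v) if the system is known to satisfy the negative-definite (respectively, positive-definite) high-gain property, then the feedback may be simplified by substituting the identity map $s\mapsto s$ (respectively, the map $s\mapsto -s$) for $N$, and assertions (i)–(iv) remain valid.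
   Context: **Notation.** $\mathbb{R}_{\ge 0}=[0,\infty)$; $\|\cdot\|$ and $\langle\cdot,\cdot\rangle$ are the Euclidean norm and inner product. For an interval $I$, $L^\infty(I,\mathbb{R}^n)$ is the space of measurable essentially bounded functions, $L^\infty_{\rm loc}(I,\mathbb{R}^n)$ the set of measurable locally essentially bounded functions, and $W^{k,\infty}(I,\mathbb{R}^n)$ the Sobolev space of functions $g:I\to\mathbb{R}^n$ with $k$-th order weak derivative $g^{(k)}$ and $g,g^{(1)},\dots,g^{(k)}\in L^\infty(I,\mathbb{R}^n)$. $C^k(V,\mathbb{R}^n)$ is the set of $k$-times continuously differentiable functions, $C=C^0$. **Operator class $\mathbb{T}^{n,q}_h$.** For $n,q\in\mathbb{N}$, $h\ge 0$, this is the set of operators $\mathbf{T}:C([-h,\infty),\mathbb{R}^n)\to L^\infty_{\rm loc}(\mathbb{R}_{\ge 0},\mathbb{R}^q)$ such that: - (TP1) (causality) for all $\zeta,\theta\in C([-h,\infty),\mathbb{R}^n)$ and all $t\ge 0$: $\zeta|_{[-h,t]}=\theta|_{[-h,t]}$ implies $\mathbf{T}(\zeta)|_{[0,t]}=\mathbf{T}(\theta)|_{[0,t]}$; - (TP2) (local Lipschitz) for each $t\ge 0$ and all $\xi\in C([-h,t],\mathbb{R}^n)$ there exist $c_0,\delta,\tau>0$ such that, for all $\zeta_1,\zeta_2\in C([-h,\infty),\mathbb{R}^n)$ with $\zeta_i|_{[-h,t]}=\xi$ and $\|\zeta_i(s)-\xi(t)\|<\delta$ for all $s\in[t,t+\tau]$,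 $i=1,2$, one has $\operatorname{ess\,sup}_{s\in[t,t+\tau]}\|\mathbf{T}(\zeta_1)(s)-\mathbf{T}(\zeta_2)(s)\|\le c_0\sup_{s\in[t,t+\tau]}\|\zeta_1(s)-\zeta_2(s)\|$; - (TP3) (BIBO) for each $c_1>0$ there exists $c_2>0$ such that, for all $\zeta\in C([-h,\infty),\mathbb{R}^n)$: $\sup_{t\in[-h,\infty)}\|\zeta(t)\|<c_1$ implies $\operatorname{ess\,sup}_{t\ge 0}\|\mathbf{T}(\zeta)(t)\|<c_2$. **High-gain property.** $f\in C(\mathbb{R}^p\times\mathbb{R}^q\times\mathbb{R}^m,\mathbb{R}^m)$ has the high-gain property if there exists $v^*\in(0,1)$ such that, for every compact $K_p\subset\mathbb{R}^p$ and compact $K_q\subset\mathbb{R}^q$, the continuous function $$\chi:\mathbb{R}\to\mathbb{R},\quad s\mapsto\min\{\langle v,f(\delta,z,-sv)\rangle : (\delta,z)\in K_p\times K_q,\ v\in\mathbb{R}^m,\ v^*\le\|v\|\le 1\}$$ satisfies $\sup_{s\in\mathbb{R}}\chi(s)=\infty$. If there exists $v^*\in(0,1)$ such that, for every such pair $(K_p,K_q)$, $\sup_{s>0}\chi(s)=\infty$ (respectively, for every such pair, $\sup_{s<0}\chi(s)=\infty$), then $f$ has the negative-definite (respectively, positive-definite) high-gain property; the system is said to satisfy the property if $f$ has it. **System class $\mathcal{N}^{m,r}$.** $(d,f,\mathbf{T})\in\mathcal{N}^{m,r}$ means that for some $p,q\in\mathbb{N}$ and $h\ge 0$: $d\in L^\infty(\mathbb{R}_{\ge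 0},\mathbb{R}^p)$, $f\in C(\mathbb{R}^p\times\mathbb{R}^q\times\mathbb{R}^m,\mathbb{R}^m)$ has the high-gain property, and $\mathbf{T}\in\mathbb{T}^{rm,q}_h$. **Funnel functions.** $\Phi$ is the set of locally absolutely continuous functions $\varphi:\mathbb{R}_{\ge 0}\to\mathbb{R}_{\ge 0}$ such that $\varphi(t)>0$ for all $t>0$, $\liminf_{t\to\infty}\varphi(t)>0$, and there exists $c>0$ with $|\dot\varphi(t)|\le c(1+\varphi(t))$ for almost all $t\ge 0$. **Funnel control design parameters** (for given $r,\hat r$): a triple $(\alpha,N,\varphi)$ where $\varphi\in\Phi$, and $\varphi$ is bounded if $\hat r<r$; $N\in C(\mathbb{R}_{\ge 0},\mathbb{R})$ is a surjection; $\alpha\in C^1([0,1),[1,\infty))$ is a bijection. **Maps $\rho_k$.** Let $\mathcal{B}=\{w\in\mathbb{R}^m:\|w\|<1\}$ and $\gamma:\mathcal{B}\to\mathbb{R}^m$, $w\mapsto\alpha(\|w\|^2)w$. Set $\mathcal{D}_1=\mathcal{B}$, $\rho_1:\mathcal{D}_1\to\mathcal{B}$, $\rho_1(\eta_1)=\eta_1$, and recursively for $k=2,\dots,r$ $$\mathcal{D}_k=\{(\eta_1,\dots,\eta_k)\in\mathbb{R}^{km}: (\eta_1,\dots,\eta_{k-1})\in\mathcal{D}_{k-1},\ \eta_k+\gamma(\rho_{k-1}(\eta_1,\dots,\eta_{k-1}))\in\mathcal{B}\},$$ $$\rho_k:\mathcal{D}_k\to\mathcal{B},\quad \rho_k(\eta_1,\dots,\eta_k)=\eta_k+\gamma(\rho_{k-1}(\eta_1,\dots,\eta_{k-1})).$$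 **Solutions.** With $e(t)=y(t)-y_{\rm ref}(t)$ and $\mathbf{e}(t)=\big(e(t),\dot e(t),\dots,e^{(\hat r-1)}(t),y^{(\hat r)}(t),\dots,y^{(r-1)}(t)\big)$, a solution of the closed-loop initial-value problem on $[-h,\omega)$, $\omega\in(0,\infty]$, is a function $y\in C^{r-1}([-h,\omega),\mathbb{R}^m)$ with $y|_{[-h,0]}=y^0$ such that $y^{(r-1)}|_{[0,\omega)}$ is locally absolutely continuous, $\varphi(t)\mathbf{e}(t)\in\mathcal{D}_r$ for all $t\in[0,\omega)$ (so that $u$ is well defined), and the differential equation $y^{(r)}(t)=f\big(d(t),\mathbf{T}(y,\dot y,\dots,y^{(r-1)})(t),u(t)\big)$ with $u(t)=(N\circ\alpha)(\|w(t)\|^2)\,w(t)$, $w(t)=\rho_r\big(\varphi(t)\mathbf{e}(t)\big)$, holds for almost all $t\in[0,\omega)$. It is maximal if it has no right extension that is also a solution. When $\omega<\infty$, $\mathbf{T}(x)$ for $x=(y,\dots,y^{(r-1)})\in C([-h,\omega),\mathbb{R}^{rm})$ is understood by causality: for each $\tau\in[0,\omega)$, $\mathbf{T}(x)|_{[0,\tau]}:=\mathbf{T}(x_\tau)|_{[0,\tau]}$, where $x_\tau(t)=x(t)$ for $t\in[-h,\tau]$ and $x_\tau(t)=x(\tau)$ for $t>\tau$. If $h=0$, the initial data are understood as prescribed values of $y(0),\dot y(0),\dots,y^{(r-1)}(0)$.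
   Formalization: As written, (ii) and (iv) fail. (ii): y∈W^{r,∞}([-h,∞)) is claimed only if y^0∈W^{r,∞}([-h,0]); always y∈W^{r,∞}(R≥0) and y∈W^{r-1,∞}([-h,∞)). (iv): for unbounded φ, e^{(k)}→0 as φ(t)→∞, hence as t→∞ if φ(t)→∞. *)

(* Defs.v *)
From HB Require Import structures.
From mathcomp Require Import all_boot all_order all_algebra.
From mathcomp Require Import all_classical all_reals all_analysis.
From mathcomp Require Import ess_sup_inf.

Set Implicit Arguments.
Unset Strict Implicit.
Unset Printing Implicit Defensive.

Import Order.TTheory GRing.Theory Num.Theory.
Import numFieldNormedType.Exports.

Local Open Scope classical_set_scope.
Local Open Scope ring_scope.

(** Functions on an interval [I] are total functions [R -> _] of which only the
    values on [I] matter. The library norm [`|v|] of ['rV[R]_n] is the sup norm;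
    it is used only for topological notions (limits, continuity, compactness,
    absolute continuity), which are the same for all norms of R^n. The Euclidean
    norm is [enorm]. *)

Section Vectors.
Context {R : realType}.

Definition dotp n (u v : 'rV[R]_n) : R := \sum_i u 0 i * v 0 i.

Definition enorm n (v : 'rV[R]_n) : R := Num.sqrt (dotp v v).

End Vectors.

Section Derivatives.
Context {R : realType} {V : normedModType R}.

(** Difference quotients are restricted to [D], so that derivatives at an
    endpoint belonging to [D] are one-sided. If [D] is a single point, the limit
    is along the trivial filter and any [l] is accepted. *)
Definition has_derivative_in (D : set R) (g : R -> V) (x : R) (l : V) : Prop :=
  (s - x)^-1 *: (g s - g x) @[s --> within D x^'] --> l.

Definition derive_in (D : set R) (g : R -> V) : R -> V :=
  fun x => lim ((s - x)^-1 *: (g s - g x) @[s --> within D x^']).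

Definition derive_in_n (D : set R) (k : nat) (g : R -> V) : R -> V :=
  iter k (derive_in D) g.

Definition C_class (D : set R) (k : nat) (g : R -> V) : Prop :=
  (forall i, (i <= k)%N -> {within D, continuous (derive_in_n D i g)}) /\
  (forall i, (i < k)%N -> forall x, D x ->
     has_derivative_in D (derive_in_n D i g) x (derive_in_n D i.+1 g x)).

Definition absolutely_continuous (a b : R) (g : R -> V) : Prop :=
  forall eps : R, 0 < eps -> exists2 delta : R, 0 < delta &
  forall (n : nat) (u v : nat -> R),
    (forall i, (i < n)%N -> [/\ a <= u i, u i <= v i & v i <= b]) ->
    trivIset `I_n (fun i => `]u i, v i[%classic) ->
    \sum_(i < n) (v i - u i) < delta ->
    \sum_(i < n) `|g (v i) - g (u i)| < eps.

Definition locally_absolutely_continuous (D : set R) (g : R -> V) : Prop :=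
  forall a b : R, a <= b -> `[a, b]%classic `<=` D -> absolutely_continuous a b g.

End Derivatives.

Section LebesgueSobolev.
Context {R : realType}.
Local Notation mu := (@lebesgue_measure R).

Definition vmeasurable n (I : set R) (g : R -> 'rV[R]_n) : Prop :=
  forall j, measurable_fun I (fun t => g t 0 j).

(** Extension by 0 outside [I] does not change the essential supremum of the
    nonnegative function [enorm \o g]. *)
Definition ess_sup_norm n (I : set R) (g : R -> 'rV[R]_n) : \bar R :=
  ess_sup mu ((fun t => (enorm (g t))%:E) \_ I).

Definition sup_norm n (I : set R) (g : R -> 'rV[R]_n) : \bar R :=
  ereal_sup [set (enorm (g t))%:E | t in I].

(** Elements of L^oo are given by Borel measurable representatives; every
    Lebesgue measurable function has one. *)
Definition Linfty n (I : set R) (g : R -> 'rV[R]_n) : Prop :=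
  vmeasurable I g /\ (ess_sup_norm I g < +oo)%E.

Definition Linfty_loc n (I : set R) (g : R -> 'rV[R]_n) : Prop :=
  vmeasurable I g /\
  forall a b : R, `[a, b]%classic `<=` I -> (ess_sup_norm `[a, b] g < +oo)%E.

Definition test_function (I : set R) (theta : R -> R) : Prop :=
  (forall (k : nat) (x : R), derivable (theta^`(k))%classic x 1) /\
  (exists a b : R, `[a, b]%classic `<=` I° /\
     forall x : R, ~ `[a, b]%classic x -> theta x = 0).

Definition weak_derivative n (I : set R) (k : nat) (g G : R -> 'rV[R]_n) : Prop :=
  forall theta, test_function I theta -> forall j,
    \int[mu]_(x in I) (g x 0 j * (theta^`(k))%classic x) =
    (-1) ^+ k * \int[mu]_(x in I) (G x 0 j * theta x).

Definition Sobolev_infty n (I : set R) (k : nat) (g : R -> 'rV[R]_n) : Prop :=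
  exists G : nat -> R -> 'rV[R]_n, G 0%N = g /\
    forall i, (i <= k)%N -> Linfty I (G i) /\ weak_derivative I i g (G i).

End LebesgueSobolev.

Section SystemClass.
Context {R : realType}.
Local Notation mu := (@lebesgue_measure R).

(** The values of an operator matter only up to equality almost everywhere. *)
Section OperatorClass.
Context {n q : nat} (h : R) (T : (R -> 'rV[R]_n) -> (R -> 'rV[R]_q)).
Local Notation admissible zeta := {within `[- h, +oo[, continuous zeta}.

Definition causal : Prop :=
  forall zeta theta : R -> 'rV[R]_n, admissible zeta -> admissible theta ->
  forall t : R, 0 <= t -> {in `[- h, t], zeta =1 theta} ->
  {ae mu, forall s, s \in `[0, t] -> T zeta s = T theta s}.

Definition locally_Lipschitz_operator : Prop :=
  forall t : R, 0 <= t ->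
  forall xi : R -> 'rV[R]_n, {within `[- h, t], continuous xi} ->
  exists c0 delta tau : R, [/\ 0 < c0, 0 < delta, 0 < tau &
    forall zeta1 zeta2 : R -> 'rV[R]_n, admissible zeta1 -> admissible zeta2 ->
    {in `[- h, t], zeta1 =1 xi} -> {in `[- h, t], zeta2 =1 xi} ->
    {in `[t, t + tau], forall s, enorm (zeta1 s - xi t) < delta} ->
    {in `[t, t + tau], forall s, enorm (zeta2 s - xi t) < delta} ->
    (ess_sup_norm `[t, (t + tau)%R] (fun s => T zeta1 s - T zeta2 s)%R <=
     c0%:E * sup_norm `[t, (t + tau)%R] (fun s => zeta1 s - zeta2 s)%R)%E].

Definition BIBO : Prop :=
  forall c1 : R, 0 < c1 -> exists2 c2 : R, 0 < c2 &
  forall zeta : R -> 'rV[R]_n, admissible zeta ->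
  (sup_norm `[(- h)%R, +oo[ zeta < c1%:E)%E ->
  (ess_sup_norm `[0%R, +oo[ (T zeta) < c2%:E)%E.

Definition operator_class : Prop :=
  [/\ forall zeta : R -> 'rV[R]_n, admissible zeta ->
        Linfty_loc `[0, +oo[ (T zeta),
      causal, locally_Lipschitz_operator & BIBO].

End OperatorClass.

(** [chi] is the minimum over a nonempty compact set, expressed as [inf]. *)
Definition chi (p q m : nat) (f : 'rV[R]_p * 'rV[R]_q * 'rV[R]_m -> 'rV[R]_m)
    (vstar : R) (Kp : set 'rV[R]_p) (Kq : set 'rV[R]_q) (s : R) : R :=
  inf [set c | exists delta z v, [/\ Kp delta, Kq z, vstar <= enorm v <= 1 &
                                   c = dotp v (f (delta, z, - s *: v))]].

(** The compact sets are required to be nonempty: otherwise the minimum [chi]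
    does not exist (and [inf set0 = 0] would make the property always fail). *)
Definition high_gain_on (S : set R) (p q m : nat)
    (f : 'rV[R]_p * 'rV[R]_q * 'rV[R]_m -> 'rV[R]_m) : Prop :=
  exists2 vstar : R, 0 < vstar < 1 &
  forall Kp Kq, compact Kp -> Kp !=set0 -> compact Kq -> Kq !=set0 ->
    ereal_sup [set (chi f vstar Kp Kq s)%:E | s in S] = +oo%E.

Definition high_gain p q m f := @high_gain_on setT p q m f.
Definition negative_definite_high_gain p q m f := @high_gain_on `]0, +oo[ p q m f.
Definition positive_definite_high_gain p q m f := @high_gain_on `]-oo, 0[ p q m f.

Definition system_class (m r p q : nat) (h : R) (d : R -> 'rV[R]_p)
    (f : 'rV[R]_p * 'rV[R]_q * 'rV[R]_m -> 'rV[R]_m)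
    (T : (R -> 'rV[R]_(r * m)) -> (R -> 'rV[R]_q)) : Prop :=
  [/\ (0 < p)%N /\ (0 < q)%N, 0 <= h, Linfty `[0, +oo[ d,
      continuous f /\ high_gain f & operator_class h T].

End SystemClass.

Section DesignParameters.
Context {R : realType}.
Local Notation mu := (@lebesgue_measure R).

Definition bounded_gain (phi : R -> R) : Prop :=
  exists M : R, forall t : R, 0 <= t -> phi t <= M.

Definition funnel_function (phi : R -> R) : Prop :=
  [/\ forall t : R, 0 <= t -> 0 <= phi t,
      locally_absolutely_continuous `[0, +oo[ phi,
      forall t : R, 0 < t -> 0 < phi t,
      (0 < limf_einf (fun t => (phi t)%:E) (@pinfty_nbhs R))%E &
      exists2 c : R, 0 < c &
        {ae mu, forall t, 0 <= t -> `|(phi^`())%classic t| <= c * (1 + phi t)}].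

Definition design_parameters (r rhat : nat) (alpha N phi : R -> R) : Prop :=
  [/\ funnel_function phi,
      (rhat < r)%N -> bounded_gain phi,
      {within `[0, +oo[, continuous N} /\ set_surj `[0, +oo[ setT N &
      C_class `[0, 1[ 1 alpha /\ set_bij `[0, 1[ `[1, +oo[ alpha].

Definition gamma (alpha : R -> R) m (w : 'rV[R]_m) : 'rV[R]_m :=
  alpha (enorm w ^+ 2) *: w.

(** For [k >= 1], [rho alpha k eta] is rho_k(eta_1, ..., eta_k) and
    [in_D alpha k eta] is (eta_1, ..., eta_k) \in D_k, where eta_i is
    [eta i.-1]; the case [k = 0] is a dummy. *)
Fixpoint rho (alpha : R -> R) m (k : nat) (eta : nat -> 'rV[R]_m) : 'rV[R]_m :=
  if k is k'.+1 then
    if k' is 0%N then eta 0%N else eta k' + gamma alpha (rho alpha k' eta)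
  else 0.

Fixpoint in_D (alpha : R -> R) m (k : nat) (eta : nat -> 'rV[R]_m) : Prop :=
  if k is k'.+1 then in_D alpha k' eta /\ enorm (rho alpha k'.+1 eta) < 1
  else True.

End DesignParameters.

Section ClosedLoop.
Context {R : realType} {m r p q : nat} (h : R) (d : R -> 'rV[R]_p)
  (f : 'rV[R]_p * 'rV[R]_q * 'rV[R]_m -> 'rV[R]_m)
  (T : (R -> 'rV[R]_(r * m)) -> (R -> 'rV[R]_q))
  (y0 : nat -> R -> 'rV[R]_m) (yref : R -> 'rV[R]_m) (rhat : nat)
  (alpha N phi : R -> R).
Local Notation mu := (@lebesgue_measure R).

(** The initial function y^0 \in C^(r-1)([-h,0]) is given together with its
    derivatives, [y0 i] being the [i]-th one. For [h > 0] these are determined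
    by [y0 0]; for [h = 0] the derivative condition is void and the [y0 i 0],
    [i < r], are arbitrary prescribed values. *)
Definition initial_data : Prop :=
  (forall i, (i < r)%N -> {within `[- h, 0], continuous (y0 i)}) /\
  (forall i, (i.+1 < r)%N -> forall t : R, t \in `[- h, 0] ->
     has_derivative_in `[- h, 0] (y0 i) t (y0 i.+1 t)).

(** Block [k] of the vector bold-e(t), the outputs and their derivatives being
    given by [Y]. *)
Definition error_blocks (Y : nat -> R -> 'rV[R]_m) (t : R) (k : nat) : 'rV[R]_m :=
  if (k < rhat)%N then Y k t - derive_in_n `[0, +oo[ k yref t else Y k t.

Definition initially_in_funnel : Prop :=
  in_D alpha r (fun k => phi 0 *: error_blocks y0 0 k).

Definition time_domain (omega : \bar R) : set R :=
  [set t | - h <= t /\ (t%:E < omega)%E].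

Definition jet (omega : \bar R) (y : R -> 'rV[R]_m) : nat -> R -> 'rV[R]_m :=
  fun k => derive_in_n (time_domain omega) k y.

Definition state (omega : \bar R) (y : R -> 'rV[R]_m) : R -> 'rV[R]_(r * m) :=
  fun t => mxvec (\matrix_(i < r) jet omega y i t).

Definition scaled_error (omega : \bar R) (y : R -> 'rV[R]_m) (t : R) :
    nat -> 'rV[R]_m :=
  fun k => phi t *: error_blocks (jet omega y) t k.

Definition control (omega : \bar R) (y : R -> 'rV[R]_m) (t : R) : 'rV[R]_m :=
  let w := rho alpha r (scaled_error omega y t) in
  N (alpha (enorm w ^+ 2)) *: w.

(** In the last clause, [fun s => state omega y (Num.min s tau)] is the function
    x_tau by which T(x) is defined on [0, tau]. For [omega = +oo] this agrees
    a.e. with T(x) itself, by causality. *)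
Definition is_solution (omega : \bar R) (y : R -> 'rV[R]_m) : Prop :=
  (0 < omega)%E /\
  [/\ C_class (time_domain omega) r.-1 y,
      forall i, (i < r)%N -> forall t : R, t \in `[- h, 0] ->
        jet omega y i t = y0 i t,
      locally_absolutely_continuous [set t : R | 0 <= t /\ (t%:E < omega)%E]
        (jet omega y r.-1),
      forall t : R, 0 <= t -> (t%:E < omega)%E ->
        in_D alpha r (scaled_error omega y t) &
      forall tau : R, 0 <= tau -> (tau%:E < omega)%E ->
        {ae mu, forall t, t \in `[0, tau] ->
          jet omega y r t =
          f (d t, T (fun s => state omega y (Num.min s tau)) t, control omega y t)}].

Definition extends (omega omega' : \bar R) (y y' : R -> 'rV[R]_m) : Prop :=
  forall t, time_domain omega t -> y' t = y t.

Definition is_maximal_solution (omega : \bar R) (y : R -> 'rV[R]_m) : Prop :=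
  is_solution omega y /\
  forall (omega' : \bar R) (y' : R -> 'rV[R]_m),
    (omega < omega')%E -> is_solution omega' y' ->
    ~ extends omega omega' y y'.

Definition funnel : set (R * 'rV[R]_m) :=
  [set tz | 0 <= tz.1 /\ phi tz.1 * enorm tz.2 < 1].

Definition error_derivative (y : R -> 'rV[R]_m) (k : nat) : R -> 'rV[R]_m :=
  derive_in_n `[0, +oo[ k (fun t => y t - yref t).

Definition prop_global (omega : \bar R) : Prop := omega = +oo%E.

(** [y \in W^(r,oo)([-h,oo))] constrains the initial function: it fails for every
    solution if [y0] is merely C^(r-1) with [y0 r.-1] not Lipschitz on [-h,0].
    Hence the last clause is conditional on the regularity of [y0]. Its premise
    is void if [h = 0]. *)
Definition prop_bounded (omega : \bar R) (y : R -> 'rV[R]_m) : Prop :=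
  [/\ Linfty `[0, +oo[ (control omega y),
      Sobolev_infty `[0, +oo[ r y,
      Sobolev_infty `[- h, +oo[ r.-1 y &
      Sobolev_infty `[- h, 0] r (y0 0%N) -> Sobolev_infty `[- h, +oo[ r y].

Definition prop_funnel (y : R -> 'rV[R]_m) : Prop :=
  (forall t : R, 0 <= t -> funnel (t, y t - yref t)) /\
  (exists2 eps : R, 0 < eps < 1 &
     forall t : R, 0 <= t -> phi t * enorm (y t - yref t) <= eps).

(** An unbounded [phi] may return to small values infinitely often, and then the
    error need not tend to 0 as t -> oo. For every unbounded [phi] the error
    derivatives tend to 0 as phi(t) -> oo; they tend to 0 as t -> oo if
    phi(t) -> oo as t -> oo. *)
Definition prop_asymptotic (y : R -> 'rV[R]_m) : Prop :=
  rhat = r -> ~ bounded_gain phi -> forall k, (k < r)%N ->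
    (forall eps : R, 0 < eps -> exists M : R, forall t : R, 0 <= t -> M < phi t ->
       enorm (error_derivative y k t) < eps) /\
    (phi t @[t --> +oo] --> +oo ->
       error_derivative y k t @[t --> +oo] --> (0 : 'rV[R]_m)).

Definition funnel_control_works : Prop :=
  [/\ exists (omega : \bar R) (y : R -> 'rV[R]_m), is_solution omega y,
      forall (omega : \bar R) (y : R -> 'rV[R]_m), is_solution omega y ->
        exists (omega' : \bar R) (y' : R -> 'rV[R]_m),
        [/\ (omega <= omega')%E, extends omega omega' y y' &
            is_maximal_solution omega' y'] &
      forall (omega : \bar R) (y : R -> 'rV[R]_m), is_maximal_solution omega y ->
        [/\ prop_global omega, prop_bounded omega y, prop_funnel y &
            prop_asymptotic y]].

End ClosedLoop.

(* Main.v *)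
(** A solution is treated as a continuous solution of the integral equation for
    the state x = (y, ..., y^(r-1)). Local existence: delaying the right-hand side
    makes the equation explicitly solvable, and equicontinuity lets the delay tend
    to 0. Since solutions need not be unique, maximal ones come from Zorn's lemma.

    Along a solution put e_k = rho_k(phi bold-e). For k < r the derivative of e_k
    is e_(k+1) - gamma(e_k) plus bounded terms. As |e_(k+1)| < 1 and alpha tends to
    infinity at 1, |e_k| cannot cross a level kappa with alpha(kappa^2) large. For
    k = r the derivative of e_r is phi f(d, T(x), u) plus bounded terms, and at
    |e_r| = kappa one has u = N(alpha(kappa^2)) e_r; the high-gain property yields
    levels kappa, arbitrarily close to 1, at which <e_r, f> is as negative as
    desired, so such a level is not crossed either. The e_k are only shown to
    be Lipschitz, so these barrier arguments compare increments instead of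
    differentiating. All levels are independent of the time interval; hence the
    solution stays in a compact part of the domain and never stops.

    Absolute continuity is converted into integral equations by writing an
    absolutely continuous function as a difference of two Stieltjes functions
    whose measures have densities by Radon-Nikodym. Weak derivatives are converted
    by testing against smooth approximations of trapezoids. *)

Require Import Defs.
From HB Require Import structures.
From mathcomp Require Import all_boot all_order all_algebra.
From mathcomp Require Import all_classical all_reals all_analysis.
From mathcomp Require Import measurable_realfun ess_sup_inf.
From mathcomp Require Import ring lra.
Import Order.TTheory GRing.Theory Num.Theory.
Import numFieldNormedType.Exports.
Set Implicit Arguments.
Unset Strict Implicit.
Unset Printing Implicit Defensive.
Local Open Scope classical_set_scope.
Local Open Scope ring_scope.

(** * Absolutely continuous functions *)

Section TotalVariationAC.
Context {R : realType}.
Implicit Types (a b : R) (g : R -> R) (p q : R * R) (s : seq (R * R)).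

(** The order of the estimates avoids a circle: a bound on w needs T(x) bounded, and BIBO bounds
    T(x) only once x is bounded. But |e_r| < 1 holds along any solution by the definition of a
    solution; together with the steps k < r this bounds all blocks of the state. Then BIBO applies,
    and only then does the high-gain property come in.

    Uniform constants exist only from some t1 > 0 on: phi(0) = 0 is allowed, and phi controls the
    errors only where it is bounded away from 0. On [0, t1] compactness takes over. An unbounded phi
    does no harm because the growth condition compares phi' bold-e with phi bold-e.

    T acts on functions on the whole half-line and its values are fixed only up to null sets. A
    solution on a finite interval therefore enters T frozen after the end of the interval, and every
    change of the continuation is an appeal to causality almost everywhere, which an integral
    equation does not notice.

    The feedbacks N, s and -s share two properties: continuity, and arbitrarily large values of
    chi(N(a)) at arbitrarily large a. The argument is carried out for any function [gain] with
    these. *)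

Definition apart p q := (p.2 <= q.1) || (q.2 <= p.1).

(* Lists of non-overlapping intervals, unlike the indexed families in
   [absolutely_continuous], are easily refined one interval at a time. *)
Definition packed a b s :=
  all (fun p => [&& a <= p.1, p.1 <= p.2 & p.2 <= b]) s && pairwise apart s.

Definition tot_length s : R := \sum_(p <- s) (p.2 - p.1).

Definition tot_jump g s : R := \sum_(p <- s) `|g p.2 - g p.1|.

Lemma packed_AC a b g : absolutely_continuous a b g ->
  forall eps : R, 0 < eps -> exists2 delta : R, 0 < delta &
  forall s, packed a b s -> tot_length s < delta -> tot_jump g s < eps.
Proof.
move=> acg eps eps0; have [delta delta0 H] := acg eps eps0.
exists delta => // s /andP[/allP sab sd] sl.
pose u i := (nth (a, a) s i).1; pose v i := (nth (a, a) s i).2.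
have := H (size s) u v.
rewrite /tot_jump (big_nth (a, a)) big_mkord; apply.
- by move=> i si; have /and3P[] := sab _ (mem_nth (a, a) si).
- apply/trivIsetP => i j /= si sj ij.
  have ap : apart (nth (a, a) s i) (nth (a, a) s j).
    have [lij|lij] := ltP i j.
      by move/(pairwiseP (a, a)) : sd; apply.
    have {}lij : (j < i)%N by rewrite ltn_neqAle eq_sym ij.
    move/(pairwiseP (a, a)) : sd => /(_ j i sj si lij).
    by rewrite /apart orbC.
  apply/seteqP; split => // x [] /=; rewrite !in_itv/= -/(u i) -/(v i).
  move=> /andP[uix xvi] /andP[ujx xvj].
  by case/orP: ap => h;
    [have := lt_le_trans (lt_trans ujx xvi) h|
     have := lt_le_trans (lt_trans uix xvj) h]; rewrite ltxx.
- by move: sl; rewrite /tot_length (big_nth (a, a)) big_mkord.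
Qed.

(** A partition in the sense of [itv_partition a b] lists the points after [a]; zipping it with
    [a :: l] pairs each point with its predecessor. *)
Definition segments (a : R) (l : seq R) : seq (R * R) :=
  [seq (x.2, x.1) | x <- zip l (a :: l)].

Lemma segments_cons a x (l : seq R) :
  segments a (x :: l) = (a, x) :: segments x l.
Proof. by []. Qed.

Lemma tot_jump_segments a b g (l : seq R) : itv_partition a b l ->
  tot_jump g (segments a l) = variation a b g l.
Proof.
by move=> abl; rewrite variation_zip// /tot_jump /segments big_map.
Qed.

Lemma packed_segments a b (l : seq R) : itv_partition a b l ->
  packed a b (segments a l).
Proof.
elim: l a => [//|x l ih] a abl.
have ax : a < x by case: abl => /= /andP[].
have xbl := itv_partition_cons abl.
have xb := itv_partition_le xbl.
have /andP[/allP h1 h2] := ih _ xbl.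
rewrite segments_cons /packed/= lexx (ltW ax) xb/= h2 andbT.
apply/andP; split.
  apply/allP => p /h1 /and3P[xp -> ->].
  by rewrite (le_trans (ltW ax) xp).
by apply/allP => p /h1 /and3P[xp _ _]; rewrite /apart/= xp.
Qed.

Lemma tot_length_segments a b (l : seq R) : itv_partition a b l ->
  tot_length (segments a l) = b - a.
Proof.
elim: l a => [a [_ /eqP/= <-]|x l ih a abl].
  by rewrite /tot_length big_nil subrr.
rewrite segments_cons /tot_length big_cons/= -/(tot_length _).
by rewrite (ih _ (itv_partition_cons abl)); ring.
Qed.

(** Jumps are replaced by total variations one interval at a time, which is why the two lists are
    mixed. A partition of the head of [s1] is moved to [s2], where only jumps count; the induction
    hypothesis applies, and the supremum over all partitions is taken. *)
Lemma tot_variation_packed a b g (eps delta : R) :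
  (forall s, packed a b s -> tot_length s < delta -> tot_jump g s <= eps) ->
  forall s1 s2, packed a b (s1 ++ s2) -> tot_length (s1 ++ s2) < delta ->
  (\sum_(p <- s1) total_variation p.1 p.2 g + (tot_jump g s2)%:E <= eps%:E)%E.
Proof.
move=> H; elim=> [|p s1 ih] s2 ps12 l12.
  by rewrite big_nil add0e lee_fin; exact: H.
have /andP[/= /andP[/and3P[ap pp pb] al] /andP[apal pw]] := ps12.
(* Refining the head interval keeps the family non-overlapping and does not change its total
   length. *)
have rearr (l : seq R) : itv_partition p.1 p.2 l ->
    packed a b (s1 ++ segments p.1 l ++ s2) /\
    tot_length (s1 ++ segments p.1 l ++ s2) < delta.
  move=> pl; have /andP[/allP segb segpw] := packed_segments pl; split.
    move: al pw apal; rewrite /packed !all_cat !pairwise_cat !allrel_catr.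
    move=> /andP[-> ->] /and3P[-> -> ->] /andP[a1 a2]; rewrite /= !andbT segpw /=.
    have apl q r : apart p q -> r \in segments p.1 l -> apart r q && apart q r.
      move=> + /segb /and3P[p1 _ p2]; rewrite /apart => /orP[h|h].
        by rewrite (le_trans p2 h)/= orbT.
      by rewrite (le_trans h p1)/= orbT.
    apply/and3P; split.
    - by apply/allP => r /segb /and3P[h1 -> h2]; rewrite (le_trans ap h1)/=
        (le_trans h2 pb).
    - apply/allrelP => q r /(allP a1) pq /(apl _ _ pq).
      by case/andP.
    - rewrite andbT; apply/allrelP => r q rs /(allP a2) pq.
      by have /andP[] := apl _ _ pq rs.
  move: l12; rewrite /tot_length !big_cat/= big_cons.
  by rewrite -/(tot_length (segments _ _)) (tot_length_segments pl)
    addrCA addrA.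
rewrite big_cons -addeA.
have sub (l : seq R) : itv_partition p.1 p.2 l ->
    ((variation p.1 p.2 g l)%:E + (\sum_(p <- s1) total_variation p.1 p.2 g
      + (tot_jump g s2)%:E) <= eps%:E)%E.
  move=> pl; have [h1 h2] := rearr l pl.
  have := ih _ h1 h2.
  rewrite /tot_jump big_cat/= -/(tot_jump _ (segments _ _)) -/(tot_jump _ s2).
  by rewrite (tot_jump_segments _ pl) EFinD addeCA.
set S := (\sum_(p <- s1) _ + _)%E in sub *.
have S0 : (0 <= S)%E.
  rewrite /S adde_ge0//; last by rewrite lee_fin sumr_ge0.
  rewrite big_seq sume_ge0// => q qs.
  apply: total_variation_ge0.
  by move: al; rewrite all_cat => /andP[/allP/(_ q qs)/and3P[]].
(* [S] can be moved across the inequality only if it is finite; a single partition of the head shows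
   this. *)
have Sfin : S \is a fin_num.
  rewrite ge0_fin_numE//.
  have ex : exists l, itv_partition p.1 p.2 l.
    have [e|e] := eqVneq p.1 p.2; first by exists [::]; split => //=; exact/eqP.
    by exists [:: p.2]; apply: itv_partition1; rewrite lt_neqAle e.
  have [l pl] := ex.
  have := sub l pl; rewrite addeC.
  move=> /le_lt_trans/(_ (ltry _)) => h.
  apply: (le_lt_trans _ h); rewrite leeDl// lee_fin.
  by rewrite -(tot_jump_segments _ pl) sumr_ge0.
rewrite -leeBrDr//; apply: ge_ereal_sup => _ [_ [l pl <-] <-].
by rewrite leeBrDr//; exact: sub.
Qed.

Lemma AC_small_total_variation a b g : absolutely_continuous a b g ->
  forall eps : R, 0 < eps -> exists2 delta : R, 0 < delta &
  forall s, packed a b s -> tot_length s < delta ->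
    (\sum_(p <- s) total_variation p.1 p.2 g <= eps%:E)%E.
Proof.
move=> acg eps eps0; have [delta delta0 H] := packed_AC acg eps0.
exists delta => // s ps ls.
have := @tot_variation_packed a b g eps delta (fun s ps ls => ltW (H s ps ls)) s [::].
by rewrite cats0 /tot_jump big_nil adde0; apply.
Qed.

(** On an interval shorter than the [delta] that belongs to 1 the variation is at most 1, and pieces
    of length [delta / 2] are cut off at the right end, finitely many times. *)
Lemma AC_bounded_variation a b g : a <= b -> absolutely_continuous a b g ->
  bounded_variation a b g.
Proof.
move=> ab acg; apply/bounded_variationP => //.
have [delta delta0 H] := AC_small_total_variation acg ltr01.
suff fin n : forall x, a <= x <= b -> x - a <= n%:R * (delta / 2) ->
    total_variation a x g \is a fin_num.
  apply: (fin (Num.bound ((b - a) / (delta / 2)))); first by rewrite ab lexx.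
  have d0 : 0 < delta / 2 by rewrite divr_gt0.
  rewrite -ler_pdivrMr// ltW// archi_boundP//.
  by rewrite divr_ge0// ?(ltW d0)// subr_ge0.
elim: n => [|n ih] x /andP[ax xb].
  rewrite mul0r subr_le0 => xa.
  have -> : x = a by apply/eqP; rewrite eq_le xa ax.
  by rewrite total_variationxx.
move=> xan; pose y := Num.max a (x - delta / 2).
have ay : a <= y by rewrite le_max lexx.
have yx : y <= x by rewrite ge_max ax/= gerBl divr_ge0// ltW.
rewrite (total_variationD _ ay yx) fin_numD ih/=; last first.
- rewrite /y /Num.max; case: ifPn => _; rewrite ?subrr.
    by move: xan; rewrite -natr1 mulrDl mul1r; lra.
  by rewrite mulr_ge0// divr_ge0// ltW.
- by rewrite ay (le_trans yx xb).
have := H [:: (y, x)]; rewrite /packed /tot_length !big_cons !big_nil/= addr0 adde0.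
rewrite ay yx xb/= => /(_ erefl) h.
rewrite ge0_fin_numE ?total_variation_ge0//.
apply: le_lt_trans (ltry 1); apply: h.
have : x - delta / 2 <= y by rewrite le_max lexx orbT.
lra.
Qed.

End TotalVariationAC.

Section StieltjesDensity.
Context {R : realType}.
Local Notation mu := (@lebesgue_measure R).
Implicit Types (a b : R).

Lemma stieltjes_itvoc (G : cumulative R R) (c e : R) : c <= e ->
  lebesgue_stieltjes_measure G `]c, e]%classic = (G e - G c)%:E.
Proof.
move=> ce; rewrite /lebesgue_stieltjes_measure /measure_extension.
by rewrite measurable_mu_extE/= ?wlength_itv_bnd//; exact: is_ocitv.
Qed.

(** Meant for a component [I] of an open set. Its part in []a, b]] contains []p.1, p.2[], which
    determines its length, and is contained in []p.1, p.2]], whose Stieltjes measure is an increment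
    of [G]. The pair [(a, a)] represents an empty part. *)
Lemma open_itv_piece (a b : R) (I : set R) (G : cumulative R R) :
  a <= b -> open I -> is_interval I ->
  exists p : R * R, [/\ [&& a <= p.1, p.1 <= p.2 & p.2 <= b],
    mu (I `&` `]a, b]) = (p.2 - p.1)%:E,
    (lebesgue_stieltjes_measure G (I `&` `]a, b]) <= (G p.2 - G p.1)%:E)%E,
    p = (a, a) \/ p.1 < p.2 &
    `]p.1, p.2[%classic `<=` I `&` `]a, b]].
Proof.
move=> ab oI iI; set J := I `&` `]a, b].
have [J0|/set0P[x0 Jx0]] := eqVneq J set0.
  exists (a, a); rewrite J0 !measure0/= !subrr !lexx ab; split => //; first by left.
  by move=> x /=; rewrite in_itv/= => /andP[/lt_trans h /h]; rewrite ltxx.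
have mJ : measurable J by apply: measurableI => //; exact: open_measurable.
have iJ : is_interval J.
  move=> x y [Ix /= xab] [Iy /= yab] z xzy; split; first exact: (iI x y).
  move: xab yab xzy; rewrite /= !in_itv/= => /andP[ax _] /andP[_ yb] /andP[xz zy].
  by rewrite (lt_le_trans ax xz) (le_trans zy yb).
have aJ x : J x -> a < x by move=> [_] /=; rewrite in_itv/= => /andP[].
have bJ x : J x -> x <= b by move=> [_] /=; rewrite in_itv/= => /andP[].
have hi : has_inf J by split; [exists x0|exists a => x /aJ /ltW].
have hs : has_sup J by split; [exists x0|exists b => x /bJ].
pose c := inf J; pose e := sup J.
have cJ x : J x -> c <= x by move=> Jx; apply: ge_inf => //; exact: hi.2.
have eJ x : J x -> x <= e by move=> Jx; apply: ub_le_sup => //; exact: hs.2.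
have nleft x : J x -> c < x.
  move=> Jx; have [Ix _] := Jx.
  have [r /= r0 rI] : exists2 r : R, 0 < r & forall y, `|x - y| < r -> I y.
    have : \forall y \near x, I y by exact: open_nbhs_nbhs.
    by move=> /nbhs_ballP[r /= r0 rI]; exists r.
  pose y := Num.min (r / 2) ((x - a) / 2).
  have y0 : 0 < y by rewrite lt_min !divr_gt0// subr_gt0 aJ.
  have : J (x - y).
    split.
      apply: rI; rewrite subKr gtr0_norm//.
      by rewrite /y gt_min ltr_pdivrMr// ltr_pMr// ltr1n.
    rewrite /= in_itv/=; have xb := bJ _ Jx; have ax := aJ _ Jx.
    have : y <= (x - a) / 2 by rewrite /y ge_min lexx orbT.
    by move=> ?; apply/andP; split; lra.
  by move/cJ => h; rewrite (le_lt_trans h)// gtrBl.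
have ce : c < e by rewrite (lt_le_trans (nleft _ Jx0))// eJ.
have oJ : `]c, e[ `<=` J.
  move=> x /=; rewrite in_itv/= => /andP[cx xe].
  have [y Jy yx] : exists2 y, J y & y < x.
    have [y Jy] := inf_adherent (eps := x - c) ltac:(by rewrite subr_gt0) hi.
    by rewrite addrC subrK => yx; exists y.
  have [z Jz xz] : exists2 z, J z & x < z.
    have [z Jz] := sup_adherent (eps := e - x) ltac:(by rewrite subr_gt0) hs.
    by rewrite subKr => xz; exists z.
  by apply: (iJ y z) => //; rewrite (ltW yx) (ltW xz).
have Joc : J `<=` `]c, e] by move=> x Jx; rewrite /= in_itv/= nleft//= eJ.
have ac : a <= c by apply: lb_le_inf; [exists x0|move=> x /aJ/ltW].
have eb : e <= b by apply: ge_sup; [exists x0|move=> x /bJ].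
exists (c, e); split => /=.
- by rewrite ac (ltW ce).
- apply/eqP; rewrite eq_le; apply/andP; split.
    have -> : (e - c)%:E = mu `]c, e]%classic.
      by rewrite lebesgue_measure_itv/= lte_fin ce -EFinD.
    by apply: le_measure => //; rewrite inE//.
  have -> : (e - c)%:E = mu `]c, e[%classic.
    by rewrite lebesgue_measure_itv/= lte_fin ce -EFinD.
  by apply: le_measure => //; rewrite inE//.
- rewrite -stieltjes_itvoc//; last exact: ltW.
  by apply: le_measure => //; rewrite inE//.
- by right.
- exact: oJ.
Qed.

(** By outer regularity a null set lies in an open set of measure below [delta]. The components of
    the latter, cut to []a, b]], are disjoint intervals, so the hypothesis bounds each finite
    partial sum of their Stieltjes measures, and hence the whole series. *)
Lemma stieltjes_null (a b : R) (G : cumulative R R) : a <= b ->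
  (forall eps : R, 0 < eps -> exists2 delta : R, 0 < delta &
    forall s, packed a b s -> tot_length s < delta ->
    \sum_(p <- s) (G p.2 - G p.1) <= eps) ->
  forall A, measurable A -> mu A = 0%E ->
    lebesgue_stieltjes_measure G (A `&` `]a, b]) = 0%E.
Proof.
move=> ab HG A mA A0.
apply/eqP; rewrite eq_le measure_ge0 andbT.
apply/lee_addgt0Pr => eps eps0; rewrite add0e.
have [delta delta0 Hd] := HG _ eps0.
have [|U [oU AU UA]] := @lebesgue_regularity_outer R A delta mA _ delta0.
  exact: (eq_ind_r (fun x => (x < +oo)%E) (ltry 0) A0).
have mU : measurable U by exact: open_measurable.
have muU : (mu U < delta%:E)%E.
  rewrite -(setDUK AU).
  by rewrite (le_lt_trans (measureU2 _ _ _))//= ?A0 ?add0e//; exact: measurableD.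
pose I := open_disjoint_itv oU.
have oI n : open (I n) by exact: open_disjoint_itv_open.
have iI n : is_interval (I n) by exact: open_disjoint_itv_is_interval.
have [p Hp] := choice (fun n => open_itv_piece G ab (oI n) (iI n)).
pose J n := I n `&` `]a, b]%classic.
have mJ n : measurable (J n) by apply: measurableI => //; exact: open_measurable.
have tJ : trivIset setT J.
  apply/trivIsetP => i j _ _ ij; apply/seteqP; split => // x [[Ii _] [Ij _]].
  have /trivIsetP/(_ i j Logic.I Logic.I ij) := @open_disjoint_itv_trivIset _ _ oU.
  by move/seteqP => [+ _] => /(_ x); apply.
have UJ : U `&` `]a, b]%classic = \bigcup_n J n.
  by rewrite {1}(open_disjoint_itv_bigcup oU) setI_bigcupl.
have mUab : measurable (U `&` `]a, b]%classic) by exact: measurableI.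
apply: (@le_trans _ _ (lebesgue_stieltjes_measure G (U `&` `]a, b]))).
  by apply: le_measure; rewrite ?inE//; [exact: measurableI|exact: setSI].
rewrite UJ measure_bigcup//; last by move=> ? _; exact: mJ.
apply: lime_le; first exact: is_cvg_nneseries.
apply: nearW => n.
apply: (@le_trans _ _ (\sum_(0 <= i < n) (G (p i).2 - G (p i).1)%:E)%E).
  under eq_bigl do rewrite in_setT.
  by apply: lee_sum => i _; have [] := Hp i.
rewrite sumEFin lee_fin -(big_map p predT (fun q => G q.2 - G q.1)).
apply: Hd.
  rewrite /packed; apply/andP; split.
    by apply/allP => q /mapP[i _ ->]; have [] := Hp i.
  rewrite pairwise_map; apply: (@sub_in_pairwise _ predT ltn); last 2 first.
  - exact/allP.
  - by rewrite -sorted_pairwise; [exact: iota_ltn_sorted|exact: ltn_trans].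
  move=> i j _ _ /= ij; rewrite /apart.
  have [/and3P[ai1 i12 i2b] _ _ pi oi] := Hp i.
  have [/and3P[aj1 j12 j2b] _ _ pj oj] := Hp j.
  case: pi => [->/=|pi]; first by rewrite aj1.
  case: pj => [->/=|pj]; first by rewrite ai1 orbT.
  (* Two overlapping nondegenerate intervals would share the midpoint of their intersection, but
     distinct components are disjoint. *)
  rewrite leNgt (leNgt _ (p i).1) -negb_and; apply/negP => /andP[h1 h2].
  pose l := Num.max (p i).1 (p j).1; pose u := Num.min (p i).2 (p j).2.
  have lu : l < u by rewrite /l /u lt_min !gt_max pi pj h1 h2.
  have := midf_lt lu; set z := (l + u) / 2 => -[lz zu].
  move: lz zu; rewrite /l /u gt_max lt_min => /andP[l1 l2] /andP[u1 u2].
  have Ji : J i z by apply: oi; rewrite /= in_itv/= l1 u1.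
  have Jj : J j z by apply: oj; rewrite /= in_itv/= l2 u2.
  have /trivIsetP/(_ i j Logic.I Logic.I (negbT (ltn_eqF ij))) := tJ.
  by move/seteqP => [+ _] => /(_ z); apply.
rewrite /tot_length big_map -lte_fin -sumEFin.
rewrite (le_lt_trans _ muU)//.
apply: (@le_trans _ _ (mu (U `&` `]a, b]))); last first.
  by apply: le_measure; rewrite ?inE//; exact: subIsetl.
rewrite UJ measure_bigcup//; last by move=> ? _; exact: mJ.
apply: le_trans; last exact: (nneseries_lim_ge n).
under [leRHS]eq_bigl do rewrite in_setT.
apply: lee_sum => i _; have [_ <- _ _ _] := Hp i.
by [].
Qed.

End StieltjesDensity.

Section Clamp.
Context {R : realType}.

Definition clamp (a b x : R) : R := Num.max a (Num.min b x).

Lemma clamp_in (a b x : R) : a <= b -> a <= clamp a b x <= b.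
Proof. by move=> ab; rewrite /clamp le_max lexx ge_max ab ge_min lexx. Qed.

Lemma clamp_id (a b x : R) : a <= x <= b -> clamp a b x = x.
Proof.
by move=> /andP[ax xb]; rewrite /clamp (min_r xb) (max_r ax).
Qed.

Lemma clamp_le (a b x y : R) : x <= y -> clamp a b x <= clamp a b y.
Proof.
move=> xy; rewrite /clamp ge_max le_max lexx/= le_max; apply/orP; right.
by rewrite le_min !ge_min lexx xy/= orbT.
Qed.

Lemma clamp_dist (a b x y : R) : `|clamp a b x - clamp a b y| <= `|x - y|.
Proof.
wlog xy : x y / x <= y => [h|].
  case/orP: (le_total x y) => /h // {}h.
  by rewrite distrC (distrC x).
rewrite ler0_norm ?subr_le0 ?clamp_le// ler0_norm ?subr_le0// !opprB.
rewrite /clamp /Num.max /Num.min.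
do 4 (case: ifPn); rewrite -?leNgt; lra.
Qed.

Lemma continuous_clamp (a b : R) : continuous (clamp a b : R -> R).
Proof.
move=> x; apply/cvgrPdist_lt => /= e e0.
apply: filterS (nbhsx_ballx x e e0) => y; rewrite /ball/= => xy.
exact: le_lt_trans (clamp_dist _ _ _ _) xy.
Qed.

Lemma within_continuous_clamp (V : topologicalType) (a b : R) (f : R -> V) :
  a <= b -> {within `[a, b], continuous f} -> continuous (f \o clamp a b).
Proof.
move=> ab /subspace_continuousP fab x.
have cx : `[a, b]%classic (clamp a b x) by rewrite /= in_itv/= clamp_in.
apply: (cvg_comp _ _ _ (fab _ cx)) => S /= nS.
have H : nbhs x [set y | `[a, b]%classic (clamp a b y) -> S (clamp a b y)].
  exact: (@continuous_clamp a b x _ nS).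
by apply: filterS H => y /=; apply; rewrite in_itv/= clamp_in.
Qed.

End Clamp.

Section ACFTC.
Context {R : realType}.
Local Notation mu := (@lebesgue_measure R).
Implicit Types (a b : R) (g : R -> R).

Lemma nondecreasing_density a b (G : R -> R) : a <= b ->
  {homo G : x y / x <= y} -> continuous G ->
  (forall eps : R, 0 < eps -> exists2 delta : R, 0 < delta &
    forall s, packed a b s -> tot_length s < delta ->
    \sum_(p <- s) (G p.2 - G p.1) <= eps) ->
  exists2 D : R -> R, mu.-integrable setT (EFin \o D) &
    forall x, a <= x <= b -> G x - G a = \int[mu]_(t in `[a, x]) D t.
Proof.
move=> ab nG cG HG.
have rcG : right_continuous G by exact: right_continuousW.
pose Gm := isCumulative.Build R _ R G nG rcG.
pose Gc : cumulative R R := HB.pack G Gm.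
have mI : measurable (`]a, b]%classic : set (measurableTypeR R)) by exact: measurable_itv.
(* The Radon-Nikodym theorem is applied to the restriction to []a, b]], which is a finite
   measure. *)
have fI : (lebesgue_stieltjes_measure Gc `]a, b] < +oo)%E.
  by rewrite stieltjes_itvoc// ltry.
have dom : mfrestr mI fI `<< mu.
  apply/null_content_dominatesP => A mA A0.
  by rewrite /mfrestr /mrestr; exact: (@stieltjes_null R a b Gc ab HG A mA A0).
have [f [f0 ffin intf fE]] := radon_nikodym_sigma_finite dom.
have EfD : EFin \o (fine \o f) = f by apply/funext => x /=; rewrite fineK.
exists (fine \o f); first by rewrite EfD.
move=> x /andP[ax xb]; rewrite /Rintegral.
under eq_integral do rewrite /= fineK//.
rewrite -integral_itv_obnd_cbnd; last first.
  by apply: measurable_funS (measurable_int _ intf).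
rewrite -fE; last exact: measurable_itv.
transitivity (fine (lebesgue_stieltjes_measure Gc `]a, x]%classic)).
  by rewrite stieltjes_itvoc.
congr fine; rewrite /= /mfrestr /mrestr.
have -> : `]a, x] `&` `]a, b] = `]a, x]%classic :> set R.
  apply/setIidPl => t /=; rewrite !in_itv/= => /andP[-> tx].
  by rewrite (le_trans tx xb).
by [].
Qed.

Lemma AC_continuous a b g : absolutely_continuous a b g ->
  {within `[a, b], continuous g}.
Proof.
move=> acg; apply/subspace_continuousP => x /=; rewrite in_itv/= => /andP[ax xb].
apply/cvgrPdist_lt => e e0.
have [delta delta0 H] := packed_AC acg e0.
rewrite near_withinE; near=> y; rewrite /= in_itv/= => /andP[ay yb].
have yx : `|x - y| < delta by near: y; apply: nbhsx_ballx.
have := H [:: (Num.min x y, Num.max x y)].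
rewrite /packed /tot_length /tot_jump !big_cons !big_nil/= !addr0 !andbT.
have [xy|xy] := leP x y.
  rewrite ax xy yb /= distrC; apply => //.
  by move: yx; rewrite ler0_norm ?opprB// subr_le0.
rewrite ay (ltW xy) xb/=; apply => //.
by move: yx; rewrite ger0_norm// subr_ge0 ltW.
Unshelve. all: by end_near. Qed.

(** Jordan decomposition [g = v - w], where [v] is the variation function. An increment of [v] is
    the total variation over the interval, and an increment of [w] is at most twice as large, so
    both functions inherit the smallness condition. Clamping extends them to the line as Stieltjes
    functions require. *)
Lemma AC_density a b g : a < b -> absolutely_continuous a b g ->
  exists2 D : R -> R, mu.-integrable setT (EFin \o D) &
    forall x, a <= x <= b -> g x - g a = \int[mu]_(t in `[a, x]) D t.
Proof.
move=> ab acg.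
have lab := ltW ab.
have bvg := AC_bounded_variation lab acg.
have cg := AC_continuous acg.
have fTV x y : a <= x -> x <= y -> y <= b -> total_variation x y g \is a fin_num.
  move=> ax xy yb; apply/bounded_variationP => //.
  by apply: (bounded_variationl (b := b)) => //;
    apply: (bounded_variationr (a := a)) => //; exact: le_trans yb.
pose v x := fine (total_variation a (clamp a b x) g).
have vE x y : a <= x -> x <= y -> y <= b ->
    v y - v x = fine (total_variation x y g).
  move=> ax xy yb.
  rewrite /v !clamp_id ?(le_trans ax xy) ?ax ?(le_trans xy yb)//.
  rewrite (total_variationD g ax xy) fineD ?fTV ?(le_trans xy yb)//.
  by rewrite addrC addKr.
have gTV x y : a <= x -> x <= y -> y <= b -> `|g y - g x| <= v y - v x.
  move=> ax xy yb; rewrite vE// -lee_fin fineK ?fTV//.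
  exact: total_variation_ge.
have nv : {homo v : x y / x <= y}.
  move=> x y xy; rewrite -subr_ge0.
  have /andP[ax xb] := clamp_in x lab; have /andP[ay yb] := clamp_in y lab.
  have := gTV _ _ ax (clamp_le a b xy) yb.
  rewrite /v !(clamp_id (clamp_in _ lab)).
  by apply: le_trans.
have cv : continuous v.
  by apply: (within_continuous_clamp lab (total_variation_continuous ab cg bvg)).
have [|D1 iD1 hD1] := nondecreasing_density lab nv cv.
  move=> eps eps0; have [delta delta0 H] := AC_small_total_variation acg eps0.
  exists delta => // s ps ls; rewrite -lee_fin -sumEFin.
  apply: le_trans (H s ps ls); rewrite big_seq [leRHS]big_seq.
  have /andP[/allP sab _] := ps.
  apply: lee_sum => p /sab /and3P[ap pp pb].
  by rewrite vE// fineK// fTV.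
pose w x := v x - g (clamp a b x).
have nw : {homo w : x y / x <= y}.
  move=> x y xy.
  have /andP[ax xb] := clamp_in x lab; have /andP[ay yb] := clamp_in y lab.
  have := gTV _ _ ax (clamp_le a b xy) yb.
  rewrite /w /v !(clamp_id (clamp_in _ lab)) => /(le_trans (ler_norm _)).
  lra.
have cw : continuous w.
  move=> x; apply: cvgB; first exact: cv.
  exact: (within_continuous_clamp lab cg).
have [|D2 iD2 hD2] := nondecreasing_density lab nw cw.
  move=> eps eps0.
  have eps20 : 0 < eps / 2 by rewrite divr_gt0.
  have [delta delta0 H] := AC_small_total_variation acg eps20.
  exists delta => // s ps ls.
  have /andP[/allP sab _] := ps.
  apply: (@le_trans _ _ (\sum_(p <- s) 2 * (v p.2 - v p.1))).
    rewrite big_seq [leRHS]big_seq.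
    apply: ler_sum => p /sab /and3P[ap pp pb].
    have := gTV _ _ ap pp pb; rewrite ler_norml /w.
    rewrite !clamp_id ?(le_trans ap pp) ?ap ?(le_trans pp pb)//.
    by move=> /andP[]; lra.
  rewrite -mulr_sumr -ler_pdivlMl// mulrC -lee_fin -sumEFin.
  apply: le_trans (H s ps ls); rewrite big_seq [leRHS]big_seq.
  apply: lee_sum => p /sab /and3P[ap pp pb].
  by rewrite vE// fineK// fTV.
exists (D1 \- D2).
  have -> : EFin \o (D1 \- D2) = ((EFin \o D1) \- (EFin \o D2))%E.
    by apply/funext => x /=; rewrite EFinB.
  exact: integrableB.
move=> x axb; rewrite RintegralB//=; last 2 first.
- by apply: integrableS iD1.
- by apply: integrableS iD2.
rewrite -hD1// -hD2// /w !clamp_id ?lexx ?lab//.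
ring.
Qed.

Lemma AC_FTC a b g : a < b -> absolutely_continuous a b g ->
  exists D : R -> R, [/\ mu.-integrable setT (EFin \o D),
    forall x, a <= x <= b -> g x - g a = \int[mu]_(t in `[a, x]) D t &
    {ae mu, forall x, a < x < b -> is_derive x 1 g (D x)}].
Proof.
move=> ab acg; have [D iD gD] := AC_density ab acg.
exists D; split => //.
have iDS (A : set R) : measurable A -> mu.-integrable A (EFin \o D).
  by move=> mA; apply: integrableS iD.
have := @FTC1 R D (BLeft a) (fun y => iDS _ (measurable_itv _))
  (open_integrable_locally openT iD).
apply: filterS; first exact: (ae_filter_ringOfSetsType mu).
move=> x /= + /andP[ax xb].
rewrite lte_fin ax => /(_ isT)[dF FD].
apply: (@near_eq_is_derive _ _ _ (fun x => \int[mu]_(t in `[a, x]) D t + g a)).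
- near=> y; rewrite -gD ?subrK//.
  by apply/andP; split; apply: ltW; near: y; [exact: lt_nbhsr|exact: lt_nbhsl].
- rewrite -[D x]addr0; apply: is_deriveD.
  by apply: DeriveDef; [exact: dF|rewrite -derive1E].
Unshelve. all: by end_near. Qed.

End ACFTC.

(** * Row vectors, derivatives and integrals on intervals *)

Section RowVectors.
Context {R : realType}.
Local Notation mu := (@lebesgue_measure R).

Lemma coord_le_norm n (v : 'rV[R]_n) j : `|v 0 j| <= `|v|.
Proof. by rewrite [leRHS]mx_normrE; apply: (le_bigmax _ _ (0, j)). Qed.

Lemma norm_le_coord n (v : 'rV[R]_n) (M : R) : 0 <= M ->
  (forall j, `|v 0 j| <= M) -> `|v| <= M.
Proof.
move=> M0 vM; rewrite [leLHS]mx_normrE; apply: bigmax_le => // -[i j] _ /=.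
by rewrite (ord1 i).
Qed.

Lemma norm_lt_coord n (v : 'rV[R]_n) (M : R) : 0 < M ->
  (forall j, `|v 0 j| < M) -> `|v| < M.
Proof.
move=> M0 vM; rewrite [ltLHS]mx_normrE; apply: bigmax_lt => // -[i j] _ /=.
by rewrite (ord1 i).
Qed.

Lemma cvg_coord (T : Type) (F : set_system T) (FF : Filter F) n
    (g : T -> 'rV[R]_n) (v : 'rV[R]_n) :
  (forall j, g t 0 j @[t --> F] --> v 0 j) -> g t @[t --> F] --> v.
Proof.
move=> H; apply/cvgrPdist_lt => e e0.
have : \forall t \near F, forall j, `|v 0 j - g t 0 j| < e.
  by apply: filter_forall => j; move/cvgrPdist_lt : (H j); exact.
apply: filterS => t vg; apply: norm_lt_coord => // j.
by rewrite !mxE.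
Qed.

Lemma cvg_to_coord (T : Type) (F : set_system T) (FF : Filter F) n
    (g : T -> 'rV[R]_n) (v : 'rV[R]_n) j :
  g t @[t --> F] --> v -> g t 0 j @[t --> F] --> v 0 j.
Proof.
move=> /cvgrPdist_lt gv; apply/cvgrPdist_lt => e /gv; apply: filterS => t.
by apply: le_lt_trans; have := coord_le_norm (v - g t) j; rewrite !mxE.
Qed.

Lemma dotpC n (u v : 'rV[R]_n) : dotp u v = dotp v u.
Proof. by apply: eq_bigr => i _; rewrite mulrC. Qed.

Lemma dotpDl n (u v w : 'rV[R]_n) : dotp (u + v) w = dotp u w + dotp v w.
Proof.
by rewrite /dotp -big_split; apply: eq_bigr => i _; rewrite mxE mulrDl.
Qed.

Lemma dotpZl n (a : R) (u v : 'rV[R]_n) : dotp (a *: u) v = a * dotp u v.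
Proof.
by rewrite /dotp mulr_sumr; apply: eq_bigr => i _; rewrite mxE mulrA.
Qed.

Lemma dotpDr n (u v w : 'rV[R]_n) : dotp w (u + v) = dotp w u + dotp w v.
Proof. by rewrite dotpC dotpDl !(dotpC w). Qed.

Lemma dotpZr n (a : R) (u v : 'rV[R]_n) : dotp u (a *: v) = a * dotp u v.
Proof. by rewrite dotpC dotpZl dotpC. Qed.

Lemma dotpNl n (u v : 'rV[R]_n) : dotp (- u) v = - dotp u v.
Proof. by rewrite -scaleN1r dotpZl mulN1r. Qed.

Lemma dotpNr n (u v : 'rV[R]_n) : dotp u (- v) = - dotp u v.
Proof. by rewrite dotpC dotpNl dotpC. Qed.

Lemma dotpp_ge0 n (u : 'rV[R]_n) : 0 <= dotp u u.
Proof. by apply: sumr_ge0 => i _; rewrite -expr2 sqr_ge0. Qed.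

Lemma enorm_ge0 n (u : 'rV[R]_n) : 0 <= enorm u.
Proof. exact: sqrtr_ge0. Qed.

Lemma enorm_sqr n (u : 'rV[R]_n) : enorm u ^+ 2 = dotp u u.
Proof. by rewrite sqr_sqrtr// dotpp_ge0. Qed.

Lemma enormZ n (a : R) (u : 'rV[R]_n) : enorm (a *: u) = `|a| * enorm u.
Proof.
by rewrite /enorm dotpZl dotpZr mulrA -expr2 sqrtrM ?sqr_ge0// sqrtr_sqr.
Qed.

Lemma enormN n (u : 'rV[R]_n) : enorm (- u) = enorm u.
Proof. by rewrite -scaleN1r enormZ normrN1 mul1r. Qed.

Lemma enorm0 n : enorm (0 : 'rV[R]_n) = 0.
Proof. by rewrite -(scale0r 0) enormZ normr0 mul0r. Qed.

Lemma norm_le_enorm n (u : 'rV[R]_n) : `|u| <= enorm u.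
Proof.
apply: norm_le_coord; first exact: enorm_ge0.
move=> j; rewrite -ler_sqr ?nnegrE ?enorm_ge0// enorm_sqr real_normK ?num_real//.
rewrite /dotp (bigD1 j)//= -expr2 lerDl.
by apply: sumr_ge0 => i _; rewrite -expr2 sqr_ge0.
Qed.

(** Only the equivalence of the two norms matters; the constant [n] is cruder than its square root
    but avoids radicals. *)
Lemma enorm_le_norm n (u : 'rV[R]_n) : enorm u <= n%:R * `|u|.
Proof.
have nu : 0 <= n%:R * `|u| by rewrite mulr_ge0.
rewrite -ler_sqr ?nnegrE ?enorm_ge0// enorm_sqr /dotp.
apply: (@le_trans _ _ (\sum_(i < n) `|u| ^+ 2)).
  apply: ler_sum => i _; rewrite -expr2 -[leLHS]real_normK ?num_real//.
  by rewrite lerXn2r ?nnegrE// coord_le_norm.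
rewrite sumr_const card_ord exprMn -[leLHS]mulr_natl ler_wpM2r ?sqr_ge0//.
by rewrite -natrX ler_nat; case: n {u nu} => // n; rewrite leq_pmull.
Qed.

(** The Cauchy-Schwarz inequality, from the square of [enorm v *: u - enorm u *: v]. Zero vectors
    are treated apart because the expansion is divided by the product of the norms. *)
Lemma dotp_le n (u v : 'rV[R]_n) : dotp u v <= enorm u * enorm v.
Proof.
have [v0|v0] := eqVneq (enorm v) 0.
  have -> : v = 0.
    apply/eqP; rewrite -normr_eq0 eq_le normr_ge0 andbT -v0.
    exact: norm_le_enorm.
  by rewrite enorm0 mulr0 /dotp big1// => i _; rewrite mxE mulr0.
have vp : 0 < enorm v by rewrite lt_neqAle eq_sym v0 enorm_ge0.
have [u0|u0] := eqVneq (enorm u) 0.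
  have -> : u = 0.
    apply/eqP; rewrite -normr_eq0 eq_le normr_ge0 andbT -u0.
    exact: norm_le_enorm.
  by rewrite enorm0 mul0r /dotp big1// => i _; rewrite mxE mul0r.
have up : 0 < enorm u by rewrite lt_neqAle eq_sym u0 enorm_ge0.
have := dotpp_ge0 (enorm v *: u - enorm u *: v).
rewrite dotpDl !dotpDr !dotpNl !dotpNr !dotpZl !dotpZr -!enorm_sqr (dotpC v u).
rewrite (_ : _ + _ = 2 * (enorm u * enorm v) * (enorm u * enorm v - dotp u v));
  last by ring.
by rewrite pmulr_rge0 ?subr_ge0// !mulr_gt0.
Qed.

Lemma dotp_norm_le n (u v : 'rV[R]_n) : `|dotp u v| <= enorm u * enorm v.
Proof.
by rewrite ler_norml dotp_le lerNl -dotpNl -(enormN u) dotp_le.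
Qed.

Lemma enormD n (u v : 'rV[R]_n) : enorm (u + v) <= enorm u + enorm v.
Proof.
rewrite -ler_sqr ?nnegrE ?addr_ge0 ?enorm_ge0// enorm_sqr.
rewrite dotpDl !dotpDr (dotpC v u) -!enorm_sqr.
have := dotp_le u v; lra.
Qed.

Lemma enormB n (u v : 'rV[R]_n) : enorm (u - v) <= enorm u + enorm v.
Proof. by rewrite -(enormN v) enormD. Qed.

Lemma enorm_distC n (u v : 'rV[R]_n) : enorm (u - v) = enorm (v - u).
Proof. by rewrite -enormN opprB. Qed.

Lemma enorm_dist_dist n (u v : 'rV[R]_n) : `|enorm u - enorm v| <= enorm (u - v).
Proof.
have h1 := enormD (u - v) v; have h2 := enormD (v - u) u.
move: h1 h2; rewrite !subrK (enorm_distC v) ler_norml => h1 h2.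
by apply/andP; split; lra.
Qed.

Lemma cvg_enorm (T : Type) (F : set_system T) (FF : Filter F) n
    (g : T -> 'rV[R]_n) (v : 'rV[R]_n) :
  g t @[t --> F] --> v -> enorm (g t) @[t --> F] --> enorm v.
Proof.
move=> gv; apply/cvgrPdist_lt => e e0.
have e1 : 0 < e / n.+1%:R by rewrite divr_gt0.
move/cvgrPdist_lt : gv => /(_ _ e1); apply: filterS => t.
rewrite ltr_pdivlMr// => vg.
rewrite (le_lt_trans (enorm_dist_dist _ _))// (le_lt_trans _ vg)//.
rewrite (le_trans (enorm_le_norm _))// mulrC ler_wpM2l// ler_nat.
exact: leqnSn.
Qed.

(* [vmeasurable] is a coordinatewise notion: a continuous function of [v] is a
   limit of countably-valued functions of the coordinates. *)
Definition lattice_floor n (k : nat) (v : 'rV[R]_n) : 'rV[R]_n :=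
  \row_j ((Num.floor (k.+1%:R * v 0 j))%:~R / k.+1%:R).

Lemma lattice_floor_dist n (k : nat) (v : 'rV[R]_n) :
  `|v - lattice_floor k v| <= k.+1%:R^-1.
Proof.
apply: norm_le_coord; first by rewrite invr_ge0.
move=> j; rewrite !mxE.
have k0 : 0 < k.+1%:R :> R by [].
have h1 := floor_le_tmp (k.+1%:R * v 0 j).
have h2 := lt_succ_floor (k.+1%:R * v 0 j).
set z : R := _%:~R in h1 *; rewrite intrD -/z in h2.
have -> : v 0 j - z / k.+1%:R = (k.+1%:R * v 0 j - z) / k.+1%:R.
  by field; rewrite gt_eqF.
rewrite normrM [`|_^-1|]gtr0_norm ?invr_gt0// ler_piMl ?invr_ge0//.
by rewrite ler_norml; apply/andP; split; lra.
Qed.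

Lemma measurable_fun_continuous_comp n (g : 'rV[R]_n -> R) (I : set R)
    (v : R -> 'rV[R]_n) : measurable I -> continuous g -> vmeasurable I v ->
  measurable_fun I (fun t => g (v t)).
Proof.
move=> mI cg mv.
apply: (@measurable_fun_cvg _ _ _ _ (fun k t => g (lattice_floor k (v t)))).
- move=> k _ Y mY.
  pose c : 'rV[int]_n -> 'rV[R]_n := fun z => \row_j ((z 0 j)%:~R / k.+1%:R).
  (* The cell of the lattice point [c z], kept only if [g] maps that point into [Y]; the preimage of
     [Y] is a union of countably many such cells. *)
  pose P (z : 'rV[int]_n) : set R :=
    if `[< Y (g (c z)) >] then
      \bigcap_(j in [set: 'I_n]) (I `&` (fun t => v t 0 j) @^-1`
        `[((z 0 j)%:~R / k.+1%:R : R), ((z 0 j + 1)%:~R / k.+1%:R : R)[%classic)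
    else set0.
  have k0 : 0 < k.+1%:R :> R by [].
  have -> : I `&` (fun t => g (lattice_floor k (v t))) @^-1` Y =
      I `&` \bigcup_z P z.
    apply/seteqP; split => t [It].
      move=> /= Yt; split => //.
      exists (\row_j Num.floor (k.+1%:R * v t 0 j)) => //.
      rewrite /P; have -> : c (\row_j Num.floor (k.+1%:R * v t 0 j)) =
          lattice_floor k (v t) by apply/rowP => j; rewrite !mxE.
      case: asboolP => // _ j _; split => //=.
      rewrite in_itv/= !mxE ler_pdivrMr// ltr_pdivlMr// mulrC.
      by rewrite floor_le_tmp lt_succ_floor.
    move=> [z _]; rewrite /P; case: asboolP => // Yz zt; split => //=.
    suff -> : lattice_floor k (v t) = c z by [].
    apply/rowP => j; rewrite !mxE; congr (_%:~R / _).
    have [_ /=] := zt j Logic.I; rewrite in_itv/= ler_pdivrMr// ltr_pdivlMr// mulrC.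
    by move=> h; apply/eqP; rewrite floor_eq.
  apply: measurableI => //; apply: countable_bigcupT_measurable.
    exact: countableP.
  move=> z; rewrite /P; case: asboolP => // _.
  apply: fin_bigcap_measurable; first exact: finite_finset.
  by move=> j _; apply: mv.
- move=> t It; apply: continuous_cvg; first exact: cg.
  apply/cvgrPdist_lt => e e0; near=> k.
  rewrite (le_lt_trans (lattice_floor_dist _ _))//.
  near: k; exact: near_infty_natSinv_lt (PosNum e0).
Unshelve. all: by end_near. Qed.

Lemma ae_mono (P Q : R -> Prop) : (forall t, P t -> Q t) ->
  {ae mu, forall t, P t} -> {ae mu, forall t, Q t}.
Proof. by move=> PQ [A [mA A0 PA]]; exists A; split => // t /= nQ; apply: PA => /= /PQ. Qed.

Lemma ae_and (P Q : R -> Prop) : {ae mu, forall t, P t} -> {ae mu, forall t, Q t} ->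
  {ae mu, forall t, P t /\ Q t}.
Proof.
move=> aP aQ; apply: filterS2 aP aQ; first exact: (ae_filter_ringOfSetsType mu).
by [].
Qed.

Lemma ess_sup_norm_le n (I : set R) (g : R -> 'rV[R]_n) (c : R) :
  (ess_sup_norm I g <= c%:E)%E ->
  {ae mu, forall t, I t -> enorm (g t) <= c}.
Proof.
move/ess_supP; apply: ae_mono => t + It; rewrite patchE mem_set// lee_fin.
Qed.

Lemma ess_sup_norm_lty n (I : set R) (g : R -> 'rV[R]_n) :
  (ess_sup_norm I g < +oo)%E ->
  exists2 c : R, 0 <= c & {ae mu, forall t, I t -> enorm (g t) <= c}.
Proof.
move=> H; exists (Num.max 0 (fine (ess_sup_norm I g))).
  by rewrite le_max lexx.
apply: ess_sup_norm_le.
move: H; case: ess_sup_norm => [s| |]//= _; last by rewrite leNye.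
by rewrite lee_fin le_max lexx orbT.
Qed.

Lemma le_ess_sup_norm n (I : set R) (g : R -> 'rV[R]_n) (c : R) : 0 <= c ->
  {ae mu, forall t, I t -> enorm (g t) <= c} ->
  (ess_sup_norm I g <= c%:E)%E.
Proof.
move=> c0 H; apply/ess_supP; move: H.
apply: ae_mono => t h; rewrite patchE; case: ifPn => [/set_mem/h|_]; first by rewrite lee_fin.
by rewrite lee_fin.
Qed.

End RowVectors.

Section RealInduction.
Context {R : realType}.
Implicit Types (a b : R).

(** Induction along an interval: the supremum of the points up to which [P] holds is itself such a
    point by the second premise; if it were less than [b], the third premise would push it
    further. *)
Lemma real_induction a b (P : R -> Prop) :
  P a ->
  (forall t, a < t -> t <= b -> (forall s, a <= s -> s < t -> P s) -> P t) ->
  (forall t, a <= t -> t < b -> (forall s, a <= s -> s <= t -> P s) ->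
    exists2 rho : R, 0 < rho & forall s, t < s -> s < t + rho -> s <= b -> P s) ->
  forall t, a <= t -> t <= b -> P t.
Proof.
move=> Pa Pl Pr t0 at0 t0b; have ab := le_trans at0 t0b.
pose S := [set t | [/\ a <= t, t <= b & forall s, a <= s -> s <= t -> P s]].
have Sa : S a.
  split => // s as_ sa; suff -> : s = a by [].
  by apply/eqP; rewrite eq_le sa as_.
have hS : has_sup S by split; [exists a|exists b => t []].
pose c := sup S.
have ac : a <= c by apply: ub_le_sup => //; exact: hS.2.
have cb : c <= b by apply: ge_sup; [exists a|move=> t []].
have Pc0 s : a <= s -> s < c -> P s.
  move=> as_ sc; have e0 : 0 < c - s by rewrite subr_gt0.
  have [u [au ub Pu]] := sup_adherent e0 hS.
  by rewrite subKr => su; apply: Pu => //; exact: ltW.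
have Pc s : a <= s -> s <= c -> P s.
  move=> as_; rewrite le_eqVlt => /predU1P[->|]; last exact: Pc0.
  move: ac; rewrite le_eqVlt => /predU1P[<- //|ac']; exact: Pl.
move: cb; rewrite le_eqVlt => /predU1P[cb|cb].
  by apply: Pc => //; rewrite cb.
have [rho rho0 Prho] := Pr _ ac cb Pc.
pose t := Num.min b (c + rho / 2).
have ct : c < t by rewrite /t lt_min cb ltrDl divr_gt0.
have : S t.
  have tb : t <= b by rewrite /t ge_min lexx.
  split => //; first exact: le_trans (ltW ct).
  move=> s as_ st; have [sc|cs] := leP s c; first exact: Pc.
  apply: Prho => //; last exact: le_trans tb.
  apply: (le_lt_trans st); rewrite /t gt_min; apply/orP; right.
  by rewrite ltrD2l ltr_pdivrMr// ltr_pMr// ltr1n.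
by move=> St; have := ub_le_sup hS.2 St; rewrite leNgt ct.
Qed.

Lemma within_continuous_dist (V : normedModType R) (D : set R) (g : R -> V) :
  {within D, continuous g} <->
  forall x, D x -> forall e : R, 0 < e ->
  exists2 d : R, 0 < d & forall y, D y -> `|y - x| < d -> `|g y - g x| < e.
Proof.
split=> [/subspace_continuousP gD x Dx e e0|H].
  have /cvgrPdist_lt/(_ e e0) := gD x Dx.
  rewrite near_withinE => /nbhs_ballP[d /= d0 dg].
  exists d => // y Dy yx; rewrite distrC; apply: dg => //.
  by rewrite /ball/= distrC.
apply/subspace_continuousP => x Dx; apply/cvgrPdist_lt => e e0.
have [d d0 Hd] := H x Dx e e0.
rewrite near_withinE; apply/nbhs_ballP; exists d => // y /= xy Dy.
by rewrite distrC; apply: Hd => //; rewrite distrC.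
Qed.

Lemma compact_norm_le (V : normedModType R) (K : set V) : compact K ->
  exists2 B : R, 0 <= B & forall v, K v -> `|v| <= B.
Proof.
move=> /compact_bounded[B [_ HB]]; exists (`|B| + 1); first by rewrite addr_ge0.
by move=> v; apply: HB; rewrite (le_lt_trans (ler_norm _))// ltrDl.
Qed.

Lemma within_bounded (V : normedModType R) (g : R -> V) a b :
  {within `[a, b], continuous g} -> exists2 B : R, 0 <= B &
  forall t, a <= t -> t <= b -> `|g t| <= B.
Proof.
move=> /continuous_compact/(_ (@segment_compact R a b))/compact_norm_le[B B0 HB].
by exists B => // t at_ tb; apply: HB; exists t => //; rewrite /= in_itv/= at_.
Qed.

(** A continuous [V] can leave the region [V <= k] only at a point where [V = k], and there the last
    premise forbids it. No derivative of [V] is involved. *)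
Lemma barrier a b (V : R -> R) (k : R) : {within `[a, b], continuous V} ->
  V a <= k ->
  (forall s, a <= s -> s < b -> V s = k -> exists2 rho : R, 0 < rho &
    forall t, s < t -> t < s + rho -> t <= b -> V t <= k) ->
  forall t, a <= t -> t <= b -> V t <= k.
Proof.
move=> /within_continuous_dist cV Va H; apply: real_induction => //.
- move=> t at_ tb Vs; rewrite leNgt; apply/negP => kV.
  have e0 : 0 < V t - k by rewrite subr_gt0.
  have [|d d0 Hd] := cV t _ _ e0; first by rewrite /= in_itv/= (ltW at_).
  pose s := Num.max a (t - d / 2).
  have st : s < t by rewrite /s gt_max at_ gtrBl divr_gt0.
  have as_ : a <= s by rewrite /s le_max lexx.
  have := Vs s as_ st.
  have : `|V s - V t| < V t - k.
    apply: Hd; first by rewrite /= in_itv/= as_ (le_trans (ltW st)).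
    rewrite ltr0_norm ?subr_lt0// opprB.
    have : t - d / 2 <= s by rewrite /s le_max lexx orbT.
    by lra.
  by rewrite ltr_norml => /andP[]; lra.
- move=> t at_ tb Vs.
  have := Vs t at_ (lexx _); rewrite le_eqVlt => /predU1P[Vt|Vt]; first exact: H.
  have e0 : 0 < k - V t by rewrite subr_gt0.
  have [|d d0 Hd] := cV t _ _ e0; first by rewrite /= in_itv/= at_ ltW.
  exists d => // s ts sd sb.
  have : `|V s - V t| < k - V t.
    apply: Hd; first by rewrite /= in_itv/= sb (le_trans at_)// ltW.
    by rewrite gtr0_norm ?subr_gt0// ltrBlDl.
  by rewrite ltr_norml => /andP[]; lra.
Qed.

(** A mean value inequality that uses right-hand increments alone. With the slack [eta] the function
    [q t - (M + eta) * (t - a)] does not exceed its initial value by [barrier]; then [eta] tends to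
    0. *)
Lemma dini_bound a b (q : R -> R) (M : R) : a <= b ->
  {within `[a, b], continuous q} ->
  (forall s, a <= s -> s < b -> forall eta : R, 0 < eta ->
    exists2 rho : R, 0 < rho &
    forall t, s < t -> t < s + rho -> t <= b -> q t - q s <= (M + eta) * (t - s)) ->
  q b - q a <= M * (b - a).
Proof.
move=> ab cq H.
suff Heta eta : 0 < eta -> q b - q a <= (M + eta) * (b - a).
  apply/ler_addgt0Pr => e e0.
  have ba0 : 0 < b - a + 1 by rewrite ltr_wpDl// subr_ge0.
  (* The summand 1 in the denominator covers the case [a = b]. *)
  have /le_trans := Heta (e / (b - a + 1)) (divr_gt0 e0 ba0); apply.
  rewrite mulrDl lerD2l mulrAC ler_pdivrMr//.
  by rewrite ler_wpM2l ?lerDl// ltW.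
move=> eta0.
pose V t := q t - (M + eta) * (t - a).
have : V b <= q a.
  apply: (@barrier a b V (q a)) => //.
  - apply/subspace_continuousP => x xab; apply: cvgB.
      by move/subspace_continuousP : cq; exact.
    apply: cvg_within_filter; apply: cvgM; first exact: cvg_cst.
    by apply: cvgB; [exact: cvg_id|exact: cvg_cst].
  - by rewrite /V subrr mulr0 subr0.
  move=> s as_ sb Vs; have [rho rho0 Hrho] := H s as_ sb eta eta0.
  exists rho => // t st trho tb; rewrite -Vs /V.
  have := Hrho t st trho tb; lra.
by rewrite /V; lra.
Qed.

Lemma dini_lipschitz a b n (g : R -> 'rV[R]_n) (M : R) : a <= b ->
  {within `[a, b], continuous g} ->
  (forall s, a <= s -> s < b -> forall eta : R, 0 < eta ->
    exists2 rho : R, 0 < rho & forall t, s < t -> t < s + rho -> t <= b ->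
      enorm (g t - g s) <= (M + eta) * (t - s)) ->
  enorm (g b - g a) <= M * (b - a).
Proof.
move=> ab cg H.
pose q t := enorm (g t - g a).
have -> : enorm (g b - g a) = q b - q a by rewrite /q subrr enorm0 subr0.
apply: dini_bound => //.
  apply/subspace_continuousP => x abx; apply: cvg_enorm.
  by apply: cvgB; [move/subspace_continuousP : cg; exact|exact: cvg_cst].
move=> s as_ sb eta eta0; have [rho rho0 Hrho] := H s as_ sb eta eta0.
exists rho => // t st tr tb; apply: le_trans (Hrho t st tr tb).
rewrite /q; have := enormD (g t - g s) (g s - g a).
by rewrite addrA subrK; lra.
Qed.

End RealInduction.

Section Derivatives.
Context {R : realType} {V : normedModType R}.
Implicit Types (D : set R) (g : R -> V).

(** Multiplying by the increment removes the quotient and the puncture of the neighbourhood: the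
    estimate is also meaningful, and true, at [s = x]. *)
Lemma has_derivative_in_dist D g x l :
  has_derivative_in D g x l <->
  forall e : R, 0 < e -> exists2 d : R, 0 < d &
    forall s, D s -> `|s - x| < d -> `|g s - g x - (s - x) *: l| <= e * `|s - x|.
Proof.
rewrite /has_derivative_in; split => [/cvgrPdist_lt H e e0|H].
  have := H e e0; rewrite near_withinE => /nbhs_ballP[d /= d0 dH].
  exists d => // s Ds sx.
  have [->|nsx] := eqVneq s x; first by rewrite !subrr scale0r subr0 !normr0 mulr0.
  have xs : `|x - s| < d by rewrite distrC.
  have sx0 : s - x != 0 by rewrite subr_eq0.
  have /ltW := dH s xs nsx Ds.
  rewrite -(ler_pM2r (x := `|s - x|)) ?normr_gt0// distrC mulrC -normrZ.
  by rewrite scalerBr scalerA divff// scale1r.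
apply/cvgrPdist_le => e e0; have [d d0 Hd] := H e e0.
rewrite near_withinE; apply/nbhs_ballP; exists d => // s /= xs nsx Ds.
have sx0 : s - x != 0 by rewrite subr_eq0.
rewrite distrC -(ler_pM2r (x := `|s - x|)) ?normr_gt0// mulrC -normrZ.
rewrite scalerBr scalerA divff// scale1r.
by apply: Hd => //; rewrite distrC.
Qed.

(** The two limits are taken along the same germ, so the equality holds even where the derivative
    does not exist. The values at [x] are compared separately since [x] may lie outside [D]. *)
Lemma derive_in_local D D' g g' x (d : R) : 0 < d -> g x = g' x ->
  (forall s, `|s - x| < d -> (D s <-> D' s) /\ (D s -> g s = g' s)) ->
  derive_in D g x = derive_in D' g' x.
Proof.
move=> d0 gx H; rewrite /derive_in; congr lim.
rewrite eqEsubset; split => A /=; rewrite !near_simpl/= !near_withinE;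
  move=> /nbhs_ballP[d1 /= d10 H1]; apply/nbhs_ballP;
  exists (Num.min d d1); rewrite /= ?lt_min ?d0// => s /=;
  rewrite /ball/= lt_min => /andP[sd sd1] nsx Ds;
  move: (sd); rewrite distrC => /H[DD' gg'].
  by rewrite -gx -gg'; [apply: H1 => //; exact/DD'|exact/DD'].
by rewrite gx gg'//; apply: H1 => //; exact/DD'.
Qed.

Lemma has_derivative_in_local D D' g g' x l (d : R) : 0 < d -> g x = g' x ->
  (forall s, `|s - x| < d -> D' s -> D s /\ g s = g' s) ->
  has_derivative_in D g x l -> has_derivative_in D' g' x l.
Proof.
move=> d0 gx H /has_derivative_in_dist Dg; apply/has_derivative_in_dist => e e0.
have [d1 d10 H1] := Dg e e0; exists (Num.min d d1); rewrite ?lt_min ?d0//.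
move=> s Ds; rewrite lt_min => /andP[sd sd1].
by have [D's <-] := H s sd Ds; rewrite -gx; exact: H1.
Qed.

Lemma has_derivative_inB D (g1 g2 : R -> V) x l1 l2 :
  has_derivative_in D g1 x l1 -> has_derivative_in D g2 x l2 ->
  has_derivative_in D (fun s => g1 s - g2 s) x (l1 - l2).
Proof.
move=> /has_derivative_in_dist H1 /has_derivative_in_dist H2.
apply/has_derivative_in_dist => e e0; have e20 : 0 < e / 2 by rewrite divr_gt0.
have [d1 d10 K1] := H1 _ e20; have [d2 d20 K2] := H2 _ e20.
exists (Num.min d1 d2); rewrite ?lt_min ?d10// => s Ds; rewrite lt_min => /andP[sd1 sd2].
have AC (a b c d : V) : a - b - (c - d) = a - c - (b - d).
  by rewrite opprD addrACA -opprD.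
rewrite scalerBr (AC (g1 s)) (AC (g1 s - g1 x)).
rewrite (le_trans (ler_normB _ _))// (splitr e) mulrDl.
by apply: lerD; [exact: K1|exact: K2].
Qed.

(** A nondegenerate interval of [D] that contains [x] makes the filter proper, so that a derivative
    relative to [D] is unique. *)
Lemma limit_point_itv D a b x : a < b -> a <= x <= b ->
  `[a, b]%classic `<=` D -> ProperFilter (within D x^').
Proof.
move=> ab /andP[ax xb] abD; split; last exact: within_filter.
rewrite /within/= => /nbhs_ballP[d /= d0 H].
have [xb'|bx] := ltP x b.
  pose s := Num.min b (x + d / 2).
  have xs : x < s by rewrite /s lt_min xb' ltrDl divr_gt0.
  apply: (H s); last 2 first.
  - by rewrite gt_eqF.
  - apply: abD; rewrite /= in_itv/= (le_trans ax (ltW xs))/=.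
    by rewrite /s ge_min lexx.
  rewrite /ball/= distrC gtr0_norm ?subr_gt0// ltrBlDl.
  rewrite /s gt_min ltrD2l [X in _ || X](_ : _ = true) ?orbT//.
  by rewrite ltr_pdivrMr// ltr_pMr// ltr1n.
have ax' : a < x by exact: lt_le_trans bx.
pose s := Num.max a (x - d / 2).
have sx : s < x by rewrite /s gt_max ax' gtrBl divr_gt0.
apply: (H s); last 2 first.
- by rewrite lt_eqF.
- apply: abD; rewrite /= in_itv/= (le_trans (ltW sx) xb) andbT.
  by rewrite /s le_max lexx.
rewrite /ball/= gtr0_norm ?subr_gt0//.
have : x - d / 2 <= s by rewrite /s le_max lexx orbT.
have : d / 2 < d by rewrite ltr_pdivrMr// ltr_pMr// ltr1n.
lra.
Qed.

Lemma derive_inE D g a b x l : a < b -> a <= x <= b ->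
  `[a, b]%classic `<=` D -> has_derivative_in D g x l -> derive_in D g x = l.
Proof.
move=> ab axb abD gl; have FF := limit_point_itv ab axb abD.
by apply/cvg_lim => //; exact: norm_hausdorff.
Qed.

End Derivatives.

Lemma has_derivative_in_coord {R : realType} n (D : set R) (g : R -> 'rV[R]_n) x l :
  has_derivative_in D g x l <->
  forall j, has_derivative_in D (fun t => g t 0 j) x (l 0 j).
Proof.
rewrite /has_derivative_in; split => [H j|H].
  have -> : (fun s => (s - x)^-1 *: (g s 0 j - g x 0 j)) =
      (fun s => ((s - x)^-1 *: (g s - g x)) 0 j).
    by apply/funext => s; rewrite !mxE.
  exact: (@cvg_to_coord _ _ _ (within_filter _ _) _ _ _ j H).
apply: (@cvg_coord _ _ _ (within_filter _ _)) => j.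
have -> : (fun s => ((s - x)^-1 *: (g s - g x)) 0 j) =
    (fun s => (s - x)^-1 *: (g s 0 j - g x 0 j)).
  by apply/funext => s; rewrite !mxE.
exact: H.
Qed.

Lemma is_derive_has_derivative_in {R : realType} (D : set R) (g : R -> R) (x l : R) :
  is_derive x 1 g l -> has_derivative_in D g x l.
Proof.
move=> gl; have dg : derivable g x 1 by [].
have gE : 'D_1 g x = l by exact: derive_val.
move: dg => /cvg_ex[l' Hl'].
have ll' : l' = l by rewrite -gE; apply/esym/cvg_lim.
rewrite {}ll' in Hl'.
apply/has_derivative_in_dist => e e0.
move/cvgrPdist_lt : Hl' => /(_ e e0)/nbhs_ballP[d /= d0 Hd].
exists d => // s Ds sx.
have [->|nsx] := eqVneq s x; first by rewrite !subrr scale0r subr0 !normr0 mulr0.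
have sx0 : s - x != 0 by rewrite subr_eq0.
have /ltW := Hd (s - x) ltac:(by rewrite /ball/= sub0r normrN) sx0.
rewrite -(ler_pM2r (x := `|s - x|)) ?normr_gt0// distrC mulrC -normrM.
rewrite mulrBr [_ *: 1]mulr1 subrK /GRing.scale/= mulrA divff// mul1r.
by [].
Qed.

Section IntervalIntegrals.
Context {R : realType}.
Local Notation mu := (@lebesgue_measure R).
Implicit Types (a b c : R) (f g u : R -> R).

Definition itg a b f := mu.-integrable `[a, b] (EFin \o f).
Definition rint a b f : R := \int[mu]_(t in `[a, b]) f t.

Lemma itg_sub a b c d f : a <= c -> d <= b -> itg a b f -> itg c d f.
Proof.
move=> ac db; apply: integrableS => //.
move=> x /=; rewrite !in_itv/= => /andP[cx xd].
by rewrite (le_trans ac cx) (le_trans xd db).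
Qed.

Lemma itg_measurable a b f : itg a b f -> measurable_fun `[a, b] f.
Proof. by move=> /measurable_int/measurable_EFinP. Qed.

(** Measurability of [g] is assumed because the Borel sets are not complete: a function equal almost
    everywhere to a measurable one need not be measurable. *)
Lemma itg_ae_eq a b f g : measurable_fun `[a, b] g -> itg a b f ->
  {ae mu, forall t, `[a, b]%classic t -> f t = g t} ->
  itg a b g /\ rint a b g = rint a b f.
Proof.
move=> mg /[dup] itf /integrableP[mf foo] fg.
have mg' : measurable_fun `[a, b] (EFin \o g) by exact/measurable_EFinP.
split.
  apply/integrableP; split => //.
  apply: le_lt_trans foo; rewrite le_eqVlt; apply/orP; left; apply/eqP.
  apply: ae_eq_integral => //.
  - exact: measurableT_comp.
  - exact: measurableT_comp.
  by apply: ae_mono fg => t /= h /h ->.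
rewrite /rint /Rintegral; congr fine.
apply: ae_eq_integral => //.
by apply: ae_mono fg => t /= h /h ->.
Qed.

(** The truncation of [f] at [M] is bounded everywhere, hence integrable, and equals [f] almost
    everywhere. *)
Lemma ae_bounded_itg a b f (M : R) : measurable_fun `[a, b] f ->
  {ae mu, forall t, `[a, b]%classic t -> `|f t| <= M} -> itg a b f.
Proof.
move=> mf fM; pose g t := Num.max (- M) (Num.min M (f t)).
have mg : measurable_fun `[a, b] g.
  by apply: measurable_maxr => //; apply: measurable_minr.
have ig : itg a b g.
  apply: measurable_bounded_integrable => //.
    have : (mu `[a, b]%classic < +oo)%E; last by [].
    by rewrite lebesgue_measure_itv/=; case: ifP => // _; rewrite -EFinD ltry.
  exists `|M|; split; first exact: num_real.
  move=> y My t _ /=; rewrite ler_norml /g le_max ge_max.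
  have := ler_norm M; have := ler_norm (- M); rewrite normrN => h1 h2.
  have hM : M <= y by lra.
  have hN : - M <= y by lra.
  by rewrite lerN2 hM hN ge_min hM.
apply: (itg_ae_eq mf ig _).1; apply: ae_mono fM => t h /h; rewrite ler_norml /g.
by move=> /andP[Mf fM]; rewrite (min_r fM) (max_r Mf).
Qed.

Lemma continuous_itg a b f : {within `[a, b], continuous f} -> itg a b f.
Proof.
by move=> cf; apply: continuous_compact_integrable => //; exact: segment_compact.
Qed.

Lemma rint_split a b c f : a <= b -> b <= c -> itg a c f ->
  rint a c f = rint a b f + rint b c f.
Proof.
move=> ab bc itf; rewrite /rint.
have -> : `[a, c]%classic = `[a, b]%classic `|` `]b, c]%classic :> set R.
  by rewrite -(@itv_bndbnd_setU _ _ _ (BRight b)).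
rewrite Rintegral_setU//; last 2 first.
- by rewrite -itv_bndbnd_setU.
- apply/disj_setPLR => x /=; rewrite !in_itv/= => /andP[_ xb].
  by apply/negP; rewrite negb_and -!leNgt xb.
congr (_ + _); rewrite /Rintegral integral_itv_obnd_cbnd//.
apply: measurable_funS (measurable_int _ itf) => //.
move=> x /=; rewrite !in_itv/= => /andP[bx ->].
by rewrite andbT (le_trans ab)// ltW.
Qed.

Lemma rint_point a f : rint a a f = 0.
Proof. by rewrite /rint set_itv1 /Rintegral integral_set1. Qed.

Lemma rint_cst a b (M : R) : a <= b -> rint a b (fun=> M) = M * (b - a).
Proof.
move=> ab; rewrite /rint /Rintegral integral_cst//=.
rewrite lebesgue_measure_itv/= lte_fin.
move: ab; rewrite le_eqVlt => /predU1P[->|ab].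
  by rewrite ltxx mule0 subrr mulr0.
by rewrite ab.
Qed.

Lemma itg_cst a b (M : R) : itg a b (fun=> M).
Proof.
by apply: (@ae_bounded_itg a b (fun=> M) `|M|) => //; apply: aeW.
Qed.

Lemma rint_le_ae a b f g : itg a b f -> itg a b g ->
  {ae mu, forall t, `[a, b]%classic t -> f t <= g t} -> rint a b f <= rint a b g.
Proof.
move=> itf itg_ fg; pose k t := Num.min (f t) (g t).
have mk : measurable_fun `[a, b] k.
  by apply: measurable_minr; exact: itg_measurable.
have [|ik <-] := itg_ae_eq mk itf.
  by apply: ae_mono fg => t h /h tfg; rewrite /k min_l.
by apply: le_Rintegral => // t _; rewrite /k ge_min lexx orbT.
Qed.

Lemma rint_abs_le a b f (M : R) : a <= b -> itg a b f ->
  {ae mu, forall t, `[a, b]%classic t -> `|f t| <= M} ->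
  `|rint a b f| <= M * (b - a).
Proof.
move=> ab itf fM; rewrite ler_norml; apply/andP; split.
  rewrite -mulNr -rint_cst//; apply: rint_le_ae => //; first exact: itg_cst.
  by apply: ae_mono fM => t h /h; rewrite ler_norml => /andP[].
rewrite -rint_cst//; apply: rint_le_ae => //; first exact: itg_cst.
by apply: ae_mono fM => t h /h; rewrite ler_norml => /andP[].
Qed.

Lemma itgD a b f g : itg a b f -> itg a b g -> itg a b (fun t => f t + g t).
Proof.
move=> itf itg_; rewrite /itg; have -> : EFin \o (fun t => f t + g t) = ((EFin \o f) \+ (EFin \o g))%E.
  by apply/funext => t.
exact: integrableD.
Qed.

Lemma itgZ a b f (k : R) : itg a b f -> itg a b (fun t => k * f t).
Proof.
move=> itf; rewrite /itg.
have -> : EFin \o (fun t => k * f t) = (fun t => k%:E * (EFin \o f) t)%E.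
  by apply/funext => t.
exact: integrableZl.
Qed.

Lemma rintD a b f g : itg a b f -> itg a b g ->
  rint a b (fun t => f t + g t) = rint a b f + rint a b g.
Proof. by move=> itf itg_; rewrite /rint RintegralD. Qed.

Lemma rintZ a b f (k : R) : itg a b f ->
  rint a b (fun t => k * f t) = k * rint a b f.
Proof. by move=> itf; rewrite /rint RintegralZl. Qed.

Lemma rintB a b f g : itg a b f -> itg a b g ->
  rint a b (fun t => f t - g t) = rint a b f - rint a b g.
Proof. by move=> itf itg_; rewrite /rint RintegralB. Qed.

Lemma itgB a b f g : itg a b f -> itg a b g -> itg a b (fun t => f t - g t).
Proof.
move=> itf itg_; rewrite /itg; have -> : EFin \o (fun t => f t - g t) = ((EFin \o f) \- (EFin \o g))%E.
  by apply/funext => t.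
exact: integrableB.
Qed.

Lemma rint_dominated a b (f_ : nat -> R -> R) f (M : R) :
  (forall k, measurable_fun `[a, b] (f_ k)) -> measurable_fun `[a, b] f ->
  {ae mu, forall t, `[a, b]%classic t -> f_ k t @[k --> \oo] --> f t} ->
  {ae mu, forall t, forall k, `[a, b]%classic t -> `|f_ k t| <= M} ->
  rint a b (f_ k) @[k --> \oo] --> rint a b f.
Proof.
move=> mf_ mf f_f f_M.
have [||||||itf _ cvg] := @dominated_convergence _ _ _ mu `[a, b]%classic _
  (fun k => EFin \o f_ k) (EFin \o f) (cst M%:E).
- by [].
- by move=> k; apply/measurable_EFinP; exact: mf_.
- exact/measurable_EFinP.
- by apply: ae_mono f_f => t h /h fft; apply: cvg_EFin => //=; exact: nearW.
- exact: itg_cst.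
- by apply: ae_mono f_M => t h k /(h k); rewrite lee_fin.
have E : (\int[mu]_(x in `[a, b]) (EFin \o f) x)%E = (rint a b f)%:E.
  by rewrite /rint /Rintegral fineK//; exact: integrable_fin_num.
by rewrite E in cvg; move/fine_cvgP : cvg => [_].
Qed.

End IntervalIntegrals.

Section Calculus.
Context {R : realType}.
Local Notation mu := (@lebesgue_measure R).
Implicit Types (a b : R) (f g u : R -> R).

Lemma primitive_has_derivative a b u g x : a <= x <= b -> itg a b g ->
  (forall s t, a <= s -> s <= t -> t <= b -> u t - u s = rint s t g) ->
  (forall e : R, 0 < e -> exists2 d : R, 0 < d &
     forall y, a <= y <= b -> `|y - x| < d -> `|g y - g x| < e) ->
  has_derivative_in `[a, b] u x (g x).
Proof.
move=> /andP[ax xb] itg_ ug cg; apply/has_derivative_in_dist => e e0.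
have [d d0 Hd] := cg e e0; exists d => // s; rewrite /= in_itv/= => /andP[as_ sb] sx.
have key y z : a <= y -> y <= z -> z <= b -> (y = x \/ z = x) -> z - y < d ->
    `|rint y z g - (z - y) * g x| <= e * (z - y).
  move=> ay yz zb yzx zyd.
  have iyz : itg y z g by apply: itg_sub itg_.
  have -> : rint y z g - (z - y) * g x = rint y z (fun t => g t - g x).
    by rewrite rintB ?rint_cst// 1?mulrC//; exact: itg_cst.
  apply: rint_abs_le => //; first by apply: itgB => //; exact: itg_cst.
  apply: aeW => t /=; rewrite in_itv/= => /andP[yt tz].
  apply/ltW/Hd; first by rewrite (le_trans ay yt) (le_trans tz zb).
  by rewrite ltr_norml; apply/andP; split; case: yzx => E; lra.
have [xs|/ltW sx'] := leP x s.
  rewrite ug// [`|s - x|]ger0_norm ?subr_ge0//; apply: key => //; first by left.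
  by move: sx; rewrite ger0_norm ?subr_ge0.
rewrite -(opprB (u x)) ug// -(opprB x) scaleNr -opprD normrN.
rewrite normrN [`|x - s|]ger0_norm ?subr_ge0// [_ *: _]/(_ * _).
apply: key => //; first by right.
by move: sx; rewrite distrC ger0_norm ?subr_ge0.
Qed.

(** Derivatives relative to [[a, b]] are one-sided at the end points. The difference of [u] and the
    primitive of [g] has derivative 0, so [dini_bound] with [M = 0] applies to it and to its
    negative. *)
Lemma derivative_primitive a b u g : a <= b ->
  {within `[a, b], continuous g} ->
  (forall x, a <= x <= b -> has_derivative_in `[a, b] u x (g x)) ->
  u b - u a = rint a b g.
Proof.
move=> ab cg ug.
have ig := continuous_itg cg.
pose F x := rint a x g.
have FE s t : a <= s -> s <= t -> t <= b -> F t - F s = rint s t g.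
  move=> as_ st tb; rewrite /F.
  by have -> := rint_split as_ st (itg_sub (lexx a) tb ig); ring.
have dF x : a <= x <= b -> has_derivative_in `[a, b] F x (g x).
  move=> axb; apply: (primitive_has_derivative axb ig) => // e e0.
  have /within_continuous_dist/(_ x) := cg.
  rewrite /= in_itv/= => /(_ axb e e0)[d d0 Hd].
  by exists d => // y ayb; apply: Hd; rewrite /= in_itv.
have dz x (e : R) : a <= x <= b -> 0 < e -> exists2 d : R, 0 < d &
    forall s, a <= s <= b -> `|s - x| < d ->
    `|(u s - F s) - (u x - F x)| <= e * `|s - x|.
  move=> axb e0; have e20 : 0 < e / 2 by rewrite divr_gt0.
  have /has_derivative_in_dist/(_ _ e20)[d1 d10 H1] := ug x axb.
  have /has_derivative_in_dist/(_ _ e20)[d2 d20 H2] := dF x axb.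
  exists (Num.min d1 d2); rewrite ?lt_min ?d10// => s asb; rewrite lt_min => /andP[sd1 sd2].
  have ss : `[a, b]%classic s by rewrite /= in_itv.
  have h1 := H1 s ss sd1; have h2 := H2 s ss sd2.
  rewrite (_ : _ - _ = (u s - u x - (s - x) *: g x) - (F s - F x - (s - x) *: g x));
    last by ring.
  by rewrite (le_trans (ler_normB _ _))//; lra.
have cz : {within `[a, b], continuous (fun s => u s - F s)}.
  apply/within_continuous_dist => x; rewrite /= in_itv/= => axb e e0.
  have [d d0 Hd] := dz x 1 axb ltr01.
  exists (Num.min d e); rewrite ?lt_min ?d0// => y; rewrite /= in_itv/= => ayb.
  rewrite lt_min => /andP[yd ye].
  by rewrite (le_lt_trans (Hd y ayb yd))// mul1r.
have H1 : (u b - F b) - (u a - F a) <= 0 * (b - a).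
  apply: (@dini_bound _ a b (fun s => u s - F s)) => // s as_ sb eta eta0.
  have [|d d0 Hd] := dz s _ _ eta0; first by rewrite as_ ltW.
  exists d => // t st td tb; rewrite add0r (le_trans (ler_norm _))//.
  rewrite -[t - s]ger0_norm ?subr_ge0; last exact: ltW.
  by apply: Hd; rewrite ?tb ?(le_trans as_ (ltW st))// gtr0_norm ?subr_gt0// ltrBlDl.
have H2 : - (u b - F b) - - (u a - F a) <= 0 * (b - a).
  apply: (@dini_bound _ a b (fun s => - (u s - F s))) => //.
    apply/subspace_continuousP => x xab; apply: cvgN.
    by move/subspace_continuousP : cz; exact.
  move=> s as_ sb eta eta0.
  have [|d d0 Hd] := dz s _ _ eta0; first by rewrite as_ ltW.
  exists d => // t st td tb; rewrite add0r -opprD (le_trans (ler_norm _))// normrN.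
  rewrite -[t - s]ger0_norm ?subr_ge0; last exact: ltW.
  by apply: Hd; rewrite ?tb ?(le_trans as_ (ltW st))// gtr0_norm ?subr_gt0// ltrBlDl.
have -> : rint a b g = F b - F a by rewrite /F rint_point subr0.
by move: H1 H2; rewrite mul0r; lra.
Qed.

Lemma primitive_ae_derive a b u g : a < b -> itg a b g ->
  (forall x, a <= x -> x <= b -> u x - u a = rint a x g) ->
  {ae mu, forall x, a < x < b -> is_derive x 1 u (g x)}.
Proof.
move=> ab ig ug.
pose G := g \_ `[a, b].
have iG : mu.-integrable setT (EFin \o G).
  by rewrite -restrict_EFin; apply/(integrable_mkcond _ _).1.
have iGy (y : R) : mu.-integrable `[a, y] (EFin \o G) by apply: integrableS iG.
have := @FTC1 R G (BLeft a) (fun y => iGy y)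
  (open_integrable_locally openT iG).
apply: ae_mono => x /= + /andP[ax xb].
rewrite lte_fin ax => /(_ isT)[dF FD].
have GE y : a <= y -> y <= b -> \int[mu]_(t in `[a, y]) G t = rint a y g.
  move=> ay yb; apply: eq_Rintegral => t; rewrite inE/= in_itv/= => /andP[at_ ty].
  by rewrite /G patchE mem_set//= in_itv/= at_ (le_trans ty yb).
apply: (@near_eq_is_derive _ _ _ (fun x => \int[mu]_(t in `[a, x]) G t + u a)).
- near=> y.
  have ay : a <= y by apply: ltW; near: y; exact: lt_nbhsr.
  have yb : y <= b by apply: ltW; near: y; exact: lt_nbhsl.
  by rewrite GE// -ug// subrK.
- rewrite -[g x]addr0; apply: is_deriveD.
  apply: DeriveDef; first exact: dF.
  rewrite -derive1E FD /G patchE mem_set//= in_itv/=.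
  by rewrite (ltW ax) (ltW xb).
Unshelve. all: by end_near. Qed.

Lemma lipschitz_AC (V : normedModType R) a b (k : R) (u : R -> V) : 0 <= k ->
  (forall s t, a <= s -> s <= t -> t <= b -> `|u t - u s| <= k * (t - s)) ->
  absolutely_continuous a b u.
Proof.
move=> k0 ku eps eps0; have k1 : 0 < k + 1 by rewrite ltr_wpDl.
exists (eps / (k + 1)); first exact: divr_gt0.
move=> n p q pq _; rewrite ltr_pdivlMr// => pqe.
apply: le_lt_trans pqe; rewrite mulrC mulr_sumr; apply: ler_sum => i _.
have [ap pq' qb] := pq i (ltn_ord i).
by rewrite (le_trans (ku _ _ ap pq' qb))// ler_wpM2r ?subr_ge0// lerDl.
Qed.

Lemma AC_coord a b n (g : R -> 'rV[R]_n) j : absolutely_continuous a b g ->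
  absolutely_continuous a b (fun t => g t 0 j).
Proof.
move=> acg eps eps0; have [delta delta0 H] := acg eps eps0.
exists delta => // k u v uv tuv suv; apply: le_lt_trans (H k u v uv tuv suv).
by apply: ler_sum => i _; have := coord_le_norm (g (v i) - g (u i)) j; rewrite !mxE.
Qed.

Lemma ae_neq (c : R) : {ae mu, forall t : R, t <> c}.
Proof.
exists [set c]; split; [exact: measurable_set1|exact: lebesgue_measure_set1|].
by move=> x /= /contrapT.
Qed.

(** Absolute continuity provides the derivative almost everywhere; [H] only has to be its value
    where it exists. This is the form in which a differential equation valid almost everywhere is
    used. *)
Lemma AC_is_derive_primitive a b (g H : R -> R) : a < b ->
  absolutely_continuous a b g -> measurable_fun `[a, b] H ->
  {ae mu, forall t, a < t < b -> forall l, is_derive t 1 g l -> l = H t} ->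
  itg a b H /\
  forall s t, a <= s -> s <= t -> t <= b -> g t - g s = rint s t H.
Proof.
move=> ab acg mH gH; have [D [iD gD dD]] := AC_FTC ab acg.
have iabD : itg a b D by apply: integrableS iD.
have DH : {ae mu, forall t, `[a, b]%classic t -> D t = H t}.
  have := ae_and (ae_and gH dD) (ae_and (ae_neq a) (ae_neq b)); apply: ae_mono => t [[h3 h4] [/eqP ta /eqP tb]] /=.
  rewrite in_itv/= => /andP[at_ tb'].
  have atb : a < t < b by rewrite !lt_neqAle eq_sym ta at_ tb tb'.
  exact: (h3 atb _ (h4 atb)).
have [iH _] := itg_ae_eq mH iabD DH.
split => // s t as_ st tb.
have : g t - g s = rint s t D.
  have -> : g t - g s = (g t - g a) - (g s - g a) by ring.
  rewrite !gD ?as_ ?(le_trans st tb) ?(le_trans as_ st)//.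
  rewrite -/(rint a t D) -/(rint a s D).
  by have -> := rint_split as_ st (itg_sub (lexx a) tb iabD); ring.
move=> ->; have mHs : measurable_fun `[s, t] H.
  by apply: itg_measurable; exact: itg_sub iH.
apply/esym; apply: (itg_ae_eq mHs _ _).2; first exact: itg_sub iabD.
apply: ae_mono DH => x h /=; rewrite in_itv/= => /andP[sx xt]; apply: h.
by rewrite /= in_itv/= (le_trans as_ sx) (le_trans xt tb).
Qed.

End Calculus.

(** * Compactness of families of Lipschitz functions *)

Section LipschitzCompactness.
Context {R : realType}.

Lemma closed_norm_ball n (B : R) : closed [set v : 'rV[R]_n | `|v| <= B].
Proof.
have : closed ((fun v : 'rV[R]_n => `|v|) @^-1` [set x | x <= B]); last by [].
apply: closed_comp; last exact: closed_le.
by move=> v _; exact: norm_continuous.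
Qed.

Lemma compact_norm_ball n (B : R) : compact [set v : 'rV[R]_n | `|v| <= B].
Proof.
apply: bounded_closed_compact; last exact: closed_norm_ball.
by exists B; split; [exact: num_real|move=> x Bx v /= vB; rewrite (le_trans vB)// ltW].
Qed.

(** An ultrafilter replaces the extraction of subsequences: along one and the same [U] all bounded
    sequences converge, so no diagonal argument is required. *)
Lemma ultra_bounded_cvg (U : set_system nat) n (f : nat -> 'rV[R]_n) (B : R) :
  UltraFilter U -> (forall k, `|f k| <= B) ->
  exists p : 'rV[R]_n, f k @[k --> U] --> p.
Proof.
move=> UU fB; have PU : ProperFilter U by exact: ultra_proper.
have [|p [_ clp]] := @compact_norm_ball n B (f k @[k --> U]).
  have : U setT by exact: filterT.
  by rewrite /nbhs/=; apply: filterS => k _; exact: fB.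
exists p => A nA.
have [//|UA] := in_ultra_setVsetC (f @^-1` A) UU.
have [q [nq Aq]] := clp (~` A) A UA nA.
by [].
Qed.

(** A version of Ascoli's theorem. The pointwise limit along an ultrafilter exists at every [t];
    some index is close to it on a finite grid, and the common Lipschitz constant fills the gaps
    between the grid points. *)
Lemma lipschitz_uniform_limit n (y_ : nat -> R -> 'rV[R]_n) (M B c d : R) :
  0 <= M -> c <= d ->
  (forall k s t, `|y_ k s - y_ k t| <= M * `|s - t|) ->
  (forall k t, `|y_ k t| <= B) ->
  exists (y : R -> 'rV[R]_n) (p : nat -> nat),
  [/\ forall k, (k <= p k)%N, forall s t, `|y s - y t| <= M * `|s - t| &
      forall k t, c <= t <= d -> `|y_ (p k) t - y t| <= k.+1%:R^-1].
Proof.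
move=> M0 cd yM yB.
have [U [UU sU]] := @ultraFilterLemma nat \oo _.
have PU : ProperFilter U by exact: ultra_proper.
have [y Hy] := choice (fun t => @ultra_bounded_cvg U n (fun k => y_ k t) B UU (yB^~ t)).
have yL s t : `|y s - y t| <= M * `|s - t|.
  have h : `|y_ k s - y_ k t| @[k --> U] --> `|y s - y t|.
    by apply: cvg_norm; apply: cvgB.
  by apply: (closed_cvg (fun x => x <= M * `|s - t|) _ _ _ h) => //;
    first [exact: nearW|exact: closed_le].
have pick k : exists m, (k <= m)%N /\ forall t, c <= t <= d ->
    `|y_ m t - y t| <= k.+1%:R^-1.
  (* The mesh [e] is such that one error [e] at a grid point and two Lipschitz errors [M * e] add up
     to [k.+1%:R^-1]. *)
  pose e : R := ((2 * M + 1) * k.+1%:R)^-1.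
  have M1 : 0 < 2 * M + 1 by rewrite ltr_wpDl// mulr_ge0.
  have e0 : 0 < e by rewrite invr_gt0 mulr_gt0.
  pose N := Num.bound ((d - c) / e).
  have HU : U [set m | (k <= m)%N /\ forall i : 'I_N.+1,
      `|y (c + i%:R * e) - y_ m (c + i%:R * e)| < e].
    apply: filterI; first by apply: sU; exists k.
    apply: filter_forall => i.
    by have /cvgrPdist_lt/(_ _ e0) := Hy (c + i%:R * e).
  have [m [km Hm]] := filter_ex HU.
  exists m; split => // t /andP[ct td].
  pose i := Num.truncn ((t - c) / e).
  have tc0 : 0 <= (t - c) / e by rewrite divr_ge0 ?subr_ge0// ltW.
  have iN : (i < N.+1)%N.
    rewrite ltnS -(ler_nat R) (@le_trans _ _ ((t - c) / e)) ?truncn_le//.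
    rewrite (@le_trans _ _ ((d - c) / e))//.
      by apply: ler_wpM2r; [rewrite invr_ge0 ltW|lra].
    by rewrite ltW// archi_boundP// divr_ge0 ?subr_ge0// ltW.
  have ti : `|t - (c + i%:R * e)| <= e.
    have h1 : i%:R <= (t - c) / e by rewrite truncn_le.
    rewrite ler_pdivlMr// in h1.
    have h2 := truncnS_gt ((t - c) / e); rewrite -/i ltr_pdivrMr// in h2.
    by move: h2; rewrite -natr1 ler_norml => h2; apply/andP; split; lra.
  have h0 : `|y_ m (c + i%:R * e) - y (c + i%:R * e)| < e.
    by rewrite distrC; exact: (Hm (Ordinal iN)).
  have h1 : `|y_ m t - y_ m (c + i%:R * e)| <= M * e.
    by rewrite (le_trans (yM _ _ _))// ler_wpM2l.
  have h2 : `|y (c + i%:R * e) - y t| <= M * e.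
    by rewrite (le_trans (yL _ _))// ler_wpM2l// distrC.
  have -> : k.+1%:R^-1 = M * e + e + M * e.
    have -> : M * e + e + M * e = (2 * M + 1) * e by ring.
    by rewrite /e invfM mulrA divff ?mul1r// gt_eqF.
  rewrite (_ : _ - y t = (y_ m t - y_ m (c + i%:R * e)) +
    (y_ m (c + i%:R * e) - y (c + i%:R * e)) + (y (c + i%:R * e) - y t)).
    apply: (le_trans (ler_normD _ _)); apply: lerD => //.
    by apply: (le_trans (ler_normD _ _)); apply: lerD => //; exact: ltW.
  by rewrite !addrA !subrK.
have [p Hp] := choice pick.
exists y, p; split => [k|//|k]; first exact: (Hp k).1.
exact: (Hp k).2.
Qed.

End LipschitzCompactness.

(** * Local existence *)

Section LocalExistence.
Context {R : realType} (n q : nat) (h : R).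
Local Notation mu := (@lebesgue_measure R).
Variables (T : (R -> 'rV[R]_n) -> (R -> 'rV[R]_q)).
Hypotheses (h_ge0 : 0 <= h) (opT : operator_class h T).
Local Notation admissible zeta := {within `[(- h)%R, +oo[, continuous zeta}.
Variables (G : R -> 'rV[R]_n -> 'rV[R]_q -> 'rV[R]_n) (M : R).
Hypothesis M_ge0 : 0 <= M.
Hypothesis GM : forall t x z, `|G t x z| <= M.
Hypothesis Gc : forall t (xs : nat -> 'rV[R]_n) (zs : nat -> 'rV[R]_q) x z,
  xs k @[k --> \oo] --> x -> zs k @[k --> \oo] --> z ->
  G t (xs k) (zs k) @[k --> \oo] --> G t x z.
Hypothesis Gm : forall (x : R -> 'rV[R]_n) (z : R -> 'rV[R]_q), admissible x ->
  vmeasurable `[0%R, +oo[ z -> vmeasurable `[0%R, +oo[ (fun t => G t (x t) (z t)).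
Variables (t0 : R) (xi : R -> 'rV[R]_n).
Hypotheses (t0_ge0 : 0 <= t0) (xic : {within `[(- h)%R, t0], continuous xi}).

Lemma admissible_min (zeta : R -> 'rV[R]_n) (c : R) : 0 <= c ->
  {within `[(- h)%R, c], continuous zeta} ->
  admissible (fun t => zeta (Num.min t c)).
Proof.
move=> c0 /within_continuous_dist zc; apply/within_continuous_dist => x.
rewrite /= in_itv/= andbT => hx e e0.
have hc : - h <= c by rewrite (le_trans _ c0)// oppr_le0.
have [|d d0 Hd] := zc (Num.min x c) _ e e0.
  by rewrite /= in_itv/= le_min hx hc ge_min lexx orbT.
exists d => // y; rewrite /= in_itv/= andbT => hy yx; apply: Hd.
  by rewrite /= in_itv/= le_min hy hc ge_min lexx orbT.
apply: le_lt_trans yx; rewrite /Num.min.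
by do 2 (case: ifPn); rewrite -?leNgt => ? ?; rewrite ?subrr ?normr0//
  ler_norml; have := ler_norm (y - x); have := ler_norm (x - y);
  rewrite (distrC x) => ? ?; apply/andP; split; lra.
Qed.

Let F (x : R -> 'rV[R]_n) (t : R) := G t (x t) (T x t).

Lemma F_itg x a b j : admissible x -> 0 <= a -> itg a b (fun t => F x t 0 j).
Proof.
move=> ax a0; apply: (@ae_bounded_itg _ _ _ _ M).
  have := Gm ax (proj1 ((let: And4 H _ _ _ := opT in H) x ax)) j.
  apply: measurable_funS => // t /=; rewrite !in_itv/= andbT.
  by move=> /andP[at_ _]; exact: le_trans at_.
by apply: aeW => t _; exact: le_trans (coord_le_norm _ _) (GM _ _ _).
Qed.

(** The clamped upper limit makes this primitive constant outside [[t0, t0 + tau]], hence Lipschitz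
    on the whole line. *)
Let Ip (tau : R) x (t : R) : 'rV[R]_n :=
  \row_j rint t0 (clamp t0 (t0 + tau) t) (fun s => F x s 0 j).

Lemma Ip_lip tau x s t : 0 <= tau -> admissible x ->
  `|Ip tau x s - Ip tau x t| <= M * `|s - t|.
Proof.
move=> tau0 ax.
have t0t : t0 <= t0 + tau by rewrite lerDl.
wlog st : s t / s <= t => [H|].
  case/orP: (le_total s t) => /H // {}H.
  by rewrite distrC (distrC s).
apply: norm_le_coord; first by rewrite mulr_ge0.
move=> j; rewrite !mxE.
have /andP[s1 s2] := clamp_in s t0t; have st' := clamp_le t0 (t0 + tau) st.
have -> := rint_split s1 st' (F_itg _ j ax t0_ge0).
rewrite opprD addrA subrr add0r normrN.
have d : clamp t0 (t0 + tau) t - clamp t0 (t0 + tau) s <= `|s - t|.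
  by rewrite (le_trans (ler_norm _))// distrC clamp_dist.
apply: (@le_trans _ _ (M * (clamp t0 (t0 + tau) t - clamp t0 (t0 + tau) s))).
  apply: rint_abs_le => //; first exact/F_itg/(le_trans t0_ge0).
  by apply: aeW => u _; exact: le_trans (coord_le_norm _ _) (GM _ _ _).
by rewrite ler_wpM2l.
Qed.

Lemma Ip0 tau x t : 0 <= tau -> t <= t0 -> Ip tau x t = 0.
Proof.
move=> tau0 tt0; apply/rowP => j; rewrite !mxE.
have -> : clamp t0 (t0 + tau) t = t0.
  by rewrite /clamp max_l// ge_min tt0 orbT.
exact: rint_point.
Qed.

(** Causality equates [T x] and [T x'] only almost everywhere, which is enough under the
    integral. *)
Lemma Ip_local tau x x' u t : 0 <= tau -> admissible x -> admissible x' ->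
  t0 <= u -> t <= u -> {in `[(- h)%R, u], x =1 x'} -> Ip tau x t = Ip tau x' t.
Proof.
move=> tau0 ax ax' t0u tu xx'.
have t0t : t0 <= t0 + tau by rewrite lerDl.
have /andP[c1 c2] := clamp_in t t0t.
have cu : clamp t0 (t0 + tau) t <= u by rewrite /clamp ge_max t0u ge_min tu orbT.
apply/rowP => j; rewrite !mxE; apply: (itg_ae_eq _ _ _).2.
- by apply: itg_measurable; exact: F_itg.
- exact: F_itg.
have [_ caus _ _] := opT.
have := caus x' x ax' ax u (le_trans t0_ge0 t0u) _.
have H : {in `[(- h)%R, u], x' =1 x} by move=> s su; rewrite xx'.
move=> /(_ H); apply: ae_mono => s Hs /=; rewrite in_itv/= => /andP[t0s sc].
rewrite /F Hs; last by rewrite in_itv/= (le_trans t0_ge0 t0s) (le_trans sc cu).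
congr (G _ _ _ 0 j); apply: H; rewrite in_itv/= (le_trans sc cu) andbT.
by rewrite (le_trans _ (le_trans t0_ge0 t0s))// oppr_le0.
Qed.

(** The Picard map with delay [eps] (Tonelli's scheme): after [t0] its value at [t] depends on [x]
    up to time [t - eps], or up to [t0] if that is later. *)
Let P tau eps x (t : R) : 'rV[R]_n :=
  xi (Num.min t t0) + Ip tau x (Num.min t (t0 + tau) - eps).

Lemma min_dist (s t c : R) : `|Num.min s c - Num.min t c| <= `|s - t|.
Proof.
wlog st : s t / s <= t => [H|].
  case/orP: (le_total s t) => /H // {}H.
  by rewrite distrC (distrC s).
rewrite distrC [leRHS]distrC ger0_norm; last by rewrite subr_ge0 le_min2.
rewrite ger0_norm ?subr_ge0// /Num.min.
by do 2 (case: ifPn); rewrite -?leNgt; lra.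
Qed.

Lemma lip_add_admissible (y : R -> 'rV[R]_n) : (forall s t, `|y s - y t| <= M * `|s - t|) ->
  admissible (fun t => xi (Num.min t t0) + y t).
Proof.
move=> yL; apply/subspace_continuousP => x xh; apply: cvgD.
  by have /subspace_continuousP := admissible_min t0_ge0 xic; exact.
apply: cvg_within_filter; apply/cvgrPdist_lt => e e0.
have M1 : 0 < M + 1 by rewrite ltr_wpDl.
apply/nbhs_ballP; exists (e / (M + 1)); first exact: divr_gt0.
move=> z /=; rewrite /ball/= ltr_pdivlMr// => xz.
rewrite (le_lt_trans (yL _ _))// (le_lt_trans _ xz)// mulrC ler_wpM2l//.
by rewrite lerDl.
Qed.

Lemma P_lip tau eps x s t : 0 <= tau -> admissible x ->
  `|Ip tau x (Num.min s (t0 + tau) - eps) - Ip tau x (Num.min t (t0 + tau) - eps)|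
  <= M * `|s - t|.
Proof.
move=> tau0 ax; rewrite (le_trans (Ip_lip _ _ tau0 ax))// ler_wpM2l//.
by rewrite opprB addrA subrK min_dist.
Qed.

Lemma P_admissible tau eps x : 0 <= tau -> admissible x -> admissible (P tau eps x).
Proof.
move=> tau0 ax.
by apply: lip_add_admissible => s t; exact: P_lip.
Qed.

(* Delaying the right-hand side by [eps] turns the integral equation into an
   explicit recursion over time intervals of length [eps]. *)
Lemma delayed_solution tau eps : 0 <= tau -> 0 < eps ->
  exists2 x, admissible x & forall t, x t = P tau eps x t.
Proof.
move=> tau0 eps0.
have t0t : t0 <= t0 + tau by rewrite lerDl.
pose X k := iter k (P tau eps) (fun t => xi (Num.min t t0)).
have aX k : admissible (X k).
  elim: k => [|k ih]; first exact: admissible_min.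
  exact: P_admissible.
have step k : {in `[(- h)%R, t0 + k%:R * eps], X k.+1 =1 X k}.
  elim: k => [|k ih] t; rewrite in_itv/= => /andP[ht tk].
    rewrite /X /= /P Ip0 ?addr0//.
    by rewrite lerBlDr ge_min; apply/orP; left; move: tk; rewrite mul0r; lra.
  rewrite [LHS]/(P tau eps (X k.+1) t) [RHS]/(P tau eps (X k) t) /P; congr (_ + _).
  apply: (@Ip_local _ _ _ (t0 + k%:R * eps)) => //.
    by rewrite lerDl mulr_ge0// ltW.
  rewrite lerBlDr ge_min; apply/orP; left.
  by move: tk; rewrite -natr1 mulrDl mul1r addrA.
have [K KX] : exists K, forall t, - h <= t -> X K.+1 t = X K t.
  (* This many steps of length [eps] cover [[t0, t0 + tau]]. After [t0 + tau] every iterate is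
     constant, so agreement there extends to all later times. *)
  pose K := (Num.bound (tau / eps)).+1.
  have tK : t0 + tau <= t0 + K%:R * eps.
    rewrite lerD2l -ler_pdivrMr// ltW// (lt_le_trans (archi_boundP _))//.
      by rewrite divr_ge0// ltW.
    by rewrite ler_nat.
  have XS k t : X k.+1 t = P tau eps (X k) t by [].
  exists K => t ht; have [tt|tt] := leP t (t0 + tau).
    by apply: step; rewrite in_itv/= ht (le_trans tt).
  have : X K.+1 (t0 + tau) = X K (t0 + tau).
    by apply: step; rewrite in_itv/= (le_trans _ (le_trans t0_ge0 t0t)) ?oppr_le0.
  rewrite 4!XS /P minxx (min_r t0t).
  by rewrite (min_r (ltW tt)) (min_r (le_trans t0t (ltW tt))).
have aY := aX K; have aZ := aX K.+1.
have ZE t : X K.+1 t = P tau eps (X K) t by [].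
move: {X aX step} (X K.+1) (X K) KX aY aZ ZE => Z Y KX aY aZ ZE.
(* [Z] is the image of [Y] under the delayed map. That map reads [Y] only on [[- h, +oo[], where [Y]
   and [Z] agree; hence [Z] is a fixed point at every real [t]. *)
exists Z => [//|t]; rewrite ZE /P; congr (_ + _).
apply: (@Ip_local _ _ _ (Num.max t0 t)) => //; first by rewrite le_max lexx.
  rewrite lerBlDr ge_min; apply/orP; left.
  by rewrite ler_wpDr ?(ltW eps0)// le_max lexx orbT.
by move=> s; rewrite in_itv/= => /andP[hs _]; rewrite KX.
Qed.

Lemma local_existence : exists (tau : R) (x : R -> 'rV[R]_n),
  [/\ 0 < tau, admissible x, {in `[(- h)%R, t0], x =1 xi} &
  forall t, t0 <= t -> t <= t0 + tau -> forall j,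
    x t 0 j = xi t0 0 j + rint t0 t (fun s => G s (x s) (T x s) 0 j)].
Proof.
have [_ caus lipT _] := opT.
have [c0 [delta [tau2 [c00 delta0 tau20 HT]]]] := lipT t0 t0_ge0 xi xic.
(* [tau2] is the time span of the Lipschitz estimate for [T]. The other bound keeps all
   approximations within Euclidean distance [delta] of [xi t0], as that estimate demands. *)
pose tau := Num.min tau2 (delta / (n.+1%:R * (M + 1))).
have M1 : 0 < M + 1 by rewrite ltr_wpDl.
have nM : 0 < n.+1%:R * (M + 1) by rewrite mulr_gt0.
have tau0 : 0 < tau by rewrite lt_min tau20 divr_gt0.
have tau00 := ltW tau0.
have t0t : t0 <= t0 + tau by rewrite lerDl.
have tau_small : n%:R * (M * tau) < delta.
  have : tau <= delta / (n.+1%:R * (M + 1)) by rewrite ge_min lexx orbT.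
  rewrite ler_pdivlMr//; apply: lt_le_trans.
  rewrite mulrA mulrC ltr_pM2l// ltr_pM// ?ler0n ?ltr_nat ?ltrDl//.
have ek k : 0 < k.+1%:R^-1 :> R by rewrite invr_gt0.
have [x_ Hx_] := choice (fun k => (fun H => ex2_ind
   (fun x a b => ex_intro (fun x => admissible x /\ forall t, x t = P tau k.+1%:R^-1 x t)
    x (conj a b)) H) (delayed_solution tau00 (ek k))).
pose y_ k t := Ip tau (x_ k) (Num.min t (t0 + tau) - k.+1%:R^-1).
have ax k : admissible (x_ k) := (Hx_ k).1.
have y_L k s t : `|y_ k s - y_ k t| <= M * `|s - t| by exact: P_lip.
have y_0 k t : t <= t0 -> y_ k t = 0.
  move=> tt0; rewrite /y_ Ip0// lerBlDr ge_min; apply/orP; left.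
  by rewrite (le_trans tt0)// lerDl ltW.
have y_c k t : y_ k t = y_ k (clamp t0 (t0 + tau) t).
  rewrite /clamp; case: (leP t0 t) => tt.
    rewrite max_r; last by rewrite le_min tt t0t.
    by rewrite /y_ (minC (t0 + tau)) -minA minxx.
  rewrite max_l; last by rewrite ge_min (ltW tt) orbT.
  by rewrite !y_0// ltW.
have y_B k t : `|y_ k t| <= M * tau.
  rewrite y_c -[y_ _ _]subr0 -(y_0 k t0 (lexx _)) (le_trans (y_L _ _ _))//.
  have /andP[c1 c2] := clamp_in t t0t.
  by rewrite ler_wpM2l// ger0_norm ?subr_ge0// lerBlDl.
have [y0 [p [kp y0L y0c]]] := lipschitz_uniform_limit M_ge0 t0t y_L y_B.
(* Uniform convergence is known on [[t0, t0 + tau]] only. All [y_ k] are constant on either side of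
   that interval, so clamping the limit extends the convergence to the line. *)
pose y t := y0 (clamp t0 (t0 + tau) t).
have yL s t : `|y s - y t| <= M * `|s - t|.
  by rewrite (le_trans (y0L _ _))// ler_wpM2l// clamp_dist.
have yc k t : `|y_ (p k) t - y t| <= k.+1%:R^-1.
  by rewrite y_c; apply: y0c; exact: clamp_in.
have ycvg t : y_ (p k) t @[k --> \oo] --> y t.
  apply/cvgrPdist_lt => e e0; near=> k; rewrite distrC (le_lt_trans (yc _ _))//.
  by near: k; exact: near_infty_natSinv_lt (PosNum e0).
have yB t : `|y t| <= M * tau.
  apply: (closed_cvg (fun v : 'rV[R]_n => `|v| <= M * tau) _ _ _ (ycvg t)).
    exact: closed_norm_ball.
  exact: nearW.
have y00 t : t <= t0 -> y t = 0.
  move=> tt0; apply: (cvg_unique _ (ycvg t)); first exact: norm_hausdorff.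
  have -> : (fun k => y_ (p k) t) = cst 0 by apply/funext => k; rewrite y_0.
  exact: cvg_cst.
pose x t := xi (Num.min t t0) + y t.
have axx : admissible x by exact: lip_add_admissible.
have x_E k t : x_ k t = xi (Num.min t t0) + y_ k t by rewrite (Hx_ k).2.
have xxi : {in `[(- h)%R, t0], x =1 xi}.
  by move=> t; rewrite in_itv/= => /andP[_ tt0]; rewrite /x y00// addr0 min_l.
have x_xi k : {in `[(- h)%R, t0], x_ k =1 xi}.
  by move=> t; rewrite in_itv/= => /andP[_ tt0]; rewrite x_E y_0// addr0 min_l.
(* The local Lipschitz property turns uniform convergence of the states into convergence of the
   operator outputs, outside one null set for all [k]. *)
have Tcvg : {ae mu, forall s, forall k, `[t0, (t0 + tau2)%R]%classic s ->
    enorm (T (x_ (p k)) s - T x s) <= c0 * (n%:R * k.+1%:R^-1)}.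
  apply: ae_foralln => k; apply: ess_sup_norm_le.
  apply: le_trans (HT _ _ (ax (p k)) axx (x_xi _) xxi _ _) _.
  - move=> s; rewrite in_itv/= => /andP[t0s _].
    rewrite x_E min_r// addrC addKr (le_lt_trans (enorm_le_norm _))//.
    by rewrite (le_lt_trans _ tau_small)// ler_wpM2l.
  - move=> s; rewrite in_itv/= => /andP[t0s _].
    rewrite /x min_r// addrC addKr (le_lt_trans (enorm_le_norm _))//.
    by rewrite (le_lt_trans _ tau_small)// ler_wpM2l.
  rewrite EFinM lee_wpmul2l ?lee_fin//; first exact: ltW.
  apply: ge_ereal_sup => _ [s _ <-]; rewrite lee_fin.
  rewrite (le_trans (enorm_le_norm _))// ler_wpM2l//.
  by rewrite x_E /x opprD addrACA subrr add0r yc.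
have Icvg t : Ip tau (x_ (p k)) t @[k --> \oo] --> Ip tau x t.
  apply: cvg_coord => j; rewrite /Ip; under eq_cvg do rewrite mxE.
  rewrite mxE; have /andP[c1 c2] := clamp_in t t0t.
  apply: (@rint_dominated _ _ _ _ _ M).
  - by move=> k; apply: itg_measurable; exact: F_itg.
  - by apply: itg_measurable; exact: F_itg.
  - apply: ae_mono Tcvg => s Hs /=; rewrite in_itv/= => /andP[t0s sc].
    apply: cvg_to_coord; apply: Gc.
      by under eq_cvg do rewrite x_E; apply: cvgD; [exact: cvg_cst|exact: ycvg].
    have cn : 0 <= c0 * n%:R by rewrite mulr_ge0// ltW.
    have cn1 : 0 < c0 * n%:R + 1 by rewrite ltr_wpDl.
    apply/cvgrPdist_lt => e e0; near=> k.
    rewrite distrC (le_lt_trans (norm_le_enorm _))//.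
    have st2 : `[t0, (t0 + tau2)%R]%classic s.
      rewrite /= in_itv/= t0s (le_trans (le_trans sc c2))// lerD2l.
      by rewrite ge_min lexx.
    rewrite (le_lt_trans (Hs k st2))// mulrA.
    apply: (@le_lt_trans _ _ ((c0 * n%:R + 1) * k.+1%:R^-1)).
      by rewrite ler_wpM2r// lerDl.
    rewrite mulrC -ltr_pdivlMr//.
    by near: k; exact: near_infty_natSinv_lt (PosNum (divr_gt0 e0 cn1)).
  - by apply: aeW => s k _; exact: le_trans (coord_le_norm _ _) (GM _ _ _).
exists tau, x; split; [exact: tau0|exact: axx|exact: xxi|move=> t t0t' tt].
(* The limit satisfies the equation without delay, since a delay changes the primitive by at most
   [M] times its length. *)
have yI : y t = Ip tau x t.
  apply: (cvg_unique _ (ycvg t)); first exact: norm_hausdorff.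
  apply/cvgrPdist_lt => e e0.
  have e20 : 0 < e / 2 by rewrite divr_gt0.
  have e2M : 0 < e / 2 / (M + 1) by rewrite divr_gt0.
  move/cvgrPdist_lt : (Icvg t) => /(_ _ e20) nI; near=> k.
  have h1 : `|Ip tau x t - Ip tau (x_ (p k)) t| < e / 2 by near: k.
  have h2 : `|Ip tau (x_ (p k)) t - y_ (p k) t| < e / 2.
    rewrite /y_; have -> : Num.min t (t0 + tau) = t by rewrite min_l.
    apply: (le_lt_trans (Ip_lip _ _ tau00 (ax _))).
    rewrite opprB addrCA subrr addr0 gtr0_norm//.
    apply: (@le_lt_trans _ _ ((M + 1) * k.+1%:R^-1)).
      apply: ler_pM; rewrite ?invr_ge0 ?lerDl//.
      by rewrite lef_pV2 ?posrE// ler_nat ltnS kp.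
    rewrite mulrC -ltr_pdivlMr//.
    by near: k; exact: near_infty_natSinv_lt (PosNum e2M).
  have := ler_normD (Ip tau x t - Ip tau (x_ (p k)) t) (Ip tau (x_ (p k)) t - y_ (p k) t).
  rewrite addrA subrK => H; rewrite (splitr e).
  exact: le_lt_trans H (ltrD h1 h2).
move=> j; rewrite {1}/x yI min_r// !mxE clamp_id// t0t'//.
Unshelve. all: by end_near. Qed.

End LocalExistence.

(** * The closed loop as an integral equation *)

Section BlockVectors.
Context {R : realType} {r m : nat}.
Implicit Types (Y : nat -> 'rV[R]_m) (x : 'rV[R]_(r * m)).

(** Indexed by [nat], like the jets, with value 0 from [r] on; no ordinals appear in later
    statements. *)
Definition blk (k : nat) x : 'rV[R]_m :=
  \row_j (if insub k is Some i then vec_mx x (i : 'I_r) j else 0).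

Definition mkst Y : 'rV[R]_(r * m) := mxvec (\matrix_(i < r) Y i).

Lemma blk_mkst Y k : (k < r)%N -> blk k (mkst Y) = Y k.
Proof.
by move=> kr; apply/rowP => j; rewrite !mxE insubT mxvecK !mxE.
Qed.

Lemma coord_blk (i : 'I_(r * m)) : exists (k : 'I_r) (j : 'I_m),
  forall x, x 0 i = blk k x 0 j.
Proof.
case/mxvec_indexP: i => k j; exists k, j => x.
by rewrite mxE valK mxE.
Qed.

Lemma mkst_blk x : mkst (fun k => blk k x) = x.
Proof.
apply/rowP => i; have [k [j H]] := coord_blk i.
by rewrite !H blk_mkst.
Qed.

Lemma eq_mkst Y Y' : (forall k, (k < r)%N -> Y k = Y' k) -> mkst Y = mkst Y'.
Proof.
move=> YY'; rewrite -[mkst Y]mkst_blk -[mkst Y']mkst_blk.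
congr (mxvec _); apply/matrixP => i j; rewrite !mxE.
by rewrite valK !mxvecK !mxE YY'.
Qed.

Lemma blk_coord_ex (k : nat) (j : 'I_m) : (k < r)%N ->
  exists i : 'I_(r * m), forall x, blk k x 0 j = x 0 i.
Proof.
by move=> kr; exists (mxvec_index (Ordinal kr) j) => x; rewrite !mxE insubT mxE.
Qed.

Lemma cvg_blk (S : Type) (F : set_system S) (FF : Filter F)
    (g : S -> 'rV[R]_(r * m)) x k :
  g s @[s --> F] --> x -> blk k (g s) @[s --> F] --> blk k x.
Proof.
move=> gx; apply: cvg_coord => j.
have [kr|rk] := ltnP k r.
  have [i H] := blk_coord_ex j kr.
  rewrite H; have -> : (fun s => blk k (g s) 0 j) = (fun s => g s 0 i).
    by apply/funext => s; rewrite H.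
  exact: cvg_to_coord.
have -> : (fun s => blk k (g s) 0 j) = (fun s => 0).
  by apply/funext => s; rewrite mxE insubF//; apply/negbTE; rewrite -leqNgt.
rewrite mxE insubF; first exact: cvg_cst.
by apply/negbTE; rewrite -leqNgt.
Qed.

Lemma cvg_mkst (S : Type) (F : set_system S) (FF : Filter F)
    (g : S -> nat -> 'rV[R]_m) Y :
  (forall k, (k < r)%N -> g s k @[s --> F] --> Y k) ->
  mkst (g s) @[s --> F] --> mkst Y.
Proof.
move=> gY; apply: cvg_coord => i; have [k [j H]] := coord_blk i.
rewrite H blk_mkst//.
have -> : (fun s => mkst (g s) 0 i) = (fun s => g s k 0 j).
  by apply/funext => s; rewrite H blk_mkst.
by apply: cvg_to_coord; exact: gY.
Qed.

Lemma blk_norm k x : `|blk k x| <= `|x|.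
Proof.
apply: norm_le_coord => // j; have [kr|rk] := ltnP k r.
  by have [i ->] := blk_coord_ex j kr; exact: coord_le_norm.
by rewrite mxE insubF ?normr0//; apply/negbTE; rewrite -leqNgt.
Qed.

Lemma mkst_norm Y (M : R) : 0 <= M -> (forall k, (k < r)%N -> `|Y k| <= M) ->
  `|mkst Y| <= M.
Proof.
move=> M0 YM; apply: norm_le_coord => // i; have [k [j ->]] := coord_blk i.
by rewrite blk_mkst// (le_trans (coord_le_norm _ _))// YM.
Qed.

Lemma blkB k (x x' : 'rV[R]_(r * m)) : blk k (x - x') = blk k x - blk k x'.
Proof.
apply/rowP => j; rewrite !mxE; case: insubP => [i _ _|_]; last by rewrite subr0.
by rewrite !mxE.
Qed.

End BlockVectors.

Section FunnelMaps.
Context {R : realType} {m : nat} (alpha : R -> R).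
Hypothesis alpha_cont : {within `[0, 1[, continuous alpha}.
Implicit Types (eta : nat -> 'rV[R]_m).

(** As [enorm w < 1], the arguments of [alpha] eventually stay in [[0, 1[]. The filter is arbitrary
    because limits are taken relative to intervals, on products and along ultrafilters. *)
Lemma cvg_gamma_arg (S : Type) (F : set_system S) (FF : Filter F)
    (g : S -> 'rV[R]_m) w : enorm w < 1 -> g s @[s --> F] --> w ->
  alpha (enorm (g s) ^+ 2) @[s --> F] --> alpha (enorm w ^+ 2).
Proof.
move=> w1 gw; have ge := cvg_enorm FF gw.
have sq v : enorm v < 1 -> `[0, 1[%classic (enorm (v : 'rV[R]_m) ^+ 2).
  by move=> v1; rewrite /= in_itv/= sqr_ge0/= expr_lt1// enorm_ge0.
have /subspace_continuousP/(_ _ (sq w w1)) ac := alpha_cont.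
apply: (cvg_comp _ _ _ ac) => A /= nA.
have g2 : enorm (g s) ^+ 2 @[s --> F] --> enorm w ^+ 2.
  by rewrite expr2; under eq_cvg do rewrite expr2; apply: cvgM.
have g1 : \forall s \near F, enorm (g s) < 1 by exact: (cvgr_lt _ ge).
rewrite /within/= in nA.
have := g2 _ nA; rewrite /nbhs/=; move: g1; apply: filterS2 => s s1; apply.
exact: sq.
Qed.

Lemma cvg_gamma (S : Type) (F : set_system S) (FF : Filter F)
    (g : S -> 'rV[R]_m) w : enorm w < 1 -> g s @[s --> F] --> w ->
  gamma alpha (g s) @[s --> F] --> gamma alpha w.
Proof. by move=> w1 gw; apply: cvgZ => //; exact: cvg_gamma_arg. Qed.

Lemma rhoS k eta : rho alpha k.+2 eta = eta k.+1 + gamma alpha (rho alpha k.+1 eta).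
Proof. by []. Qed.

Lemma in_DS k eta : in_D alpha k.+1 eta = (in_D alpha k eta /\ enorm (rho alpha k.+1 eta) < 1).
Proof. by []. Qed.

Lemma eq_rho k eta eta' : (forall i, (i < k)%N -> eta i = eta' i) ->
  rho alpha k eta = rho alpha k eta'.
Proof.
elim: k => // -[|k] ih H; first by rewrite /= H.
by rewrite !rhoS H// ih// => i ik; apply: H; exact: ltnW.
Qed.

Lemma eq_in_D k eta eta' : (forall i, (i < k)%N -> eta i = eta' i) ->
  in_D alpha k eta -> in_D alpha k eta'.
Proof.
elim: k => // k ih H; rewrite !in_DS => -[Dk rk]; split.
  by apply: ih Dk => i ik; apply: H; exact: ltnW.
by rewrite -(eq_rho H).
Qed.

Lemma in_D_rho k eta i : in_D alpha k eta -> (0 < i <= k)%N ->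
  enorm (rho alpha i eta) < 1.
Proof.
elim: k => [|k ih]; first by case: i.
rewrite in_DS => -[Dk rk] /andP[i0]; rewrite leq_eqVlt => /predU1P[->//|ik].
by apply: ih; rewrite ?i0.
Qed.

Lemma in_DP k eta : (forall i, (0 < i <= k)%N -> enorm (rho alpha i eta) < 1) ->
  in_D alpha k eta.
Proof.
elim: k => // k ih H; rewrite in_DS; split; last by apply: H; rewrite /= leqnn.
by apply: ih => i /andP[i0 ik]; apply: H; rewrite i0 ltnW.
Qed.

(** Only the arguments of gamma have to lie in the open ball, so membership at level [k.-1]
    suffices. This allows passing to a limit that is not yet known to lie in the domain of level
    [k]. *)
Lemma cvg_rho (S : Type) (F : set_system S) (FF : Filter F) k
    (g : S -> nat -> 'rV[R]_m) eta :
  (forall i, (i < k)%N -> g s i @[s --> F] --> eta i) ->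
  in_D alpha k.-1 eta -> rho alpha k (g s) @[s --> F] --> rho alpha k eta.
Proof.
elim: k => [_ _|[|k] ih geta D]; first exact: cvg_cst.
  exact: geta.
have D' := D; rewrite in_DS in D'; have [Dk rk] := D'.
under eq_cvg do rewrite rhoS; rewrite rhoS.
apply: cvgD; first exact: geta.
apply: cvg_gamma => //; apply: ih => // i ik; apply: geta; exact: ltnW.
Qed.

Lemma near_in_D (S : Type) (F : set_system S) (FF : Filter F) k
    (g : S -> nat -> 'rV[R]_m) eta :
  (forall i, (i < k)%N -> g s i @[s --> F] --> eta i) ->
  in_D alpha k eta -> \forall s \near F, in_D alpha k (g s).
Proof.
elim: k => [_ _|k ih geta]; first exact: nearW.
rewrite in_DS => -[Dk rk].
have h1 := ih (fun i ik => geta i (ltnW ik)) Dk.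
have h2 : \forall s \near F, enorm (rho alpha k.+1 (g s)) < 1.
  have h := cvg_enorm FF (@cvg_rho S F FF k.+1 g eta geta Dk).
  exact: (cvgr_lt _ h).
by apply: filterS2 h1 h2.
Qed.

End FunnelMaps.

Section ContinuousNonlinearity.
Context {R : realType} {p q m : nat}.
Variable f : 'rV[R]_p * 'rV[R]_q * 'rV[R]_m -> 'rV[R]_m.
Hypothesis f_cont : continuous f.
Local Notation mu := (@lebesgue_measure R).

Lemma cvg_nonlinearity (S : Type) (F : set_system S) (FF : Filter F)
    (g1 : S -> 'rV[R]_p) (g2 : S -> 'rV[R]_q) (g3 : S -> 'rV[R]_m) a b c :
  g1 s @[s --> F] --> a -> g2 s @[s --> F] --> b -> g3 s @[s --> F] --> c ->
  f (g1 s, g2 s, g3 s) @[s --> F] --> f (a, b, c).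
Proof.
move=> h1 h2 h3; apply: continuous_cvg; first exact: f_cont.
move=> A [[B C] /= [[[B1 B2] /= [nB1 nB2] B12] nC] BC].
have f1 : F (g1 @^-1` B1) := h1 _ nB1.
have f2 : F (g2 @^-1` B2) := h2 _ nB2.
have f3 : F (g3 @^-1` C) := h3 _ nC.
have : F ((fun x => (g1 x, g2 x, g3 x)) @^-1` A); last by [].
apply: (@filterS3 _ F FF _ _ _ _ _ f1 f2 f3) => s s1 s2 s3.
by apply: BC; split => //; exact: B12.
Qed.

Lemma nonlinearity_bounded (A : R) : exists2 M : R, 0 <= M &
  forall a b c, `|a| <= A -> `|b| <= A -> `|c| <= A -> `|f (a, b, c)| <= M.
Proof.
pose K := (([set v : 'rV[R]_p | `|v| <= A] `*` [set v : 'rV[R]_q | `|v| <= A])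
  `*` [set v : 'rV[R]_m | `|v| <= A])%classic.
have cK : compact K.
  by apply: compact_setX; [apply: compact_setX|]; exact: compact_norm_ball.
have : compact (f @` K).
  by apply: continuous_compact => //; exact: continuous_subspaceT.
move=> /compact_norm_le[M M0 HM]; exists M => // a b c ha hb hc.
by apply: HM; exists (a, b, c).
Qed.

(** The three arguments are concatenated into one row vector, so that
    [measurable_fun_continuous_comp] applies. *)
Lemma nonlinearity_measurable (I : set R) (g1 : R -> 'rV[R]_p)
    (g2 : R -> 'rV[R]_q) (g3 : R -> 'rV[R]_m) : measurable I ->
  vmeasurable I g1 -> vmeasurable I g2 -> vmeasurable I g3 ->
  vmeasurable I (fun t => f (g1 t, g2 t, g3 t)).
Proof.
move=> mI m1 m2 m3 j.
pose v t := row_mx (row_mx (g1 t) (g2 t)) (g3 t).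
pose k (w : 'rV[R]_(p + q + m)) :=
  f (lsubmx (lsubmx w), rsubmx (lsubmx w), rsubmx w) 0 j.
have -> : (fun t => f (g1 t, g2 t, g3 t) 0 j) = (fun t => k (v t)).
  by apply/funext => t; rewrite /k /v !(row_mxKl, row_mxKr).
apply: measurable_fun_continuous_comp => //.
  move=> w; apply: (@cvg_to_coord _ _ (nbhs w)).
  by apply: (@cvg_nonlinearity _ (nbhs w)); apply: (@cvg_coord _ _ (nbhs w)) => i;
    under eq_cvg do rewrite !mxE; rewrite !mxE; exact: coord_continuous.
move=> i; rewrite /v; case: (split_ordP i) => i1 ->.
  case: (split_ordP i1) => i2 ->.
    by under eq_fun do rewrite !row_mxEl; exact: m1.
  by under eq_fun do rewrite row_mxEl row_mxEr; exact: m2.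
by under eq_fun do rewrite row_mxEr; exact: m3.
Qed.

End ContinuousNonlinearity.

Lemma continuous_vmeasurable {R : realType} n (D : set R) (g : R -> 'rV[R]_n) :
  measurable D -> {within D, continuous g} -> vmeasurable D g.
Proof.
move=> mD /subspace_continuousP cg j; apply: subspace_continuous_measurable_fun => //.
by apply/subspace_continuousP => x Dx; apply: cvg_to_coord; exact: cg.
Qed.

Section Setup.
Context {R : realType} {m r p q : nat} (h : R) (d : R -> 'rV[R]_p)
  (f : 'rV[R]_p * 'rV[R]_q * 'rV[R]_m -> 'rV[R]_m)
  (T : (R -> 'rV[R]_(r * m)) -> (R -> 'rV[R]_q))
  (y0 : nat -> R -> 'rV[R]_m) (yref : R -> 'rV[R]_m) (rhat : nat)
  (alpha gain phi : R -> R).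

Definition vec_error (t : R) (x : 'rV[R]_(r * m)) : nat -> 'rV[R]_m :=
  fun k => phi t *: error_blocks yref rhat (fun k _ => blk k x) t k.

Definition wvec (t : R) (x : 'rV[R]_(r * m)) : 'rV[R]_m :=
  rho alpha r (vec_error t x).

Definition ctrl (t : R) (x : 'rV[R]_(r * m)) : 'rV[R]_m :=
  gain (alpha (enorm (wvec t x) ^+ 2)) *: wvec t x.

Definition inD (t : R) (x : 'rV[R]_(r * m)) : Prop :=
  in_D alpha r (vec_error t x).

Definition vfield (t : R) (x : 'rV[R]_(r * m)) (z : 'rV[R]_q) : 'rV[R]_(r * m) :=
  mkst (fun k => if (k.+1 < r)%N then blk k.+1 x else f (d t, z, ctrl t x)).

Definition xi0 (t : R) : 'rV[R]_(r * m) := mkst (fun k => y0 k t).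

Definition stopped (x : R -> 'rV[R]_(r * m)) (tau : R) : R -> 'rV[R]_(r * m) :=
  fun t => x (Num.min t tau).

(* A solution on the closed interval [[- h, tau]] as a solution of the integral
   equation for the state (y, ..., y^(r-1)), in which [T] is applied to the state
   frozen after [tau]. *)
Definition csol (tau : R) (x : R -> 'rV[R]_(r * m)) : Prop :=
  [/\ {within `[(- h)%R, tau], continuous x}, {in `[(- h)%R, 0], x =1 xi0},
      forall t, 0 <= t -> t <= tau -> inD t (x t) &
      forall t, 0 <= t -> t <= tau -> forall j, x t 0 j - x 0 0 j =
        rint 0 t (fun s => vfield s (x s) (T (stopped x tau) s) 0 j)].

Local Notation yr k := (derive_in_n `[(0:R)%R, +oo[ k yref).

(* What the proof uses of the data; [gain] stands for N, id or - id, and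
   [st_gain] is the common consequence of the three high-gain hypotheses. *)
Record setup : Prop := Setup {
  st_m : (0 < m)%N; st_r : (0 < r)%N;
  st_h : 0 <= h;
  st_d : Linfty `[0%R, +oo[ d;
  st_f : continuous f;
  st_T : operator_class h T;
  st_init : initial_data (r := r) h y0;
  st_initD : initially_in_funnel (r := r) y0 yref rhat alpha phi;
  st_rhat : (1 <= rhat <= r)%N;
  st_ref_cont : forall k, (k < r)%N -> {within `[0%R, +oo[, continuous (yr k)};
  st_ref_der : forall k, (k.+1 < r)%N -> forall x : R, 0 <= x ->
    has_derivative_in `[0%R, +oo[ (yr k) x (yr k.+1 x);
  st_ref_bnd : exists2 B : R, 0 <= B &
    forall k, (k < r)%N -> forall t : R, 0 <= t -> enorm (yr k t) <= B;
  st_ref_lip : exists2 B : R, 0 <= B & forall s t : R, 0 <= s -> s <= t ->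
    enorm (yr r.-1 t - yr r.-1 s) <= B * (t - s);
  st_phi_cont : {within `[0%R, +oo[, continuous phi};
  st_phi_ge0 : forall t : R, 0 <= t -> 0 <= phi t;
  st_phi_lip : exists2 c : R, 0 < c & forall s t K : R, 0 <= s -> s <= t ->
    (forall u, s <= u -> u <= t -> phi u <= K) ->
    `|phi t - phi s| <= c * (1 + K) * (t - s);
  st_phi_low : forall t1 : R, 0 < t1 -> exists2 c : R, 0 < c &
    forall t, t1 <= t -> c <= phi t;
  st_phi_bnd : (rhat < r)%N -> bounded_gain phi;
  st_alpha_ge1 : forall s : R, 0 <= s -> s < 1 -> 1 <= alpha s;
  st_alpha_cont : {within `[0%R, 1%R[, continuous alpha};
  st_alpha_surj : forall a : R, 1 <= a -> exists s : R, [/\ 0 <= s, s < 1 & alpha s = a];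
  st_gamma_lip : forall k : R, 0 <= k -> k < 1 -> exists2 L : R, 0 <= L &
    forall v w : 'rV[R]_m, enorm v <= k -> enorm w <= k ->
    enorm (gamma alpha v - gamma alpha w) <= L * enorm (v - w);
  st_gain_cont : {within `[0%R, +oo[, continuous gain};
  st_gain : exists2 vs : R, 0 < vs < 1 &
    forall Kp Kq, compact Kp -> Kp !=set0 -> compact Kq -> Kq !=set0 ->
    forall A C : R, exists a : R, A < a /\ C < chi f vs Kp Kq (gain a) }.

Lemma cvg_within_comp (S : Type) (F : set_system S) (FF : Filter F)
    (V : topologicalType) (D : set R) (g : R -> V) (u : S -> R) (c : R) :
  {within D, continuous g} -> D c -> u s @[s --> F] --> c ->
  (\forall s \near F, D (u s)) -> g (u s) @[s --> F] --> g c.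
Proof.
move=> /subspace_continuousP gD Dc uc uD.
have gc : g x @[x --> within D (nbhs c)] --> g c := gD c Dc.
apply: (cvg_comp _ _ _ gc) => A /= nA.
have h1 : F [set s | D (u s) -> A (u s)] := uc _ nA.
have : F (u @^-1` A); last by [].
by apply: filterS2 h1 uD => s; apply.
Qed.

Hypothesis H : setup.
Local Notation mu := (@lebesgue_measure R).

Section Filters.
Variables (S : Type) (F : set_system S) (FF : Filter F).
Variables (u : S -> R) (g : S -> 'rV[R]_(r * m)) (c : R) (x : 'rV[R]_(r * m)).
Hypotheses (c0 : 0 <= c) (uc : u s @[s --> F] --> c)
  (u0 : \forall s \near F, 0 <= u s) (gx : g s @[s --> F] --> x).

Lemma itv0y (y : R) : 0 <= y -> `[(0:R)%R, +oo[%classic y.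
Proof. by move=> y0'; rewrite /= in_itv/= andbT. Qed.

Lemma cvg_vec_error k : (k < r)%N ->
  vec_error (u s) (g s) k @[s --> F] --> vec_error c x k.
Proof.
move=> kr; have c0' := itv0y c0.
have u0' : \forall s \near F, `[(0:R)%R, +oo[%classic (u s).
  by apply: filterS u0 => s; exact: itv0y.
apply: cvgZ; first exact: (cvg_within_comp _ (st_phi_cont H)).
rewrite /error_blocks; case: ifPn => krh; last exact: cvg_blk.
apply: cvgB; first exact: cvg_blk.
exact: (cvg_within_comp _ (st_ref_cont H kr)).
Qed.

Hypothesis xD : inD c x.

Lemma near_inD : \forall s \near F, inD (u s) (g s).
Proof.
by apply: (near_in_D (st_alpha_cont H)) xD => i ir; exact: cvg_vec_error.
Qed.

Lemma cvg_wvec : wvec (u s) (g s) @[s --> F] --> wvec c x.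
Proof.
apply: (cvg_rho (st_alpha_cont H)); first by move=> i ir; exact: cvg_vec_error.
have := xD; rewrite /inD; have := st_r H; case: (r) => // k _.
by rewrite in_DS => -[].
Qed.

Lemma cvg_ctrl : ctrl (u s) (g s) @[s --> F] --> ctrl c x.
Proof.
have w1 : enorm (wvec c x) < 1.
  by apply: (in_D_rho xD); rewrite (st_r H) leqnn.
have sq v : enorm v < 1 -> `[(0:R)%R, +oo[%classic (alpha (enorm (v : 'rV[R]_m) ^+ 2)).
  move=> v1; apply: itv0y; apply: le_trans (st_alpha_ge1 H _ _) => //.
    by rewrite sqr_ge0.
  by rewrite expr_lt1// enorm_ge0.
have cw := cvg_wvec.
apply: cvgZ => //; apply: (cvg_within_comp _ (st_gain_cont H)).
- exact: sq.
- exact: (cvg_gamma_arg (st_alpha_cont H)).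
- have : \forall s \near F, enorm (wvec (u s) (g s)) < 1.
    exact: (cvgr_lt _ (cvg_enorm FF cw)).
  by apply: filterS => s; exact: sq.
Qed.

End Filters.

Lemma stopped_admissible (x : R -> 'rV[R]_(r * m)) tau : 0 <= tau ->
  {within `[(- h)%R, tau], continuous x} ->
  {within `[(- h)%R, +oo[, continuous (stopped x tau)}.
Proof. by move=> tau0 cx; apply: admissible_min => //; exact: st_h H. Qed.

Lemma T_causal (x x' : R -> 'rV[R]_(r * m)) t :
  {within `[(- h)%R, +oo[, continuous x} -> {within `[(- h)%R, +oo[, continuous x'} ->
  0 <= t -> (forall s, - h <= s -> s <= t -> x s = x' s) ->
  {ae mu, forall s, 0 <= s -> s <= t -> T x s = T x' s}.
Proof.
move=> cx cx' t0 xx'; have [_ caus _ _] := st_T H.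
have := caus x x' cx cx' t t0 _.
have K : {in `[(- h)%R, t], x =1 x'}.
  by move=> s; rewrite in_itv/= => /andP[s1 s2]; exact: xx'.
move=> /(_ K); apply: ae_mono => s Ts s0 st; apply: Ts.
by rewrite in_itv/= s0.
Qed.

Lemma ctrl_continuous tau (x : R -> 'rV[R]_(r * m)) : 0 <= tau -> {within `[(- h)%R, tau], continuous x} ->
  (forall t, 0 <= t -> t <= tau -> inD t (x t)) ->
  {within `[(0:R)%R, tau], continuous (fun t => ctrl t (x t))}.
Proof.
move=> tau0 cx Dx; apply/subspace_continuousP => t /= t0t.
move: (t0t); rewrite in_itv/= => /andP[t0 tt].
have FF : Filter (within `[(0:R)%R, tau] (nbhs t)) by exact: within_filter.
apply: cvg_ctrl => //; last exact: Dx.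
- by apply: cvg_within_filter; exact: cvg_id.
- by apply: filterS (@withinT _ _ _ (nbhs_filter t)) => s /=; rewrite in_itv/= => /andP[].
- have cx0 : {within `[(0:R)%R, tau], continuous x}.
    apply: continuous_subspaceW cx => s /=; rewrite !in_itv/= => /andP[s0 ->].
    by rewrite andbT (le_trans _ s0)// oppr_le0; exact: st_h H.
  by move/subspace_continuousP : cx0; exact.
Qed.

Lemma d_bounded : exists2 B : R, 0 <= B &
  {ae mu, forall t : R, 0 <= t -> `|d t| <= B}.
Proof.
have [_ dlt] := st_d H; have [B B0 HB] := ess_sup_norm_lty dlt.
exists B => //; apply: ae_mono HB => t h1 t0.
by rewrite (le_trans (norm_le_enorm _))// h1//; exact: itv0y.
Qed.

Lemma vfield_itg tau (x : R -> 'rV[R]_(r * m)) (z : R -> 'rV[R]_q) (B : R) j : 0 <= tau ->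
  {within `[(- h)%R, tau], continuous x} ->
  (forall t, 0 <= t -> t <= tau -> inD t (x t)) ->
  vmeasurable `[(0:R)%R, tau] z ->
  {ae mu, forall t, 0 <= t -> t <= tau -> `|z t| <= B} ->
  itg 0 tau (fun s => vfield s (x s) (z s) 0 j).
Proof.
move=> tau0 cx Dx mz zB.
have cu := ctrl_continuous tau0 cx Dx.
have cx0 : {within `[(0:R)%R, tau], continuous x}.
  apply: continuous_subspaceW cx => s /=; rewrite !in_itv/= => /andP[s0 ->].
  by rewrite andbT (le_trans _ s0)// oppr_le0; exact: st_h H.
have [k [i E]] := @coord_blk R r m j.
have -> : (fun s => vfield s (x s) (z s) 0 j) =
    (fun s => (if (k.+1 < r)%N then blk k.+1 (x s)
       else f (d s, z s, ctrl s (x s))) 0 i).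
  by apply/funext => s; rewrite E blk_mkst.
case: (k.+1 < r)%N.
  apply: continuous_itg; apply/subspace_continuousP => t tt.
  apply: cvg_to_coord; apply: cvg_blk.
  by move/subspace_continuousP : cx0; exact.
have [Bd Bd0 HBd] := d_bounded.
have [Bu Bu0 HBu] := within_bounded cu.
have [M M0 HM] := nonlinearity_bounded (st_f H) (Num.max Bd (Num.max B Bu)).
apply: (@ae_bounded_itg _ _ _ _ M).
  apply: (nonlinearity_measurable (st_f H)) => //.
    have [md _] := st_d H => l; apply: measurable_funS (md l) => //.
    by move=> s /=; rewrite !in_itv/= andbT => /andP[].
  exact: continuous_vmeasurable.
have := ae_and HBd zB; apply: ae_mono => t [h1 h2] /=; rewrite in_itv/= => /andP[t0 tt].
rewrite (le_trans (coord_le_norm _ _))//; apply: HM; rewrite !le_max.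
- by rewrite h1.
- by rewrite h2// orbT.
- by rewrite HBu// !orbT.
Qed.

Lemma T_stopped_props tau (x : R -> 'rV[R]_(r * m)) : 0 <= tau -> {within `[(- h)%R, tau], continuous x} ->
  vmeasurable `[(0:R)%R, tau] (T (stopped x tau)) /\
  exists B, {ae mu, forall t, 0 <= t -> t <= tau -> `|T (stopped x tau) t| <= B}.
Proof.
move=> tau0 cx; have [TL _ _ _] := st_T H.
have [mT bT] := TL _ (stopped_admissible tau0 cx); split.
  move=> l; apply: measurable_funS (mT l) => //.
  by move=> s /=; rewrite !in_itv/= andbT => /andP[].
have sub : `[(0:R)%R, tau]%classic `<=` `[(0:R)%R, +oo[%classic.
  by move=> s /=; rewrite !in_itv/= andbT => /andP[].
have [B B0 HB] := ess_sup_norm_lty (bT _ _ sub).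
exists B; apply: ae_mono HB => t h1 t0 tt.
by rewrite (le_trans (norm_le_enorm _))// h1//= in_itv/= t0.
Qed.

Lemma csol_itg tau x j : 0 <= tau -> csol tau x ->
  itg 0 tau (fun s => vfield s (x s) (T (stopped x tau) s) 0 j).
Proof.
move=> tau0 [cx _ Dx _]; have [mT [B HB]] := T_stopped_props tau0 cx.
exact: vfield_itg HB.
Qed.

Lemma csol_step tau x s t j : 0 <= tau -> csol tau x -> 0 <= s -> s <= t -> t <= tau ->
  x t 0 j - x s 0 j = rint s t (fun s => vfield s (x s) (T (stopped x tau) s) 0 j).
Proof.
move=> tau0 cs s0 st tt; have [_ _ _ E] := cs.
have := E t (le_trans s0 st) tt j; have := E s s0 (le_trans st tt) j.
have -> := rint_split s0 st (itg_sub (lexx 0) tt (csol_itg j tau0 cs)).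
by move=> <- h1; rewrite -[LHS](addrK (x s 0 j - x 0 0 j)) addrA subrK h1; ring.
Qed.

(** The states frozen at [tau] and at [sigma] agree up to [sigma], so causality equates the operator
    outputs almost everywhere on [[0, sigma]]. *)
Lemma csol_transfer tau sigma (x x' : R -> 'rV[R]_(r * m)) : 0 <= sigma -> sigma <= tau ->
  csol tau x -> (forall t, - h <= t -> t <= sigma -> x t = x' t) -> csol sigma x'.
Proof.
move=> s0 st cs xx'; have [cx x0 Dx E] := cs.
have tau0 := le_trans s0 st; have h0 := st_h H.
have hN : - h <= 0 by rewrite oppr_le0.
have cx' : {within `[(- h)%R, sigma], continuous x'}.
  apply: (@subspace_eq_continuous _ _ _ x).
    by move=> t; rewrite inE/= in_itv/= => /andP[? ?]; exact: xx'.
  apply: continuous_subspaceW cx => t /=; rewrite !in_itv/= => /andP[-> h1].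
  exact: le_trans st.
split => //.
- move=> t /[dup] tI; rewrite in_itv/= => /andP[ht t0].
  by rewrite -xx' ?x0// (le_trans t0).
- by move=> t t0 ts; rewrite -xx' ?(le_trans hN)//; apply: Dx => //; exact: le_trans st.
have xE u : 0 <= u -> u <= sigma -> x u = x' u by move=> u0; apply: xx'; exact: le_trans u0.
move=> t t0 ts j; have tt := le_trans ts st.
rewrite -(xE t t0 ts) -(xE 0 (lexx 0) s0) (E t t0 tt).
have aT : {ae mu, forall s, 0 <= s -> s <= sigma ->
    T (stopped x tau) s = T (stopped x' sigma) s}.
  apply: (T_causal (stopped_admissible tau0 cx) (stopped_admissible s0 cx') s0).
  by move=> s hs ss; rewrite /stopped !min_l ?xx'// (le_trans ss).
have i1 := itg_sub (lexx 0) tt (csol_itg j tau0 cs).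
have [mT' [B' HB']] := T_stopped_props s0 cx'.
have Dx' s : 0 <= s -> s <= sigma -> inD s (x' s).
  by move=> s0' ss; rewrite -xx' ?(le_trans hN)//; apply: Dx => //; exact: le_trans st.
have i2 := itg_sub (lexx 0) ts (vfield_itg j s0 cx' Dx' mT' HB').
apply: (itg_ae_eq (itg_measurable i1) i2 _).2.
apply: ae_mono aT => s h1 /=; rewrite in_itv/= => /andP[s0' st'].
by rewrite h1 ?(le_trans st')// xE// (le_trans st').
Qed.

(** The initial data solve the equation on a degenerate interval, which makes local existence a
    special case of extension. *)
Lemma csol0 : csol 0 xi0.
Proof.
have [yc _] := st_init H; have h0 := st_h H.
split => //.
- apply/subspace_continuousP => t tt; apply: cvg_mkst => k kr.
  by have /subspace_continuousP := yc k kr; exact.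
- move=> t t0 t0'; have -> : t = 0 by apply/eqP; rewrite eq_le t0 t0'.
  apply: eq_in_D (st_initD H) => i ir.
  by rewrite /vec_error /error_blocks /xi0 !blk_mkst.
- move=> t t0 t0' j; have -> : t = 0 by apply/eqP; rewrite eq_le t0 t0'.
  by rewrite subrr rint_point.
Qed.

End Setup.

Section Truncation.
Context {R : realType}.

Definition clip n (A : R) (v : 'rV[R]_n) : 'rV[R]_n :=
  \row_j clamp (- A) A (v 0 j).

Lemma clip_norm n (A : R) (v : 'rV[R]_n) : 0 <= A -> `|clip A v| <= A.
Proof.
move=> A0; apply: norm_le_coord => // j; rewrite mxE ler_norml.
by apply: clamp_in; rewrite ge0_cp.
Qed.

Lemma clip_id n (A : R) (v : 'rV[R]_n) : `|v| <= A -> clip A v = v.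
Proof.
move=> vA; apply/rowP => j; rewrite mxE clamp_id// -ler_norml.
exact: le_trans (coord_le_norm _ _) vA.
Qed.

Lemma cvg_clip (S : Type) (F : set_system S) (FF : Filter F) n A
    (g : S -> 'rV[R]_n) v : g s @[s --> F] --> v -> clip A (g s) @[s --> F] --> clip A v.
Proof.
move=> gv; apply: cvg_coord => j; under eq_cvg do rewrite mxE; rewrite mxE.
apply: continuous_cvg; first exact: continuous_clamp.
exact: cvg_to_coord.
Qed.

Lemma clip_vmeasurable n A (I : set R) (g : R -> 'rV[R]_n) :
  measurable I -> vmeasurable I g -> vmeasurable I (fun t => clip A (g t)).
Proof.
move=> mI mg; move=> j; under eq_fun do rewrite mxE /clamp.
apply: measurable_maxr => //; apply: measurable_minr => //.
Qed.

End Truncation.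

Section Extension.
Context {R : realType} {m r p q : nat} {h : R} {d : R -> 'rV[R]_p}
  {f : 'rV[R]_p * 'rV[R]_q * 'rV[R]_m -> 'rV[R]_m}
  {T : (R -> 'rV[R]_(r * m)) -> (R -> 'rV[R]_q)}
  {y0 : nat -> R -> 'rV[R]_m} {yref : R -> 'rV[R]_m} {rhat : nat}
  {alpha gain phi : R -> R}.
Hypothesis H : setup h d f T y0 yref rhat alpha gain phi.
Local Notation mu := (@lebesgue_measure R).
Local Notation csol := (csol h d f T y0 yref rhat alpha gain phi).
Local Notation inD := (inD (r := r) yref rhat alpha phi).
Local Notation ctrl := (ctrl (r := r) yref rhat alpha gain phi).
Local Notation vfield := (vfield (r := r) d f yref rhat alpha gain phi).

(** The domain is relatively open in [t >= 0] and the control is continuous on it. Time is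
    restricted to [[0, +oo[] since [t0 = 0] occurs. *)
Lemma csol_near_inD t0 (v0 : 'rV[R]_(r * m)) : 0 <= t0 -> inD t0 v0 ->
  exists e : R, 0 < e /\ forall t v, 0 <= t -> `|t - t0| <= e -> `|v - v0| <= e ->
    inD t v /\ `|ctrl t v| <= `|ctrl t0 v0| + 1.
Proof.
move=> t00 Dv.
pose F := filter_prod (within `[(0:R)%R, +oo[ (nbhs t0)) (nbhs v0).
have FF1 : Filter (within `[(0:R)%R, +oo[ (nbhs t0)) by exact: within_filter.
have FF : Filter F by exact: filter_prod_filter.
have u1 : z.1 @[z --> F] --> t0.
  by apply: cvg_trans (cvg_fst (F := within `[(0:R)%R, +oo[ (nbhs t0))) _; exact: cvg_within.
have u2 : z.2 @[z --> F] --> v0 by exact: cvg_snd.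
have u0 : \forall z \near F, 0 <= z.1.
  exists (`[(0:R)%R, +oo[%classic, setT); last by move=> z [/=]; rewrite in_itv/= andbT.
  by split; [exact: withinT|exact: filterT].
have n1 := near_inD H FF t00 u1 u0 u2 Dv.
have n2 : \forall z \near F, `|ctrl z.1 z.2| < `|ctrl t0 v0| + 1.
  have := cvg_norm (cvg_ctrl H FF t00 u1 u0 u2 Dv).
  by move=> /(_ FF) c; apply: (cvgr_lt _ c); rewrite ltrDl.
have [[A B] /= [nA nB] AB] := filterI n1 n2.
move: nA; rewrite /within/= => /nbhs_ballP[e1 /= e10 H1].
move: nB => /nbhs_ballP[e2 /= e20 H2].
exists (Num.min e1 e2 / 2); split; first by rewrite divr_gt0// lt_min e10.
have half (e : R) : 0 < e -> e / 2 < e by move=> e0; rewrite ltr_pdivrMr// ltr_pMr// ltr1n.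
have m0 : 0 < Num.min e1 e2 by rewrite lt_min e10.
have m1 : Num.min e1 e2 / 2 < e1 by rewrite (lt_le_trans (half _ m0))// ge_min lexx.
have m2 : Num.min e1 e2 / 2 < e2 by rewrite (lt_le_trans (half _ m0))// ge_min lexx orbT.
move=> t v tge0 te ve.
have := AB (t, v); rewrite /= => -[|h1 h2]; last by split => //; exact: ltW.
split.
  apply: H1; last exact: itv0y.
  by rewrite /ball/= distrC (le_lt_trans te).
by apply: H2; rewrite -ball_normE /= distrC (le_lt_trans ve).
Qed.

Lemma T_bounded (B : R) : 0 <= B -> exists2 C : R, 0 <= C &
  forall zeta : R -> 'rV[R]_(r * m), {within `[(- h)%R, +oo[, continuous zeta} ->
  (forall t, - h <= t -> `|zeta t| <= B) ->
  {ae mu, forall t : R, 0 <= t -> `|T zeta t| <= C}.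
Proof.
move=> B0; have [_ _ _ bibo] := st_T H.
pose c1 : R := (r * m)%:R * B + 1.
have c10 : 0 < c1 by rewrite ltr_wpDl// mulr_ge0.
have [c2 c20 Hc2] := bibo c1 c10; exists c2; first exact: ltW.
move=> zeta cz zB; have := Hc2 zeta cz _.
have K : (sup_norm `[(- h)%R, +oo[ zeta < c1%:E)%E.
  apply: (@le_lt_trans _ _ ((r * m)%:R * B)%:E); last by rewrite lte_fin ltrDl.
  apply: ge_ereal_sup => _ [t + <-]; rewrite /= in_itv/= andbT => ht.
  by rewrite lee_fin (le_trans (enorm_le_norm _))// ler_wpM2l// zB.
move=> /(_ K)/ltW/ess_sup_norm_le; apply: ae_mono => t h1 t0.
by rewrite (le_trans (norm_le_enorm _))// h1//; exact: itv0y.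
Qed.

(* The right-hand side is made globally bounded by truncating the disturbance,
   the operator output and the state, which does not affect solutions on a short
   time interval. *)
Lemma csol_extend t0 xi : 0 <= t0 -> csol t0 xi ->
  exists tau x, [/\ t0 < tau, csol tau x &
    forall t, - h <= t -> t <= t0 -> x t = xi t].
Proof.
move=> t00 cs; have [cxi xi_0 Dxi Exi] := cs.
have h0 := st_h H; have hN : - h <= 0 by rewrite oppr_le0.
have ht0 : - h <= t0 by exact: le_trans t00.
have [e [e0 He]] := csol_near_inD t00 (Dxi t0 t00 (lexx _)).
set v0 := xi t0 in He.
have [Bxi Bxi0 HBxi] := within_bounded cxi.
(* BIBO provides the truncation level for the operator output in advance, for every state bounded by
   [Bxi + e]. *)
have [C C0 HC] := @T_bounded (Bxi + e) (addr_ge0 Bxi0 (ltW e0)).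
have [Bd Bd0 HBd] := d_bounded H.
pose A := Num.max (Num.max Bd C) (`|ctrl t0 v0| + 1).
have A0 : 0 <= A by rewrite !le_max Bd0.
have [Mf Mf0 HMf] := nonlinearity_bounded (st_f H) A.
pose xc v := v0 + clip e (v - v0).
have xc_near v : `|xc v - v0| <= e by rewrite /xc addrC addKr clip_norm// ltW.
have t0e : t0 <= t0 + e by rewrite lerDl ltW.
pose tc t := clamp t0 (t0 + e) t.
have tc_near t : 0 <= tc t /\ `|tc t - t0| <= e.
  have /andP[c1 c2] := clamp_in t t0e; split; first exact: le_trans c1.
  by rewrite ger0_norm ?subr_ge0// lerBlDl.
have DG t v : inD (tc t) (xc v) /\ `|ctrl (tc t) (xc v)| <= `|ctrl t0 v0| + 1.
  by have [? ?] := tc_near t; apply: He.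
pose G t v z : 'rV[R]_(r * m) := mkst (fun k => if (k.+1 < r)%N then blk k.+1 (xc v)
  else f (clip A (d t), clip A z, ctrl (tc t) (xc v))).
pose M := `|v0| + e + Mf.
have M0 : 0 <= M by rewrite !addr_ge0// ltW.
have GM t v z : `|G t v z| <= M.
  apply: mkst_norm => // k kr; case: ifP => _.
    rewrite (le_trans (blk_norm _ _))// /M.
    rewrite (le_trans (ler_normD _ _))// -addrA lerD2l.
    by rewrite (le_trans (clip_norm _ (ltW e0)))// lerDl.
  rewrite (le_trans (HMf _ _ _ _ _ _)) ?clip_norm//.
    by rewrite (le_trans (DG t v).2)// /A le_max lexx orbT.
  by rewrite /M lerDr addr_ge0// ltW.
have xcvg (S : Type) (F : set_system S) (FF : Filter F) (g : S -> 'rV[R]_(r * m)) v :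
    g s @[s --> F] --> v -> xc (g s) @[s --> F] --> xc v.
  move=> gv; apply: cvgD; first exact: cvg_cst.
  by apply: cvg_clip; apply: cvgB => //; exact: cvg_cst.
have Gc t (xs : nat -> 'rV[R]_(r * m)) (zs : nat -> 'rV[R]_q) v z :
    xs k @[k --> \oo] --> v -> zs k @[k --> \oo] --> z ->
    G t (xs k) (zs k) @[k --> \oo] --> G t v z.
  move=> xv zz; have xcv : xc (xs s) @[s --> \oo] --> xc v by exact: xcvg.
  apply: cvg_mkst => k kr; case: ifP => _; first exact: cvg_blk.
  apply: (cvg_nonlinearity (st_f H)).
  - exact: cvg_cst.
  - exact: cvg_clip.
  - apply: (cvg_ctrl H _ (tc_near t).1) => //.
    + exact: cvg_cst.
    + by apply: nearW => _; exact: (tc_near t).1.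
    + exact: (DG t v).1.
have Gm (x : R -> 'rV[R]_(r * m)) (z : R -> 'rV[R]_q) :
    {within `[(- h)%R, +oo[, continuous x} -> vmeasurable `[0%R, +oo[ z ->
    vmeasurable `[0%R, +oo[ (fun t => G t (x t) (z t)).
  move=> cx mz j.
  have cx0 : {within `[(0:R)%R, +oo[, continuous x}.
    apply: continuous_subspaceW cx => s /=; rewrite !in_itv/= !andbT.
    exact: le_trans.
  have [k [i E]] := @coord_blk R r m j.
  have -> : (fun t => G t (x t) (z t) 0 j) = (fun t => (if (k.+1 < r)%N
      then blk k.+1 (xc (x t))
      else f (clip A (d t), clip A (z t), ctrl (tc t) (xc (x t)))) 0 i).
    by apply/funext => s; rewrite E blk_mkst.
  case: (k.+1 < r)%N.
    apply: (@continuous_vmeasurable _ _ _ (fun t => blk k.+1 (xc (x t)))) => //.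
    apply/subspace_continuousP => t t0'; apply: cvg_blk; apply: xcvg.
    by move/subspace_continuousP : cx0; exact.
  apply: (nonlinearity_measurable (st_f H)) => //.
  - by apply: clip_vmeasurable => //; have [] := st_d H.
  - exact: clip_vmeasurable.
  - apply: continuous_vmeasurable => //.
    apply/subspace_continuousP => t t0'; have FF := within_filter `[(0:R)%R, +oo[ (nbhs_filter t).
    apply: (cvg_ctrl H FF (tc_near t).1).
    + by apply: cvg_within_filter; exact: continuous_clamp.
    + by apply: nearW => s; exact: (tc_near s).1.
    + by apply: xcvg; move/subspace_continuousP : cx0; exact.
    + exact: (DG t _).1.
have [tau1 [x [tau10 cx xxi Ex]]] := local_existence h0 (st_T H) M0 GM Gc Gm t00 cxi.
have xt0 : x t0 = v0 by rewrite xxi// in_itv/= ht0 lexx.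
have [tau2 tau20 Htau2] : exists2 tau2 : R, 0 < tau2 &
    forall t, t0 <= t -> t <= t0 + tau2 -> `|x t - v0| <= e.
  move/within_continuous_dist : cx => /(_ t0 _ e e0)[|dl dl0 Hdl].
    by rewrite /= in_itv/= andbT.
  exists (dl / 2); first exact: divr_gt0.
  move=> t t0t tdl; rewrite -xt0; apply/ltW/Hdl.
    by rewrite /= in_itv/= andbT (le_trans ht0).
  rewrite ger0_norm ?subr_ge0// ltrBlDl (le_lt_trans tdl)// ltrD2l.
  by rewrite ltr_pdivrMr// ltr_pMr// ltr1n.
(* Until [tau] the truncated equation is solved ([tau1]), the state stays in the box around [v0]
   ([tau2]), and the clamp of time is inactive ([e]). *)
pose tau := t0 + Num.min (Num.min tau1 tau2) e.
have tau_t0 : t0 < tau by rewrite /tau ltrDl !lt_min tau10 tau20 e0.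
have tau_1 : tau <= t0 + tau1 by rewrite /tau lerD2l !ge_min lexx.
have tau_2 : tau <= t0 + tau2 by rewrite /tau lerD2l !ge_min lexx orbT.
have tau_e : tau <= t0 + e by rewrite /tau lerD2l ge_min lexx orbT.
have tau0 : 0 <= tau by rewrite (le_trans t00)// ltW.
have cxt : {within `[(- h)%R, tau], continuous x}.
  by apply: continuous_subspaceW cx => s /=; rewrite !in_itv/= andbT => /andP[].
have xE t : - h <= t -> t <= t0 -> x t = xi t.
  by move=> ht tt; rewrite xxi// in_itv/= ht.
have Dx t : 0 <= t -> t <= tau -> inD t (x t).
  move=> tge tt; have [tle|tgt] := leP t t0.
    by rewrite xE ?(le_trans hN)//; exact: Dxi.
  apply: (He t (x t) tge _ _).1.
    by rewrite gtr0_norm ?subr_gt0// lerBlDl (le_trans tt).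
  by apply: Htau2; [exact: ltW|exact: le_trans tt _].
pose xs := stopped x tau.
have cxs := stopped_admissible H tau0 cxt.
have xsB t : - h <= t -> `|xs t| <= Bxi + e.
  move=> ht; rewrite /xs /stopped.
  have [tle|tgt] := leP (Num.min t tau) t0.
    rewrite xE ?le_min ?ht ?(le_trans hN)// (le_trans (HBxi _ _ _))// ?lerDl ?(ltW e0)//.
    by rewrite le_min ht (le_trans hN).
  have xn : `|x (Num.min t tau) - v0| <= e.
    by apply: Htau2; [exact: ltW|rewrite ge_min tau_2 orbT].
  have := ler_normD v0 (x (Num.min t tau) - v0); rewrite addrC subrK => /le_trans; apply.
  by apply: lerD => //; exact: HBxi.
have aeC := HC xs cxs xsB.
have aeT : {ae mu, forall s, 0 <= s -> s <= tau -> T x s = T xs s}.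
  apply: (T_causal H cx cxs tau0) => s hs st.
  by rewrite /xs /stopped min_l.
have aeT0 : {ae mu, forall s, 0 <= s -> s <= t0 -> T (stopped xi t0) s = T xs s}.
  apply: (T_causal H (stopped_admissible H t00 cxi) cxs t00) => s hs st.
  by rewrite /xs /stopped !min_l// ?xE// (le_trans st)// ltW.
have [mT [BT HBT]] := T_stopped_props H tau0 cxt.
have iV j : itg 0 tau (fun s => vfield s (x s) (T xs s) 0 j).
  exact: (vfield_itg H j tau0 cxt Dx mT HBT).
exists tau, x; split; [exact: tau_t0| |exact: xE].
split; [exact: cxt| |exact: Dx|].
  move=> t /[dup] tI; rewrite in_itv/= => /andP[ht tle].
  by rewrite xE// ?xi_0// (le_trans tle).
have x0E : x 0 = xi 0 by apply: xE.
have first_part j t : 0 <= t -> t <= t0 ->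
    x t 0 j - x 0 0 j = rint 0 t (fun s => vfield s (x s) (T xs s) 0 j).
  move=> tge tle; rewrite x0E xE ?(le_trans hN)// (Exi t tge tle).
  have ttau : t <= tau by rewrite (le_trans tle)// ltW.
  apply/esym; apply: (itg_ae_eq _ _ _).2.
  - exact: itg_measurable (itg_sub (lexx 0) ttau (iV j)).
  - exact: itg_sub (lexx 0) tle (csol_itg H j t00 cs).
  - apply: ae_mono aeT0 => s hs /=; rewrite in_itv/= => /andP[sge st].
    by rewrite hs ?(le_trans st)// xE ?(le_trans hN)// (le_trans st).
move=> t tge tt j; have [tle|/ltW tgt] := leP t t0; first exact: first_part.
have iVt := itg_sub (lexx 0) tt (iV j).
rewrite (rint_split t00 tgt iVt) -(first_part j t0 t00 (lexx _)).
have iV0t := itg_sub t00 (lexx t) iVt.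
suff -> : rint t0 t (fun s => vfield s (x s) (T xs s) 0 j) = x t 0 j - x t0 0 j.
  ring.
rewrite (Ex t tgt (le_trans tt tau_1)) xt0 -/v0 addrC addKr.
apply/esym; apply: (itg_ae_eq _ iV0t _).2.
  apply: measurable_funS (Gm x (T x) cx _ j) => //.
    by move=> s /=; rewrite !in_itv/= andbT => /andP[+ _]; exact: le_trans.
  by have [TL _ _ _] := st_T H; have [] := TL x cx.
have := ae_and (ae_and aeT aeC) HBd.
apply: ae_mono => s [[h1 h2] h3] /=; rewrite in_itv/= => /andP[sge st].
have s0 : 0 <= s by exact: le_trans sge.
have stau : s <= tau by exact: le_trans tt.
(* On [[t0, t]] every truncation acts as the identity, almost everywhere. *)
suff -> : vfield s (x s) (T xs s) = G s (x s) (T x s) by [].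
rewrite (h1 s0 stau); apply: eq_mkst => k kr.
have -> : xc (x s) = x s.
  rewrite /xc clip_id; last by apply: Htau2 => //; exact: le_trans tau_2.
  by rewrite addrC subrK.
have -> : tc s = s by rewrite /tc clamp_id// sge (le_trans stau).
rewrite !clip_id//.
  by rewrite (le_trans (h2 s0))// /A !le_max lexx orbT.
by rewrite (le_trans (h3 s0))// /A !le_max lexx.
Qed.

End Extension.

(** * A priori bounds *)

Section Apriori.
Context {R : realType} {m r p q : nat} {h : R} {d : R -> 'rV[R]_p}
  {f : 'rV[R]_p * 'rV[R]_q * 'rV[R]_m -> 'rV[R]_m}
  {T : (R -> 'rV[R]_(r * m)) -> (R -> 'rV[R]_q)}
  {y0 : nat -> R -> 'rV[R]_m} {yref : R -> 'rV[R]_m} {rhat : nat}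
  {alpha gain phi : R -> R}.
Hypothesis H : setup h d f T y0 yref rhat alpha gain phi.
Local Notation mu := (@lebesgue_measure R).
Local Notation csol := (csol h d f T y0 yref rhat alpha gain phi).
Local Notation inD := (inD (r := r) yref rhat alpha phi).
Local Notation ctrl := (ctrl (r := r) yref rhat alpha gain phi).
Local Notation vfield := (vfield (r := r) d f yref rhat alpha gain phi).
Local Notation vec_error := (vec_error (r := r) yref rhat phi).
Local Notation yr k := (derive_in_n `[(0:R)%R, +oo[ k yref).

(** [alpha] is bounded on the compact interval [[0, k0 ^+ 2]]; a value above that bound is attained,
    hence at the square of some [k > k0]. *)
Lemma alpha_level (k0 : R) : 0 <= k0 -> k0 < 1 -> exists A : R, forall a : R,
  A < a -> 1 <= a -> exists k : R, [/\ k0 < k, k < 1 & alpha (k ^+ 2) = a].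
Proof.
move=> k00 k01.
have k02 : k0 ^+ 2 < 1 by rewrite expr_lt1.
have ca : {within `[(0:R)%R, k0 ^+ 2], continuous alpha}.
  apply: continuous_subspaceW (st_alpha_cont H) => s /=; rewrite !in_itv/=.
  by move=> /andP[-> sk]; exact: le_lt_trans k02.
have [A A0 HA] := within_bounded ca; exists A => a Aa a1.
have [s [s0 s1 sa]] := st_alpha_surj H a1.
have ks : k0 ^+ 2 < s.
  rewrite ltNge; apply/negP => /(HA s s0); rewrite sa => h1.
  by have := le_lt_trans (le_trans (ler_norm _) h1) Aa; rewrite ltxx.
exists (Num.sqrt s); rewrite sqr_sqrtr//; split => //.
  by rewrite -(ger0_norm k00) -sqrtr_sqr ltr_sqrt// (le_lt_trans _ ks)// sqr_ge0.
by rewrite -[ltRHS]sqrtr1 ltr_sqrt.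
Qed.

Lemma blk_derivative tau x k s : 0 <= tau -> csol tau x -> (k.+1 < r)%N ->
  0 <= s <= tau -> has_derivative_in `[0%R, tau] (fun t => blk k (x t)) s (blk k.+1 (x s)).
Proof.
move=> tau0 cs kr s0t; have kr' := ltnW kr; have [cx _ _ _] := cs.
have cx0 : {within `[(0:R)%R, tau], continuous x}.
  apply: continuous_subspaceW cx => t /=; rewrite !in_itv/= => /andP[t0 ->].
  by rewrite andbT (le_trans _ t0)// oppr_le0; exact: st_h H.
have cb : {within `[(0:R)%R, tau], continuous (fun t => blk k.+1 (x t))}.
  apply/subspace_continuousP => t tt; apply: cvg_blk.
  by move/subspace_continuousP : cx0; exact.
apply/has_derivative_in_coord => j.
have cbj : {within `[(0:R)%R, tau], continuous (fun t => blk k.+1 (x t) 0 j)}.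
  apply/subspace_continuousP => t tt; apply: cvg_to_coord.
  by move/subspace_continuousP : cb; exact.
have [i E] := @blk_coord_ex R r m k j kr'.
apply: (@primitive_has_derivative _ _ _ _ (fun t => blk k.+1 (x t) 0 j)) => //.
- exact: continuous_itg.
- move=> a b a0 ab bt; rewrite !E (csol_step H i tau0 cs a0 ab bt).
  congr rint; apply/funext => u.
  by rewrite -E blk_mkst// kr.
- move=> e e0; have := s0t; rewrite -[X in X -> _]/(is_true _) => st'.
  have sI : `[(0:R)%R, tau]%classic s by rewrite /= in_itv.
  have [dl dl0 Hdl] := (within_continuous_dist _ _).1 cbj s sI e e0.
  by exists dl => // y yI; apply: Hdl; rewrite /= in_itv.
Qed.

Variables (omega : \bar R) (x : R -> 'rV[R]_(r * m)).
Hypothesis xsol : forall tau : R, 0 <= tau -> (tau%:E < omega)%E -> csol tau x.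

Local Notation dom t := ((t%:E < omega)%E).

(* [ek k] is rho_k(phi bold-e) along the solution, [Eb k] is block [k] of bold-e,
   and [gk k] is the summand gamma(rho_k), so that [ek k.+1 = phi Eb k + gk k]. *)
Definition Eb k t := error_blocks yref rhat (fun k s => blk k (x s)) t k.
Definition ek k t := rho alpha k (vec_error t (x t)).
Definition gk k t : 'rV[R]_m := if k is 0%N then 0 else gamma alpha (ek k t).

Lemma ekS k t : ek k.+1 t = phi t *: Eb k t + gk k t.
Proof. by case: k => [|k]; rewrite /ek/= ?addr0. Qed.

Lemma dom_le s t : s <= t -> dom t -> dom s.
Proof. by move=> st; apply: le_lt_trans; rewrite lee_fin. Qed.

Lemma x_inD t : 0 <= t -> dom t -> inD t (x t).
Proof. by move=> t0 td; have [_ _ + _] := xsol t0 td; apply. Qed.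

Lemma ek_lt1 k t : (0 < k <= r)%N -> 0 <= t -> dom t -> enorm (ek k t) < 1.
Proof. by move=> kr t0 td; exact: in_D_rho (x_inD t0 td) kr. Qed.

Lemma x_continuous b : 0 <= b -> dom b -> {within `[(0:R)%R, b], continuous x}.
Proof.
move=> b0 bd; have [cx _ _ _] := xsol b0 bd.
apply: continuous_subspaceW cx => t /=; rewrite !in_itv/= => /andP[t0 ->].
by rewrite andbT (le_trans _ t0)// oppr_le0; exact: st_h H.
Qed.

Lemma within_cvg_itv (a b t : R) : 0 <= a -> a <= t <= b ->
  [/\ Filter (within `[a, b] (nbhs t)), s @[s --> within `[a, b] (nbhs t)] --> t &
    \forall s \near within `[a, b] (nbhs t), 0 <= s].
Proof.
move=> a0 /andP[at_ tb]; split; first exact: within_filter.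
- by apply: cvg_within_filter; exact: cvg_id.
- apply: filterS (@withinT _ _ _ (nbhs_filter t)) => s /=.
  by rewrite in_itv/= => /andP[/(le_trans a0)].
Qed.

Lemma x_cvg (a b t : R) : 0 <= a -> dom b -> a <= t <= b ->
  x s @[s --> within `[a, b] (nbhs t)] --> x t.
Proof.
move=> a0 bd /andP[at_ tb].
have b0 : 0 <= b by rewrite (le_trans a0)// (le_trans at_).
have cx : {within `[a, b], continuous x}.
  apply: continuous_subspaceW (x_continuous b0 bd) => s /=; rewrite !in_itv/=.
  by move=> /andP[/(le_trans a0) -> ->].
by move/subspace_continuousP : cx; apply; rewrite /= in_itv/= at_.
Qed.

Lemma ek_continuous k a b : (0 < k <= r)%N -> 0 <= a -> dom b ->
  {within `[a, b], continuous (ek k)}.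
Proof.
move=> /andP[k0 kr] a0 bd; apply/subspace_continuousP => t /=; rewrite in_itv/= => atb.
have [FF u1 u2] := within_cvg_itv a0 atb.
have xt := x_cvg a0 bd atb; move: atb => /andP[at_ tb].
have t0 : 0 <= t by exact: le_trans at_.
apply: (cvg_rho (st_alpha_cont H)).
  by move=> i ik; apply: (cvg_vec_error H) => //; exact: leq_trans kr.
apply: in_DP => i /andP[i0 ik]; apply: ek_lt1 => //; last exact: dom_le bd.
by rewrite i0 (leq_trans ik)// (leq_trans (leq_pred _)).
Qed.

Lemma Eb_continuous k a b : (k < r)%N -> 0 <= a -> dom b ->
  {within `[a, b], continuous (Eb k)}.
Proof.
move=> kr a0 bd; apply/subspace_continuousP => t /=; rewrite in_itv/= => atb.
have [FF u1 u2] := within_cvg_itv a0 atb.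
have xt := x_cvg a0 bd atb; move: atb => /andP[at_ tb].
rewrite /Eb /error_blocks; case: (k < rhat)%N; last exact: cvg_blk.
apply: cvgB; first exact: cvg_blk.
have u2' : \forall s \near within `[a, b] (nbhs t), `[(0:R)%R, +oo[%classic s.
  by apply: filterS u2 => s; exact: itv0y.
apply: (cvg_within_comp FF (st_ref_cont H kr)) => //.
by apply: itv0y; exact: le_trans at_.
Qed.

(* The derivative of block [k] is block [k.+1] except where bold-e switches from
   derivatives of the error to derivatives of the output. *)
Definition corr k t : 'rV[R]_m := if (k.+1 == rhat)%N then yr rhat t else 0.

Lemma Eb_derivative k b s : (k.+1 < r)%N -> dom b -> 0 <= s <= b ->
  has_derivative_in `[0%R, b] (Eb k) s (Eb k.+1 s - corr k s).
Proof.
move=> kr bd s0b; have b0 : 0 <= b by move: s0b => /andP[]; exact: le_trans.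
have Db := blk_derivative b0 (xsol b0 bd) kr s0b.
have Dy : has_derivative_in `[0%R, b] (yr k) s (yr k.+1 s).
  apply: (@has_derivative_in_local _ _ `[0%R, +oo[ _ (yr k) (yr k) _ _ 1) => //.
    by move=> t _ /=; rewrite !in_itv/= andbT => /andP[->].
  by apply: st_ref_der H _ kr _ _; move: s0b => /andP[].
have Dsub := has_derivative_inB Db Dy.
rewrite /Eb /error_blocks /corr.
have [krh|krh] := ltnP k rhat.
  case: eqP => [E|/eqP E]; first by rewrite -E ltnn.
  by rewrite ltn_neqAle E krh subr0.
rewrite (gtn_eqF (leq_ltn_trans krh (ltnSn _))) ltnNge (leq_trans krh (leqnSn _))/=.
by rewrite subr0.
Qed.

Variables (t1 : R).
Hypotheses (t10 : 0 < t1) (t1d : dom t1).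

(** Continuity keeps [phi] below [phi s + eta] for a short time, so the growth bound can be
    evaluated at [s]. *)
Lemma phi_increment : exists2 c : R, 0 < c & forall s eta : R, 0 <= s -> 0 < eta ->
  exists2 rho : R, 0 < rho & forall t, s < t -> t < s + rho ->
    `|phi t - phi s| <= c * (1 + phi s + eta) * (t - s).
Proof.
have [c c0 Hc] := st_phi_lip H; exists c => // s eta s0 eta0.
have [dl dl0 Hdl] := (within_continuous_dist _ _).1 (st_phi_cont H) s (itv0y s0) eta eta0.
exists dl => // t st tdl; rewrite -addrA; apply: Hc => //; first exact: ltW.
move=> u su ut; have := Hdl u (itv0y (le_trans s0 su)).
rewrite ger0_norm ?subr_ge0// ltrBlDl (le_lt_trans ut)// => /(_ isT).
by rewrite ltr_norml => /andP[_]; lra.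
Qed.

(** The induction hypothesis carried from [gk k] to [gk k.+1]; the constants are uniform up to
    [omega]. *)
Definition bounded_lipschitz (g : R -> 'rV[R]_m) : Prop :=
  exists G L : R, [/\ 0 <= G, 0 <= L,
    forall t, t1 <= t -> dom t -> enorm (g t) <= G &
    forall s t, t1 <= s -> s <= t -> dom t -> enorm (g t - g s) <= L * (t - s)].

(* The growth condition makes [phi' Eb] bounded as soon as [phi Eb] is. *)
Lemma phi_term k (G : R) : (k < r)%N -> 0 <= G ->
  (forall t, t1 <= t -> dom t -> enorm (gk k t) <= G) ->
  exists2 C : R, 0 <= C & forall s, t1 <= s -> dom s ->
  exists2 rho : R, 0 < rho & forall t, s < t -> t < s + rho -> dom t ->
    enorm ((phi t - phi s) *: Eb k t) <= C * (t - s).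
Proof.
move=> kr G0 gG; have [c c0 Hc] := phi_increment.
have [phi0 phi00 Hphi0] := st_phi_low H t10.
have K0 : 0 <= c * (phi0^-1 + 1) * (1 + G).
  by rewrite mulr_ge0 ?mulr_ge0 ?addr_ge0 ?invr_ge0 ?(ltW phi00) ?(ltW c0).
exists (c * (phi0^-1 + 1) * (1 + G) + 1); first by rewrite addr_ge0.
move=> s t1s sd; have s0 : 0 <= s by rewrite (le_trans (ltW t10)).
have ps : phi0 <= phi s by exact: Hphi0.
have ps0 : 0 < phi s by exact: lt_le_trans ps.
pose E := enorm (Eb k s); have E0 : 0 <= E by exact: enorm_ge0.
have pE : phi s * E <= 1 + G.
  have -> : phi s * E = enorm (phi s *: Eb k s) by rewrite enormZ gtr0_norm.
  have -> : phi s *: Eb k s = ek k.+1 s - gk k s by rewrite ekS addrK.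
  rewrite (le_trans (enormB _ _))// lerD ?gG//.
  by apply/ltW/ek_lt1; rewrite ?kr.
(* small enough errors [eta] so that the product exceeds its limit by at most 1 *)
pose eta := Num.min 1 (c * (1 + phi s + 1 + E))^-1.
have D0 : 0 < c * (1 + phi s + 1 + E) by apply: mulr_gt0 => //; lra.
have eta0 : 0 < eta by rewrite lt_min ltr01 invr_gt0.
have eta1 : eta <= 1 by rewrite ge_min lexx.
have etaD : c * (1 + phi s + 1 + E) * eta <= 1.
  by rewrite mulrC -ler_pdivlMr// div1r ge_min lexx orbT.
have [rho1 rho10 H1] := Hc s eta s0 eta0.
have [[b sb bd]|nob] := pselect (exists2 b, s < b & dom b); last first.
  exists 1 => // t st _ td; exfalso; apply: nob; by exists t.
have sI : `[s, b]%classic s by rewrite /= in_itv/= lexx ltW.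
have e1 : 0 < eta / m.+1%:R by rewrite divr_gt0.
have [rho2 rho20 H2] := (within_continuous_dist _ _).1 (Eb_continuous kr s0 bd) s sI _ e1.
exists (Num.min (Num.min rho1 rho2) (b - s)).
  by rewrite !lt_min rho10 rho20 subr_gt0.
move=> t st; rewrite -ltrBlDl !lt_min !ltrBlDl => /andP[/andP[tr1 tr2] tb] td.
have tb' : t <= b by lra.
have h1 := H1 t st tr1.
have h2 : enorm (Eb k t) <= E + eta.
  have : `|Eb k t - Eb k s| < eta / m.+1%:R.
    apply: H2; first by rewrite /= in_itv/= (ltW st).
    by rewrite gtr0_norm ?subr_gt0// ltrBlDl.
  rewrite ltr_pdivlMr// => h3.
  rewrite -[Eb k t](subrK (Eb k s)) (le_trans (enormD _ _))// addrC lerD2l.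
  rewrite (le_trans (enorm_le_norm _))// (le_trans _ (ltW h3))// mulrC ler_wpM2l//.
  by rewrite ler_nat leqnSn.
rewrite enormZ.
have ts : 0 < t - s by rewrite subr_gt0.
apply: (le_trans (ler_pM (normr_ge0 _) (enorm_ge0 _) h1 h2)).
rewrite mulrAC ler_pM2r//.
(* As [phi s >= phi0], the factor [1 + phi s] is at most [(phi0^-1 + 1) * phi s], and
   [phi s * E <= 1 + G]. *)
have e2 : c * (1 + phi s) * E <= c * (phi0^-1 + 1) * (1 + G).
  rewrite -!mulrA ler_pM2l//.
  apply: (@le_trans _ _ ((phi0^-1 + 1) * (phi s * E))).
    rewrite mulrA ler_wpM2r// mulrDl mul1r lerD2r.
    by rewrite mulrC ler_pdivlMr// mul1r.
  by rewrite ler_wpM2l// addr_ge0// invr_ge0 ltW.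
have e3 : c * (1 + phi s + eta) * (E + eta) <=
    c * (1 + phi s) * E + c * (1 + phi s + 1 + E) * eta.
  rewrite -!mulrA -mulrDr ler_pM2l//.
  have : eta * eta <= 1 * eta by rewrite ler_wpM2r// ltW.
  by lra.
by apply: (le_trans e3); exact: lerD.
Qed.

(** Here [phi] has to be bounded if [rhat < r]: at the switch a derivative of the reference, and not
    of the error, is multiplied by [phi]. *)
Lemma corr_bounded k : (k.+1 < r)%N -> exists2 C : R, 0 <= C &
  forall s, 0 <= s -> phi s * enorm (corr k s) <= C.
Proof.
move=> kr; rewrite /corr; case: eqP => [E|_]; last first.
  by exists 0 => // s _; rewrite enorm0 mulr0.
have rr : (rhat < r)%N by rewrite -E.
have [M HM] := st_phi_bnd H rr; have [B B0 HB] := st_ref_bnd H.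
exists (M * B) => [|s s0]; last by apply: ler_pM => //; [exact: st_phi_ge0 H _ s0|
  exact: enorm_ge0|exact: HM|exact: HB].
by rewrite mulr_ge0// (le_trans (st_phi_ge0 H (lexx 0)))// HM.
Qed.

Lemma ek_increment k s t : ek k.+1 t - ek k.+1 s =
  (phi t - phi s) *: Eb k t + phi s *: (Eb k t - Eb k s) + (gk k t - gk k s).
Proof. by rewrite !ekS scalerBl scalerBr; apply/rowP => i; rewrite !mxE; ring. Qed.

(** [phi *: Eb k.+1] equals [ek k.+2 - gamma (ek k.+1)], which brings the damping term in. The
    constant collects the variation of [phi], the switch to output derivatives, a remainder 1 and
    the Lipschitz constant of [gk k]. *)
Lemma step_estimate k : (k.+1 < r)%N -> bounded_lipschitz (gk k) ->
  exists2 C : R, 0 <= C & forall s, t1 <= s -> dom s ->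
  exists2 rho : R, 0 < rho & forall t, s < t -> t < s + rho -> dom t ->
    enorm (ek k.+1 t - ek k.+1 s - (t - s) *: (ek k.+2 s - gamma alpha (ek k.+1 s)))
    <= C * (t - s).
Proof.
move=> kr [G [L [G0 L0 gG gL]]]; have kr' := ltnW kr.
have [C1 C10 H1] := phi_term kr' G0 gG.
have [C2 C20 H2] := corr_bounded kr.
exists (C1 + (C2 + 1) + L) => [|s t1s sd].
  by rewrite !addr_ge0.
have s0 : 0 <= s by rewrite (le_trans (ltW t10)).
have ps0 := st_phi_ge0 H s0.
have [rho1 rho10 K1] := H1 s t1s sd.
have [[b sb bd]|nob] := pselect (exists2 b, s < b & dom b); last first.
  by exists 1 => // t st _ td; exfalso; apply: nob; exists t.
have sb0 : 0 <= s <= b by rewrite s0 ltW.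
(* With this accuracy the remainder of the derivative of [Eb k], multiplied by [phi s] and measured
   in the Euclidean norm, is at most [t - s]. *)
have e0 : 0 < ((phi s + 1) * m.+1%:R)^-1 :> R.
  by rewrite invr_gt0 mulr_gt0// ltr_wpDl.
have [rho2 rho20 K2] := (has_derivative_in_dist _ _ _ _).1 (Eb_derivative kr bd sb0) _ e0.
exists (Num.min (Num.min rho1 rho2) (b - s)).
  by rewrite !lt_min rho10 rho20 subr_gt0.
move=> t st; rewrite -ltrBlDl !lt_min !ltrBlDl => /andP[/andP[tr1 tr2] tb] td.
have ts : 0 < t - s by rewrite subr_gt0.
have tb' : t <= b by lra.
have h1 := K1 t st tr1 td.
have h2 : enorm (phi s *: (Eb k t - Eb k s - (t - s) *: (Eb k.+1 s - corr k s))) <= t - s.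
  have := K2 t; rewrite /= in_itv/= (le_trans s0 (ltW st)) tb' gtr0_norm// ltrBlDl.
  move=> /(_ isT tr2) h3; rewrite enormZ ger0_norm//.
  apply: (@le_trans _ _ (phi s * (m%:R * (((phi s + 1) * m.+1%:R)^-1 * (t - s))))).
    by rewrite ler_wpM2l// (le_trans (enorm_le_norm _))// ler_wpM2l.
  rewrite !mulrA -[leRHS]mul1r ler_pM2r// ler_pdivrMr ?mul1r; last first.
    by rewrite mulr_gt0// ltr_wpDl.
  by apply: ler_pM => //; rewrite ?lerDl// ler_nat leqnSn.
have h3 := gL s t t1s (ltW st) td.
have E : ek k.+2 s - gamma alpha (ek k.+1 s) = phi s *: Eb k.+1 s.
  by rewrite (ekS k.+1)/= addrK.
rewrite E ek_increment.
have -> : (phi t - phi s) *: Eb k t + phi s *: (Eb k t - Eb k s) + (gk k t - gk k s)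
    - (t - s) *: (phi s *: Eb k.+1 s) =
  (phi t - phi s) *: Eb k t +
  (phi s *: (Eb k t - Eb k s - (t - s) *: (Eb k.+1 s - corr k s)) -
   (t - s) *: (phi s *: corr k s)) + (gk k t - gk k s).
  by apply/rowP => i; rewrite !mxE; ring.
rewrite !mulrDl; apply: (le_trans (enormD _ _)); apply: lerD => //.
apply: (le_trans (enormD _ _)); apply: lerD => //.
apply: (le_trans (enormB _ _)); rewrite addrC mul1r; apply: lerD => //.
rewrite enormZ gtr0_norm// mulrC ler_pM2r// enormZ ger0_norm//; exact: H2.
Qed.

Lemma gamma0 : gamma alpha (0 : 'rV[R]_m) = 0.
Proof. by rewrite /gamma scaler0. Qed.

(* With |ek| = ka and alpha(ka^2) large, the term - gamma(ek) in the derivative of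
   [ek] dominates, so the sphere of radius [ka] is not crossed outwards. *)
Lemma ek_step k : (k.+1 < r)%N -> bounded_lipschitz (gk k) ->
  (exists k0 : R, [/\ 0 <= k0, k0 < 1 & forall t, t1 <= t -> dom t ->
     enorm (ek k.+1 t) <= k0]) /\ bounded_lipschitz (gk k.+1).
Proof.
move=> kr bl; have [C C0 HC] := step_estimate kr bl.
have kr1 : (0 < k.+1 <= r)%N by exact: ltnW kr.
have kr2 : (0 < k.+2 <= r)%N by [].
have t10' := ltW t10.
pose k0 := Num.max (2^-1) (enorm (ek k.+1 t1)).
have k00 : 0 < k0 by rewrite lt_max invr_gt0 ltr0n.
have k01 : k0 < 1.
  rewrite gt_max ek_lt1// andbT; lra.
have [A HA] := alpha_level (ltW k00) k01.
(* [A + 1] makes [a] a value of [alpha] beyond [k0]. Since [ka >= 1/2], the other bound gives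
   [a * ka >= C + 2], which exceeds the error [C] plus the norm of [ek k.+2]. *)
pose a := Num.max (A + 1) (2 * (C + 2)).
have Aa : A < a by rewrite lt_max ltrDl ltr01.
have aC : 2 * (C + 2) <= a by rewrite le_max lexx orbT.
have [||ka [k0k k1 ak]] := HA a; [by []|lra|].
have ka0 : 0 < ka by exact: lt_trans k0k.
have ka2 : 2^-1 <= ka by rewrite (le_trans _ (ltW k0k))// le_max lexx.
have bnd t : t1 <= t -> dom t -> enorm (ek k.+1 t) <= ka.
  move=> t1t td.
  have ce := ek_continuous kr1 t10' td.
  apply: (@barrier _ t1 t (fun u => enorm (ek k.+1 u))) => //.
  - apply/subspace_continuousP => u uI; apply: cvg_enorm.
    by move/subspace_continuousP : ce; exact.
  - by rewrite (le_trans _ (ltW k0k))// le_max lexx orbT.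
  move=> s t1s st es; have sd : dom s := dom_le (ltW st) td.
  have s0 : 0 <= s by exact: le_trans t1s.
  have [rho rho0 Hrho] := HC s t1s sd.
  have a0 : 0 < a by lra.
  (* Up to time [s + a^-1] the coefficient [1 - (u - s) * a] below is nonnegative. *)
  exists (Num.min rho a^-1); first by rewrite lt_min rho0 invr_gt0.
  move=> u su; rewrite -ltrBlDl lt_min !ltrBlDl => /andP[ur ua] ut.
  have us : 0 < u - s by rewrite subr_gt0.
  have usa : (u - s) * a <= 1 by rewrite -ler_pdivlMr// div1r; lra.
  have := Hrho u su ur (dom_le ut td) => h1.
  set z := (u - s) *: _ in h1.
  (* On the sphere gamma is multiplication by [a], so the main term is [ek k.+1 s] shrunk by the
     factor [1 - (u - s) * a], plus a vector of norm at most [u - s]. *)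
  have zE : ek k.+1 s + z = (1 - (u - s) * a) *: ek k.+1 s + (u - s) *: ek k.+2 s.
    rewrite /z /gamma es ak; apply/rowP => i; rewrite !mxE; ring.
  have -> : ek k.+1 u = (ek k.+1 u - ek k.+1 s - z) + (ek k.+1 s + z).
    by apply/rowP => i; rewrite !mxE; ring.
  apply: (le_trans (enormD _ _)); rewrite zE.
  have h2 : enorm ((1 - (u - s) * a) *: ek k.+1 s + (u - s) *: ek k.+2 s) <=
      (1 - (u - s) * a) * ka + (u - s).
    apply: (le_trans (enormD _ _)); apply: lerD.
      by rewrite enormZ es ger0_norm// subr_ge0.
    by rewrite enormZ gtr0_norm// ler_piMr ?ltW// ek_lt1.
  have h3 : (C + 1) * (u - s) <= (u - s) * a * ka.
    rewrite -mulrA mulrC ler_pM2l//.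
    have : 2 * (C + 2) * 2^-1 <= a * ka by apply: ler_pM => //; lra.
    by lra.
  by lra.
split; first by exists ka; split => //; exact: ltW.
have [L L0 HL] := st_gamma_lip H (ltW ka0) k1.
have gB (v : 'rV[R]_m) : enorm v <= ka -> enorm (gamma alpha v) <= L * ka.
  move=> vk; have := HL v 0 vk; rewrite enorm0 => /(_ (ltW ka0)).
  by rewrite gamma0 !subr0 => /le_trans; apply; rewrite ler_wpM2l.
(* In the ball of radius [ka] gamma is bounded by [L * ka]; the increment of [ek k.+1] then consists
   of [ek k.+2], of norm below 1, the gamma term and the error [C]. *)
pose L1 := 1 + L * ka + C.
have L10 : 0 <= L1 by rewrite !addr_ge0// mulr_ge0// ltW.
have eL s t : t1 <= s -> s <= t -> dom t -> enorm (ek k.+1 t - ek k.+1 s) <= L1 * (t - s).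
  move=> t1s st td; have s0 : 0 <= s by exact: le_trans t1s.
  apply: dini_lipschitz => //; first exact: ek_continuous.
  move=> u su ut eta eta0; have ud := dom_le (ltW ut) td.
  have u0 : 0 <= u by exact: le_trans su.
  have [rho rho0 Hrho] := HC u (le_trans t1s su) ud.
  exists rho => // v uv vr vt; have vd := dom_le vt td.
  have vu : 0 < v - u by rewrite subr_gt0.
  have := Hrho v uv vr vd; set z := (v - u) *: _ => h1.
  rewrite -[_ - ek k.+1 u](subrK z) (le_trans (enormD _ _))//.
  have h2 : enorm z <= (v - u) * (1 + L * ka).
    rewrite /z enormZ gtr0_norm// ler_pM2l// (le_trans (enormB _ _))//.
    apply: lerD; first by apply/ltW/ek_lt1.
    by apply: gB; apply: bnd => //; exact: le_trans su.
  have : 0 <= eta * (v - u) by rewrite mulr_ge0// ltW.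
  rewrite /L1; lra.
exists (L * ka), (L * L1); split.
- by rewrite mulr_ge0// ltW.
- exact: mulr_ge0.
- by move=> t t1t td; apply: gB; exact: bnd.
- move=> s t t1s st td; rewrite /= (le_trans (HL _ _ _ _))//.
  + by apply: bnd => //; exact: le_trans st.
  + by apply: bnd => //; exact: dom_le td.
  + by rewrite -mulrA ler_wpM2l// eL.
Qed.

Lemma gk_bounded k : (k < r)%N -> bounded_lipschitz (gk k).
Proof.
elim: k => [_|k ih kr]; last by have [] := ek_step kr (ih (ltnW kr)).
exists 0, 0; split => //= [t _ _|s t _ _ _]; first by rewrite enorm0.
by rewrite subrr enorm0 mul0r.
Qed.

Lemma ek_bounded k : (k.+1 < r)%N -> exists k0 : R, [/\ 0 <= k0, k0 < 1 &
  forall t, t1 <= t -> dom t -> enorm (ek k.+1 t) <= k0].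
Proof. by move=> kr; have [] := ek_step kr (gk_bounded (ltnW kr)). Qed.

Lemma Eb_bounded k : (k < r)%N -> exists2 B : R, 0 <= B &
  forall t, t1 <= t -> dom t -> enorm (phi t *: Eb k t) <= B /\ enorm (Eb k t) <= B.
Proof.
move=> kr; have [G [L [G0 L0 gG gL]]] := gk_bounded kr.
have [phi0 phi00 Hphi0] := st_phi_low H t10.
exists (Num.max (1 + G) ((1 + G) / phi0)).
  by rewrite le_max addr_ge0.
move=> t t1t td; have t0 : 0 <= t by rewrite (le_trans (ltW t10)).
have h1 : enorm (phi t *: Eb k t) <= 1 + G.
  have -> : phi t *: Eb k t = ek k.+1 t - gk k t by rewrite ekS addrK.
  rewrite (le_trans (enormB _ _))// lerD ?gG//.
  by apply/ltW/ek_lt1; rewrite ?kr.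
split; first by rewrite le_max h1.
rewrite le_max; apply/orP; right; rewrite ler_pdivlMr// mulrC.
have pt := Hphi0 t t1t.
apply: le_trans h1; rewrite enormZ ger0_norm ?(st_phi_ge0 H t0)//.
by rewrite ler_wpM2r// enorm_ge0.
Qed.

Lemma blk_bounded_after k : (k < r)%N -> exists2 B : R, 0 <= B &
  forall t, t1 <= t -> dom t -> `|blk k (x t)| <= B.
Proof.
move=> kr; have [B B0 HB] := Eb_bounded kr; have [C C0 HC] := st_ref_bnd H.
exists (B + C); first exact: addr_ge0.
move=> t t1t td; have t0 : 0 <= t by rewrite (le_trans (ltW t10)).
have [_ hE] := HB t t1t td.
apply: (le_trans (norm_le_enorm _)).
move: hE; rewrite /Eb /error_blocks; case: (k < rhat)%N => hE; last first.
  by rewrite (le_trans hE)// lerDl.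
by rewrite -[blk k _](subrK (yr k t)) (le_trans (enormD _ _))// lerD// HC.
Qed.

(** Inverting the maps rho_k bounds the blocks from [t1] on, with [|e_r| < 1] for the last of them;
    up to [t1] compactness does. The operator output can therefore be bounded before the
    nonlinearity is estimated. *)
Lemma x_bounded : exists2 B : R, 0 <= B &
  forall t, - h <= t -> dom t -> `|x t| <= B.
Proof.
have [B1 B10 HB1] : exists2 B : R, 0 <= B & forall k, (k < r)%N ->
    forall t, t1 <= t -> dom t -> `|blk k (x t)| <= B.
  suff : forall n, (n <= r)%N -> exists2 B : R, 0 <= B & forall k, (k < n)%N ->
    forall t, t1 <= t -> dom t -> `|blk k (x t)| <= B by move=> /(_ r (leqnn _)).
  elim=> [_|n ih nr]; first by exists 0.
  have [B B0 HB] := ih (ltnW nr); have [C C0 HC] := blk_bounded_after nr.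
  exists (Num.max B C); first by rewrite le_max B0.
  move=> k; rewrite ltnS leq_eqVlt => /predU1P[->|kn] t t1t td.
    by rewrite le_max HC ?orbT.
  by rewrite le_max HB.
have [cx _ _ _] := xsol (ltW t10) t1d.
have [B2 B20 HB2] := within_bounded cx.
exists (Num.max B1 B2); first by rewrite le_max B10.
move=> t ht td; rewrite le_max; have [tt|/ltW tt] := leP t t1.
  by rewrite HB2// orbT.
apply/orP; left; rewrite -[x t]mkst_blk; apply: mkst_norm => // k kr.
exact: HB1.
Qed.

Lemma T_bounded_sol : exists2 C : R, 0 <= C & forall tau, 0 <= tau -> dom tau ->
  {ae mu, forall t : R, 0 <= t -> `|T (stopped x tau) t| <= C}.
Proof.
have [B B0 HB] := x_bounded; have [C C0 HC] := T_bounded H B0.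
exists C => // tau tau0 td; apply: HC.
  by have [cx _ _ _] := xsol tau0 td; exact: (stopped_admissible H tau0 cx).
move=> t ht; apply: HB.
  by rewrite le_min ht (le_trans _ tau0)// oppr_le0; exact: st_h H.
by apply: dom_le td; rewrite ge_min lexx orbT.
Qed.

Lemma top_increment tau s t j : 0 <= tau -> dom tau -> 0 <= s -> s <= t -> t <= tau ->
  let F := fun u => f (d u, T (stopped x tau) u, ctrl u (x u)) 0 j in
  itg 0 tau F /\ blk r.-1 (x t) 0 j - blk r.-1 (x s) 0 j = rint s t F.
Proof.
move=> tau0 td s0 st tt F.
have rr : (r.-1 < r)%N by rewrite ltn_predL (st_r H).
have [i E] := @blk_coord_ex R r m r.-1 j rr.
have FE : F = (fun u => vfield u (x u) (T (stopped x tau) u) 0 i).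
  by apply/funext => u; rewrite -E blk_mkst// prednK ?ltnn// (st_r H).
rewrite FE !E; split; first exact: csol_itg (xsol tau0 td).
exact: csol_step (xsol tau0 td) _ _ _.
Qed.

End Apriori.

(** * The high-gain estimate and the last error variable *)

Section HighGainBounds.
Context {R : realType} {m p q : nat}
  {f : 'rV[R]_p * 'rV[R]_q * 'rV[R]_m -> 'rV[R]_m}.
Hypothesis f_cont : continuous f.
Local Notation mu := (@lebesgue_measure R).

Lemma dotp_rint_le n a b (v w : 'rV[R]_n) (G : R -> 'rV[R]_n) (M : R) : a <= b ->
  (forall j, itg a b (fun u => G u 0 j) /\ v 0 j = rint a b (fun u => G u 0 j)) ->
  {ae mu, forall u, `[a, b]%classic u -> dotp w (G u) <= M} ->
  dotp w v <= M * (b - a).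
Proof.
move=> ab Hv HM.
have key : forall s : seq 'I_n, itg a b (fun u => \sum_(j <- s) w 0 j * G u 0 j) /\
    \sum_(j <- s) w 0 j * v 0 j = rint a b (fun u => \sum_(j <- s) w 0 j * G u 0 j).
  elim=> [|j s [ih1 ih2]].
    under eq_fun do rewrite big_nil; rewrite big_nil; split; first exact: itg_cst.
    by rewrite rint_cst// mul0r.
  under eq_fun do rewrite big_cons; rewrite big_cons.
  have [h1 h2] := Hv j; split; first by apply: itgD => //; exact: itgZ.
  by rewrite rintD ?rintZ ?h2 ?ih2//; exact: itgZ.
have [h1 h2] := key (index_enum 'I_n).
rewrite /dotp h2 -rint_cst//; apply: rint_le_ae => //; exact: itg_cst.
Qed.

(** The choice [v = - w] in the minimum turns [- g *: v] into [g *: w], so a large value of [chi]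
    makes <w, f> very negative. The set has a lower bound by compactness, as [inf] requires. *)
Lemma chi_le (vs Bp Bq g : R) (w : 'rV[R]_m) a b : 0 < vs -> `|a| <= Bp -> `|b| <= Bq ->
  vs <= enorm w -> enorm w <= 1 ->
  chi f vs [set v | `|v| <= Bp] [set v | `|v| <= Bq] g <= - dotp w (f (a, b, g *: w)).
Proof.
move=> vs0 aB bB vw w1; apply: ge_inf; last first.
  exists a, b, (- w); rewrite enormN vw w1; split => //.
  by rewrite dotpNl scaleNr scalerN opprK.
pose A := Num.max Bp (Num.max Bq `|g|).
have [M M0 HM] := nonlinearity_bounded f_cont A.
exists (- (m%:R * M)) => _ [a' [b' [v [aB' bB' /andP[_ v1] ->]]]].
have : `|dotp v (f (a', b', - g *: v))| <= m%:R * M.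
  rewrite (le_trans (dotp_norm_le _ _))// -[leRHS]mul1r.
  apply: ler_pM => //; rewrite ?enorm_ge0//.
  rewrite (le_trans (enorm_le_norm _))// ler_wpM2l//; apply: HM; rewrite !le_max.
  - by rewrite aB'.
  - by rewrite bB' orbT.
  - rewrite normrZ normrN ler_piMr ?orbT// (le_trans (norm_le_enorm _))//.
by rewrite ler_norml => /andP[].
Qed.

(** Continuity in the control, uniform in bounded disturbances and outputs. Otherwise a sequence of
    counterexamples converges along an ultrafilter, and the two values of [f] have the same
    limit. *)
Lemma nonlinearity_tube (B e : R) (u0 : 'rV[R]_m) : 0 < e -> exists2 eta : R, 0 < eta &
  forall a b u, `|a| <= B -> `|b| <= B -> `|u - u0| < eta ->
    `|f (a, b, u) - f (a, b, u0)| < e.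
Proof.
move=> e0; apply: contrapT => noeta.
have wit k : exists abu : 'rV[R]_p * 'rV[R]_q * 'rV[R]_m,
    [/\ `|abu.1.1| <= B, `|abu.1.2| <= B, `|abu.2 - u0| < k.+1%:R^-1 &
     e <= `|f abu - f (abu.1.1, abu.1.2, u0)|].
  apply: contrapT => nw; apply: noeta; exists k.+1%:R^-1; first by rewrite invr_gt0.
  move=> a b u aB bB uu; rewrite ltNge; apply/negP => H.
  by apply: nw; exists (a, b, u).
have [s Hs] := choice wit.
have [U [UU sU]] := @ultraFilterLemma nat \oo _.
have PU : ProperFilter U by exact: ultra_proper.
have FU : Filter U by exact: filter_filter.
have [a ca] := @ultra_bounded_cvg R U p (fun k => (s k).1.1) B UU
  (fun k => let: And4 h _ _ _ := Hs k in h).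
have [b cb] := @ultra_bounded_cvg R U q (fun k => (s k).1.2) B UU
  (fun k => let: And4 _ h _ _ := Hs k in h).
have cu : (s k).2 @[k --> U] --> u0.
  apply/cvgrPdist_lt => eps eps0; apply: sU.
  have [n _ Hn] := near_infty_natSinv_lt (PosNum eps0).
  exists n => // k /= nk; rewrite distrC.
  by have [_ _ h _] := Hs k; exact: lt_trans h (Hn _ nk).
have h1 := cvg_nonlinearity f_cont FU ca cb cu.
have h2 := cvg_nonlinearity f_cont FU ca cb (@cvg_cst _ u0 _ U FU).
have e2 : 0 < e / 2 by rewrite divr_gt0.
have /cvgrPdist_lt/(_ _ e2) k1 := h1; have /cvgrPdist_lt/(_ _ e2) k2 := h2.
have [k [/= g1 g2]] := filter_ex (filterI k1 k2).
have [_ _ _] := Hs k; rewrite leNgt => /negP; apply.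
rewrite -!surjective_pairing in g1; set X := f (s k) in g1 *; set Y := f ((s k).1.1, (s k).1.2, u0) in g2 *.
rewrite (_ : X - Y = (f (a, b, u0) - Y) - (f (a, b, u0) - X)); last first.
  by apply/rowP => j; rewrite !mxE; ring.
rewrite (le_lt_trans (ler_normB _ _))// (splitr e); exact: ltrD.
Qed.

End HighGainBounds.

Section AprioriTop.
Context {R : realType} {m r p q : nat} {h : R} {d : R -> 'rV[R]_p}
  {f : 'rV[R]_p * 'rV[R]_q * 'rV[R]_m -> 'rV[R]_m}
  {T : (R -> 'rV[R]_(r * m)) -> (R -> 'rV[R]_q)}
  {y0 : nat -> R -> 'rV[R]_m} {yref : R -> 'rV[R]_m} {rhat : nat}
  {alpha gain phi : R -> R}.
Hypothesis H : setup h d f T y0 yref rhat alpha gain phi.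
Local Notation mu := (@lebesgue_measure R).
Local Notation csol := (csol h d f T y0 yref rhat alpha gain phi).
Local Notation inD := (inD (r := r) yref rhat alpha phi).
Local Notation ctrl := (ctrl (r := r) yref rhat alpha gain phi).
Local Notation vfield := (vfield (r := r) d f yref rhat alpha gain phi).
Local Notation yr k := (derive_in_n `[(0:R)%R, +oo[ k yref).
Variables (omega : \bar R) (x : R -> 'rV[R]_(r * m)).
Hypothesis xsol : forall tau : R, 0 <= tau -> (tau%:E < omega)%E -> csol tau x.
Local Notation dom t := ((t%:E < omega)%E).
Local Notation ek := (ek (yref := yref) (rhat := rhat) (alpha := alpha) (phi := phi) x).
Local Notation gk := (gk (yref := yref) (rhat := rhat) (alpha := alpha) (phi := phi) x).
Local Notation Eb := (Eb (yref := yref) (rhat := rhat) x).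
Variables (t1 : R).
Hypotheses (t10 : 0 < t1) (t1d : dom t1).

Lemma f_bounded_ae (B : R) : exists2 M : R, 0 <= M & forall a b c,
  `|a| <= B -> `|b| <= B -> `|c| <= B -> `|f (a, b, c)| <= M.
Proof. exact: nonlinearity_bounded (st_f H) B. Qed.

(** The last block differs from the output derivative at most by a derivative of the reference,
    which is Lipschitz. *)
Lemma ref_increment : exists2 C : R, 0 <= C & forall s t, 0 <= s -> s <= t ->
  enorm (Eb r.-1 t - Eb r.-1 s - (blk r.-1 (x t) - blk r.-1 (x s))) <= C * (t - s).
Proof.
have [C C0 HC] := st_ref_lip H; exists C => // s t s0 st.
rewrite /Eb /error_blocks; case: (r.-1 < rhat)%N.
  rewrite (_ : _ - _ = - (yr r.-1 t - yr r.-1 s)) ?enormN; first exact: HC.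
  by apply/rowP => i; rewrite !mxE; ring.
by rewrite subrr enorm0 mulr_ge0// subr_ge0.
Qed.

(* On the sphere |w| = ka the high-gain property gives <w, f> <= - C, and C is
   chosen to dominate all other contributions to the derivative of |w|^2. *)
Lemma w_bounded : exists k0 : R, [/\ 0 <= k0, k0 < 1 &
  forall t, t1 <= t -> dom t -> enorm (ek r t) <= k0].
Proof.
have r0 := st_r H; have rr : (r.-1 < r)%N by rewrite ltn_predL.
have rE : r.-1.+1 = r by rewrite prednK.
have rI : (0 < r <= r)%N by rewrite r0 leqnn.
have [G [L [G0 L0 gG gL]]] := gk_bounded H xsol t10 t1d rr.
have [C1 C10 H1] := phi_term H xsol t10 rr G0 gG.
have [By By0 HBy] := ref_increment.
have [phi0 phi00 Hphi0] := st_phi_low H t10.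
have [Bd Bd0 HBd] := d_bounded H.
have [CT CT0 HCT] := T_bounded_sol H xsol t10 t1d.
have [vs /andP[vs0 vs1] Hg] := st_gain H.
pose k0 := Num.max vs (enorm (ek r t1)).
have k00 : 0 < k0 by rewrite lt_max vs0.
have t10' := ltW t10.
have k01 : k0 < 1 by rewrite gt_max vs1 (ek_lt1 xsol).
have [A HA] := alpha_level H (ltW k00) k01.
pose Kp : set 'rV[R]_p := [set v | `|v| <= Bd].
pose Kq : set 'rV[R]_q := [set v | `|v| <= CT].
(* After division by [phi s >= phi0]: [By] pays for the reference, [(C1 + L) / phi0] for the
   variation of [phi] and of gamma. Of the 3/2, one half pays for the deviation of the control from
   its value at [s], and 1 leaves a strict decrease. *)
pose C := By + (C1 + L) / phi0 + 3 / 2.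
have Kp0 : Kp !=set0 by exists 0; rewrite /Kp/= normr0.
have Kq0 : Kq !=set0 by exists 0; rewrite /Kq/= normr0.
(* The level is chosen through the gain: [chi] exceeds [C] at [gain a], and [a] is so large that it
   equals [alpha (ka ^+ 2)] for some [ka] between [k0] and 1. *)
have [a [Aa Ca]] := Hg Kp Kq (@compact_norm_ball _ _ _) Kp0 (@compact_norm_ball _ _ _)
  Kq0 (Num.max A 1) C.
move: Aa; rewrite gt_max => /andP[Aa a1].
have [ka [k0k k1 ak]] := HA a Aa (ltW a1).
have ka0 : 0 < ka by exact: lt_trans k0k.
have vk : vs <= ka by rewrite (le_trans _ (ltW k0k))// le_max lexx.
exists ka; split => //; first exact: ltW.
move=> b t1b bd; have b0 : 0 <= b by exact: le_trans t1b.
have ce := ek_continuous H xsol rI t10' bd.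
have [cx _ Dx _] := xsol b0 bd.
have cc := ctrl_continuous H b0 cx Dx.
suff : forall t, t1 <= t -> t <= b -> enorm (ek r t) <= ka by move=> /(_ b t1b (lexx _)).
apply: (@barrier _ t1 b (fun u => enorm (ek r u))).
- apply/subspace_continuousP => u uI; apply: cvg_enorm.
  by move/subspace_continuousP : ce; exact.
- by rewrite (le_trans _ (ltW k0k))// le_max lexx orbT.
move=> s t1s sb es; have sd : dom s := dom_le (ltW sb) bd.
have s0 : 0 <= s by exact: le_trans t1s.
have ps := Hphi0 s t1s; have ps0 : 0 < phi s by exact: lt_le_trans ps.
set w := ek r s in es.
have us : ctrl s (x s) = gain a *: w by rewrite -ak -es.
have [rho1 rho10 K1] := H1 s t1s sd.
pose B := Num.max Bd (Num.max CT (`|gain a *: w| + 1)).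
(* Becomes an error of at most one half in the Euclidean norm. *)
have e0 : 0 < (2 * m.+1%:R)^-1 :> R by rewrite invr_gt0 mulr_gt0.
have [eta eta0 Heta] := nonlinearity_tube (st_f H) B (gain a *: w) e0.
have [Mf Mf0 HMf] := f_bounded_ae B.
have eta1 : 0 < Num.min eta 1 by rewrite lt_min eta0 ltr01.
have sI : `[0%R, b]%classic s by rewrite /= in_itv/= s0 ltW.
have [rho2 rho20 K2] := (within_continuous_dist _ _).1 cc s sI _ eta1.
pose Ms := C1 + phi s * (m%:R * Mf + By) + L.
have Ms0 : 0 <= Ms.
  by rewrite /Ms !addr_ge0// mulr_ge0 ?(ltW ps0)// addr_ge0// mulr_ge0.
(* [Ms * (t - s)] bounds the increment [D] of [w]. For times this short the square of its norm is at
   most [phi0 * (t - s)], while twice the inner product of [w] and [D] is at most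
   [- 2 * phi0 * (t - s)]. *)
have D0 : 0 < phi0 / (Ms ^+ 2 + 1) by rewrite divr_gt0// ltr_wpDl ?sqr_ge0.
exists (Num.min (Num.min rho1 rho2) (phi0 / (Ms ^+ 2 + 1))).
  by rewrite !lt_min rho10 rho20 D0.
move=> t st; rewrite -ltrBlDl !lt_min => /andP[/andP[]].
rewrite (ltrBlDl t) => tr1 tr2 tD tb.
have td : dom t := dom_le tb bd.
have ts : 0 < t - s by rewrite subr_gt0.
have h1 := K1 t st tr1 td.
have h3 := gL s t t1s (ltW st) td.
have h2 := HBy s t s0 (ltW st).
have near_u u : s <= u -> u <= t -> `|ctrl u (x u) - gain a *: w| < Num.min eta 1.
  move=> su ut; rewrite -us; apply: K2.
    by rewrite /= in_itv/= (le_trans s0 su) (le_trans ut tb).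
  by rewrite ger0_norm ?subr_ge0// (le_lt_trans _ tr2)// lerD2r.
have HCTb := HCT b b0 bd.
set Z := fun u => f (d u, T (stopped x b) u, ctrl u (x u)).
have itv0 u : `[s, t]%classic u -> [/\ 0 <= u, s <= u & u <= t].
  by rewrite /= in_itv/= => /andP[su ut]; rewrite (le_trans s0 su).
have ZM : {ae mu, forall u, `[s, t]%classic u -> `|Z u| <= Mf}.
  have := ae_and HBd HCTb; apply: ae_mono => u [g1 g2] /itv0[u0 su ut].
  apply: HMf; rewrite !le_max ?g1 ?g2 ?orbT//.
  have := near_u u su ut; rewrite lt_min => /andP[_ /ltW g3].
  apply/orP; right; apply/orP; right.
  rewrite -[ctrl u (x u)](subrK (gain a *: w)) (le_trans (ler_normD _ _))//.
  by rewrite addrC lerD2l.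
have ZC : {ae mu, forall u, `[s, t]%classic u -> dotp w (Z u) <= - C + 2^-1}.
  have := ae_and HBd HCTb; apply: ae_mono => u [g1 g2] /itv0[u0 su ut].
  have w1 : enorm w <= 1 by rewrite es ltW.
  have vw : vs <= enorm w by rewrite es.
  have g4 := chi_le (st_f H) (gain a) vs0 (g1 u0) (g2 u0) vw w1.
  have := near_u u su ut; rewrite lt_min => /andP[g3 _].
  have g5 : `|Z u - f (d u, T (stopped x b) u, gain a *: w)| < (2 * m.+1%:R)^-1.
    by apply: Heta; rewrite ?le_max ?g1 ?g2 ?orbT.
  have g6 : dotp w (Z u - f (d u, T (stopped x b) u, gain a *: w)) <= 2^-1.
    apply: (le_trans (dotp_le _ _)); rewrite -[leRHS]mul1r.
    apply: ler_pM => //; rewrite ?enorm_ge0// (le_trans (enorm_le_norm _))//.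
    apply: (@le_trans _ _ (m.+1%:R * (2 * m.+1%:R)^-1)).
      by apply: ler_pM => //; [rewrite ler_nat|exact: ltW].
    by rewrite invfM mulrCA divff ?mulr1// pnatr_eq0.
  move: g6; rewrite dotpDr dotpNr lerBlDr => g6; apply: (le_trans g6).
  rewrite addrC lerD2r -lerNr (le_trans (ltW Ca))//.
pose Db := blk r.-1 (x t) - blk r.-1 (x s).
have Zb j : itg s t (fun u => Z u 0 j) /\ Db 0 j = rint s t (fun u => Z u 0 j).
  have [i1 i2] := top_increment H xsol j b0 bd s0 (ltW st) tb; split.
    exact: itg_sub i1.
  by rewrite -i2 /Db !mxE.
have Dw : dotp w Db <= (- C + 2^-1) * (t - s).
  exact: dotp_rint_le (ltW st) Zb ZC.
have Dn : enorm Db <= m%:R * Mf * (t - s).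
  rewrite (le_trans (enorm_le_norm _))// -mulrA ler_wpM2l//.
  apply: norm_le_coord; first by rewrite mulr_ge0// ltW.
  move=> j; have [i1 ->] := Zb j; apply: rint_abs_le => //; first exact: ltW.
  by apply: ae_mono ZM => u Zu /Zu; exact: le_trans (coord_le_norm _ _).
set Dr := Eb r.-1 t - Eb r.-1 s - (blk r.-1 (x t) - blk r.-1 (x s)) in h2.
set P := (phi t - phi s) *: Eb r.-1 t in h1.
set Q := gk r.-1 t - gk r.-1 s in h3.
have wE : ek r t = w + (P + phi s *: (Db + Dr) + Q).
  have := @ek_increment R m r yref rhat alpha phi x r.-1 s t.
  rewrite rE -/w -/P -/Q => /eqP; rewrite subr_eq addrC => /eqP ->.
  congr (_ + (_ + _ *: _ + _)); rewrite /Dr /Db; apply/rowP => i; rewrite !mxE; ring.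
have w1 : enorm w <= 1 by rewrite es ltW.
have dw v : dotp w v <= enorm v.
  by rewrite (le_trans (dotp_le _ _))// ler_piMl// enorm_ge0.
set D := P + _ + Q in wE.
have Ddot : dotp w D <= - phi0 * (t - s).
  rewrite /D dotpDr [dotp w (P + _)]dotpDr dotpZr [dotp w (Db + _)]dotpDr.
  have g1 := le_trans (dw P) h1; have g2 := le_trans (dw Q) h3.
  have g3 := le_trans (dw Dr) h2.
  have g4 : phi s * (dotp w Db + dotp w Dr) <= phi s * ((- C + 2^-1) * (t - s) + By * (t - s)).
    by rewrite ler_pM2l// lerD.
  have g5 : phi s * ((- C + 2^-1) * (t - s) + By * (t - s)) =
      - (phi s * ((C1 + L) / phi0) + phi s) * (t - s).
    by rewrite /C; field; rewrite gt_eqF.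
  have g6 : C1 + L <= phi s * ((C1 + L) / phi0).
    by rewrite mulrCA ler_peMr ?addr_ge0// ler_pdivlMr// mul1r.
  have g7 : C1 * (t - s) + L * (t - s) + - (phi s * ((C1 + L) / phi0) + phi s) * (t - s)
     <= - phi0 * (t - s).
    by rewrite -!mulrDl ler_pM2r//; lra.
  lra.
have Dnorm : enorm D <= Ms * (t - s).
  rewrite /D /Ms !mulrDl (le_trans (enormD _ _))// lerD//.
  rewrite (le_trans (enormD _ _))// lerD//.
  rewrite enormZ gtr0_norm// -mulrA ler_pM2l// mulrDl (le_trans (enormD _ _))//.
  exact: lerD.
rewrite -ler_sqr ?nnegrE ?enorm_ge0 ?(ltW ka0)// enorm_sqr wE.
rewrite (dotpDl w D) (dotpDr w D w) (dotpDr w D D) (dotpC D w) -!enorm_sqr es.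
have g1 : enorm D ^+ 2 <= Ms ^+ 2 * (t - s) * (t - s).
  rewrite -mulrA -expr2 -exprMn ler_sqr ?nnegrE ?enorm_ge0//.
  by rewrite mulr_ge0// ltW.
have g2 : Ms ^+ 2 * (t - s) <= phi0.
  move: tD; rewrite ltr_pdivlMr ?ltr_wpDl ?sqr_ge0// => tD.
  apply: le_trans (ltW tD); rewrite mulrC ler_pM2l// lerDl//.
have g3 : Ms ^+ 2 * (t - s) * (t - s) <= phi0 * (t - s) by rewrite ler_pM2r.
have g4 : 0 <= phi0 * (t - s) by rewrite mulr_ge0// ltW.
lra.
Qed.

End AprioriTop.

Section AprioriUniform.
Context {R : realType} {m r p q : nat} {h : R} {d : R -> 'rV[R]_p}
  {f : 'rV[R]_p * 'rV[R]_q * 'rV[R]_m -> 'rV[R]_m}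
  {T : (R -> 'rV[R]_(r * m)) -> (R -> 'rV[R]_q)}
  {y0 : nat -> R -> 'rV[R]_m} {yref : R -> 'rV[R]_m} {rhat : nat}
  {alpha gain phi : R -> R}.
Hypothesis H : setup h d f T y0 yref rhat alpha gain phi.
Local Notation mu := (@lebesgue_measure R).
Local Notation csol := (csol h d f T y0 yref rhat alpha gain phi).
Local Notation inD := (inD (r := r) yref rhat alpha phi).
Local Notation ctrl := (ctrl (r := r) yref rhat alpha gain phi).
Local Notation vfield := (vfield (r := r) d f yref rhat alpha gain phi).

Lemma alpha_bounded (k0 : R) : k0 < 1 -> exists2 A : R, 0 <= A &
  forall v : 'rV[R]_m, enorm v <= k0 -> `|alpha (enorm v ^+ 2)| <= A.
Proof.
move=> k1; have ca : {within `[0, (Num.max 0 k0) ^+ 2], continuous alpha}.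
  apply: continuous_subspaceW (st_alpha_cont H) => s /=; rewrite !in_itv/=.
  move=> /andP[-> /le_lt_trans]; apply; rewrite expr_lt1 ?gt_max ?ltr01//.
  by rewrite le_max lexx.
have [A A0 HA] := within_bounded ca; exists A => // v vk; apply: HA.
  exact: sqr_ge0.
rewrite ler_sqr ?nnegrE ?enorm_ge0 ?le_max ?vk ?orbT//.
by rewrite lexx.
Qed.

Lemma gain_bounded (k0 : R) : k0 < 1 -> exists2 A : R, 0 <= A &
  forall v : 'rV[R]_m, enorm v <= k0 -> `|gain (alpha (enorm v ^+ 2))| <= A.
Proof.
move=> k1; pose b : R := (Num.max 0 k0) ^+ 2.
have b1 : b < 1 by rewrite expr_lt1 ?gt_max ?ltr01// le_max lexx.
have ca : {within `[0, b], continuous alpha}.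
  apply: continuous_subspaceW (st_alpha_cont H) => s /=; rewrite !in_itv/=.
  by move=> /andP[-> /le_lt_trans]; apply.
have a1 s : `[0, b]%classic s -> `[(0:R)%R, +oo[%classic (alpha s).
  rewrite /= in_itv/= => /andP[s0 sb]; apply: itv0y; rewrite (le_trans ler01)//.
  by apply: (st_alpha_ge1 H s0); exact: le_lt_trans b1.
have cg : {within `[0, b], continuous (gain \o alpha)}.
  apply/subspace_continuousP => t tt.
  have FF : Filter (within `[0, b] (nbhs t)) by exact: within_filter.
  apply: (cvg_within_comp FF (st_gain_cont H) (a1 t tt)).
    by move/subspace_continuousP : ca; exact.
  by apply: filterS (@withinT _ _ _ (nbhs_filter t)) => s; exact: a1.
have [A A0 HA] := within_bounded cg; exists A => // v vk; apply: HA.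
  exact: sqr_ge0.
rewrite ler_sqr ?nnegrE ?enorm_ge0 ?le_max ?vk ?orbT//.
by rewrite lexx.
Qed.

Variables (omega : \bar R) (x : R -> 'rV[R]_(r * m)).
Hypothesis omega0 : (0 < omega)%E.
Hypothesis xsol : forall tau : R, 0 <= tau -> (tau%:E < omega)%E -> csol tau x.
Local Notation dom t := ((t%:E < omega)%E).
Local Notation ek := (ek (yref := yref) (rhat := rhat) (alpha := alpha) (phi := phi) x).
Local Notation gk := (gk (yref := yref) (rhat := rhat) (alpha := alpha) (phi := phi) x).
Local Notation Eb := (Eb (yref := yref) (rhat := rhat) x).

Lemma dom_pos : exists2 t1 : R, 0 < t1 & dom t1.
Proof.
case: omega omega0 => [w||//]; last by exists 1 => //; rewrite ltry.
by rewrite lte_fin => w0; exists (w / 2); rewrite ?divr_gt0// lte_fin; lra.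
Qed.

(** From [t1] on the barrier levels give the margin; on [[0, t1]] a continuous function below 1
    attains its maximum. *)
Lemma ek_margin k : (0 < k <= r)%N -> exists2 k0 : R, k0 < 1 &
  forall t, 0 <= t -> dom t -> enorm (ek k t) <= k0.
Proof.
move=> kr; have [t1 t10 t1d] := dom_pos; have t10' := ltW t10.
have [k0 [k00 k01 Hk0]] : exists k0 : R, [/\ 0 <= k0, k0 < 1 &
    forall t, t1 <= t -> dom t -> enorm (ek k t) <= k0].
  case/andP : kr; case: k => // k _; rewrite leq_eqVlt => /predU1P[->|kr].
    exact: (w_bounded H xsol t10 t1d).
  exact: (ek_bounded H xsol t10 t1d kr).
have ce := ek_continuous H xsol kr (lexx 0) t1d.
have cn : {within `[(0:R)%R, t1], continuous (fun u => enorm (ek k u))}.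
  apply/subspace_continuousP => u uI; apply: cvg_enorm.
  by move/subspace_continuousP : ce; exact.
have [c] := EVT_max t10' cn; rewrite in_itv/= => /andP[c0 c1] Hc.
exists (Num.max k0 (enorm (ek k c))).
  by rewrite gt_max k01 (ek_lt1 xsol kr c0)// (dom_le c1).
move=> t t0 td; rewrite le_max; have [t1t|/ltW tt1] := leP t1 t.
  by rewrite Hk0.
by rewrite Hc ?orbT// in_itv/= t0.
Qed.

Lemma ek_margins : exists k0 : R, [/\ 0 <= k0, k0 < 1 & forall k, (0 < k <= r)%N ->
  forall t, 0 <= t -> dom t -> enorm (ek k t) <= k0].
Proof.
suff : forall n, (n <= r)%N -> exists k0 : R, [/\ 0 <= k0, k0 < 1 &
    forall k, (0 < k <= n)%N -> forall t, 0 <= t -> dom t -> enorm (ek k t) <= k0].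
  by move=> /(_ r (leqnn r)).
elim=> [_|n ih nr]; first by exists 0; split => // -[|k]//; rewrite andbF.
have [k0 [k00 k01 Hk0]] := ih (ltnW nr).
have [k1 k11 Hk1] := @ek_margin n.+1 nr.
exists (Num.max k0 k1); split; first by rewrite le_max k00.
  by rewrite gt_max k01.
move=> k /andP[kp]; rewrite leq_eqVlt => /predU1P[->|kn] t t0 td.
  by rewrite le_max Hk1 ?orbT.
by rewrite le_max Hk0// kp.
Qed.

Lemma ctrl_bounded : exists2 U : R, 0 <= U &
  forall t, 0 <= t -> dom t -> enorm (ctrl t (x t)) <= U.
Proof.
have [k0 [k00 k01 Hk0]] := ek_margins; have [A A0 HA] := gain_bounded k01.
exists A => // t t0 td; rewrite enormZ -[leRHS]mulr1.
have wk : enorm (wvec (r := r) yref rhat alpha phi t (x t)) <= k0.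
  by apply: (Hk0 r) => //; rewrite (st_r H) leqnn.
by apply: ler_pM => //; [exact: enorm_ge0|exact: HA|rewrite (le_trans wk)// ltW].
Qed.

Lemma phi_Eb_bounded : exists2 B : R, 0 <= B & forall k, (k < r)%N ->
  forall t, 0 <= t -> dom t -> phi t * enorm (Eb k t) <= B.
Proof.
have [k0 [k00 k01 Hk0]] := ek_margins; have [A A0 HA] := alpha_bounded k01.
exists (1 + A) => [|k kr t t0 td]; first by rewrite addr_ge0.
have -> : phi t * enorm (Eb k t) = enorm (ek k.+1 t - gk k t).
  by rewrite ekS addrK enormZ ger0_norm// (st_phi_ge0 H).
apply: (le_trans (enormB _ _)); apply: lerD; first by apply/ltW/(ek_lt1 xsol).
case: k kr => [|k] kr; first by rewrite enorm0.
have kr' : (0 < k.+1 <= r)%N by exact: ltnW kr.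
have ek1 := Hk0 _ kr' t t0 td.
rewrite /gk/= enormZ -[leRHS]mulr1; apply: ler_pM => //; first exact: enorm_ge0.
  exact: HA.
by rewrite (le_trans ek1)// ltW.
Qed.

Lemma sol_bounded : exists2 B : R, 0 <= B & forall t, - h <= t -> dom t -> `|x t| <= B.
Proof. by have [t1 t10 t1d] := dom_pos; exact: (x_bounded H xsol t10 t1d). Qed.

Lemma T_sol_bounded : exists2 C : R, 0 <= C & forall tau, 0 <= tau -> dom tau ->
  {ae mu, forall t : R, 0 <= t -> `|T (stopped x tau) t| <= C}.
Proof. by have [t1 t10 t1d] := dom_pos; exact: (T_bounded_sol H xsol t10 t1d). Qed.

(** The bounds on state, operator output and control make the right-hand side essentially bounded.
    This provides the limit of a solution at a finite end point and the absolute continuity of the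
    top derivative. *)
Lemma x_lipschitz : exists2 L : R, 0 <= L & forall s t, 0 <= s -> s <= t -> dom t ->
  `|x t - x s| <= L * (t - s).
Proof.
have [Bx Bx0 HBx] := sol_bounded; have [CT CT0 HCT] := T_sol_bounded.
have [U U0 HU] := ctrl_bounded; have [Bd Bd0 HBd] := d_bounded H.
have [M M0 HM] := nonlinearity_bounded (st_f H) (Num.max Bd (Num.max CT U)).
exists (Num.max Bx M) => [|s t s0 st td]; first by rewrite le_max Bx0.
have t0 := le_trans s0 st; have cs := xsol t0 td.
have ts : 0 <= t - s by rewrite subr_ge0.
apply: norm_le_coord => [|j]; first by rewrite mulr_ge0// le_max Bx0.
rewrite !mxE (csol_step H j t0 cs s0 st (lexx t)).
apply: rint_abs_le => //; first exact: itg_sub s0 (lexx t) (csol_itg H j t0 cs).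
have := ae_and HBd (HCT t t0 td); apply: ae_mono => u [g1 g2] /=; rewrite in_itv/= => /andP[su ut].
have u0 := le_trans s0 su; have ud := dom_le ut td.
have [k [i E]] := @coord_blk R r m j.
rewrite E blk_mkst//; case: (_ < _)%N.
  rewrite le_max (le_trans (coord_le_norm _ _))// (le_trans (blk_norm _ _))//.
  by rewrite HBx// (le_trans _ u0)// oppr_le0 (st_h H).
rewrite le_max; apply/orP; right; rewrite (le_trans (coord_le_norm _ _))//.
apply: HM; rewrite !le_max ?g1 ?g2 ?orbT//.
by rewrite (le_trans (norm_le_enorm _) (HU u u0 ud)) !orbT.
Qed.

End AprioriUniform.

(** * Maximal extension *)

Section GlobalExtension.
Context {R : realType} {m r p q : nat} {h : R} {d : R -> 'rV[R]_p}
  {f : 'rV[R]_p * 'rV[R]_q * 'rV[R]_m -> 'rV[R]_m}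
  {T : (R -> 'rV[R]_(r * m)) -> (R -> 'rV[R]_q)}
  {y0 : nat -> R -> 'rV[R]_m} {yref : R -> 'rV[R]_m} {rhat : nat}
  {alpha gain phi : R -> R}.
Hypothesis H : setup h d f T y0 yref rhat alpha gain phi.
Local Notation mu := (@lebesgue_measure R).
Local Notation csol := (csol h d f T y0 yref rhat alpha gain phi).
Local Notation inD := (inD (r := r) yref rhat alpha phi).
Local Notation ctrl := (ctrl (r := r) yref rhat alpha gain phi).
Local Notation vfield := (vfield (r := r) d f yref rhat alpha gain phi).

Definition isol (omega : \bar R) (x : R -> 'rV[R]_(r * m)) : Prop :=
  (0 < omega)%E /\ forall tau : R, 0 <= tau -> (tau%:E < omega)%E -> csol tau x.

(** For [t < w] freezing at [t] or at [w] makes no difference almost everywhere, by causality; at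
    [w] itself both sides of the equation are continuous. *)
Lemma csol_left_closed (w : R) x : 0 < w -> {within `[(- h)%R, w], continuous x} ->
  inD w (x w) -> (forall tau, 0 <= tau -> tau < w -> csol tau x) -> csol w x.
Proof.
move=> w0 cx Dw sx; have w0' := ltW w0; have h0 := st_h H.
have Dx t : 0 <= t -> t <= w -> inD t (x t).
  move=> t0; rewrite le_eqVlt => /predU1P[->//|tw].
  by have [_ _ + _] := sx t t0 tw; apply.
split => //; first by have [_ + _ _] := sx 0 (lexx _) w0.
have [mT [B HB]] := T_stopped_props H w0' cx.
pose F j := fun s => vfield s (x s) (T (stopped x w) s) 0 j.
have iF j : itg 0 w (F j) by exact: (vfield_itg H j w0' cx Dx mT HB).
have E t j : 0 <= t -> t < w -> x t 0 j - x 0 0 j = rint 0 t (F j).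
  move=> t0 tw; have cs := sx t t0 tw; have [cxt _ _ ->//] := cs.
  apply: (itg_ae_eq (itg_measurable (csol_itg H j t0 cs))
    (itg_sub (lexx _) (ltW tw) (iF j)) _).2.
  have aT := T_causal H (stopped_admissible H t0 cxt) (stopped_admissible H w0' cx) t0.
  have /aT : forall s, - h <= s -> s <= t -> stopped x t s = stopped x w s.
    by move=> s hs st; rewrite /stopped !min_l// (le_trans st)// ltW.
  by apply: ae_mono => s h1; rewrite /= in_itv/= => /andP[s0 st]; rewrite /F h1.
move=> t t0 tw j; move: tw; rewrite le_eqVlt => /predU1P[->|/(E _ j t0)//].
pose g t := x t 0 j - x 0 0 j - rint 0 t (F j).
suff : g w = 0 by move=> /eqP; rewrite subr_eq0 => /eqP.
have cg : {within `[0, w], continuous g}.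
  apply/subspace_continuousP => s sI; apply: cvgB; last first.
    by have /subspace_continuousP := parameterized_integral_continuous w0' (iF j); exact.
  have FF : Filter (within `[0, w] (nbhs s)) by exact: within_filter.
  apply: cvgB; last exact: cvg_cst.
  apply: cvg_to_coord; move: s sI {FF}; apply/subspace_continuousP.
  apply: continuous_subspaceW cx => s /=; rewrite !in_itv/= => /andP[s0 ->].
  by rewrite andbT (le_trans _ s0)// oppr_le0.
apply/eqP; case: (eqVneq (g w) 0) => // gw.
have gw0 : 0 < `|g w| by rewrite normr_gt0.
have wI : `[0, w]%classic w by rewrite /= in_itv/= w0'/=.
have [dl dl0 Hdl] := (within_continuous_dist _ _).1 cg w wI _ gw0.
pose s := Num.max 0 (w - dl / 2).
have s0 : 0 <= s by rewrite le_max lexx.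
have sw : s < w by rewrite gt_max w0 ltrBlDr ltrDl divr_gt0.
have sd : `|s - w| < dl.
  rewrite distrC gtr0_norm ?subr_gt0// ltrBlDl -ltrBlDr lt_max; apply/orP; right; lra.
have sI : `[0, w]%classic s by rewrite /= in_itv/= s0 ltW.
have := Hdl s sI sd; rewrite {1}/g E// subrr sub0r normrN ltxx.
by [].
Qed.

(** Boundedness and the Lipschitz bound give a limit [pt] at [w]; the uniform margin [k0 < 1] places
    it in the domain. *)
Lemma isol_finite (w : R) x : isol w%:E x -> exists x', csol w x' /\
  forall t, t < w -> x' t = x t.
Proof.
move=> [w0 sx]; have := w0; rewrite lte_fin => w0'.
have sx' tau : 0 <= tau -> tau < w -> csol tau x.
  by move=> t0 tw; apply: sx => //; rewrite lte_fin.
have [L L0 HL] := x_lipschitz H w0 sx.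
have [B B0 HB] := sol_bounded H w0 sx.
have h0 := st_h H; have hN : - h <= 0 by rewrite oppr_le0.
have [U [UU sU]] := @ultraFilterLemma nat \oo _.
have PU : ProperFilter U by exact: ultra_proper.
pose s_ (n : nat) : R := w - w / n.+2%:R.
have s0 n : 0 <= s_ n.
  by rewrite subr_ge0 ler_pdivrMr// ler_peMr ?ler1n// ltW.
have sw n : s_ n < w by rewrite ltrBlDr ltrDl divr_gt0.
have [pt cp] := @ultra_bounded_cvg R U _ (fun n => x (s_ n)) B UU
  (fun n => HB (s_ n) (le_trans hN (s0 n)) (eq_ind_r is_true (sw n) (lte_fin _ _))).
have Lp t : 0 <= t -> t < w -> `|pt - x t| <= L * (w - t).
  move=> t0 tw.
  have c1 : `|x (s_ n) - x t| @[n --> U] --> `|pt - x t|.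
    by apply: cvg_norm; apply: cvgB => //; exact: cvg_cst.
  apply: (closed_cvg (fun z => z <= L * (w - t)) _ _ _ c1); first exact: closed_le.
  apply: sU; have : 0 < (w - t) / w by rewrite divr_gt0// subr_gt0.
  move=> e0; have [n _ Hn] := near_infty_natSinv_lt (PosNum e0).
  exists n => // k /= nk; have := Hn k nk; rewrite /= => h1.
  have ts : t <= s_ k.
    rewrite lerBrDr -lerBrDl.
    apply: (@le_trans _ _ (w * k.+1%:R^-1)).
      by rewrite ler_pM2l// lef_pV2 ?posrE// ler_nat.
    move: h1; rewrite ltr_pdivlMr// mulrC => /ltW; apply: le_trans.
    by [].
  rewrite (le_trans (HL t (s_ k) t0 ts _))//; first by rewrite lte_fin.
  by rewrite ler_wpM2l// lerB// ltW.
pose x' t := if t < w then x t else pt.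
have xE t : t < w -> x' t = x t by rewrite /x' => ->.
exists x'; split => //.
have x'w : x' w = pt by rewrite /x' ltxx.
have sx2 tau : 0 <= tau -> tau < w -> csol tau x'.
  move=> t0 tw; apply: (csol_transfer H t0 (lexx _) (sx' tau t0 tw)) => t _ tt.
  by rewrite xE// (le_lt_trans tt).
have Lx' t : 0 <= t -> t <= w -> `|x' t - pt| <= L * (w - t).
  move=> t0; rewrite le_eqVlt => /predU1P[->|tw].
    by rewrite x'w !subrr normr0 mulr0.
  by rewrite xE// distrC; exact: Lp.
have L1 : 0 < L + 1 by rewrite ltr_wpDl.
have cx' : {within `[(- h)%R, w], continuous x'}.
  apply/within_continuous_dist => t; rewrite /= in_itv/= => /andP[ht].
  rewrite le_eqVlt => /predU1P[->|tw] e e0.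
    exists (Num.min w (e / (L + 1))); first by rewrite lt_min w0' divr_gt0.
    move=> y; rewrite /= in_itv/= => /andP[hy yw].
    rewrite distrC ger0_norm ?subr_ge0// lt_min => /andP[y1 y2].
    rewrite x'w; have y0' : 0 <= y by lra.
    rewrite (le_lt_trans (Lx' y y0' yw))//.
    move: y2; rewrite ltr_pdivlMr// => y2.
    have : 0 <= w - y by rewrite subr_ge0.
    by lra.
  pose tau := Num.max 0 ((t + w) / 2).
  have tau0 : 0 <= tau by rewrite le_max lexx.
  have tauw : tau < w by rewrite gt_max w0' ltr_pdivrMr//; lra.
  have ttau : t < tau by rewrite lt_max; apply/orP; right; rewrite ltr_pdivlMr//; lra.
  have [cx _ _ _] := sx2 tau tau0 tauw.
  have tI : `[(- h)%R, tau]%classic t by rewrite /= in_itv/= ht ltW.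
  have [dl dl0 Hdl] := (within_continuous_dist _ _).1 cx t tI e e0.
  exists (Num.min dl (tau - t)); first by rewrite lt_min dl0 subr_gt0.
  move=> y; rewrite /= in_itv/= => /andP[hy yw]; rewrite lt_min => /andP[y1 y2].
  apply: Hdl => //; rewrite /= in_itv/= hy.
  by move: y2; rewrite ltr_norml => /andP[_ y2]; lra.
apply: csol_left_closed => //; rewrite x'w.
have [k0 [k00 k01 Hk0]] := ek_margins H w0 sx.
have FF : Filter (s_ n @[n --> U]) by exact: filter_filter.
have cs : s_ n @[n --> U] --> w.
  apply/cvgrPdist_lt => e e0; apply: sU.
  have e1 : 0 < e / w by rewrite divr_gt0.
  have [n _ Hn] := near_infty_natSinv_lt (PosNum e1).
  exists n => // k /= nk; have := Hn k nk; rewrite /= ltr_pdivlMr// => h1.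
  rewrite /s_ opprB addrC subrK gtr0_norm ?divr_gt0//; apply: le_lt_trans h1.
  by rewrite mulrC ler_pM2r// lef_pV2 ?posrE// ler_nat.
have cv i : (i < r)%N ->
    vec_error (r := r) yref rhat phi (s_ n) (x (s_ n)) i @[n --> U] -->
    vec_error (r := r) yref rhat phi w pt i.
  move=> ir; apply: (cvg_vec_error H _ (ltW w0')) => //.
  by apply: sU; exists 0%N => // n _; exact: s0.
(* A priori [pt] may lie on the boundary. Given level [k], the map of level [k.+1] passes to the
   limit, where the margin keeps its value in the open ball. *)
suff : forall k, (k <= r)%N -> in_D alpha k (vec_error (r := r) yref rhat phi w pt) by exact.
elim=> // k ih kr; rewrite in_DS; split; first exact: ih (ltnW kr).
have cr : rho alpha k.+1 (vec_error (r := r) yref rhat phi (s_ n) (x (s_ n))) @[n --> U] -->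
    rho alpha k.+1 (vec_error (r := r) yref rhat phi w pt).
  apply: (cvg_rho (st_alpha_cont H)); first by move=> i ik; apply: cv; exact: leq_trans kr.
  exact: ih (ltnW kr).
have ce := cvg_enorm (@filter_filter _ U PU) cr.
apply: le_lt_trans k01.
apply: (closed_cvg (fun z => z <= k0) _ _ _ ce); first exact: closed_le.
by apply: sU; exists 0%N => // n _; apply: Hk0 => //; rewrite lte_fin.
Qed.

Lemma isol_extend (w : R) x : isol w%:E x -> exists (tau : R) x', [/\ w < tau,
  isol tau%:E x' & forall t, - h <= t -> t < w -> x' t = x t].
Proof.
move=> /[dup] -[w0 _] /isol_finite[x1 [s1 E1]].
move: w0; rewrite lte_fin => w0.
have [tau [x2 [wt s2 E2]]] := csol_extend H (ltW w0) s1.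
exists tau, x2; split => //; last by move=> t ht tw; rewrite E2 ?E1// ltW.
split; first by rewrite lte_fin (lt_trans w0).
move=> s s0; rewrite lte_fin => st.
by apply: (csol_transfer H s0 (ltW st) s2).
Qed.

Lemma isol_exists : exists omega x, isol omega x.
Proof.
have [tau [x [t0 sx _]]] := csol_extend H (lexx 0) (csol0 H).
exists tau%:E, x; split; first by rewrite lte_fin.
move=> s s0; rewrite lte_fin => st.
by apply: (csol_transfer H s0 (ltW st) sx).
Qed.

(** Extension is only a preorder, since total functions that agree on their time interval may differ
    elsewhere. The members of a chain are glued over the supremum of their end points; a maximal
    element with a finite end point would contradict [isol_extend]. *)
Lemma isol_global omega x : isol omega x -> exists x', isol +oo%E x' /\
  forall t, - h <= t -> (t%:E < omega)%E -> x' t = x t.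
Proof.
move=> sx.
pose le (s s' : \bar R * (R -> 'rV[R]_(r * m))) :=
  (s.1 <= s'.1)%E /\ forall t, - h <= t -> (t%:E < s.1)%E -> s'.2 t = s.2 t.
pose P (s : \bar R * (R -> 'rV[R]_(r * m))) := isol s.1 s.2 /\ le (omega, x) s.
have le_refl s : le s s by split.
have le_trans' s1 s2 s3 : le s1 s2 -> le s2 s3 -> le s1 s3.
  move=> [a1 b1] [a2 b2]; split; first exact: le_trans a2.
  by move=> t ht td; rewrite b2 ?b1// (lt_le_trans td).
pose base : {s | P s} := exist _ (omega, x) (conj sx (le_refl _)).
pose rle (s s' : {s | P s}) : bool := `[< le (sval s) (sval s') >].
have [||A totA|[z [sz bz]] Hz] := @ZL_preorder _ base rle.
- by move=> t; apply/asboolP; exact: le_refl.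
- by move=> s1 s2 s3 /asboolP a /asboolP b; apply/asboolP; exact: le_trans' b.
- have [[s0 As0]|noA] := pselect (exists s, A s); last first.
    by exists base => s As; exfalso; apply: noA; exists s.
  have chain s s' t : A s -> A s' -> - h <= t -> (t%:E < (sval s).1)%E ->
      (t%:E < (sval s').1)%E -> (sval s).2 t = (sval s').2 t.
    move=> As As' ht ts ts'; have [/asboolP[_ e]|/asboolP[_ e]] := totA s s' As As'.
      by rewrite e.
    by rewrite e.
  pose om := ereal_sup [set (sval s).1 | s in A].
  have [xx Hxx] : exists xx : R -> 'rV[R]_(r * m), forall s, A s -> forall t, - h <= t ->
      (t%:E < (sval s).1)%E -> xx t = (sval s).2 t.
    have : forall t, exists v : 'rV[R]_(r * m), forall s, A s -> - h <= t ->
        (t%:E < (sval s).1)%E -> v = (sval s).2 t.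
      move=> t.
      have [[s1 [As1 ts1]]|no] := pselect (exists s, A s /\ (t%:E < (sval s).1)%E).
        by exists ((sval s1).2 t) => s As ht ts; exact: chain.
      by exists 0 => s As ht ts; exfalso; apply: no; exists s.
    by move=> /choice[xx Hxx]; exists xx => s As t ht ts; exact: Hxx.
  have om_ub s : A s -> ((sval s).1 <= om)%E by move=> As; apply: ereal_sup_ubound; exists s.
  have Pb : P (om, xx).
    split => /=.
      split.
        by apply: lt_le_trans (om_ub _ As0); case: (svalP s0) => -[].
      move=> tau tau0 /ereal_sup_gt[_ [s As <-] taus].
      have [[_ ss] _] := svalP s.
      apply: (csol_transfer H tau0 (lexx _) (ss tau tau0 taus)) => t ht tt.
      by rewrite (Hxx s As)//; exact: dom_le taus.
    have [_ [a b]] := svalP s0.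
    split => /=; first exact: le_trans a (om_ub _ As0).
    by move=> t ht td; rewrite (Hxx s0 As0) ?b// (lt_le_trans td).
  exists (exist _ (om, xx) Pb) => s As; apply/asboolP; split => /=; first exact: om_ub.
  by move=> t ht ts; rewrite (Hxx s As).
have [zoo|] := eqVneq z.1 +oo%E.
  by exists z.2; split; [rewrite -zoo|move=> t ht td; exact: bz.2].
move=> zoo; exfalso; case: z sz bz zoo Hz => -[w||]//= zx sz bz _ Hz; last first.
  by have := sz.1; rewrite ltNge leNye.
have [tau [x' [wt st E]]] := isol_extend sz.
have le_zx : le (w%:E, zx) (tau%:E, x') by split => //=; rewrite lee_fin ltW.
have Px : P (tau%:E, x') by split => //; exact: le_trans' bz le_zx.
have := Hz (exist _ _ Px); rewrite /rle/= => /(_ (asboolT le_zx))/asboolP[/=].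
by rewrite lee_fin leNgt wt.
Qed.

End GlobalExtension.

(** * From the integral equation to the closed loop and back *)

Section Gluing.
Context {R : realType} {V : normedModType R}.
Local Notation mu := (@lebesgue_measure R).

(** Meant for the point 0, where the initial function and the solution meet; with [D1 = D2] it
    merely localizes. *)
Lemma has_derivative_in_union (D1 D2 D : set R) (g g' : R -> V) x l (dl : R) : 0 < dl ->
  g x = g' x ->
  (forall s, `|s - x| < dl -> D s -> (D1 s \/ D2 s) /\ g s = g' s) ->
  has_derivative_in D1 g x l -> has_derivative_in D2 g x l ->
  has_derivative_in D g' x l.
Proof.
move=> dl0 gx Hs /has_derivative_in_dist H1 /has_derivative_in_dist H2.
apply/has_derivative_in_dist => e e0.
have [d1 d10 K1] := H1 e e0; have [d2 d20 K2] := H2 e e0.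
exists (Num.min dl (Num.min d1 d2)); first by rewrite !lt_min dl0 d10.
move=> s Ds; rewrite !lt_min => /andP[sd /andP[s1 s2]].
have [[Ds1|Ds2] gs] := Hs s sd Ds; rewrite -gs -gx; [exact: K1|exact: K2].
Qed.

Lemma within_continuous_local (D : set R) (g : R -> V) :
  (forall x, D x -> exists (D0 : set R) (g0 : R -> V) (dl : R),
    [/\ 0 < dl, D0 x, {within D0, continuous g0} &
        forall y, D y -> `|y - x| < dl -> D0 y /\ g0 y = g y]) ->
  {within D, continuous g}.
Proof.
move=> HD; apply/within_continuous_dist => x Dx e e0.
have [D0 [g0 [dl [dl0 D0x cg0 E]]]] := HD x Dx.
have [d1 d10 K1] := (within_continuous_dist _ _).1 cg0 x D0x e e0.
have Ex : g0 x = g x by apply: (E x Dx _).2; rewrite subrr normr0.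
exists (Num.min dl d1); first by rewrite lt_min dl0.
move=> y Dy; rewrite lt_min => /andP[y1 y2]; have [D0y gy] := E y Dy y1.
by rewrite -gy -Ex; exact: K1.
Qed.

End Gluing.

Section Conversion.
Context {R : realType} {m r p q : nat} {h : R} {d : R -> 'rV[R]_p}
  {f : 'rV[R]_p * 'rV[R]_q * 'rV[R]_m -> 'rV[R]_m}
  {T : (R -> 'rV[R]_(r * m)) -> (R -> 'rV[R]_q)}
  {y0 : nat -> R -> 'rV[R]_m} {yref : R -> 'rV[R]_m} {rhat : nat}
  {alpha gain phi : R -> R}.
Hypothesis H : setup h d f T y0 yref rhat alpha gain phi.
Local Notation mu := (@lebesgue_measure R).
Local Notation csol := (csol h d f T y0 yref rhat alpha gain phi).
Local Notation isol := (isol (h := h) (d := d) (f := f) (T := T) (y0 := y0) (yref := yref)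
  (rhat := rhat) (alpha := alpha) (gain := gain) (phi := phi)).
Local Notation inD := (inD (r := r) yref rhat alpha phi).
Local Notation ctrl := (ctrl (r := r) yref rhat alpha gain phi).
Local Notation vfield := (vfield (r := r) d f yref rhat alpha gain phi).
Local Notation is_solution := (is_solution h d f T y0 yref rhat alpha gain phi).
Local Notation control := (control (r := r) h yref rhat alpha gain phi).
Local Notation td := (time_domain h).

Lemma scaled_error_vec omega y t (v : 'rV[R]_(r * m)) k :
  (forall k, (k < r)%N -> blk k v = jet h omega y k t) -> (k < r)%N ->
  vec_error (r := r) yref rhat phi t v k = scaled_error h yref rhat phi omega y t k.
Proof. by move=> E kr; rewrite /vec_error /scaled_error /error_blocks E. Qed.

Lemma control_ctrl omega y t (v : 'rV[R]_(r * m)) :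
  (forall k, (k < r)%N -> blk k v = jet h omega y k t) -> ctrl t v = control omega y t.
Proof.
move=> E; rewrite /control /ctrl /wvec.
by rewrite (@eq_rho _ _ alpha r _ (scaled_error h yref rhat phi omega y t))// => k kr;
  exact: scaled_error_vec.
Qed.

Lemma inD_scaled omega y t (v : 'rV[R]_(r * m)) :
  (forall k, (k < r)%N -> blk k v = jet h omega y k t) ->
  inD t v <-> in_D alpha r (scaled_error h yref rhat phi omega y t).
Proof.
move=> E; split; apply: eq_in_D => k kr; first exact: scaled_error_vec.
by apply/esym; exact: scaled_error_vec.
Qed.

Lemma time_domain_itv omega (a b : R) : - h <= a -> (b%:E < omega)%E ->
  `[a, b]%classic `<=` td omega.
Proof.
move=> ha bo t /=; rewrite in_itv/= => /andP[at_ tb].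
by split; [exact: le_trans at_|exact: dom_le bo].
Qed.

Lemma jet_top omega (y : R -> 'rV[R]_m) t : jet h omega y r t = derive_in (td omega) (jet h omega y r.-1) t.
Proof. by rewrite -{1}(prednK (st_r H)). Qed.

Lemma history_le0 : - h <= 0. Proof. by rewrite oppr_le0 (st_h H). Qed.

Lemma interior_derive omega (t b : R) (g : R -> 'rV[R]_m) (l : 'rV[R]_m) :
  0 <= t -> t < b -> (b%:E < omega)%E ->
  (forall j, is_derive t 1 (fun s => g s 0 j) (l 0 j)) ->
  derive_in (td omega) g t = l.
Proof.
move=> t0 tb bo Hl; apply: (@derive_inE _ _ _ g t b t l tb).
- by rewrite lexx ltW.
- by apply: time_domain_itv => //; exact: le_trans history_le0 t0.
- by apply/has_derivative_in_coord => j; apply: is_derive_has_derivative_in.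
Qed.

(** The lower blocks are primitives of the next ones because the jets are continuously
    differentiable. The last one is absolutely continuous, and the differential equation identifies
    its derivative almost everywhere. *)
Lemma sol_isol omega (y : R -> 'rV[R]_m) : is_solution omega y -> isol omega (Defs.state (r := r) h omega y).
Proof.
move=> [om0 [[Cc Cd] ini lac Dy eqn]]; split => // tau tau0 taud.
pose x t : 'rV[R]_(r * m) := mkst (fun k => jet h omega y k t).
have -> : Defs.state h omega y = x by [].
have xE t k : (k < r)%N -> blk k (x t) = jet h omega y k t by move=> kr; rewrite blk_mkst.
have rr : (r.-1 < r)%N by rewrite ltn_predL (st_r H).
have kr1 k : (k < r)%N -> (k <= r.-1)%N by move=> kr; rewrite -ltnS prednK ?(st_r H).
have cx : {within `[(- h)%R, tau], continuous x}.
  apply/subspace_continuousP => t tt; apply: cvg_mkst => k kr.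
  have : {within `[(- h)%R, tau], continuous (jet h omega y k)}.
    by apply: continuous_subspaceW (Cc k (kr1 k kr)); exact: time_domain_itv.
  by move/subspace_continuousP; exact.
have Dx t : 0 <= t -> t <= tau -> inD t (x t).
  move=> t0 tt; apply/(inD_scaled (omega := omega) (y := y)); first by move=> k; exact: xE.
  by apply: Dy => //; exact: dom_le taud.
have [mT [B HB]] := T_stopped_props H tau0 cx.
split => //.
- by move=> t tI; apply: eq_mkst => k kr; exact: ini.
- move=> t; rewrite le_eqVlt => /predU1P[<-|t0] tt j; first by rewrite subrr rint_point.
  have iF := vfield_itg H j tau0 cx Dx mT HB.
  have iFt := itg_sub (lexx 0) tt iF.
  have tdo := dom_le tt taud.
  have sub0 : `[0, t]%classic `<=` td omega by apply: time_domain_itv => //; exact: history_le0.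
  have [k [i E]] := @coord_blk R r m j.
  pose F s := (if (k.+1 < r)%N then blk k.+1 (x s)
     else f (d s, T (stopped x tau) s, ctrl s (x s))) 0 i.
  have FE : (fun s => vfield s (x s) (T (stopped x tau) s) 0 j) = F.
    by apply/funext => s; rewrite E blk_mkst.
  rewrite FE in iFt *; rewrite !E !xE//.
  case: (ltnP k.+1 r) => [kr|rk].
    rewrite (derivative_primitive (u := fun s => jet h omega y k s 0 i)
      (g := fun s => jet h omega y k.+1 s 0 i) (ltW t0)).
    + by congr rint; apply/funext => s; rewrite /F kr xE.
    + apply/subspace_continuousP => s sI; apply: cvg_to_coord.
      have : {within `[(0:R)%R, t], continuous (jet h omega y k.+1)}.
        by apply: continuous_subspaceW (Cc k.+1 (kr1 k.+1 kr)).
      by move/subspace_continuousP; exact.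
    + move=> s s0t.
      have sI : `[(0:R)%R, t]%classic s by rewrite /= in_itv.
      have kr2 : (k < r.-1)%N by rewrite -ltnS prednK ?(st_r H).
      have := Cd k kr2 s (sub0 s sI).
      move=> /has_derivative_in_coord/(_ i).
      by apply: (has_derivative_in_local (d := 1)) => // u _ uI; split => //; exact: sub0.
  have kE : nat_of_ord k = r.-1.
    by apply/eqP; rewrite eqn_leq kr1//= -subn1 leq_subLR add1n.
  have ack : absolutely_continuous 0 t (jet h omega y k).
    rewrite kE; apply: lac (ltW t0) _ => s /=; rewrite in_itv/= => /andP[s0 st].
    by split => //; exact: dom_le tdo.
  (* All coordinates are needed at once: [jet] of order [r] is the limit of a vector of difference
     quotients, which says nothing if one coordinate fails to converge. *)
  have aeD : {ae mu, forall s, forall j' : 'I_m, exists D : R, 0 < s < t ->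
      is_derive s 1 (fun u => jet h omega y k u 0 j') D}.
    apply: filter_forall => j'.
    have [D [_ _ HD]] := AC_FTC t0 (AC_coord j' ack).
    by apply: ae_mono HD => s Ds; exists (D s).
  have eqn' := eqn tau tau0 taud.
  have key : {ae mu, forall s : R, 0 < s < t -> forall l,
      is_derive s 1 (fun u => jet h omega y k u 0 i) l -> l = F s}.
    have := ae_and aeD eqn'; apply: ae_mono => s [aD es] /[dup] s0t /andP[s0 st] l Dl.
    have [L HL] := choice aD.
    have jr : jet h omega y r s = \row_j L j.
      rewrite jet_top -kE; apply: (interior_derive (ltW s0) st tdo) => j'.
      by rewrite mxE; exact: HL.
    have lL : l = L i.
      have := HL i s0t => HLi.
      have e1 : 'D_1 (fun u => jet h omega y k u 0 i) s = l by exact: derive_val.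
      have e2 : 'D_1 (fun u => jet h omega y k u 0 i) s = L i by exact: derive_val.
      by rewrite -e1 e2.
    have sI : s \in `[0, tau] by rewrite in_itv/= (ltW s0) (le_trans (ltW st)).
    have := es sI; rewrite jr => /(congr1 (fun v : 'rV[R]_m => v 0 i)).
    rewrite mxE lL => ->; rewrite /F ltnNge rk/=.
    by rewrite (control_ctrl (omega := omega) (y := y)) => // k' kr'; exact: xE.
  have [_ EE] := AC_is_derive_primitive t0 (AC_coord i ack) (itg_measurable iFt) key.
  by rewrite EE// ltW.
Qed.

Section FromState.
Variables (omega : \bar R) (x : R -> 'rV[R]_(r * m)).
Hypothesis sx : isol omega x.

Lemma dom_above (t : R) : (t%:E < omega)%E -> exists2 tau : R, t < tau /\ 0 < tau & (tau%:E < omega)%E.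
Proof.
have [om0 _] := sx; case: omega om0 => [w||]//=.
  rewrite !lte_fin => w0 tw; exists (Num.max ((t + w) / 2) (w / 2)).
    by rewrite !lt_max; split; apply/orP; [left|right]; rewrite ?divr_gt0//; lra.
  by rewrite lte_fin gt_max; apply/andP; split; lra.
move=> _ _; exists (Num.max (t + 1) 1); last by rewrite ltry.
by rewrite !lt_max ltrDl ltr01/= orbT.
Qed.

Lemma blk_has_derivative k t : (k.+1 < r)%N -> td omega t ->
  has_derivative_in (td omega) (fun s => blk k (x s)) t (blk k.+1 (x t)).
Proof.
move=> kr [ht tdm]; have [om0 sol] := sx; have [yc yd] := st_init H.
have [tau [tt tau0] taud] := dom_above tdm; have tau0' := ltW tau0.
have cs := sol tau tau0' taud; have [cx x0 _ _] := cs.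
have x0k s i : (i < r)%N -> - h <= s -> s <= 0 -> blk i (x s) = y0 i s.
  by move=> ir hs s0; rewrite x0 ?in_itv/= ?hs// blk_mkst.
have Dneg : t <= 0 -> has_derivative_in `[(- h)%R, 0%R] (fun s => blk k (x s)) t (blk k.+1 (x t)).
  move=> t0; have tI : t \in `[(- h)%R, 0%R] by rewrite in_itv/= ht.
  rewrite (x0k t k.+1)//; have := yd k kr t tI.
  apply: (has_derivative_in_local (d := 1)) => //; first by rewrite x0k// ltnW.
  by move=> s _ /[dup] sI; rewrite /= in_itv/= => /andP[hs s0]; rewrite x0k// ltnW.
have Dpos : 0 <= t -> has_derivative_in `[0%R, tau] (fun s => blk k (x s)) t (blk k.+1 (x t)).
  by move=> t0; apply: (blk_derivative H tau0' cs kr); rewrite t0 ltW.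
have [t0|t0|t0] := ltgtP t 0.
- apply: (@has_derivative_in_union _ _ `[(- h)%R, 0%R] `[(- h)%R, 0%R] _ _ _ _ _ (- t)); last 2 first.
  + exact: Dneg (ltW t0).
  + exact: Dneg (ltW t0).
  + by rewrite oppr_gt0.
  + by [].
  + move=> s st [hs _]; split => //; left; rewrite /= in_itv/= hs.
    by move: st; rewrite ltr_norml => /andP[_]; lra.
- apply: (@has_derivative_in_union _ _ `[0%R, tau] `[0%R, tau] _ _ _ _ _
    (Num.min t (tau - t))); last 2 first.
  + exact: Dpos (ltW t0).
  + exact: Dpos (ltW t0).
  + by rewrite lt_min t0 subr_gt0.
  + by [].
  + move=> s; rewrite lt_min !ltr_norml => /andP[/andP[s1 s2] /andP[s3 s4]] _.
    by split => //; left; rewrite /= in_itv/=; apply/andP; split; lra.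
(* At 0 the derivative from the left comes from the initial data and the one from the right from the
   equation, with the same value. *)
- apply: (@has_derivative_in_union _ _ `[(- h)%R, 0%R] `[0%R, tau] _ _ _ _ _ tau); last 2 first.
  + by apply: Dneg; rewrite t0.
  + by apply: Dpos; rewrite t0.
  + by [].
  + by [].
  + move=> s; rewrite t0 subr0 ltr_norml => /andP[s1 s2] [hs _]; split => //.
    have [s0|s0] := leP s 0; [left|right]; rewrite /= in_itv/= ?hs ?s0//.
    by rewrite (ltW s0) (ltW s2).
Qed.

Let y := fun t => blk 0 (x t).

Lemma jet_blk k t : (k < r)%N -> td omega t -> jet h omega y k t = blk k (x t).
Proof.
elim: k t => // k ih t kr tt; have kr' := ltnW kr.
have [tau [ttau _] taud] := dom_above tt.2.
have tdt : `[t, tau]%classic `<=` td omega by apply: time_domain_itv => //; case: tt.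
rewrite -[LHS]/(derive_in (td omega) (jet h omega y k) t).
have -> : derive_in (td omega) (jet h omega y k) t =
    derive_in (td omega) (fun s => blk k (x s)) t.
  apply: (derive_in_local (d := 1)) => //; first exact: ih.
  by move=> s _; split => // ds; exact: ih.
apply: (derive_inE ttau _ tdt); first by rewrite lexx ltW.
exact: blk_has_derivative.
Qed.

Lemma isol_sol : is_solution omega y.
Proof.
have [om0 sol] := sx; have rr : (r.-1 < r)%N by rewrite ltn_predL (st_r H).
have kr1 k : (k <= r.-1)%N -> (k < r)%N by move=> kr; rewrite -(prednK (st_r H)) ltnS.
split => //; split.
- split => [k kr|k kr t tt].
    apply: within_continuous_local => t tt.
    have [tau [ttau tau0] taud] := dom_above tt.2.
    have [cx _ _ _] := sol tau (ltW tau0) taud.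
    exists `[(- h)%R, tau]%classic, (fun s => blk k (x s)), (tau - t); split.
    + by rewrite subr_gt0.
    + by rewrite /= in_itv/= tt.1 ltW.
    + apply/subspace_continuousP => s sI; apply: cvg_blk.
      by move/subspace_continuousP : cx; exact.
    + move=> s ds; rewrite ltr_norml => /andP[_ s2]; split; last by rewrite -jet_blk ?kr1.
      by rewrite /= in_itv/= ds.1; lra.
  have kr' : (k.+1 < r)%N by rewrite -(prednK (st_r H)) ltnS.
  have := blk_has_derivative kr' tt.
  have -> : derive_in_n (td omega) k.+1 y t = blk k.+1 (x t) by exact: (jet_blk kr' tt).
  apply: (has_derivative_in_local (d := 1)) => //; first by rewrite -jet_blk// ltnW.
  by move=> s _ ds; split => //; rewrite -jet_blk// ltnW.
- move=> i ir t tI; move: (tI); rewrite in_itv/= => /andP[ht t0].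
  have dt : td omega t by split => //; apply: le_lt_trans om0; rewrite lee_fin.
  have [_ x0 _ _] := sol 0 (lexx _) om0.
  by rewrite jet_blk// x0// blk_mkst.
- move=> a b ab sub; have aI : `[a, b]%classic a by rewrite /= in_itv/= lexx.
  have bI : `[a, b]%classic b by rewrite /= in_itv/= ab lexx.
  have [a0 _] := sub a aI; have [_ bd] := sub b bI.
  have [L L0 HL] := x_lipschitz H om0 sol.
  apply: (lipschitz_AC L0) => s t as_ st tb.
  have s0 := le_trans a0 as_; have t0 := le_trans s0 st.
  have dt := dom_le tb bd; have ds := dom_le st dt.
  rewrite !jet_blk//; last 2 first.
  + by split => //; exact: le_trans history_le0 s0.
  + by split => //; exact: le_trans history_le0 t0.
  by rewrite -blkB (le_trans (blk_norm _ _))// HL.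
- move=> t t0 dt; have [_ _ Dx _] := sol t t0 dt.
  apply/(inD_scaled (v := x t)); last exact: Dx.
  by move=> k kr; rewrite jet_blk//; split => //; exact: le_trans history_le0 t0.
- move=> tau tau0 taud; have cs := sol tau tau0 taud; have [cx _ _ _] := cs.
  move: tau0; rewrite le_eqVlt => /predU1P[<-|tau0].
    apply: ae_mono (ae_neq 0) => t tn; rewrite in_itv/= => /andP[t0 t0'].
    by exfalso; apply: tn; apply/eqP; rewrite eq_le t0 t0'.
  have tau0' := ltW tau0.
  have aeD : {ae mu, forall s, forall j : 'I_m, 0 < s < tau ->
     is_derive s 1 (fun u => blk r.-1 (x u) 0 j)
       (f (d s, T (stopped x tau) s, ctrl s (x s)) 0 j)}.
    apply: filter_forall => j.
    have [iF _] := top_increment H sol j tau0' taud (lexx 0) (lexx 0) tau0'.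
    apply: (primitive_ae_derive (u := fun u => blk r.-1 (x u) 0 j) tau0 iF) => s s0 st.
    by have [_ ->] := top_increment H sol j tau0' taud (lexx 0) s0 st.
  have stE s : - h <= s -> s <= tau -> Defs.state h omega y (Num.min s tau) = stopped x tau s.
    move=> hs st; rewrite /stopped -[RHS]mkst_blk.
    apply: (@eq_mkst _ _ _ (fun k => jet h omega y k (Num.min s tau))) => k kr.
    by rewrite jet_blk//; rewrite min_l//; split => //; exact: dom_le taud.
  have cs1 : {within `[(- h)%R, +oo[, continuous (stopped x tau)}.
    exact: (stopped_admissible H tau0' cx).
  have cs2 : {within `[(- h)%R, +oo[, continuous (fun s => Defs.state (r := r) h omega y (Num.min s tau))}.
    apply: (@subspace_eq_continuous _ _ _ (stopped x tau)) => // s.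
    rewrite inE/= in_itv/= andbT => hs.
    change (stopped x tau s = Defs.state (r := r) h omega y (Num.min s tau)).
    have [st|/ltW st] := leP s tau; first by rewrite -stE// min_l.
    have := stE tau (le_trans history_le0 tau0') (lexx tau).
    by rewrite /stopped minxx (min_r st) => ->.
  have aT := T_causal H cs1 cs2 tau0' (fun s hs st => esym (stE s hs st)).
  have := ae_and (ae_and aeD aT) (ae_and (ae_neq 0) (ae_neq tau)).
  apply: ae_mono => t [[Dt Tt] [t0 ttau]]; rewrite in_itv/= => /andP[t0' tt].
  have t00 : 0 < t by rewrite lt_neqAle t0' andbT; apply/eqP => e; apply: t0.
  have tt' : t < tau by rewrite lt_neqAle tt andbT; apply/eqP.
  have dt := dom_le tt taud.
  have dt' : td omega t by split => //; exact: le_trans history_le0 t0'.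
  rewrite jet_top -Tt//.
  rewrite -(control_ctrl (v := x t)); last by move=> k kr; rewrite jet_blk.
  have -> : derive_in (td omega) (jet h omega y r.-1) t =
      derive_in (td omega) (fun s => blk r.-1 (x s)) t.
    apply: (derive_in_local (d := 1)) => //; first exact: jet_blk.
    by move=> s _; split => // ds; exact: jet_blk.
  apply: (interior_derive t0' tt' taud) => j; apply: Dt.
  by rewrite t00.
Qed.

End FromState.

End Conversion.

(** * Smooth functions and weak derivatives *)

Section SmoothFunctions.
Context {R : realType}.
Implicit Types (f g : R -> R) (p : {poly R}).

Lemma is_derive_dist f (x l : R) :
  (forall e : R, 0 < e -> exists2 dl : R, 0 < dl &
    forall s, `|s - x| < dl -> `|f s - f x - (s - x) * l| <= e * `|s - x|) ->
  is_derive x 1 f l.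
Proof.
move=> H.
have C : (fun u : R => u^-1 *: ((f \o shift x) (u *: 1) - f x)) @ 0^' --> l.
  apply/cvgrPdist_le => e e0; have [dl dl0 Hdl] := H e e0.
  rewrite near_withinE; apply/nbhs_ballP; exists dl => // u /= ul u0.
  have u0' : 0 < `|u| by rewrite normr_gt0.
  rewrite distrC -(ler_pM2r u0') -normrM.
  have := Hdl (u + x); rewrite addrK; move: ul; rewrite /ball/= sub0r normrN => ul /(_ ul).
  rewrite (_ : (_ - l) * u = f (u + x) - f x - u * l)//.
  by rewrite /= [u *: 1]mulr1 /GRing.scale/=; field.
have dv : derivable f x 1 by apply/cvg_ex; exists l.
by apply: DeriveDef => //; exact/cvg_lim.
Qed.

Lemma is_derive_val f (x l : R) : is_derive x 1 f l -> f^`()%classic x = l.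
Proof. by move=> D; rewrite derive1E; exact: derive_val. Qed.

(** Level [k] means [k.+1] derivatives. They are given by witnesses, so that closure under the
    operations follows by induction. *)
Fixpoint smooth_upto (k : nat) f : Prop := exists g : R -> R,
  (forall x : R, is_derive x 1 f (g x)) /\ if k is k'.+1 then smooth_upto k' g else True.

Definition smooth f : Prop := forall k, smooth_upto k f.

Lemma smooth_uptoW k f : smooth_upto k.+1 f -> smooth_upto k f.
Proof.
elim: k f => [|k ih] f [g [Dg sg]]; exists g; split => //.
exact: ih.
Qed.

Lemma smooth_derivable f : smooth f ->
  forall k (x : R), derivable (f^`(k))%classic x 1.
Proof.
move=> sf k; move: (sf k) => {sf}; elim: k f => [|k ih] f [g [Dg sg]] x.
  by have [] := Dg x.
rewrite derive1Sn (_ : f^`()%classic = g); first exact: ih.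
by apply/funext => z; exact: is_derive_val.
Qed.

Lemma smooth_uptoD k f g : smooth_upto k f -> smooth_upto k g ->
  smooth_upto k (fun x => f x + g x).
Proof.
elim: k f g => [|k ih] f g [f' [Df sf]] [g' [Dg sg]];
  (exists (fun x => f' x + g' x); split; first by move=> x; exact: is_deriveD).
- by [].
- exact: ih.
Qed.

Lemma smooth_cst k (c : R) : smooth_upto k (fun=> c).
Proof.
elim: k c => [|k ih] c; (exists (fun=> 0); split; first by move=> x; exact: is_derive_cst).
- by [].
- exact: ih.
Qed.

Lemma smooth_uptoM k f g : smooth_upto k f -> smooth_upto k g ->
  smooth_upto k (fun x => f x * g x).
Proof.
elim: k f g => [|k ih] f g sf0 sg0; move: (sf0) (sg0);
  move=> [f' [Df sf]] [g' [Dg sg]];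
  (exists (fun x => f x * g' x + g x * f' x); split; first by move=> x; exact: is_deriveM).
- by [].
- by apply: smooth_uptoD; apply: ih => //; exact: smooth_uptoW.
Qed.

Lemma smooth_uptoV k f : (forall x, f x != 0) -> smooth_upto k f ->
  smooth_upto k (fun x => (f x)^-1).
Proof.
move=> f0; elim: k => [|k ih] sf0; move: (sf0) => [f' [Df sf]];
  exists (fun x => -1 * ((f x)^-1 * (f x)^-1) * f' x).
  split=> // x; have := is_deriveV (f0 x) (Df x).
  by move/is_derive_eq; apply; rewrite /GRing.scale/= -expr2 -exprVn mulN1r.
split=> [x|].
  have := is_deriveV (f0 x) (Df x).
  by move/is_derive_eq; apply; rewrite /GRing.scale/= -expr2 -exprVn mulN1r.
have sk := ih (smooth_uptoW sf0).
by apply: smooth_uptoM => //; apply: smooth_uptoM; [exact: smooth_cst|exact: smooth_uptoM].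
Qed.

Lemma is_derive_affine (a b x : R) : is_derive x 1 (fun s : R => a * s + b) a.
Proof.
apply: is_derive_dist => e e0; exists 1 => // s _.
rewrite (_ : _ - (s - x) * a = 0) ?normr0 ?mulr_ge0 ?(ltW e0)//; ring.
Qed.

Lemma smooth_affine k (a b : R) : smooth_upto k (fun x => a * x + b).
Proof.
case: k => [|k]; (exists (fun=> a); split; first by move=> x; exact: is_derive_affine).
- by [].
- exact: smooth_cst.
Qed.

Lemma smooth_upto_comp k f (a b : R) : smooth_upto k f ->
  smooth_upto k (fun x => f (a * x + b)).
Proof.
have D f0 f' : (forall x : R, is_derive x 1 f0 (f' x)) ->
    forall x : R, is_derive x 1 (fun x => f0 (a * x + b)) (a * f' (a * x + b)).
  move=> Df x; have /is_derive_eq := @is_derive1_comp _ f0 (fun s : R => a * s + b) x _ _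
    (Df (a * x + b)) (is_derive_affine a b x).
  by apply; rewrite mulrC.
elim: k f => [|k ih] f [f' [Df sf]];
  (exists (fun x => a * f' (a * x + b)); split; first exact: D).
- by [].
- by apply: smooth_uptoM; [exact: smooth_cst|exact: ih].
Qed.

(* p(1/x) e^(-1/x): with the factor [p] the family is closed under derivatives. *)
Definition flat p (x : R) : R := if 0 < x then p.[x^-1] * expR (- x^-1) else 0.

Lemma poly_le_expR p : exists2 C : R, 0 <= C & forall y, 0 <= y -> `|p.[y]| <= C * expR y.
Proof.
have mon n : forall y : R, 0 <= y -> y ^+ n <= n`!%:R * expR y.
  move=> y y0; case: n => [|n].
    by rewrite expr0 mul1r (le_trans _ (expR_ge1Dx y))// lerDl.
  have := expR_ge1Dxn n y0 => h; rewrite mulrC -ler_pdivrMr ?ltr0n ?fact_gt0//.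
  by apply: le_trans h; rewrite lerDr.
elim/poly_ind: p => [|p c _].
  by exists 0 => // y _; rewrite horner0 normr0 mul0r.
pose s := p * 'X + c%:P.
exists (\sum_(i < size s) `|s`_i| * i`!%:R); first by apply: sumr_ge0 => i _; rewrite mulr_ge0.
move=> y y0; rewrite -/s horner_coef (le_trans (ler_norm_sum _ _ _))// mulr_suml.
apply: ler_sum => i _; rewrite normrM -mulrA ler_wpM2l// ger0_norm ?exprn_ge0//.
exact: mon.
Qed.

(** The factor ['X^2] multiplied to [p] yields a quadratic bound near 0, hence the derivative 0
    there. *)
Lemma flat_bound p : exists2 C : R, 0 <= C & forall x, 0 < x -> `|flat p x| <= C * x ^+ 2.
Proof.
have [C C0 HC] := poly_le_expR (p * 'X^2); exists C => // x x0.
rewrite /flat x0; have y0 : 0 < x^-1 by rewrite invr_gt0.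
have := HC x^-1 (ltW y0); rewrite hornerM hornerXn !normrM => h.
rewrite [`|expR _|]ger0_norm ?expR_ge0// expRN.
rewrite -ler_pdivlMr ?invr_gt0 ?expR_gt0// invrK.
have x2 : 0 < x ^+ 2 by rewrite exprn_gt0.
rewrite -(ler_pM2r (x := `|x^-1 ^+ 2|)) ?normr_gt0 ?expf_neq0 ?gt_eqF//.
rewrite -(normrM x^-1 x^-1) -expr2 in h; apply: (le_trans h); rewrite ger0_norm ?exprn_ge0 ?(ltW y0)//.
rewrite (_ : C * x ^+ 2 * expR x^-1 * x^-1 ^+ 2 = C * expR x^-1)//.
by field; rewrite gt_eqF.
Qed.

(** With y = 1/x the derivative of p(y) e^(-y) with respect to x is (p(y) - p'(y)) y^2 e^(-y), again
    of the same form; at 0 the quadratic bound applies. *)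
Lemma flat_derive p (x : R) : is_derive x 1 (flat p) (flat ((p - p^`()) * 'X^2) x).
Proof.
have [x0|x0] := ltP 0 x; last first.
  rewrite {2}/flat ltNge x0/=; apply: is_derive_dist => e e0.
  have [C C0 HC] := flat_bound p.
  have C1 : 0 < C + 1 by rewrite ltr_wpDl.
  exists (e / (C + 1)); first by rewrite divr_gt0.
  move=> s sx; rewrite {2}/flat ltNge x0/= mulr0 !subr0.
  have [s0|s0] := ltP 0 s; last by rewrite /flat ltNge s0/= normr0 mulr_ge0// ltW.
  apply: (le_trans (HC s s0)).
  have sx0 : 0 < s - x by lra.
  move: sx; rewrite (gtr0_norm sx0) ltr_pdivlMr// => sx.
  have h1 : s <= s - x by lra.
  rewrite expr2 mulrA; apply: ler_pM => //; rewrite ?mulr_ge0 ?(ltW s0)//.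
  have : C * s <= C * (s - x) by rewrite ler_wpM2l.
  lra.
have xn0 : x != 0 by rewrite gt_eqF.
have D1 : is_derive x 1 (fun z : R => z^-1) (- x ^- 2).
  have := is_deriveV (f := id) xn0 (is_derive_id x (1 : R)).
  by move/is_derive_eq; apply; rewrite /GRing.scale/= mulr1.
have D2 := is_derive1_comp (is_derive_poly p x^-1) D1.
have D3 : is_derive x 1 (fun z : R => - z^-1) (x ^- 2).
  by have /is_derive_eq := is_deriveN D1; apply; rewrite opprK.
have D4 := @is_derive1_comp _ expR (fun z : R => - z^-1) x _ _ (is_derive_expR (- x^-1)) D3.
have D5 := is_deriveM D2 D4.
apply: is_derive_dist => e e0.
have /has_derivative_in_dist := is_derive_has_derivative_in setT D5.
move=> /(_ e e0)[dl dl0 Hdl]; exists (Num.min dl x); first by rewrite lt_min dl0.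
move=> s; rewrite lt_min => /andP[sd]; rewrite ltr_norml => /andP[sx _].
have s0 : 0 < s by lra.
have := Hdl s I sd; rewrite /flat x0 s0 /= /GRing.scale/=.
rewrite (_ : _ * _ + _ * _ = ((p - p^`()) * 'X^2).[x^-1] * expR (- x^-1))//.
by rewrite hornerM hornerD hornerN hornerXn; field.
Qed.

Lemma smooth_flat p : smooth (flat p).
Proof.
move=> k; elim: k p => [|k ih] p; exists (flat ((p - p^`()) * 'X^2));
  split => // x; exact: flat_derive.
Qed.

Definition step (x : R) : R := flat 1 x * (flat 1 x + flat 1 (- 1 * x + 1))^-1.

Lemma flat1 (x : R) : 0 < x -> 0 < flat 1 x.
Proof. by move=> x0; rewrite /flat x0 hornerC mul1r expR_gt0. Qed.

Lemma flat0 (x : R) : x <= 0 -> flat 1 x = 0.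
Proof. by move=> x0; rewrite /flat ltNge x0. Qed.

Lemma flat_ge0 (x : R) : 0 <= flat 1 x.
Proof. by have [/flat1/ltW//|/flat0->] := ltP 0 x. Qed.

Lemma step_den (x : R) : 0 < flat 1 x + flat 1 (- 1 * x + 1).
Proof.
have [x0|x0] := ltP 0 x; first by rewrite ltr_wpDr ?flat_ge0// flat1.
by rewrite ltr_wpDl ?flat_ge0// flat1//; lra.
Qed.

Lemma smooth_step : smooth step.
Proof.
move=> k; apply: smooth_uptoM; first exact: smooth_flat.
apply: smooth_uptoV; first by move=> x; rewrite gt_eqF// step_den.
apply: smooth_uptoD; first exact: smooth_flat.
exact: (smooth_upto_comp _ _ (@smooth_flat 1 k)).
Qed.

Lemma step0 (x : R) : x <= 0 -> step x = 0.
Proof. by move=> x0; rewrite /step flat0// mul0r. Qed.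

Lemma step1 (x : R) : 1 <= x -> step x = 1.
Proof.
move=> x1; rewrite /step (@flat0 (- 1 * x + 1)) ?addr0 ?divff//; last by lra.
by rewrite gt_eqF// flat1// (lt_le_trans ltr01).
Qed.

Lemma step_in01 (x : R) : 0 <= step x <= 1.
Proof.
rewrite /step mulr_ge0 ?flat_ge0 ?invr_ge0 ?(ltW (step_den x))//=.
by rewrite ler_pdivrMr ?step_den// mul1r lerDl flat_ge0.
Qed.

(** The bound on [x * S' x] is invariant under scaling; it makes the derivatives of [ramp k] bounded
    uniformly in [k]. *)
Lemma step_derivative : exists (S' : R -> R) (C : R),
  [/\ forall x : R, is_derive x 1 step (S' x), forall x, `|x * S' x| <= C,
      forall x, x <= 0 -> S' x = 0 & forall x, 1 < x -> S' x = 0].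
Proof.
have [S' [DS' [S2 [DS2 _]]]] := smooth_step 1.
have loc0 (x c dl : R) : 0 < dl -> (forall s, `|s - x| < dl -> step s = c) -> S' x = 0.
  move=> dl0 Hs; rewrite -(is_derive_val (DS' x)); apply: is_derive_val.
  apply: is_derive_dist => e e0; exists dl => // s sx.
  by rewrite !Hs ?subrr ?normr0// mulr0 subr0 normr0 mulr_ge0// ltW.
have cS' : continuous S'.
  by move=> x; apply/differentiable_continuous/derivable1_diffP; have [] := DS2 x.
have S1 x : 1 < x -> S' x = 0.
  move=> x1; apply: (loc0 x 1 (x - 1)); first by rewrite subr_gt0.
  by move=> s; rewrite ltr_norml => /andP[s1 _]; apply: step1; lra.
have Sneg x : x < 0 -> S' x = 0.
  move=> x0; apply: (loc0 x 0 (- x)); first by rewrite oppr_gt0.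
  by move=> s; rewrite ltr_norml => /andP[_ s1]; apply: step0; lra.
have S0 x : x <= 0 -> S' x = 0.
  rewrite le_eqVlt => /predU1P[->|//]; last exact: Sneg.
  apply/eqP; case: (eqVneq (S' 0) 0) => // n0.
  have n0' : 0 < `|S' 0| by rewrite normr_gt0.
  have /cvgrPdist_lt/(_ _ n0') := cS' 0.
  move=> /nbhs_ballP[dl /= dl0] /(_ (- (dl / 2))); rewrite /ball/= sub0r opprK.
  rewrite gtr0_norm ?divr_gt0// ltr_pdivrMr// ltr_pMr// ltr1n => /(_ isT).
  by rewrite (Sneg (- (dl / 2))) ?subr0 ?ltxx// oppr_lt0 divr_gt0.
have [C C0 HC] := within_bounded (continuous_subspaceT cS' : {within `[(0:R)%R, 1%R], continuous S'}).
exists S', C; split => // x; have [x0|x0] := leP x 0; first by rewrite S0// mulr0 normr0.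
have [x1|x1] := ltP 1 x; first by rewrite S1// mulr0 normr0.
rewrite normrM -[leRHS]mul1r; apply: ler_pM => //; first by rewrite gtr0_norm.
by apply: HC => //; exact: ltW.
Qed.

End SmoothFunctions.

Section DuBoisReymond.
Context {R : realType}.
Local Notation mu := (@lebesgue_measure R).
Implicit Types (u g theta : R -> R).

Lemma Rintegral_support (I : set R) a b u : `[a, b]%classic `<=` I ->
  (forall x, ~ `[a, b]%classic x -> u x = 0) -> \int[mu]_(x in I) u x = rint a b u.
Proof.
move=> abI u0; rewrite /rint /Rintegral integral_mkcond [in RHS]integral_mkcond.
congr (fine (integral _ _ _)); apply/funext => x; rewrite !patchE.
case: ifPn => [xI|xI]; case: ifPn => [xab|xab] //.
- by rewrite u0// => /mem_set; apply/negP.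
- by move: xI => /negP[]; apply/mem_set/abI/set_mem.
Qed.

Definition pos_part (y : R) : R := Num.max y 0.

Definition jump : R -> R := \1_(`]0%R, +oo[%classic : set R).

Lemma jumpE y : jump y = (0 < y)%R%:R.
Proof. by rewrite /jump indicE mem_setE in_itv/= andbT. Qed.

(* With [F = pos_part] this is the trapezoid that rises from 0 to [dl] on
   [[a, a + dl]] and falls back on [[b, b + dl]]; with its derivative [F = jump] it
   compares the averages of [u] after [a] and after [b]. *)
Definition four (F : R -> R) (a b dl x : R) : R :=
  F (x - a) - F (x - (a + dl)) - F (x - b) + F (x - (b + dl)).

(* A smooth approximation of [pos_part], exact outside [(0, 1/k)], so that
   [four (ramp k)] has compact support. *)
Definition ramp (k y : R) : R := y * step (k * y).

Lemma smooth_ramp k n : smooth_upto n (ramp k).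
Proof.
have h1 := smooth_affine n (1 : R) 0.
have h2 := smooth_upto_comp k 0 (@smooth_step R n).
have := smooth_uptoM h1 h2; congr smooth_upto; apply/funext => y.
by rewrite /ramp mul1r !addr0.
Qed.

Lemma ramp_neg k y : 0 < k -> y <= 0 -> ramp k y = 0.
Proof. by move=> k0 y0; rewrite /ramp step0 ?mulr0// pmulr_rle0. Qed.

Lemma ramp_id k y : 1 <= k * y -> ramp k y = y.
Proof. by move=> ky; rewrite /ramp step1 ?mulr1. Qed.

Lemma ramp_bound k y : `|ramp k y| <= `|y|.
Proof.
have /andP[s0 s1] := step_in01 (k * y).
by rewrite /ramp normrM ler_piMr// ger0_norm.
Qed.

(** [C] is independent of [k], as dominated convergence requires. The derivatives converge to [jump]
    at every point, also at 0. *)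
Lemma ramp_derivative : exists (P' : R -> R -> R) (C : R),
  [/\ forall k (x : R), is_derive x 1 (ramp k) (P' k x), forall k x, `|P' k x| <= C,
      forall k x, 0 < k -> x <= 0 -> P' k x = 0 & forall k x, 1 < k * x -> P' k x = 1].
Proof.
have [S' [C [DS SC S0 S1]]] := @step_derivative R.
exists (fun k x => step (k * x) + (k * x) * S' (k * x)), (1 + C); split.
- move=> k x.
  have D1 := @is_derive1_comp _ step (fun s : R => k * s + 0) x _ _
    (DS (k * x + 0)) (is_derive_affine k 0 x).
  rewrite (_ : ramp k = (fun y : R => y * step (k * y + 0))); last first.
    by apply/funext => y; rewrite /ramp addr0.
  apply: (is_derive_eq (is_deriveM (is_derive_id x (1 : R)) D1)).
  by rewrite /GRing.scale/= addr0; ring.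
- move=> k x; rewrite (le_trans (ler_normD _ _))// lerD//.
  by have /andP[s0 s1] := step_in01 (k * x); rewrite ger0_norm.
- by move=> k x k0 x0; rewrite step0 ?S0 ?mulr0 ?addr0// pmulr_rle0.
- by move=> k x kx; rewrite step1 ?S1 ?mulr0 ?addr0// ltW.
Qed.

Lemma smooth_four k a b dl : smooth (four (ramp k) a b dl).
Proof.
move=> n; have sh c := smooth_upto_comp 1 (- c) (smooth_ramp k n).
have neg c := smooth_uptoM (smooth_cst n (-1 : R)) (sh c).
have := smooth_uptoD (smooth_uptoD (smooth_uptoD (sh a) (neg (a + dl))) (neg b)) (sh (b + dl)).
by congr smooth_upto; apply/funext => x; rewrite /four !mul1r !mulN1r.
Qed.

Lemma four_is_derive (F F' : R -> R) a b dl (x : R) :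
  (forall y : R, is_derive y 1 F (F' y)) ->
  is_derive x 1 (four F a b dl) (four F' a b dl x).
Proof.
move=> DF; have sh c : is_derive x 1 (fun z => F (z - c)) (F' (x - c)).
  have := @is_derive1_comp _ F (fun s : R => 1 * s + - c) x _ _
    (DF (1 * x + - c)) (is_derive_affine 1 (- c) x).
  rewrite mulr1 mul1r (_ : F \o _ = (fun z => F (z - c)))//.
  by apply/funext => z /=; rewrite mul1r.
exact: (is_deriveD (is_deriveB (is_deriveB (sh a) (sh (a + dl))) (sh b)) (sh (b + dl))).
Qed.

Lemma four_ramp_support k a b dl : a < b -> 0 < dl -> 1 <= k * dl ->
  forall x, ~ `[a, b + dl + dl]%classic x -> four (ramp k) a b dl x = 0.
Proof.
move=> ab dl0 kd x xab.
have k0 : 0 < k by rewrite -(pmulr_lgt0 _ dl0) (lt_le_trans ltr01).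
have [xa|ax] := ltP x a.
  by rewrite /four !ramp_neg ?subrr ?add0r ?subr0 ?addr0 ?oppr0//; lra.
have [xb|bx] := ltP (b + dl + dl) x; last first.
  by exfalso; apply: xab; rewrite /= in_itv/= ax.
have big c : c <= b + dl -> ramp k (x - c) = x - c.
  move=> cb; apply: ramp_id; rewrite (le_trans kd)// ler_pM2l//; lra.
by rewrite /four !big; lra.
Qed.

Lemma four_test (I : set R) k a b dl : a < b -> 0 < dl -> 1 <= k * dl ->
  `[a, b + dl + dl]%classic `<=` I° -> test_function I (four (ramp k) a b dl).
Proof.
move=> ab dl0 kd sub; split; first exact: smooth_derivable (smooth_four k a b dl).
by exists a, (b + dl + dl); split => //; exact: four_ramp_support.
Qed.

Definition weak1 (I : set R) u g := forall theta, test_function I theta ->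
  \int[mu]_(x in I) (u x * theta^`()%classic x) = - \int[mu]_(x in I) (g x * theta x).

Lemma cvg_four (F_ : nat -> R -> R) (F : R -> R) a b dl x :
  (forall y, F_ n y @[n --> \oo] --> F y) ->
  four (F_ n) a b dl x @[n --> \oo] --> four F a b dl x.
Proof. by move=> H; apply: cvgD; [apply: cvgB; [apply: cvgB|]|]; exact: H. Qed.

Lemma four_bound (F : R -> R) a b dl x (C : R) :
  (forall y, y \in [:: x - a; x - (a + dl); x - b; x - (b + dl)] -> `|F y| <= C) ->
  `|four F a b dl x| <= 4 * C.
Proof.
move=> H; have := H (x - a); have := H (x - (a + dl)); have := H (x - b).
have := H (x - (b + dl)); rewrite !inE !eqxx !orbT => /(_ isT) h1 /(_ isT) h2 /(_ isT) h3 /(_ isT) h4.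
rewrite /four (le_trans (ler_normD _ _))//.
rewrite (_ : 4 * C = C + C + C + C); last by ring.
apply: lerD => //; rewrite (le_trans (ler_normB _ _))// lerD//.
by rewrite (le_trans (ler_normB _ _))// lerD.
Qed.

Lemma measurable_four (F : R -> R) a b dl D : measurable D -> measurable_fun setT F ->
  measurable_fun D (four F a b dl).
Proof.
move=> mD mF; have sh c : measurable_fun D (fun x => F (x - c)).
  apply: (measurableT_comp mF); apply: measurable_funB => //.
by apply: measurable_funD => //; apply: measurable_funB => //; apply: measurable_funB.
Qed.

Lemma measurable_jump : measurable_fun setT jump.
Proof. exact: measurable_indic. Qed.

Lemma measurable_pos_part : measurable_fun setT pos_part.
Proof. exact: measurable_maxr. Qed.

Variables (a b : R) (I : set R) (u g : R -> R) (M : R).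
Hypothesis ab : a < b.

Section Identity.
Variables (dl c : R).
Hypotheses (dl0 : 0 < dl) (dlb : a + dl <= b) (cE : b + dl + dl <= c).
Hypotheses (sub : `[a, c]%classic `<=` I°) (wug : weak1 I u g).
Hypotheses (mu_ : measurable_fun `[a, c] u) (mg : measurable_fun `[a, c] g).
Hypotheses (bu : {ae mu, forall x, `[a, c]%classic x -> `|u x| <= M}).
Hypotheses (bg : {ae mu, forall x, `[a, c]%classic x -> `|g x| <= M}).

(** The definition of the weak derivative, tested with [four (ramp (k n))]; both sides converge by
    dominated convergence as the ramps sharpen. *)
Lemma trapezoid_identity :
  rint a c (fun x => u x * four jump a b dl x) =
  - rint a c (fun x => g x * four pos_part a b dl x).
Proof.
have [P' [C [DP PC P0 P1]]] := ramp_derivative.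
(* Dividing by [dl] makes each ramp exact after length [dl], so that the test function vanishes
   after [b + dl + dl]. *)
pose k (n : nat) := n.+1%:R / dl.
have k0 n : 0 < k n by rewrite divr_gt0.
have kd n : 1 <= k n * dl by rewrite /k divfK ?gt_eqF// ler1n.
have kbig y : 0 < y -> \forall n \near \oo, 1 < k n * y.
  move=> y0; have e0 : 0 < y / dl by rewrite divr_gt0.
  have [N _ HN] := near_infty_natSinv_lt (PosNum e0).
  exists N => // n Nn; have := HN n Nn; rewrite /= /k => h1.
  by rewrite mulrAC -mulrA -ltr_pdivrMl// mulr1.
have subI : `[a, c]%classic `<=` I by move=> x /sub; exact: interior_subset.
have tst n : test_function I (four (ramp (k n)) a b dl).
  apply: four_test => // x /=; rewrite in_itv/= => /andP[ax xb]; apply: sub.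
  by rewrite /= in_itv/= ax (le_trans xb).
have supp n x : ~ `[a, c]%classic x -> four (ramp (k n)) a b dl x = 0.
  move=> xI; apply: four_ramp_support => //; rewrite /= in_itv/= => /andP[ax xb].
  by apply: xI; rewrite /= in_itv/= ax (le_trans xb).
have P'0 n x : ~ `[a, c]%classic x -> four (P' (k n)) a b dl x = 0.
  move=> xI; have [xa|ax] := ltP x a.
    have z e : a <= e -> P' (k n) (x - e) = 0 by move=> ae; apply: P0 => //; lra.
    have [e1 e2 e3 e4] : [/\ P' (k n) (x - a) = 0, P' (k n) (x - (a + dl)) = 0,
        P' (k n) (x - b) = 0 & P' (k n) (x - (b + dl)) = 0].
      by have := dl0; have := ab; split; apply: z; lra.
    by rewrite /four e1 e2 e3 e4; ring.
  have [xc|cx] := ltP c x; last by exfalso; apply: xI; rewrite /= in_itv/= ax.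
  have big z : z <= b + dl -> P' (k n) (x - z) = 1.
    move=> zb; apply: P1; apply: (le_lt_trans (kd n)); rewrite ltr_pM2l//.
    by have := cE; lra.
  have [e1 e2 e3 e4] : [/\ P' (k n) (x - a) = 1, P' (k n) (x - (a + dl)) = 1,
      P' (k n) (x - b) = 1 & P' (k n) (x - (b + dl)) = 1].
    by have := dl0; have := ab; split; apply: big; lra.
  by rewrite /four e1 e2 e3 e4; ring.
have key n : rint a c (fun x => u x * four (P' (k n)) a b dl x) =
    - rint a c (fun x => g x * four (ramp (k n)) a b dl x).
  have := wug (tst n).
  rewrite (Rintegral_support subI (u := fun x => g x * _)); last first.
    by move=> x xI; rewrite supp// mulr0.
  move=> <-; rewrite -(Rintegral_support subI (u := fun x => u x * _)); last first.
    by move=> x xI; rewrite P'0// mulr0.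
  congr Rintegral; apply/funext => x; congr (_ * _); apply/esym.
  by apply: is_derive_val; apply: four_is_derive => y; exact: DP.
have mP n : measurable_fun setT (P' (k n)).
  have -> : P' (k n) = (ramp (k n))^`()%classic.
    by apply/funext => y; apply/esym/is_derive_val; exact: DP.
  apply: continuous_measurable_fun => y.
  apply/differentiable_continuous/derivable1_diffP.
  by have := @smooth_derivable _ _ (smooth_ramp (k n)) 1%N y.
have mR n : measurable_fun setT (ramp (k n)).
  apply: continuous_measurable_fun => y.
  apply/differentiable_continuous/derivable1_diffP.
  by have := @smooth_derivable _ _ (smooth_ramp (k n)) 0%N y.
have c1 : rint a c (fun x => u x * four (P' (k n)) a b dl x) @[n --> \oo] -->
    rint a c (fun x => u x * four jump a b dl x).
  apply: (rint_dominated (M := M * (4 * C))).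
  - by move=> n; apply: measurable_funM => //; apply: measurable_four.
  - by apply: measurable_funM => //; apply: measurable_four => //; exact: measurable_jump.
  - apply: aeW => x _; apply: cvgM; first exact: cvg_cst.
    apply: cvg_four => y; rewrite jumpE; have [y0|y0] := ltP 0 y.
      apply: cvg_near_cst; apply: filterS (kbig y y0) => n; exact: P1.
    by under eq_cvg do rewrite P0//; exact: cvg_cst.
  - apply: ae_mono bu => x ux n xI; rewrite normrM; apply: ler_pM => //; first exact: ux.
    by apply: four_bound => y _.
have c2 : - rint a c (fun x => g x * four (ramp (k n)) a b dl x) @[n --> \oo] -->
    - rint a c (fun x => g x * four pos_part a b dl x).
  apply: cvgN; apply: (rint_dominated (M := M * (4 * (c - a)))).
  - by move=> n; apply: measurable_funM => //; apply: measurable_four.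
  - by apply: measurable_funM => //; apply: measurable_four => //; exact: measurable_pos_part.
  - apply: aeW => x _; apply: cvgM; first exact: cvg_cst.
    apply: cvg_four => y; rewrite /pos_part; have [y0|y0] := ltP 0 y.
      by apply: cvg_near_cst; apply: filterS (kbig y y0) => n /ltW; exact: ramp_id.
    by under eq_cvg do rewrite ramp_neg//; exact: cvg_cst.
  - apply: ae_mono bg => x ux n xI; rewrite normrM; apply: ler_pM => //; first exact: ux.
    apply: four_bound => y; rewrite !inE => yE; apply: (le_trans (ramp_bound _ _)).
    move: xI; rewrite /= in_itv/= => /andP[ax xc].
    have := dl0; have := cE; have := dlb.
    by rewrite ler_norml; case/or4P : yE => /eqP ->; move=> *; apply/andP; split; lra.
move: c1; under eq_cvg do rewrite key; move=> c1.
exact: (cvg_unique (@norm_hausdorff _ _) c1 c2).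
Qed.

(** Up to single points [four jump] equals 1, 0, -1 and 0 on the successive pieces of [[a, c]]. *)
Lemma rint_four_jump :
  rint a c (fun x => u x * four jump a b dl x) =
  rint a (a + dl) u - rint b (b + dl) u.
Proof.
have iu : itg a c u by exact: ae_bounded_itg bu.
have M0 : {ae mu, forall x, `[a, c]%classic x -> `|u x * four jump a b dl x| <= M * (4 * 1)}.
  apply: ae_mono bu => x ux xI; rewrite normrM; apply: ler_pM => //; first exact: ux.
  apply: four_bound => y _; rewrite jumpE; case: (0 < y); rewrite ?normr1 ?normr0//.
have mF : measurable_fun `[a, c] (fun x => u x * four jump a b dl x).
  by apply: measurable_funM => //; apply: measurable_four => //; exact: measurable_jump.
have iF : itg a c (fun x => u x * four jump a b dl x) by exact: ae_bounded_itg M0.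
have acE : b + dl <= c by rewrite (le_trans _ cE)// lerDl ltW.
have ad : a <= a + dl by rewrite lerDl ltW.
have bd : b <= b + dl by rewrite lerDl ltW.
have ac' : a + dl <= c by rewrite (le_trans dlb)// (le_trans bd).
have bc : b <= c by exact: le_trans acE.
rewrite (rint_split ad ac' iF) (rint_split dlb bc (itg_sub ad (lexx c) iF)).
rewrite (rint_split bd acE (itg_sub (ltW ab) (lexx c) iF)).
have piece s t v : a <= s -> t <= c ->
    (forall x, s < x -> x <= t -> four jump a b dl x = v) ->
    rint s t (fun x => u x * four jump a b dl x) = v * rint s t u.
  move=> as_ tc Hv; rewrite -rintZ; last exact: itg_sub iu.
  apply/esym; apply: (itg_ae_eq _ _ _).2.
  - by apply: measurable_funM => //; exact: (itg_measurable (itg_sub as_ tc iu)).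
  - exact: itg_sub iF.
  - apply: ae_mono (ae_neq s) => x xs /=; rewrite in_itv/= => /andP[sx xt].
    by rewrite Hv 1?mulrC// lt_neqAle sx andbT; apply/eqP => e; apply: xs.
have J1 y : 0 < y -> jump y = 1 by rewrite jumpE => ->.
have J0 y : y <= 0 -> jump y = 0 by rewrite jumpE ltNge => ->.
rewrite (piece a (a + dl) 1)//; last 1 first.
  by move=> x ax xd; rewrite /four J1 ?J0 ?subr0 ?addr0//; have := dlb; lra.
rewrite (piece (a + dl) b 0)//; last 1 first.
  move=> x ax xd; rewrite /four (J1 (x - a)) ?(J1 (x - (a + dl))) ?J0; have := dl0; lra.
rewrite (piece b (b + dl) (-1)) ?(ltW ab)//; last 1 first.
  move=> x ax xd; rewrite /four (J0 (x - (b + dl))) ?J1; have := dl0; have := dlb; lra.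
rewrite (piece (b + dl) c 0) ?(le_trans (ltW ab))//; last 1 first.
  move=> x ax xd; rewrite /four !J1; have := dl0; have := dlb; lra.
by rewrite !mul0r !mul1r mulN1r addr0 add0r.
Qed.

End Identity.

Variables (dl0 : R).
Hypotheses (dl00 : 0 < dl0) (dlb : a + dl0 <= b).
Let c := b + dl0 + dl0.
Hypotheses (sub : `[a, c]%classic `<=` I°) (wug : weak1 I u g).
Hypotheses (mu_ : measurable_fun `[a, c] u) (mg : measurable_fun `[a, c] g).
Hypotheses (bu : {ae mu, forall x, `[a, c]%classic x -> `|u x| <= M}).
Hypotheses (bg : {ae mu, forall x, `[a, c]%classic x -> `|g x| <= M}).

(** To the right only, since the trapezoids produce averages over [[x, x + dl]]. *)
Definition lebesgue_point u (x ux : R) : Prop :=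
  forall e : R, 0 < e -> exists2 d : R, 0 < d & forall dl, 0 < dl -> dl < d ->
    `|rint x (x + dl) u - dl * ux| <= e * dl.

(** The trapezoid identity is divided by [dl]. As [dl] tends to 0, the averages of [u] converge to
    [ua] and [ub], and the trapezoids to the indicator of []a, b]]. *)
Lemma du_bois_reymond (ua ub : R) : lebesgue_point u a ua -> lebesgue_point u b ub ->
  ub - ua = rint a b g.
Proof.
move=> La Lb; pose dl n := dl0 / n.+1%:R.
have d0 n : 0 < dl n by rewrite divr_gt0.
have dle n : dl n <= dl0 by rewrite ler_pdivrMr// ler_peMr ?ler1n// ltW.
have dsmall d : 0 < d -> \forall n \near \oo, dl n < d.
  move=> d0'; have e0 : 0 < d / dl0 by rewrite divr_gt0.
  have [N _ HN] := near_infty_natSinv_lt (PosNum e0).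
  exists N => // n Nn; have := HN n Nn; rewrite /= /dl => h1.
  by rewrite -ltr_pdivlMl// mulrC.
have bc : b <= c by rewrite /c; have := dl00; lra.
have cn n : b + dl n + dl n <= c by rewrite /c; have := dle n; lra.
have subn n : `[a, b + dl n + dl n]%classic `<=` `[a, c]%classic.
  by move=> x /=; rewrite !in_itv/= => /andP[-> /le_trans]; apply.
have cLx x ux : lebesgue_point u x ux ->
    (dl n)^-1 * rint x (x + dl n) u @[n --> \oo] --> ux.
  move=> Lx; apply/cvgrPdist_le => e e0; have [d d0' Hd] := Lx e e0.
  apply: filterS (dsmall d d0') => n /(Hd _ (d0 n)) h.
  rewrite distrC -(ler_pM2r (d0 n)); apply: le_trans h.
  have -> : rint x (x + dl n) u - dl n * ux = ((dl n)^-1 * rint x (x + dl n) u - ux) * dl n.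
    by move: (dl n) (d0 n) => D D0; field; rewrite gt_eqF.
  by rewrite normrM (gtr0_norm (d0 n)).
have c1 : - ((dl n)^-1 * rint a (a + dl n) u - (dl n)^-1 * rint b (b + dl n) u)
    @[n --> \oo] --> - (ua - ub).
  by apply: cvgN; apply: cvgB; exact: cLx.
pose F n x := g x * ((dl n)^-1 * four pos_part a b (dl n) x).
have D1 n y : (dl n)^-1 * `|pos_part y - pos_part (y - dl n)| <= 1.
  rewrite mulrC ler_pdivrMr// mul1r /pos_part.
  have := d0 n; case: (leP y 0) => y0; case: (leP (y - dl n) 0) => y1 dn0;
    rewrite ler_norml; apply/andP; split; lra.
have fourE n x : four pos_part a b (dl n) x =
   (pos_part (x - a) - pos_part (x - a - dl n)) - (pos_part (x - b) - pos_part (x - b - dl n)).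
  by rewrite /four !opprD !addrA; ring.
have c2 : rint a c (F n) @[n --> \oo] --> rint a c (fun x => g x * (jump (x - a) - jump (x - b))).
  have DJ y : (dl n)^-1 * (pos_part y - pos_part (y - dl n)) @[n --> \oo] --> jump y.
    rewrite jumpE; have [y0|y0] := ltP 0 y.
      apply: cvg_near_cst; apply: filterS (dsmall y y0) => n yn.
      rewrite /pos_part !max_l ?subr_ge0 ?(ltW yn) ?(ltW y0)//.
      by rewrite opprB addrC subrK mulVf// gt_eqF.
    have E n : (dl n)^-1 * (pos_part y - pos_part (y - dl n)) = 0.
      by rewrite /pos_part !max_r ?subrr ?mulr0//; have := d0 n; lra.
    by under eq_cvg do rewrite E; exact: cvg_cst.
  apply: (rint_dominated (M := M * 2)).
  - move=> n; apply: measurable_funM => //; apply: measurable_funM => //.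
    by apply: measurable_four => //; exact: measurable_pos_part.
  - apply: measurable_funM => //; apply: measurable_funB;
      by apply: (measurableT_comp measurable_jump); apply: measurable_funB.
  - apply: aeW => x _; apply: cvgM; first exact: cvg_cst.
    under eq_cvg do rewrite fourE mulrBr.
    by apply: cvgB; exact: DJ.
  - apply: ae_mono bg => x gx n xI; rewrite normrM; apply: ler_pM => //; first exact: gx.
    rewrite fourE normrM gtr0_norm ?invr_gt0//.
    apply: (@le_trans _ _ ((dl n)^-1 * (`|pos_part (x - a) - pos_part (x - a - dl n)| +
      `|pos_part (x - b) - pos_part (x - b - dl n)|))).
      by rewrite ler_pM2l ?invr_gt0// ler_normB.
    by rewrite mulrDr; have := D1 n (x - a); have := D1 n (x - b); lra.
have ig : itg a c g by exact: ae_bounded_itg bg.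
have lim : rint a c (fun x => g x * (jump (x - a) - jump (x - b))) = rint a b g.
  have mF : measurable_fun `[a, c] (fun x => g x * (jump (x - a) - jump (x - b))).
    apply: measurable_funM => //; apply: measurable_funB;
      by apply: (measurableT_comp measurable_jump); apply: measurable_funB.
  have iF : itg a c (fun x => g x * (jump (x - a) - jump (x - b))).
    apply: (@ae_bounded_itg _ _ _ _ (M * 2)) => //.
    apply: ae_mono bg => x gx xI; rewrite normrM; apply: ler_pM => //; first exact: gx.
    rewrite !jumpE; case: (0 < x - a); case: (0 < x - b);
      rewrite ?subrr ?subr0 ?sub0r ?normrN ?normr0 ?normr1; lra.
  rewrite (rint_split (ltW ab) bc iF).
  have e1 : rint a b (fun x => g x * (jump (x - a) - jump (x - b))) = rint a b g.
    apply: (itg_ae_eq (itg_measurable (itg_sub (lexx a) bc iF)) (itg_sub (lexx a) bc ig) _).2.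
    apply: ae_mono (ae_neq a) => x xa /=; rewrite in_itv/= => /andP[ax xb].
    have ax' : a < x by rewrite lt_neqAle ax andbT; apply/eqP => e; apply: xa.
    by rewrite !jumpE subr_gt0 ax' subr_gt0 ltNge xb/= subr0 mulr1.
  have e2 : rint b c (fun x => g x * (jump (x - a) - jump (x - b))) = 0 * rint b c g.
    rewrite -rintZ; last exact: itg_sub (ltW ab) (lexx c) ig.
    apply/esym; apply: (itg_ae_eq _ (itg_sub (ltW ab) (lexx c) iF) _).2.
      by apply: measurable_funM => //; exact: (itg_measurable (itg_sub (ltW ab) (lexx c) ig)).
    apply: ae_mono (ae_neq b) => x xb /=; rewrite in_itv/= => /andP[bx _].
    have bx' : b < x by rewrite lt_neqAle bx andbT; apply/eqP => e; apply: xb.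
    by rewrite !jumpE !subr_gt0 bx' (lt_trans ab bx') subrr mulr0 mul0r.
  by rewrite e1 e2 mul0r addr0.
have seqE n : rint a c (F n) =
    - ((dl n)^-1 * rint a (a + dl n) u - (dl n)^-1 * rint b (b + dl n) u).
  have dbn : a + dl n <= b by have := dle n; have := dlb; lra.
  have T := trapezoid_identity (d0 n) dbn (cn n) sub wug mu_ mg bu bg.
  rewrite (rint_four_jump (d0 n) dbn (cn n) mu_ bu) in T.
  have mF : measurable_fun `[a, c] (fun x => g x * four pos_part a b (dl n) x).
    by apply: measurable_funM => //; apply: measurable_four => //; exact: measurable_pos_part.
  have iF : itg a c (fun x => g x * four pos_part a b (dl n) x).
    apply: (@ae_bounded_itg _ _ _ _ (M * (2 * dl n))) => //.
    apply: ae_mono bg => x gx xI; rewrite normrM; apply: ler_pM => //; first exact: gx.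
    rewrite fourE (le_trans (ler_normB _ _))//.
    have := D1 n (x - a); have := D1 n (x - b).
    rewrite !(mulrC (dl n)^-1) !ler_pdivrMr// !mul1r; lra.
  have -> : F n = (fun x => (dl n)^-1 * (g x * four pos_part a b (dl n) x)).
    by apply/funext => x; rewrite /F; ring.
  by rewrite rintZ// -[X in _ * X]opprK -T mulrN mulrBr.
move: c2; under eq_cvg do rewrite seqE; move=> c2.
rewrite -lim -[LHS]opprB; exact: (cvg_unique (@norm_hausdorff _ _) c1 c2).
Qed.

End DuBoisReymond.

(** * Regular representatives of Sobolev functions *)

Section WeakRegularity.
Context {R : realType}.
Local Notation mu := (@lebesgue_measure R).
Local Notation Ipos := `[(0:R)%R, +oo[%classic.

Lemma ae_dense (P : R -> Prop) (a b : R) : {ae mu, forall t, P t} -> a < b ->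
  exists t, [/\ a < t, t < b & P t].
Proof.
move=> [N [mN N0 PN]] ab; apply: contrapT => no.
have sub : `]a, b[%classic `<=` N.
  move=> t /=; rewrite in_itv/= => /andP[at_ tb]; apply: PN => Pt.
  by apply: no; exists t.
have : (mu `]a, b[%classic <= 0)%E.
  by rewrite -N0; apply: le_measure => //; rewrite inE//; exact: measurable_itv.
rewrite lebesgue_measure_itv/= lte_fin ab lee_fin subr_le0 leNgt ab.
by [].
Qed.

Lemma ae_le_continuous a b (F : R -> R) (B : R) : a < b ->
  {within `[a, b], continuous F} ->
  {ae mu, forall t, `[a, b]%classic t -> F t <= B} ->
  forall t, a <= t -> t <= b -> F t <= B.
Proof.
move=> ab cF aF t at_ tb; rewrite leNgt; apply/negP => Bt.
have e0 : 0 < F t - B by rewrite subr_gt0.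
have tI : `[a, b]%classic t by rewrite /= in_itv/= at_.
have [dl dl0 Hdl] := (within_continuous_dist _ _).1 cF t tI _ e0.
have lohi : Num.max a (t - dl) < Num.min b (t + dl).
  by rewrite lt_min !gt_max ab; apply/andP; split; apply/andP; split; lra.
have [s [s1 s2 Fs]] := ae_dense aF lohi.
move: s1 s2; rewrite gt_max lt_min => /andP[as_ ts] /andP[sb st].
have sI : `[a, b]%classic s by rewrite /= in_itv/= !ltW.
have := Hdl s sI; rewrite ltr_norml => /(_ _).
have -> : - dl < s - t < dl by apply/andP; split; lra.
by move=> /(_ isT); rewrite ltr_norml => /andP[h _]; have := Fs sI; lra.
Qed.

Lemma ae_eq_continuous a b (F G : R -> R) : a < b ->
  {within `[a, b], continuous F} -> {within `[a, b], continuous G} ->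
  {ae mu, forall t, `[a, b]%classic t -> F t = G t} ->
  forall t, a <= t -> t <= b -> F t = G t.
Proof.
move=> ab cF cG aFG t at_ tb; apply/eqP; rewrite -subr_eq0 -normr_le0.
apply: (@ae_le_continuous a b (fun t => `|F t - G t|)) => //.
  apply/subspace_continuousP => s sI; apply: cvg_norm; apply: cvgB.
    by move/subspace_continuousP : cF; exact.
  by move/subspace_continuousP : cG; exact.
by apply: ae_mono aFG => s h /h ->; rewrite subrr normr0.
Qed.

Lemma itg_pos (u : R -> R) (M s t : R) : measurable_fun Ipos u ->
  {ae mu, forall t, 0 <= t -> `|u t| <= M} -> 0 <= s -> itg s t u.
Proof.
move=> mu_ bu s0; have sub : `[s, t]%classic `<=` Ipos.
  by move=> x /=; rewrite !in_itv/= andbT => /andP[/(le_trans s0)].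
apply: (@ae_bounded_itg _ _ _ _ M); first exact: measurable_funS mu_.
apply: ae_mono bu => x ux /=; rewrite in_itv/= => /andP[sx _]; apply: ux.
exact: le_trans sx.
Qed.

(** A point where the primitive of [u] has derivative [u x] is a Lebesgue point. *)
Lemma lebesgue_point_ae (u : R -> R) (M : R) : measurable_fun Ipos u ->
  {ae mu, forall t, 0 <= t -> `|u t| <= M} ->
  {ae mu, forall x, 0 < x -> lebesgue_point u x (u x)}.
Proof.
move=> mu_ bu; have iu s t : 0 <= s -> itg s t u by exact: itg_pos bu.
have H n : {ae mu, forall x : R, 0 < x < n.+1%:R -> is_derive x 1 (fun t => rint 0 t u) (u x)}.
  apply: (primitive_ae_derive (u := fun t => rint 0 t u) (ltr0Sn _ n) (iu 0 _ (lexx 0))).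
  by move=> x x0 xn; rewrite rint_point subr0.
have := ae_foralln H; apply: ae_mono => x Hx x0 e e0.
have := Hx (Num.bound x); rewrite x0 (lt_trans (archi_boundP (ltW x0))) ?ltr_nat// => /(_ isT).
move=> /(is_derive_has_derivative_in setT)/has_derivative_in_dist/(_ e e0)[d d0 Hd].
exists d => // dl dl0 dld; have := Hd (x + dl) I; rewrite addrC addKr gtr0_norm// => /(_ dld).
have xd : x <= x + dl by rewrite lerDl ltW.
rewrite (rint_split (ltW x0) xd (iu 0 _ (lexx 0))).
by rewrite (addrC (rint 0 x u)) addrK.
Qed.

Lemma interior_pos (a c : R) : 0 < a -> `[a, c]%classic `<=` (Ipos : set R)°.
Proof.
move=> a0 x /=; rewrite in_itv/= => /andP[ax _].
have x0 : 0 < x by exact: lt_le_trans ax.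
apply/nbhs_ballP; exists x => // y; rewrite /ball/= ltr_norml => /andP[_ h].
by rewrite in_itv/= andbT; lra.
Qed.

(** [z] is the primitive of [g] that equals [u] at one Lebesgue point; by [du_bois_reymond] it then
    equals [u] at every positive Lebesgue point. *)
Lemma weak1_representative (u g : R -> R) (M : R) :
  measurable_fun Ipos u -> measurable_fun Ipos g ->
  {ae mu, forall t, 0 <= t -> `|u t| <= M} -> {ae mu, forall t, 0 <= t -> `|g t| <= M} ->
  weak1 Ipos u g ->
  exists z : R -> R, (forall s t, 0 <= s -> s <= t -> z t - z s = rint s t g) /\
    {ae mu, forall t, 0 <= t -> z t = u t}.
Proof.
move=> mu_ mg bu bg wug; have lp := lebesgue_point_ae mu_ bu.
have iu s t : 0 <= s -> itg s t u by exact: itg_pos bu.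
have ig s t : 0 <= s -> itg s t g by exact: itg_pos bg.
have key a b : 0 < a -> a < b -> lebesgue_point u a (u a) -> lebesgue_point u b (u b) ->
    u b - u a = rint a b g.
  move=> a0 ab la lb; have d0 : 0 < b - a by rewrite subr_gt0.
  have sub : `[a, b + (b - a) + (b - a)]%classic `<=` Ipos.
    by move=> x /=; rewrite !in_itv/= andbT => /andP[/(le_trans (ltW a0))].
  apply: (@du_bois_reymond _ a b Ipos u g M ab (b - a) d0 _ _ wug) => //.
  - by rewrite addrC subrK.
  - exact: interior_pos.
  - exact: measurable_funS mu_.
  - exact: measurable_funS mg.
  - by apply: ae_mono bu => x h /sub; rewrite /= in_itv/= andbT.
  - by apply: ae_mono bg => x h /sub; rewrite /= in_itv/= andbT.
have [a [a0 _ /(_ a0) la]] := ae_dense lp (@ltr01 R).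
pose z t := u a + (rint 0 t g - rint 0 a g).
have zE s t : 0 <= s -> s <= t -> z t - z s = rint s t g.
  by move=> s0 st; rewrite /z (rint_split s0 st (ig 0 t (lexx 0))); ring.
exists z; split => //.
have := ae_and lp (ae_neq 0); apply: ae_mono => t [lt tn] t0.
have t0' : 0 < t by rewrite lt_neqAle t0 andbT; apply/eqP => e; apply: tn.
have za : z a = u a by rewrite /z subrr addr0.
have [ta|ta|->//] := ltgtP t a.
- have := key t a t0' ta (lt t0') la; rewrite -(zE t a t0 (ltW ta)) za.
  by move=> /addrI/oppr_inj.
- have := key a t a0 ta la (lt t0'); rewrite -(zE a t (ltW a0) (ltW ta)) za.
  by move=> /addIr.
Qed.

Lemma derive1_support (theta : R -> R) a b :
  (forall x, ~ `[a, b]%classic x -> theta x = 0) ->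
  forall x, ~ `[a, b]%classic x -> theta^`()%classic x = 0.
Proof.
move=> th0 x xab.
have [dl dl0 Hdl] : exists2 dl : R, 0 < dl & forall s, `|s - x| < dl -> ~ `[a, b]%classic s.
  have [xa|ax] := ltP x a.
    exists (a - x); first by rewrite subr_gt0.
    move=> s; rewrite ltr_norml => /andP[_ h] /=; rewrite in_itv/= => /andP[as_ _]; lra.
  have [bx|xb] := ltP b x; last by exfalso; apply: xab; rewrite /= in_itv/= ax.
  exists (x - b); first by rewrite subr_gt0.
  move=> s; rewrite ltr_norml => /andP[h _] /=; rewrite in_itv/= => /andP[_ sb]; lra.
apply: is_derive_val; apply: is_derive_dist => e e0; exists dl => // s sx.
rewrite !th0 ?subrr ?mulr0 ?subrr ?normr0 ?mulr_ge0 ?(ltW e0)//.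
exact: Hdl.
Qed.

Lemma test_function_derive (I : set R) theta : test_function I theta ->
  test_function I theta^`()%classic.
Proof.
move=> [dth [a [b [abI th0]]]]; split => [k x|].
  by have := dth k.+1 x; rewrite derive1Sn.
by exists a, b; split => //; exact: derive1_support.
Qed.

(** The derivative of a test function is a test function. Testing the derivative of order [i] with
    it reduces higher weak derivatives to a chain of first-order ones. *)
Lemma weak_derivative_step n (I : set R) (g G G' : R -> 'rV[R]_n) i j :
  weak_derivative I i g G -> weak_derivative I i.+1 g G' ->
  weak1 I (fun x => G x 0 j) (fun x => G' x 0 j).
Proof.
move=> wG wG' theta th.
have := wG _ (test_function_derive th) j; have := wG' _ th j.
rewrite -derive1Sn => -> /esym; rewrite exprS -mulrA mulN1r => h.
by apply: (@mulfI _ ((-1) ^+ i)); [rewrite expf_neq0// oppr_eq0 oner_eq0|rewrite h mulrN].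
Qed.

Lemma Linfty_pos n (G : R -> 'rV[R]_n) : Linfty Ipos G ->
  (forall j, measurable_fun Ipos (fun t => G t 0 j)) /\
  exists2 B : R, 0 <= B & {ae mu, forall t, 0 <= t -> enorm (G t) <= B}.
Proof.
move=> [mG /ess_sup_norm_lty[B B0 HB]]; split; first exact: mG.
by exists B => //; apply: ae_mono HB => t h t0; apply: h; rewrite /= in_itv/= andbT.
Qed.

(** Each weak derivative of order below [r] has a Lipschitz representative [Z i]. Relations known
    almost everywhere then hold everywhere by continuity, including the equality with the continuous
    [yref]. *)
Lemma Sobolev_representatives n r (yref : R -> 'rV[R]_n) : (0 < r)%N ->
  Sobolev_infty Ipos r yref -> {within Ipos, continuous yref} ->
  exists (Z : nat -> R -> 'rV[R]_n) (B : R), [/\ 0 <= B,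
    forall t, 0 <= t -> Z 0%N t = yref t,
    forall i, (i < r)%N -> forall t, 0 <= t -> enorm (Z i t) <= B,
    forall i, (i < r)%N -> forall s t, 0 <= s -> s <= t -> enorm (Z i t - Z i s) <= n%:R * B * (t - s) &
    forall i, (i.+1 < r)%N -> forall s t, 0 <= s -> s <= t -> forall j,
      Z i t 0 j - Z i s 0 j = rint s t (fun u => Z i.+1 u 0 j)].
Proof.
move=> r0 [G [G0 HG]] cy.
have GB i : (i <= r)%N -> exists2 B : R, 0 <= B & {ae mu, forall t, 0 <= t -> enorm (G i t) <= B}.
  by move=> ir; have [/Linfty_pos[]] := HG i ir.
have [B B0 HB] : exists2 B : R, 0 <= B & forall i, (i <= r)%N ->
    {ae mu, forall t, 0 <= t -> enorm (G i t) <= B}.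
  suff : forall k, (k <= r)%N -> exists2 B : R, 0 <= B & forall i, (i <= k)%N ->
      {ae mu, forall t, 0 <= t -> enorm (G i t) <= B} by move=> /(_ r (leqnn r)).
  elim=> [_|k ih kr].
    by have [B B0 HB] := GB 0%N (leq0n r); exists B => // i; rewrite leqn0 => /eqP ->.
  have [B1 B10 H1] := ih (ltnW kr); have [B2 B20 H2] := GB k.+1 kr.
  exists (Num.max B1 B2); first by rewrite le_max B10.
  move=> i; rewrite leq_eqVlt => /predU1P[->|ik].
    by apply: ae_mono H2 => t h t0; rewrite le_max h ?orbT.
  by apply: ae_mono (H1 i ik) => t h t0; rewrite le_max h.
have HBj i j : (i <= r)%N -> {ae mu, forall t, 0 <= t -> `|G i t 0 j| <= B}.
  move=> ir; apply: ae_mono (HB i ir) => t h t0.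
  by rewrite (le_trans (coord_le_norm _ _))// (le_trans (norm_le_enorm _))// h.
have mG i j : (i <= r)%N -> measurable_fun Ipos (fun t => G i t 0 j).
  by move=> ir; have [/Linfty_pos[+ _] _] := HG i ir; apply.
have rep i j : exists z : R -> R, (i < r)%N ->
    (forall s t, 0 <= s -> s <= t -> z t - z s = rint s t (fun x => G i.+1 x 0 j)) /\
    {ae mu, forall t, 0 <= t -> z t = G i t 0 j}.
  have [ir|ri] := ltnP i r; last by exists (fun=> 0).
  have ir' := ltnW ir.
  have w1 := weak_derivative_step j (HG i ir').2 (HG i.+1 ir).2.
  have [z Hz] := weak1_representative (mG i j ir') (mG i.+1 j ir) (HBj i j ir') (HBj i.+1 j ir) w1.
  by exists z.
have [z0 Hz0] := choice (fun ij : nat * 'I_n => rep ij.1 ij.2).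
pose Z i t : 'rV[R]_n := \row_j z0 (i, j) t.
have Zprim i j s t : (i < r)%N -> 0 <= s -> s <= t ->
    Z i t 0 j - Z i s 0 j = rint s t (fun x => G i.+1 x 0 j).
  by move=> ir s0 st; rewrite !mxE; exact: (Hz0 (i, j) ir).1.
have Zae i j : (i < r)%N -> {ae mu, forall t, 0 <= t -> Z i t 0 j = G i t 0 j}.
  by move=> ir; apply: ae_mono (Hz0 (i, j) ir).2 => t h t0; rewrite mxE h.
have Zlip i s t : (i < r)%N -> 0 <= s -> s <= t -> `|Z i t - Z i s| <= B * (t - s).
  move=> ir s0 st; apply: norm_le_coord; first by rewrite mulr_ge0// subr_ge0.
  move=> j; have := Zprim i j s t ir s0 st; rewrite !mxE => ->.
  apply: rint_abs_le => //; first exact: itg_pos (mG i.+1 j ir) (HBj i.+1 j ir) s0.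
  apply: ae_mono (HBj i.+1 j ir) => x h /=; rewrite in_itv/= => /andP[sx _].
  by apply: h; exact: le_trans sx.
have Zcont i j b : (i < r)%N -> {within `[(0:R)%R, b], continuous (fun t => Z i t 0 j)}.
  move=> ir; apply: AC_continuous; apply: (lipschitz_AC B0) => s t s0 st _.
  have := Zlip i s t ir s0 st; apply: le_trans.
  by have := coord_le_norm (Z i t - Z i s) j; rewrite !mxE.
exists Z, B; split => //.
- move=> t t0; apply/rowP => j; have t1 : 0 < t + 1 by rewrite ltr_wpDl.
  apply: (@ae_eq_continuous 0 (t + 1) (fun t => Z 0%N t 0 j) (fun t => yref t 0 j)) => //.
  + exact: Zcont.
  + apply/subspace_continuousP => s sI; apply: cvg_to_coord.
    have : {within `[(0:R)%R, (t + 1)%R], continuous yref}.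
      apply: continuous_subspaceW cy => x /=; rewrite !in_itv/= andbT.
      by move=> /andP[].
    by move/subspace_continuousP; exact.
  + apply: ae_mono (Zae 0%N j r0) => s h /=; rewrite in_itv/= => /andP[s0 _].
    by rewrite h// G0.
  + by rewrite lerDl.
- move=> i ir t t0; have t1 : 0 < t + 1 by rewrite ltr_wpDl.
  apply: (@ae_le_continuous 0 (t + 1) (fun t => enorm (Z i t))) => //.
  + apply/subspace_continuousP => s sI; apply: cvg_enorm; apply: cvg_coord => j.
    by have /subspace_continuousP := Zcont i j (t + 1) ir; exact.
  + have aZ : {ae mu, forall t, forall j : 'I_n, 0 <= t -> Z i t 0 j = G i t 0 j}.
      by apply: filter_forall => j; exact: Zae.
    have := ae_and aZ (HB i (ltnW ir)); apply: ae_mono => s [h1 h2] /=.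
    rewrite in_itv/= => /andP[s0 _].
    have -> : Z i s = G i s by apply/rowP => j; exact: h1.
    exact: h2.
  + by rewrite lerDl.
- move=> i ir s t s0 st; rewrite (le_trans (enorm_le_norm _))// -mulrA ler_wpM2l//.
  exact: Zlip.
- move=> i ir s t s0 st j; rewrite (Zprim i j s t (ltnW ir) s0 st).
  have iZ : itg s t (fun x => Z i.+1 x 0 j).
    apply: (@itg_sub _ 0 t) => //; apply: continuous_itg; exact: Zcont.
  apply: (itg_ae_eq (itg_measurable _) iZ _).2.
    exact: itg_pos (mG i.+1 j (ltnW ir)) (HBj i.+1 j (ltnW ir)) s0.
  apply: ae_mono (Zae i.+1 j ir) => x h /=; rewrite in_itv/= => /andP[sx _].
  by apply: h; exact: le_trans sx.
Qed.

Local Notation yr k yref := (derive_in_n `[(0:R)%R, +oo[ k yref).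

Lemma itv_pos_sub (a b : R) : 0 <= a -> `[a, b]%classic `<=` Ipos.
Proof. by move=> a0 x /=; rewrite !in_itv/= andbT => /andP[/(le_trans a0)]. Qed.

Lemma reference_facts n r (yref : R -> 'rV[R]_n) : (0 < r)%N ->
  Sobolev_infty Ipos r yref -> {within Ipos, continuous yref} ->
  [/\ forall k, (k < r)%N -> {within Ipos, continuous (yr k yref)},
      forall k, (k.+1 < r)%N -> forall x : R, 0 <= x ->
        has_derivative_in Ipos (yr k yref) x (yr k.+1 yref x),
      exists2 B : R, 0 <= B & forall k, (k < r)%N -> forall t : R, 0 <= t ->
        enorm (yr k yref t) <= B &
      exists2 B : R, 0 <= B & forall s t : R, 0 <= s -> s <= t ->
        enorm (yr r.-1 yref t - yr r.-1 yref s) <= B * (t - s)].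
Proof.
move=> r0 sy cy; have [Z [B [B0 Z0 ZB Zlip Zp]]] := Sobolev_representatives r0 sy cy.
have K0 : 0 <= n%:R * B by rewrite mulr_ge0.
have Zc i j b : (i < r)%N -> {within `[(0:R)%R, b], continuous (fun t => Z i t 0 j)}.
  move=> ir; apply: AC_continuous; apply: (lipschitz_AC K0) => s t s0 st _.
  have := Zlip i ir s t s0 st; apply: le_trans; apply: le_trans (norm_le_enorm _).
  by have := coord_le_norm (Z i t - Z i s) j; rewrite !mxE.
have ZD i x : (i.+1 < r)%N -> 0 <= x -> has_derivative_in Ipos (Z i) x (Z i.+1 x).
  move=> ir x0; apply/has_derivative_in_coord => j.
  have x1 : x < x + 1 by rewrite ltrDl.
  have x01 : 0 <= x <= x + 1 by rewrite x0 ltW.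
  have xI : `[(0:R)%R, (x + 1)%R]%classic x by rewrite /= in_itv.
  have c1 := Zc i.+1 j (x + 1) ir.
  have D := primitive_has_derivative (u := fun t => Z i t 0 j) x01 (continuous_itg c1)
    (fun s t s0 st _ => Zp i ir s t s0 st j).
  have /D : forall e : R, 0 < e -> exists2 d : R, 0 < d & forall y, 0 <= y <= x + 1 ->
      `|y - x| < d -> `|Z i.+1 y 0 j - Z i.+1 x 0 j| < e.
    move=> e e0; have [dl dl0 Hdl] := (within_continuous_dist _ _).1 c1 x xI e e0.
    by exists dl => // y yI; apply: Hdl; rewrite /= in_itv.
  apply: (has_derivative_in_local (d := 1)) => // s; rewrite ltr_norml => /andP[_ h] /=.
  by rewrite !in_itv/= andbT => s0; split => //; rewrite s0; lra.
have yrE k x : (k < r)%N -> 0 <= x -> yr k yref x = Z k x.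
  elim: k x => [|k ih] x kr x0; first by rewrite Z0.
  rewrite -[LHS]/(derive_in Ipos (yr k yref) x).
  have -> : derive_in Ipos (yr k yref) x = derive_in Ipos (Z k) x.
    apply: (derive_in_local (d := 1)) => //; first by apply: ih => //; exact: ltnW.
    move=> s _; split => //=; rewrite in_itv/= andbT => s0; apply: ih => //.
    exact: ltnW.
  apply: (@derive_inE _ _ _ (Z k) x (x + 1)); rewrite ?ltrDl ?lexx ?lerDl ?ler01//.
    exact: itv_pos_sub.
  exact: ZD.
split.
- move=> k kr; apply: within_continuous_local => x /=; rewrite in_itv/= andbT => x0.
  exists `[(0:R)%R, (x + 1)%R]%classic, (Z k), 1; split => //.
  + by rewrite /= in_itv/= x0 lerDl ler01.
  + by apply/subspace_continuousP => s sI; apply: cvg_coord => j;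
      have /subspace_continuousP := Zc k j (x + 1) kr; exact.
  + move=> y; rewrite in_itv/= andbT => y0; rewrite ltr_norml => /andP[_ h].
    by split; [rewrite in_itv/= y0; lra|rewrite yrE].
- move=> k kr x x0; rewrite yrE//.
  have := ZD k x kr x0; apply: (has_derivative_in_local (d := 1)) => //.
    by rewrite yrE// ltnW.
  by move=> s _ sI; split => //; rewrite yrE 1?ltnW//; move: sI; rewrite /= in_itv/= andbT.
- by exists B => // k kr t t0; rewrite yrE// ZB.
- exists (n%:R * B) => // s t s0 st.
  have rr : (r.-1 < r)%N by rewrite ltn_predL.
  by rewrite !yrE ?(le_trans s0)// Zlip.
Qed.

End WeakRegularity.

Section SobolevPrimitives.
Context {R : realType}.
Local Notation mu := (@lebesgue_measure R).

(** The enlarged interval has end points outside [[a, b]], where a test function supported there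
    vanishes. *)
Lemma interval_of_test (I : set R) a b : a <= b -> `[a, b]%classic `<=` I° ->
  exists a' b', [/\ a' < a, b < b' & `[a', b']%classic `<=` I].
Proof.
move=> ab sub.
have aI : `[a, b]%classic a by rewrite /= in_itv/= lexx.
have bI : `[a, b]%classic b by rewrite /= in_itv/= ab lexx.
have /nbhs_ballP[e1 /= e10 H1] := sub a aI; have /nbhs_ballP[e2 /= e20 H2] := sub b bI.
exists (a - e1 / 2), (b + e2 / 2); split.
- by rewrite ltrBlDr ltrDl divr_gt0.
- by rewrite ltrDl divr_gt0.
- move=> x /=; rewrite in_itv/= => /andP[ax xb].
  have [xa|ax'] := ltP x a.
    by apply: H1; rewrite /ball/= ger0_norm ?subr_ge0 ?(ltW xa)//; lra.
  have [bx|xb'] := ltP b x.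
    by apply: H2; rewrite /ball/= ltr0_norm ?subr_lt0//; lra.
  by apply: interior_subset; apply: sub; rewrite /= in_itv/= ax'.
Qed.

Lemma test_function_continuous (I : set R) (theta : R -> R) : test_function I theta ->
  continuous theta /\ continuous theta^`()%classic.
Proof.
move=> [dth _]; split => x; apply/differentiable_continuous/derivable1_diffP.
- by have := dth 0%N x.
- by have := dth 1%N x.
Qed.

Variables (I : set R) (mI : measurable I).

(** Integration by parts: on an interval slightly larger than the support [u] is Lipschitz, so its
    product with [theta] is absolutely continuous, and the boundary terms vanish. *)
Lemma weak_parts (u g : R -> R) (M : R) : measurable_fun I g ->
  {ae mu, forall t, I t -> `|g t| <= M} ->
  (forall s t, s <= t -> `[s, t]%classic `<=` I -> u t - u s = rint s t g) ->
  weak1 I u g.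
Proof.
move=> mg bg ug theta th; have [cth cth'] := test_function_continuous th.
have [dth [a [b [abI th0]]]] := th; have th'0 := derive1_support th0.
(* The interval in [test_function] may be empty; then [theta] is 0. *)
have ab0 (v : R -> R) : (forall x, ~ `[a, b]%classic x -> v x = 0) ->
    b < a -> \int[mu]_(x in I) v x = 0.
  move=> v0 ba; have E : `[a, b]%classic = set0 :> set R by rewrite set_itv_ge// bnd_simp -ltNge.
  rewrite (@Rintegral_support _ I a b v) ?E//; last by move=> x _; apply: v0; rewrite E.
  by rewrite /rint E /Rintegral integral_set0.
have [ba|ab] := ltP b a.
  rewrite !ab0 ?oppr0//.
    by move=> x xab; rewrite th0// mulr0.
  by move=> x xab; rewrite th'0// mulr0.
have [a' [b' [aa bb sub]]] := interval_of_test ab abI.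
have ab' : a' < b' by rewrite (lt_trans aa)// (le_lt_trans ab).
have out x : ~ `[a', b']%classic x -> ~ `[a, b]%classic x.
  move=> H /=; rewrite in_itv/= => /andP[ax xb]; apply: H; rewrite /= in_itv/=.
  by rewrite (le_trans (ltW aa) ax) (le_trans xb (ltW bb)).
rewrite (Rintegral_support sub (u := fun x => u x * _)); last first.
  by move=> x /out xab; rewrite th'0// mulr0.
rewrite (Rintegral_support sub (u := fun x => g x * _)); last first.
  by move=> x /out xab; rewrite th0// mulr0.
have subst_ s t : a' <= s -> t <= b' -> `[s, t]%classic `<=` I.
  move=> as_ tb x /=; rewrite in_itv/= => /andP[sx xt]; apply: sub.
  by rewrite /= in_itv/= (le_trans as_)// (le_trans xt).
have mg' : measurable_fun `[a', b'] g by exact: measurable_funS mg.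
have bg' : {ae mu, forall t, `[a', b']%classic t -> `|g t| <= M}.
  by apply: ae_mono bg => t h /sub.
have ig : itg a' b' g by exact: ae_bounded_itg bg'.
have M0 : 0 <= M.
  have [t [t1 t2 h]] := ae_dense bg' ab'.
  by rewrite (le_trans (normr_ge0 (g t)))// h//= in_itv/= !ltW.
have uL s t : a' <= s -> s <= t -> t <= b' -> `|u t - u s| <= M * (t - s).
  move=> as_ st tb; rewrite (ug s t st (subst_ s t as_ tb)).
  apply: rint_abs_le => //; first exact: itg_sub ig.
  by apply: ae_mono bg' => x h /=; rewrite in_itv/= => /andP[sx xt]; apply: h;
    rewrite /= in_itv/= (le_trans as_)// (le_trans xt).
have cu : {within `[a', b'], continuous u} by apply: AC_continuous; exact: lipschitz_AC uL.
have [Bu Bu0 HBu] := within_bounded cu.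
have cth1 : {within `[a', b'], continuous theta} by exact: continuous_subspaceT.
have cth2 : {within `[a', b'], continuous theta^`()%classic} by exact: continuous_subspaceT.
have [Bt Bt0 HBt] := within_bounded cth1; have [Bd Bd0 HBd] := within_bounded cth2.
have dth0 (x : R) : is_derive x 1 theta (theta^`()%classic x).
  by apply: DeriveDef; [have := dth 0%N x|rewrite derive1E].
have tL s t : a' <= s -> s <= t -> t <= b' -> `|theta t - theta s| <= Bd * (t - s).
  move=> as_ st tb; rewrite (derivative_primitive (u := theta) (g := theta^`()%classic) st).
  - apply: rint_abs_le => //; first by apply: continuous_itg; exact: continuous_subspaceT.
    by apply: aeW => x /=; rewrite in_itv/= => /andP[sx xt]; apply: HBd;
      [exact: le_trans sx|exact: le_trans tb].
  - exact: continuous_subspaceT.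
  - by move=> x _; exact: is_derive_has_derivative_in.
have pAC : absolutely_continuous a' b' (fun x => u x * theta x).
  have K0 : 0 <= Bu * Bd + M * Bt by rewrite addr_ge0 ?mulr_ge0.
  apply: (lipschitz_AC K0) => s t as_ st tb.
  rewrite (_ : _ - _ = u t * (theta t - theta s) + (u t - u s) * theta s); last by ring.
  rewrite (le_trans (ler_normD _ _))// [leRHS]mulrDl; apply: lerD; rewrite normrM.
    rewrite -mulrA; apply: ler_pM => //; last exact: tL.
    by apply: HBu => //; exact: le_trans st.
  rewrite mulrAC; apply: ler_pM => //; first exact: uL.
  by apply: HBt => //; exact: le_trans tb.
pose H x := u x * theta^`()%classic x + g x * theta x.
have mu1 : measurable_fun `[a', b'] u by exact: subspace_continuous_measurable_fun.
have i1 : itg a' b' (fun x => u x * theta^`()%classic x).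
  apply: continuous_itg; apply/subspace_continuousP => x xI; apply: cvgM.
    by move/subspace_continuousP : cu; exact.
  by move/subspace_continuousP : cth2; exact.
have i2 : itg a' b' (fun x => g x * theta x).
  apply: (@ae_bounded_itg _ _ _ _ (M * Bt)).
    by apply: measurable_funM => //; exact: subspace_continuous_measurable_fun.
  apply: ae_mono bg' => x gx xI; rewrite normrM; apply: ler_pM => //; first exact: gx.
  by move: xI; rewrite /= in_itv/= => /andP[ax xb]; exact: HBt.
have iH : itg a' b' H by exact: itgD.
have aeu := primitive_ae_derive (u := u) ab' ig
  (fun x ax xb => ug a' x ax (subst_ a' x (lexx a') xb)).
have key : {ae mu, forall x : R, a' < x < b' -> forall l,
    is_derive x 1 (fun x => u x * theta x) l -> l = H x}.
  apply: ae_mono aeu => x Du axb l Dl.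
  have e1 : 'D_1 (fun x => u x * theta x) x = l by exact: derive_val.
  have D2 := is_deriveM (Du axb) (dth0 x).
  have e2 : 'D_1 (fun x => u x * theta x) x = u x * theta^`()%classic x + theta x * g x.
    by exact: derive_val.
  by rewrite -e1 e2 /H (mulrC (theta x)).
have [_ /(_ a' b' (lexx _) (ltW ab') (lexx _))] :=
  AC_is_derive_primitive ab' pAC (itg_measurable iH) key.
have za : theta a' = 0.
  by apply: th0; rewrite /= in_itv/= => /andP[]; rewrite leNgt aa.
have zb : theta b' = 0.
  by apply: th0; rewrite /= in_itv/= => /andP[_]; rewrite leNgt bb.
by rewrite za zb !mulr0 subrr rintD// => /esym/eqP; rewrite addr_eq0 => /eqP.
Qed.

Lemma weak_derivative_iter n (Y : nat -> R -> 'rV[R]_n) k :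
  (forall i, (i < k)%N -> forall j, weak1 I (fun t => Y i t 0 j) (fun t => Y i.+1 t 0 j)) ->
  forall i, (i <= k)%N -> weak_derivative I i (Y 0%N) (Y i).
Proof.
move=> Yw; elim=> [_|i ih ik] theta th j; first by rewrite expr0 mul1r.
rewrite derive1Sn (ih (ltnW ik) _ (test_function_derive th)) (Yw i ik j _ th).
by rewrite mulrN exprS mulN1r mulNr.
Qed.

Lemma Sobolev_of_primitives n (Y : nat -> R -> 'rV[R]_n) k :
  (forall i, (i <= k)%N -> vmeasurable I (Y i) /\
     exists2 B : R, 0 <= B & {ae mu, forall t, I t -> enorm (Y i t) <= B}) ->
  (forall i, (i < k)%N -> forall s t, s <= t -> `[s, t]%classic `<=` I -> forall j,
     Y i t 0 j - Y i s 0 j = rint s t (fun x => Y i.+1 x 0 j)) ->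
  Sobolev_infty I k (Y 0%N).
Proof.
move=> YB Yp; exists Y; split => // i ik; split.
  have [mY [B B0 HB]] := YB i ik; split => //.
  by apply: (le_lt_trans (le_ess_sup_norm B0 HB)); rewrite ltry.
apply: (weak_derivative_iter (k := k)) => // {}i {}ik j.
have [mY [B B0 HB]] := YB i.+1 ik.
apply: (weak_parts (M := B)); first exact: mY.
- apply: ae_mono HB => t h It; rewrite (le_trans (coord_le_norm _ _))//.
  by rewrite (le_trans (norm_le_enorm _))// h.
- by move=> s t st sub; exact: Yp.
Qed.

End SobolevPrimitives.

Section ContinuousWeakDerivative.
Context {R : realType}.
Local Notation mu := (@lebesgue_measure R).

Lemma continuous_lebesgue_point (A B : R) (u : R -> R) x :
  {within `[A, B], continuous u} -> A < x -> x < B -> lebesgue_point u x (u x).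
Proof.
move=> cu Ax xB e e0.
have xI : `[A, B]%classic x by rewrite /= in_itv/= !ltW.
have [d d0 Hd] := (within_continuous_dist _ _).1 cu x xI e e0.
exists (Num.min d (B - x)); first by rewrite lt_min d0 subr_gt0.
move=> dl dl0; rewrite lt_min => /andP[dld dlB].
have xd : x <= x + dl by rewrite lerDl ltW.
have xdB : x + dl <= B by lra.
have iu : itg x (x + dl) u by apply: (itg_sub (ltW Ax) xdB); exact: continuous_itg.
have E : dl * u x = rint x (x + dl) (fun=> u x) by rewrite rint_cst//; ring.
rewrite E -rintB//; last exact: itg_cst.
rewrite (_ : e * dl = e * (x + dl - x)); last by ring.
apply: rint_abs_le => //; first by apply: itgB => //; exact: itg_cst.
apply: aeW => t /=; rewrite in_itv/= => /andP[xt td]; apply/ltW/Hd.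
  by rewrite /= in_itv/= (le_trans (ltW Ax) xt) (le_trans td).
by rewrite ger0_norm ?subr_ge0//; lra.
Qed.

(** Every interior point is a Lebesgue point of a continuous [u], which settles the open interval;
    continuity of both sides adds the end points. *)
Lemma weak1_continuous_primitive (A B : R) (u g : R -> R) (M : R) : A < B ->
  {within `[A, B], continuous u} -> measurable_fun `[A, B] g ->
  {ae mu, forall t, `[A, B]%classic t -> `|g t| <= M} ->
  weak1 `[A, B]%classic u g ->
  forall s t, A <= s -> s <= t -> t <= B -> u t - u s = rint s t g.
Proof.
move=> AB cu mg bg wug.
have [M' M'0 HM'] := within_bounded cu.
pose K := Num.max M M'.
have bu' : {ae mu, forall t, `[A, B]%classic t -> `|u t| <= K}.
  apply: aeW => t /=; rewrite in_itv/= => /andP[At tB].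
  by rewrite le_max HM' ?orbT.
have bg' : {ae mu, forall t, `[A, B]%classic t -> `|g t| <= K}.
  by apply: ae_mono bg => t h It; rewrite le_max h.
have mu_ : measurable_fun `[A, B] u by exact: subspace_continuous_measurable_fun.
have ig : itg A B g by exact: ae_bounded_itg bg.
have key a b : A < a -> a < b -> b < B -> u b - u a = rint a b g.
  (* One third leaves room for [b + d0 + d0 < B]. *)
  move=> Aa ab bB; pose d0 := Num.min (b - a) ((B - b) / 3).
  have d00 : 0 < d0 by rewrite lt_min subr_gt0 ab divr_gt0// subr_gt0.
  have d1 : d0 <= b - a by rewrite ge_min lexx.
  have d2 : d0 <= (B - b) / 3 by rewrite ge_min lexx orbT.
  have cB : b + d0 + d0 < B by lra.
  have sub : `[a, b + d0 + d0]%classic `<=` `[A, B]%classic.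
    move=> x /=; rewrite !in_itv/= => /andP[ax xc].
    by rewrite (le_trans (ltW Aa) ax) (le_trans xc (ltW cB)).
  apply: (@du_bois_reymond _ a b `[A, B]%classic u g K ab d0 d00 _ _ wug).
  - by lra.
  - move=> x /=; rewrite in_itv/= => /andP[ax xc].
    have e0 : 0 < Num.min (x - A) (B - x) by rewrite lt_min !subr_gt0; apply/andP; split; lra.
    apply/nbhs_ballP; exists (Num.min (x - A) (B - x)) => // y.
    rewrite /ball/= lt_min !ltr_norml => /andP[/andP[h1 h2] /andP[h3 h4]].
    by rewrite in_itv/=; apply/andP; split; lra.
  - exact: measurable_funS mu_.
  - exact: measurable_funS mg.
  - by apply: ae_mono bu' => x h /sub.
  - by apply: ae_mono bg' => x h /sub.
  - by apply: (continuous_lebesgue_point cu) => //; exact: lt_trans bB.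
  - by apply: (continuous_lebesgue_point cu) => //; exact: lt_trans ab.
pose c := (A + B) / 2.
have Ac : A < c by rewrite /c; lra.
have cB : c < B by rewrite /c; lra.
pose G t := u c + (rint A t g - rint A c g).
have GE s t : A <= s -> s <= t -> t <= B -> G t - G s = rint s t g.
  by move=> As st tB; rewrite /G (rint_split As st (itg_sub (lexx A) tB ig)); ring.
have uG : forall t, A <= t -> t <= B -> u t = G t.
  apply: (ae_eq_continuous AB cu).
    apply/subspace_continuousP => s sI; apply: cvgD; first exact: cvg_cst.
    apply: cvgB; last exact: cvg_cst.
    by have /subspace_continuousP := parameterized_integral_continuous (ltW AB) ig; exact.
  have := ae_and (ae_neq A) (ae_neq B); apply: ae_mono => t [tA tB] /=.
  rewrite in_itv/= => /andP[At tB'].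
  have At' : A < t by rewrite lt_neqAle At andbT; apply/eqP => e; apply: tA.
  have tB'' : t < B by rewrite lt_neqAle tB' andbT; apply/eqP.
  have Gc : G c = u c by rewrite /G subrr addr0.
  have [tc|ct|->//] := ltgtP t c.
  - have := key t c At' tc cB; rewrite -(GE t c At (ltW tc) (ltW cB)) Gc.
    by move=> /addrI/oppr_inj.
  - have := key c t Ac ct tB''; rewrite -(GE c t (ltW Ac) (ltW ct) tB') Gc.
    by move=> /addIr.
move=> s t As st tB; have At := le_trans As st; have sB := le_trans st tB.
by rewrite !uG// GE.
Qed.

End ContinuousWeakDerivative.

(** * Properties of global solutions *)

Section SolutionProperties.
Context {R : realType} {m r p q : nat} {h : R} {d : R -> 'rV[R]_p}
  {f : 'rV[R]_p * 'rV[R]_q * 'rV[R]_m -> 'rV[R]_m}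
  {T : (R -> 'rV[R]_(r * m)) -> (R -> 'rV[R]_q)}
  {y0 : nat -> R -> 'rV[R]_m} {yref : R -> 'rV[R]_m} {rhat : nat}
  {alpha gain phi : R -> R}.
Hypothesis H : setup h d f T y0 yref rhat alpha gain phi.
Local Notation mu := (@lebesgue_measure R).
Local Notation csol := (csol h d f T y0 yref rhat alpha gain phi).
Local Notation isol := (isol (h := h) (d := d) (f := f) (T := T) (y0 := y0) (yref := yref)
  (rhat := rhat) (alpha := alpha) (gain := gain) (phi := phi)).
Local Notation inD := (inD (r := r) yref rhat alpha phi).
Local Notation ctrl := (ctrl (r := r) yref rhat alpha gain phi).
Local Notation is_solution := (is_solution h d f T y0 yref rhat alpha gain phi).
Local Notation control := (control (r := r) h yref rhat alpha gain phi).
Local Notation td := (time_domain h).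
Local Notation yr k := (derive_in_n `[(0:R)%R, +oo[ k yref).
Local Notation Ipos := `[(0:R)%R, +oo[%classic.
Local Notation Ih := `[(- h)%R, +oo[%classic.

Variable (y : R -> 'rV[R]_m).
Hypothesis sy : is_solution +oo%E y.
Let x t : 'rV[R]_(r * m) := mkst (fun k => jet h +oo%E y k t).
Let J k := jet h +oo%E y k.

Let sx : isol +oo%E x. Proof. exact: (sol_isol H sy). Qed.
Let sol := sx.2.
Let oo0 : (0 < +oo :> \bar R)%E. Proof. by []. Qed.
Let domT (t : R) : (t%:E < +oo)%E. Proof. exact: ltry. Qed.
Let xE k t : (k < r)%N -> blk k (x t) = J k t. Proof. exact: blk_mkst. Qed.
Let hN0 : - h <= 0. Proof. exact: history_le0 H. Qed.
Let rr : (r.-1 < r)%N. Proof. by rewrite ltn_predL (st_r H). Qed.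

Lemma td_Ih : td +oo%E = Ih.
Proof.
apply/seteqP; split => t /=; rewrite in_itv/= andbT; first by case.
by move=> ht; split.
Qed.

Lemma x_global_continuous : {within Ih, continuous x}.
Proof.
apply: within_continuous_local => t /=; rewrite in_itv/= andbT => ht.
pose tau := Num.max 0 (t + 1).
have t0 : 0 <= tau by rewrite le_max lexx.
have tt : t + 1 <= tau by rewrite le_max lexx orbT.
have [cx _ _ _] := sol t0 (domT tau).
exists `[(- h)%R, tau]%classic, x, 1; split => //.
  by rewrite /= in_itv/= ht; lra.
move=> s; rewrite /= !in_itv/= andbT => hs; rewrite ltr_norml => /andP[_ st].
by split => //; rewrite hs; lra.
Qed.

Lemma control_eq : control +oo%E y = (fun t => ctrl t (x t)).
Proof. by apply/funext => t; apply/esym; apply: control_ctrl => k kr; exact: xE. Qed.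

Lemma ctrl_global_continuous : {within Ipos, continuous (fun t => ctrl t (x t))}.
Proof.
apply: within_continuous_local => t /=; rewrite in_itv/= andbT => t0.
have t1 : 0 <= t + 1 by rewrite addr_ge0.
have [cx _ Dx _] := sol t1 (domT _).
exists `[(0:R)%R, (t + 1)%R]%classic, (fun t => ctrl t (x t)), 1; split => //.
- by rewrite /= in_itv/= t0 lerDl ler01.
- exact: (ctrl_continuous H t1 cx Dx).
- move=> s; rewrite /= !in_itv/= andbT => s0; rewrite ltr_norml => /andP[_ st].
  by split => //; rewrite s0; lra.
Qed.

Lemma control_Linfty : Linfty Ipos (control +oo%E y).
Proof.
rewrite control_eq; split; first exact: continuous_vmeasurable ctrl_global_continuous.
have [U U0 HU] := ctrl_bounded H oo0 sol.
apply: (@le_lt_trans _ _ U%:E); last exact: ltry.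
apply: le_ess_sup_norm => //; apply: aeW => t /=; rewrite in_itv/= andbT => t0.
exact: HU.
Qed.

(** The weak derivative of order [r] on the half-line, with [T] applied to the state without
    freezing. *)
Definition top t := f (d t, T x t, ctrl t (x t)).

Lemma top_Linfty : vmeasurable Ipos top /\
  exists2 B : R, 0 <= B & {ae mu, forall t, Ipos t -> enorm (top t) <= B}.
Proof.
have [TL _ _ _] := st_T H; have [mT _] := TL _ x_global_continuous.
have [md _] := st_d H; split.
  apply: (nonlinearity_measurable (st_f H)) => //.
  exact: continuous_vmeasurable ctrl_global_continuous.
have [Bx Bx0 HBx] := sol_bounded H oo0 sol.
have [CT CT0 HCT] := T_bounded H Bx0.
have aT := HCT x x_global_continuous (fun t ht => HBx t ht (domT t)).
have [U U0 HU] := ctrl_bounded H oo0 sol; have [Bd Bd0 HBd] := d_bounded H.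
have [M M0 HM] := nonlinearity_bounded (st_f H) (Num.max Bd (Num.max CT U)).
exists (m%:R * M); first exact: mulr_ge0.
have := ae_and HBd aT; apply: ae_mono => t [g1 g2] /=; rewrite in_itv/= andbT => t0.
rewrite (le_trans (enorm_le_norm _))// ler_wpM2l//; apply: HM.
- by rewrite le_max g1.
- by rewrite !le_max g2 ?orbT.
- by rewrite !le_max (le_trans (norm_le_enorm _) (HU t t0 (domT t))) !orbT.
Qed.

Lemma top_primitive s t j : 0 <= s -> s <= t ->
  J r.-1 t 0 j - J r.-1 s 0 j = rint s t (fun u => top u 0 j).
Proof.
move=> s0 st; have t0 := le_trans s0 st.
have [iF E] := top_increment H sol j t0 (domT t) s0 st (lexx t).
rewrite -!xE// E; have [mG [B B0 HB]] := top_Linfty.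
have sub : `[s, t]%classic `<=` Ipos by exact: itv_pos_sub.
have [cx _ _ _] := sol t0 (domT t).
have aT := T_causal H (stopped_admissible H t0 cx) x_global_continuous t0.
have /aT {}aT : forall u, - h <= u -> u <= t -> stopped x t u = x u.
  by move=> u hu ut; rewrite /stopped min_l.
have ig : itg s t (fun u => top u 0 j).
  apply: (@ae_bounded_itg _ _ _ _ B); first exact: measurable_funS (mG j).
  apply: ae_mono HB => u hu /sub/hu; apply: le_trans.
  by rewrite (le_trans (coord_le_norm _ _))// norm_le_enorm.
apply: (itg_ae_eq (itg_measurable (itg_sub s0 (lexx t) iF)) ig _).2.
apply: ae_mono aT => u Tu /=; rewrite in_itv/= => /andP[su ut].
by rewrite /top Tu// (le_trans s0).
Qed.

Lemma jet_has_derivative k t : (k.+1 < r)%N -> - h <= t ->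
  has_derivative_in Ih (J k) t (J k.+1 t).
Proof.
move=> kr ht; have kr' := ltnW kr; have tdt : td +oo%E t by split.
have := blk_has_derivative H sx kr tdt; rewrite td_Ih xE//.
apply: (has_derivative_in_local (d := 1)) => //; first by rewrite xE.
by move=> s _; split => //; rewrite xE.
Qed.

Lemma jet_continuous k : (k < r)%N -> {within Ih, continuous (J k)}.
Proof.
move=> kr; have -> : J k = (fun t => blk k (x t)) by apply/funext => t; rewrite xE.
apply/subspace_continuousP => s sI; apply: cvg_blk.
by move/subspace_continuousP : x_global_continuous; exact.
Qed.

Lemma jet_primitive k s t j : (k.+1 < r)%N -> - h <= s -> s <= t ->
  J k t 0 j - J k s 0 j = rint s t (fun u => J k.+1 u 0 j).
Proof.
move=> kr hs st.
have sub : `[s, t]%classic `<=` Ih.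
  by move=> u /=; rewrite !in_itv/= andbT => /andP[/(le_trans hs)].
apply: (derivative_primitive (u := fun u => J k u 0 j) st).
  apply/subspace_continuousP => u uI; apply: cvg_to_coord.
  have : {within `[s, t], continuous (J k.+1)}.
    exact: continuous_subspaceW sub (jet_continuous kr).
  by move/subspace_continuousP; exact.
move=> u /andP[su ut].
have := jet_has_derivative kr (le_trans hs su) => /has_derivative_in_coord/(_ j).
by apply: (has_derivative_in_local (d := 1)) => // v _ vI; split => //; exact: sub.
Qed.

Lemma jet_Linfty (I : set R) k : measurable I -> I `<=` Ih -> (k < r)%N ->
  vmeasurable I (J k) /\
  exists2 B : R, 0 <= B & {ae mu, forall t, I t -> enorm (J k t) <= B}.
Proof.
move=> mI sub kr; split.
  apply: continuous_vmeasurable => //; apply: continuous_subspaceW sub _.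
  exact: jet_continuous.
have [B B0 HB] := sol_bounded H oo0 sol.
exists (m%:R * B); first exact: mulr_ge0.
apply: aeW => t /sub /=; rewrite in_itv/= andbT => ht.
rewrite (le_trans (enorm_le_norm _))// ler_wpM2l// -xE// (le_trans (blk_norm _ _))//.
exact: HB.
Qed.

Lemma Sobolev_pos : Sobolev_infty Ipos r y.
Proof.
pose Y k := if (k < r)%N then J k else top.
have -> : y = Y 0%N by rewrite /Y (st_r H).
have sub : Ipos `<=` Ih.
  by move=> t /=; rewrite !in_itv/= !andbT; exact: le_trans.
apply: Sobolev_of_primitives => // [k|k kr s t st].
  rewrite leq_eqVlt /Y => /predU1P[->|kr]; first by rewrite ltnn; exact: top_Linfty.
  by rewrite kr; exact: jet_Linfty.
move=> sI j; have s0 : 0 <= s.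
  by have := sI s; rewrite /= !in_itv/= andbT lexx st => /(_ isT).
rewrite /Y kr; case: ltnP => kr'; first by apply: jet_primitive => //; exact: le_trans s0.
have -> : k = r.-1 by apply/eqP; rewrite eqn_leq -ltnS prednK ?(st_r H)// kr -subn1 leq_subLR.
exact: top_primitive.
Qed.

Lemma Sobolev_h_pred : Sobolev_infty Ih r.-1 y.
Proof.
apply: (@Sobolev_of_primitives _ _ _ _ J) => // [k kr|k kr s t st sI j].
  by apply: jet_Linfty => //; rewrite -(prednK (st_r H)) ltnS.
have hs : - h <= s.
  by have := sI s; rewrite /= !in_itv/= andbT lexx st => /(_ isT).
by apply: jet_primitive => //; rewrite -(prednK (st_r H)) ltnS.
Qed.

(** Both the jet and [G] are weak derivatives of the initial function, of orders [r.-1] and [r], so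
    [G] is a first-order weak derivative of the continuous top jet. If [h = 0] the interval is a
    point. *)
Lemma initial_top_primitive (G : R -> 'rV[R]_m) : Linfty `[(- h)%R, 0%R]%classic G ->
  weak_derivative `[(- h)%R, 0%R]%classic r (y0 0%N) G ->
  forall s t j, - h <= s -> s <= t -> t <= 0 ->
    J r.-1 t 0 j - J r.-1 s 0 j = rint s t (fun u => G u 0 j).
Proof.
move=> [mG /ess_sup_norm_lty[B B0 HB]] wG s t j hs st t0.
have [hE|h0] := eqVneq h 0.
  have e : s = t by apply/eqP; rewrite eq_le st/= (le_trans t0)// -oppr0 -hE.
  by rewrite e subrr rint_point.
have h0' : - h < 0 by rewrite oppr_lt0 lt_neqAle eq_sym h0 (st_h H).
have sub : `[(- h)%R, 0%R]%classic `<=` Ih.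
  by move=> u /=; rewrite !in_itv/= andbT => /andP[].
have [_ [_ ini _ _ _]] := sy.
have Jy k u : (k < r)%N -> `[(- h)%R, 0%R]%classic u -> J k u = y0 k u.
  by move=> kr uI; apply: ini.
have wJ : weak_derivative `[(- h)%R, 0%R]%classic r.-1 (J 0%N) (J r.-1).
  apply: (@weak_derivative_iter _ _ _ J r.-1) => // i ir i'.
  have ir' : (i.+1 < r)%N by rewrite -(prednK (st_r H)) ltnS.
  have [mJ [BJ _ HBJ]] := jet_Linfty (measurable_itv `[(- h)%R, 0%R]) sub ir'.
  apply: (@weak_parts _ _ (measurable_itv _) _ _ BJ); first exact: mJ.
    apply: ae_mono HBJ => u hu /hu; apply: le_trans.
    by rewrite (le_trans (coord_le_norm _ _))// norm_le_enorm.
  move=> a b ab abI; apply: jet_primitive => //.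
  by have := abI a; rewrite /= !in_itv/= lexx ab => /(_ isT)/andP[].
have wG' : weak_derivative `[(- h)%R, 0%R]%classic r.-1.+1 (J 0%N) G.
  rewrite prednK ?(st_r H)// => theta th i; rewrite -(wG theta th i).
  apply: eq_Rintegral => u /set_mem uI; rewrite Jy// (st_r H)//.
have w1 := weak_derivative_step j wJ wG'.
apply: (weak1_continuous_primitive h0' _ (mG j) _ w1 hs st t0 (M := B)).
  apply/subspace_continuousP => u uI; apply: cvg_to_coord.
  have : {within `[(- h)%R, 0%R], continuous (J r.-1)}.
    exact: continuous_subspaceW sub (jet_continuous rr).
  by move/subspace_continuousP; exact.
apply: ae_mono HB => u hu /hu; apply: le_trans.
by rewrite (le_trans (coord_le_norm _ _))// norm_le_enorm.
Qed.

Lemma Sobolev_h : Sobolev_infty `[(- h)%R, 0%R]%classic r (y0 0%N) -> Sobolev_infty Ih r y.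
Proof.
move=> [G [_ /(_ r (leqnn r))[LG wG]]].
have ip := initial_top_primitive LG wG; have [mG /ess_sup_norm_lty[B1 B10 HB1]] := LG.
have [mtop [B2 B20 HB2]] := top_Linfty.
(* The weak derivative of order [r] need not be continuous at 0; continuity of the jet of order
   [r.-1] there is what makes the two pieces fit. *)
pose top' t := if t < 0 then G r t else top t.
have Btop : {ae mu, forall t, Ih t -> enorm (top' t) <= Num.max B1 B2}.
  have := ae_and HB1 HB2; apply: ae_mono => t [h1 h2] /=; rewrite in_itv/= andbT => ht.
  rewrite /top'; case: ltP => t0.
    by rewrite le_max h1//= in_itv/= ht ltW.
  by rewrite le_max h2 ?orbT//= in_itv/= t0.
have mtop' : vmeasurable Ih top'.
  move=> j; rewrite (_ : (fun t => top' t 0 j) =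
    (fun t => if t < 0 then G r t 0 j else top t 0 j)); last first.
    by apply/funext => t; rewrite /top'; case: ifP.
  have -> : Ih = `[(- h)%R, 0%R[%classic `|` Ipos.
    by rewrite -itv_bndbnd_setU//= ?bnd_simp.
  apply/measurable_funU => //; split.
    apply: (@eq_measurable_fun _ _ _ _ _ (fun t => G r t 0 j)).
      by move=> t /set_mem /=; rewrite in_itv/= => /andP[_ ->].
    apply: measurable_funS (mG j) => // t /=; rewrite !in_itv/= => /andP[-> t0].
    exact: ltW.
  apply: (@eq_measurable_fun _ _ _ _ _ (fun t => top t 0 j)); last exact: mtop.
  by move=> t /set_mem /=; rewrite in_itv/= andbT leNgt => /negbTE ->.
pose Y k := if (k < r)%N then J k else top'.
have -> : y = Y 0%N by rewrite /Y (st_r H).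
apply: Sobolev_of_primitives => // [k|k kr s t st].
  rewrite leq_eqVlt /Y => /predU1P[->|kr].
    rewrite ltnn; split => //; exists (Num.max B1 B2) => //.
    by rewrite le_max B10.
  by rewrite kr; exact: jet_Linfty.
move=> sI j; have hs : - h <= s.
  by have := sI s; rewrite /= !in_itv/= andbT lexx st => /(_ isT).
rewrite /Y kr; case: ltnP => kr'; first exact: jet_primitive.
have -> : k = r.-1 by apply/eqP; rewrite eqn_leq -ltnS prednK ?(st_r H)// kr -subn1 leq_subLR.
have it a b : - h <= a -> itg a b (fun u => top' u 0 j).
  move=> ha; have sub : `[a, b]%classic `<=` Ih.
    by move=> u /=; rewrite !in_itv/= andbT => /andP[/(le_trans ha)].
  apply: (@ae_bounded_itg _ _ _ _ (Num.max B1 B2)); first exact: measurable_funS (mtop' j).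
  apply: ae_mono Btop => u hu /sub/hu; apply: le_trans.
  by rewrite (le_trans (coord_le_norm _ _))// norm_le_enorm.
have neg a b : - h <= a -> a <= b -> b <= 0 ->
    J r.-1 b 0 j - J r.-1 a 0 j = rint a b (fun u => top' u 0 j).
  move=> ha ab b0; rewrite (ip a b j ha ab b0).
  apply: (itg_ae_eq _ (it a b ha) _).2.
    apply: measurable_funS (mG j) => // u /=; rewrite !in_itv/= => /andP[au ub].
    by rewrite (le_trans ha au) (le_trans ub b0).
  apply: ae_mono (ae_neq b) => u ub /=; rewrite in_itv/= => /andP[_ ub'].
  have -> // : top' u = G r u.
  rewrite /top' ifT// (lt_le_trans _ b0)// lt_neqAle ub' andbT; exact/eqP.
have pos a b : 0 <= a -> a <= b ->
    J r.-1 b 0 j - J r.-1 a 0 j = rint a b (fun u => top' u 0 j).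
  move=> a0 ab; rewrite (top_primitive j a0 ab).
  apply: eq_Rintegral => u /set_mem /=; rewrite in_itv/= => /andP[au _].
  by rewrite /top' ltNge (le_trans a0 au).
have [t0|t0] := leP t 0; first exact: neg.
have [s0|s0] := leP 0 s; first exact: pos.
rewrite (rint_split (ltW s0) (ltW t0) (it s t hs)) -neg ?(ltW s0)// -pos ?(ltW t0)//.
by ring.
Qed.

Lemma solution_bounded : prop_bounded (r := r) h y0 yref rhat alpha gain phi +oo%E y.
Proof.
split; [exact: control_Linfty|exact: Sobolev_pos|exact: Sobolev_h_pred|].
exact: Sobolev_h.
Qed.

Lemma rhat0 : (0 < rhat)%N. Proof. by have /andP[] := st_rhat H. Qed.

Lemma solution_funnel : prop_funnel yref phi y.
Proof.
have [k0 [k00 k01 Hk0]] := ek_margins H oo0 sol.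
have e1 t : 0 <= t -> phi t * enorm (y t - yref t) <= k0.
  move=> t0; have r1 : (0 < 1 <= r)%N by rewrite (st_r H).
  have := Hk0 1%N r1 t t0 (domT t); rewrite ekS /gk addr0 enormZ.
  rewrite (ger0_norm (st_phi_ge0 H t0)) /Eb /error_blocks rhat0 xE ?(st_r H)//.
split.
  by move=> t t0; split => //=; exact: le_lt_trans (e1 t t0) k01.
exists (Num.max k0 2^-1).
  rewrite lt_max invr_gt0 ltr0n orbT/= gt_max k01/=; lra.
by move=> t t0; rewrite le_max e1.
Qed.

Lemma error_derivative_jet k t : (k < r)%N -> 0 <= t ->
  error_derivative yref y k t = J k t - yr k t.
Proof.
elim: k t => // k ih t kr t0; have kr' := ltnW kr.
rewrite -[LHS]/(derive_in Ipos (error_derivative yref y k) t).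
have -> : derive_in Ipos (error_derivative yref y k) t =
    derive_in Ipos (fun s => J k s - yr k s) t.
  apply: (derive_in_local (d := 1)) => //; first exact: ih.
  by move=> s _; split => //=; rewrite in_itv/= andbT => s0; exact: ih.
apply: (@derive_inE _ _ _ _ t (t + 1)); rewrite ?ltrDl ?lexx ?lerDl ?ler01//.
  exact: itv_pos_sub.
have D1 : has_derivative_in Ipos (J k) t (J k.+1 t).
  have := jet_has_derivative kr (le_trans hN0 t0).
  apply: (has_derivative_in_local (d := 1)) => // s _ /=.
  by rewrite !in_itv/= !andbT => /(le_trans hN0).
exact: (has_derivative_inB D1 (st_ref_der H kr t0)).
Qed.

(** For [rhat = r] every block is an error derivative, so [phi] times its norm is at most a common
    [B], and the norm is below [eps] as soon as [phi t] exceeds [B / eps]. *)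
Lemma solution_asymptotic : prop_asymptotic (r := r) yref rhat phi y.
Proof.
move=> rE _ k kr.
have [B B0 HB] := phi_Eb_bounded H oo0 sol.
have EE t : 0 <= t -> phi t * enorm (error_derivative yref y k t) <= B.
  move=> t0; have := HB k kr t t0 (domT t).
  by rewrite error_derivative_jet// /Eb /error_blocks rE kr xE.
have main (eps : R) : 0 < eps -> forall t : R, 0 <= t -> B / eps < phi t ->
    enorm (error_derivative yref y k t) < eps.
  move=> e0 t t0; rewrite ltr_pdivrMr// => Bp.
  have p0 : 0 < phi t.
    by have := le_lt_trans B0 Bp; rewrite pmulr_lgt0.
  by rewrite -(ltr_pM2l p0) (le_lt_trans (EE t t0)).
split; first by move=> eps e0; exists (B / eps); exact: main.
move=> /cvgryPgt phioo; apply/cvgrPdist_lt => eps e0.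
have h1 := phioo (B / eps).
have h2 : \forall t \near +oo, 0 <= t :> R by exact: nbhs_pinfty_ge.
apply: filterS2 h1 h2 => t Bp t0; rewrite sub0r normrN.
by rewrite (le_lt_trans (norm_le_enorm _))//; exact: main.
Qed.

End SolutionProperties.

Section Works.
Context {R : realType} {m r p q : nat} {h : R} {d : R -> 'rV[R]_p}
  {f : 'rV[R]_p * 'rV[R]_q * 'rV[R]_m -> 'rV[R]_m}
  {T : (R -> 'rV[R]_(r * m)) -> (R -> 'rV[R]_q)}
  {y0 : nat -> R -> 'rV[R]_m} {yref : R -> 'rV[R]_m} {rhat : nat}
  {alpha gain phi : R -> R}.
Hypothesis H : setup h d f T y0 yref rhat alpha gain phi.
Local Notation is_solution := (is_solution h d f T y0 yref rhat alpha gain phi).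

(** Since every solution extends to a global one, this gives maximal extensions and also forces a
    maximal solution to be global. *)
Lemma solution_extends omega (y : R -> 'rV[R]_m) : is_solution omega y ->
  exists2 y' : R -> 'rV[R]_m, is_solution +oo%E y' & extends h omega +oo%E y y'.
Proof.
move=> sy; have [x' [sx' E]] := isol_global H (sol_isol H sy).
exists (fun t => blk 0 (x' t)); first exact: (isol_sol H sx').
move=> t [ht td]; rewrite E//.
have := @blk_mkst R r m (fun k => jet h omega y k t) 0%N (st_r H).
by move=> ->.
Qed.

Lemma works_of_setup : funnel_control_works h d f T y0 yref rhat alpha gain phi.
Proof.
split.
- have [omega [x sx]] := isol_exists H.
  by exists omega, (fun t => blk 0 (x t)); exact: (isol_sol H sx).
- move=> omega y sy; have [y' sy' ext] := solution_extends sy.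
  exists +oo%E, y'; split => //; first exact: leey.
  by split => // omega' y2; rewrite ltNge leey.
- move=> omega y [sy maxy].
  have oE : omega = +oo%E.
    apply: contrapT => /eqP; rewrite -ltey => lto.
    have [y' sy' ext] := solution_extends sy.
    exact: maxy lto sy' ext.
  rewrite oE in sy *; split => //.
  + exact: (solution_bounded H sy).
  + exact: (solution_funnel H sy).
  + exact: (solution_asymptotic H sy).
Qed.

End Works.

(** * Properties of the design parameters and of the high-gain condition *)

Section FunnelFacts.
Context {R : realType} (phi : R -> R).
Local Notation mu := (@lebesgue_measure R).
Hypothesis fphi : funnel_function phi.

Lemma funnel_AC a b : 0 <= a -> a <= b -> absolutely_continuous a b phi.
Proof.
have [_ lac _ _ _] := fphi; move=> a0 ab; apply: lac => //; exact: itv_pos_sub.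
Qed.

Lemma funnel_continuous : {within `[0%R, +oo[, continuous phi}.
Proof.
apply: within_continuous_local => t /=; rewrite in_itv/= andbT => t0.
exists `[(0:R)%R, (t + 1)%R]%classic, phi, 1; split => //.
- by rewrite /= in_itv/= t0 lerDl ler01.
- by apply: AC_continuous; apply: funnel_AC => //; rewrite addr_ge0.
- move=> s; rewrite /= !in_itv/= andbT => s0; rewrite ltr_norml => /andP[_ st].
  by split => //; rewrite s0; lra.
Qed.

Lemma funnel_growth : exists2 c : R, 0 < c & forall s t K : R, 0 <= s -> s <= t ->
  (forall u, s <= u -> u <= t -> phi u <= K) ->
  `|phi t - phi s| <= c * (1 + K) * (t - s).
Proof.
have [phi_ge0 _ _ _ [c c0 Hc]] := fphi; exists c => // s t K s0.
rewrite le_eqVlt => /predU1P[->|st] HK; first by rewrite !subrr normr0 mulr0.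
have [D [iD ED aD]] := AC_FTC st (funnel_AC s0 (ltW st)).
have id_ : itg s t D by apply: integrableS iD.
rewrite ED ?(ltW st) ?lexx//; apply: rint_abs_le => //; first exact: ltW.
have := ae_and (ae_and aD Hc) (ae_and (ae_neq s) (ae_neq t)).
apply: ae_mono => u [[Du Hu] [us ut]] /=; rewrite in_itv/= => /andP[su ut'].
have su' : s < u by rewrite lt_neqAle su andbT; apply/eqP => e; apply: us.
have ut'' : u < t by rewrite lt_neqAle ut' andbT; apply/eqP.
have Du' := Du _; rewrite su' ut'' in Du'.
have := Hu (le_trans s0 su); rewrite (is_derive_val (Du' isT)) => h1.
by rewrite (le_trans h1)// ler_pM2l// lerD2l HK.
Qed.

Lemma funnel_low (t1 : R) : 0 < t1 -> exists2 c : R, 0 < c & forall t, t1 <= t -> c <= phi t.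
Proof.
move=> t10; have [_ _ pos + _] := fphi.
rewrite /limf_einf oppe_gt0 => /ereal_inf_lt[_ [A nA <-] supA].
(* The lower limit is minus the upper limit of [- phi]; its positivity provides a neighbourhood [A]
   of infinity on which the supremum of [- phi] is negative. Before that neighbourhood the minimum
   over a compact interval serves. *)
have [c [c0 Hc]] : exists c : R, 0 < c /\ forall t, A t -> c <= phi t.
  have ub t : A t -> ((- phi t)%:E <= ereal_sup ((\- (fun t => (phi t)%:E))%E @` A))%E.
    by move=> At; apply: ereal_sup_ubound; exists t.
  case: (ereal_sup _) supA ub => [c| |]//=.
    rewrite lte_fin => c0 ub; exists (- c); split; first by rewrite oppr_gt0.
    by move=> t At; rewrite lerNl -lee_fin; exact: ub.
  by move=> _ ub; exists 1; split => // t /ub; rewrite leeNy_eq.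
case: nA => t2 [_ Ht2].
pose t3 := Num.max t1 (t2 + 1).
have t13 : t1 <= t3 by rewrite le_max lexx.
have cp : {within `[t1, t3], continuous phi}.
  apply: continuous_subspaceW funnel_continuous; exact: itv_pos_sub (ltW t10).
have [s] := EVT_min t13 cp; rewrite in_itv/= => /andP[ts st] Hs.
exists (Num.min c (phi s)).
  by rewrite lt_min c0 pos// (lt_le_trans t10).
move=> t t1t; rewrite ge_min; have [tt3|t3t] := leP t t3.
  by rewrite (Hs t) ?orbT// in_itv/= t1t.
by rewrite Hc//; apply: Ht2; apply: lt_trans t3t; rewrite lt_max ltrDl ltr01 orbT.
Qed.

End FunnelFacts.

Section AlphaFacts.
Context {R : realType} (alpha : R -> R).
Hypotheses (calpha : C_class `[(0:R)%R, 1%R[ 1 alpha)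
  (balpha : set_bij `[(0:R)%R, 1%R[ `[(1:R)%R, +oo[ alpha).

Lemma alpha_ge1 s : 0 <= s -> s < 1 -> 1 <= alpha s.
Proof.
have [fa _ _] := balpha; move=> s0 s1.
by have := fa s; rewrite /= !in_itv/= andbT s0 s1; apply.
Qed.

Lemma alpha_continuous : {within `[0%R, 1%R[, continuous alpha}.
Proof. exact: (calpha.1 0%N isT). Qed.

Lemma alpha_surjective a : 1 <= a -> exists s : R, [/\ 0 <= s, s < 1 & alpha s = a].
Proof.
have [_ _ sa] := balpha; move=> a1; have [|s] := sa a.
  by rewrite /= in_itv/= a1.
by rewrite /= in_itv/= => /andP[s0 s1] <-; exists s.
Qed.

Lemma alpha_lipschitz (b : R) : b < 1 -> exists2 L : R, 0 <= L &
  forall s t, 0 <= s -> s <= t -> t <= b -> `|alpha t - alpha s| <= L * (t - s).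
Proof.
move=> b1; have sub : `[0, b]%classic `<=` `[(0:R)%R, 1%R[%classic.
  by move=> u /=; rewrite !in_itv/= => /andP[-> /le_lt_trans]; apply.
have c1 : {within `[0, b], continuous (derive_in_n `[(0:R)%R, 1%R[ 1 alpha)}.
  exact: continuous_subspaceW sub (calpha.1 1%N isT).
have [L L0 HL] := within_bounded c1; exists L => // s t s0 st tb.
have sub2 : `[s, t]%classic `<=` `[0, b]%classic.
  by move=> u /=; rewrite !in_itv/= => /andP[su ut]; rewrite (le_trans s0 su) (le_trans ut).
have c2 := continuous_subspaceW sub2 c1.
rewrite (derivative_primitive (u := alpha) st c2).
  apply: rint_abs_le => //; first exact: continuous_itg.
  by apply: aeW => u /sub2 /=; rewrite in_itv/= => /andP[]; exact: HL.
move=> u sut; have uI : `[s, t]%classic u by rewrite /= in_itv.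
have := calpha.2 0%N isT u (sub u (sub2 u uI)).
by apply: (has_derivative_in_local (d := 1)) => // v _ vI; split => //; exact/sub/sub2.
Qed.

(** For [k < 1] the argument of [alpha] stays in the compact interval [[0, k ^+ 2]], where [alpha]
    is bounded and Lipschitz. *)
Lemma gamma_lipschitz m (k : R) : 0 <= k -> k < 1 -> exists2 L : R, 0 <= L &
  forall v w : 'rV[R]_m, enorm v <= k -> enorm w <= k ->
  enorm (gamma alpha v - gamma alpha w) <= L * enorm (v - w).
Proof.
move=> k0 k1; have k21 : k ^+ 2 < 1 by rewrite expr_lt1.
have [L L0 HL] := alpha_lipschitz k21.
have ca : {within `[0, k ^+ 2], continuous alpha}.
  apply: continuous_subspaceW alpha_continuous => s /=; rewrite !in_itv/=.
  by move=> /andP[-> /le_lt_trans]; apply.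
have [A A0 HA] := within_bounded ca.
have sqk (v : 'rV[R]_m) : enorm v <= k -> enorm v ^+ 2 <= k ^+ 2.
  by move=> vk; rewrite ler_sqr ?nnegrE ?enorm_ge0.
have HL2 s t : 0 <= s -> s <= k ^+ 2 -> 0 <= t -> t <= k ^+ 2 ->
    `|alpha t - alpha s| <= L * `|t - s|.
  move=> s0 sk t0 tk; have [st|/ltW ts] := leP s t.
    by rewrite (le_trans (HL s t s0 st tk))// ger0_norm ?subr_ge0.
  by rewrite distrC (distrC t) (le_trans (HL t s t0 ts sk))// ger0_norm ?subr_ge0.
exists (A + L * 2); first by rewrite addr_ge0// mulr_ge0.
move=> v w vk wk; have v0 := enorm_ge0 v; have w0 := enorm_ge0 w.
rewrite (_ : _ - _ = alpha (enorm v ^+ 2) *: (v - w) +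
  (alpha (enorm v ^+ 2) - alpha (enorm w ^+ 2)) *: w); last first.
  by rewrite /gamma scalerBr scalerBl addrA subrK.
rewrite (le_trans (enormD _ _))// !enormZ mulrDl lerD//.
  by rewrite ler_wpM2r ?enorm_ge0// HA ?sqr_ge0// sqk.
have h1 : `|enorm v ^+ 2 - enorm w ^+ 2| <= 2 * enorm (v - w).
  rewrite subr_sqr normrM mulrC; apply: ler_pM => //; last exact: enorm_dist_dist.
  by rewrite ger0_norm ?addr_ge0//; lra.
have h2 := HL2 _ _ (sqr_ge0 (enorm w)) (sqk w wk) (sqr_ge0 (enorm v)) (sqk v vk).
rewrite -[leRHS]mulr1; apply: ler_pM => //; last by rewrite (le_trans wk)// ltW.
by rewrite (le_trans h2)// -mulrA ler_wpM2l.
Qed.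

End AlphaFacts.

Section HighGain.
Context {R : realType} {m p q : nat}
  (f : 'rV[R]_p * 'rV[R]_q * 'rV[R]_m -> 'rV[R]_m).
Hypotheses (f_cont : continuous f) (m_gt0 : (0 < m)%N).

Lemma unit_vector : exists v : 'rV[R]_m, enorm v = 1.
Proof.
exists (delta_mx 0 (Ordinal m_gt0)); rewrite /enorm /dotp (bigD1 (Ordinal m_gt0))//=.
rewrite big1 ?addr0 ?mxE ?eqxx ?mulr1 ?sqrtr1// => i ni.
by rewrite mxE (negbTE ni) andbF mul0r.
Qed.

(** The minimum is at most its value at one fixed unit vector, which exists because [m] is positive,
    and [f] is bounded on compact sets. *)
Lemma chi_bounded_above vs Kp Kq (B : R) : vs <= 1 -> compact Kp -> Kp !=set0 ->
  compact Kq -> Kq !=set0 -> exists C : R, forall s, `|s| <= B -> chi f vs Kp Kq s <= C.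
Proof.
move=> vs1 cKp [a Ka] cKq [b Kb]; have [v v1] := unit_vector.
have [Bp Bp0 HBp] := compact_norm_le cKp; have [Bq Bq0 HBq] := compact_norm_le cKq.
have [M M0 HM] := nonlinearity_bounded f_cont (Num.max Bp (Num.max Bq B)).
have bd (s : R) a' b' (v' : 'rV[R]_m) : `|s| <= B -> Kp a' -> Kq b' -> enorm v' <= 1 ->
    `|dotp v' (f (a', b', - s *: v'))| <= m%:R * M.
  move=> sB Ka' Kb' v'1; rewrite (le_trans (dotp_norm_le _ _))// -[leRHS]mul1r.
  apply: ler_pM => //; rewrite ?enorm_ge0//.
  rewrite (le_trans (enorm_le_norm _))// ler_wpM2l//; apply: HM.
  - by rewrite le_max HBp.
  - by rewrite !le_max HBq ?orbT.
  - rewrite !le_max normrZ normrN; apply/orP; right; apply/orP; right.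
    rewrite -[leRHS]mulr1; apply: ler_pM => //.
    by rewrite (le_trans (norm_le_enorm _)).
exists (m%:R * M) => s sB.
apply: (@le_trans _ _ (dotp v (f (a, b, - s *: v)))).
  apply: ge_inf.
    exists (- (m%:R * M)) => _ [a' [b' [v' [Ka' Kb' /andP[_ v'1] ->]]]].
    by have := bd s a' b' v' sB Ka' Kb' v'1; rewrite ler_norml => /andP[].
  by exists a, b, v; rewrite v1 vs1 lexx.
by rewrite (le_trans (ler_norm _))// bd// v1.
Qed.

(** Large values of [chi] cannot occur at bounded arguments, so they occur at arbitrarily large
    [|s|]. *)
Lemma high_gain_unbounded (S : set R) : high_gain_on S f ->
  exists2 vs : R, 0 < vs < 1 &
    forall Kp Kq, compact Kp -> Kp !=set0 -> compact Kq -> Kq !=set0 ->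
    forall B C : R, exists s : R, [/\ S s, B < `|s| & C < chi f vs Kp Kq s].
Proof.
move=> [vs vs01 Hvs]; exists vs => // Kp Kq cKp Kp0 cKq Kq0 B C.
have /andP[_ vs1] := vs01.
have [C' HC'] := chi_bounded_above B (ltW vs1) cKp Kp0 cKq Kq0.
have : ((Num.max C C')%:E < ereal_sup [set (chi f vs Kp Kq s)%:E | s in S])%E.
  by rewrite Hvs// ltry.
move=> /ereal_sup_gt[_ [s Ss <-]]; rewrite lte_fin gt_max => /andP[Cs C's].
exists s; split => //; rewrite ltNge; apply/negP => /HC'.
by rewrite leNgt C's.
Qed.

Definition gain_condition (gain : R -> R) : Prop := exists2 vs : R, 0 < vs < 1 &
  forall Kp Kq, compact Kp -> Kp !=set0 -> compact Kq -> Kq !=set0 ->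
  forall A C : R, exists a : R, A < a /\ C < chi f vs Kp Kq (gain a).

(** [N] is bounded on [[0, A]]; a value beyond that bound is attained by surjectivity, hence after
    [A]. *)
Lemma gain_surjective (N : R -> R) : {within `[(0:R)%R, +oo[, continuous N} ->
  set_surj `[(0:R)%R, +oo[ setT N -> high_gain f -> gain_condition N.
Proof.
move=> cN sN /high_gain_unbounded[vs vs01 Hvs]; exists vs => // Kp Kq cKp Kp0 cKq Kq0 A C.
have cNA : {within `[(0:R)%R, A], continuous N}.
  by apply: continuous_subspaceW cN; exact: itv_pos_sub.
have [B B0 HB] := within_bounded cNA.
have [s [_ Bs Cs]] := Hvs Kp Kq cKp Kp0 cKq Kq0 B C.
have [a + aE] := sN s I; rewrite /= in_itv/= andbT => a0.
exists a; split; last by rewrite aE.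
by rewrite ltNge; apply/negP => /(HB a a0); rewrite aE leNgt Bs.
Qed.

Lemma gain_negative : negative_definite_high_gain f -> gain_condition (fun s => s).
Proof.
move=> /high_gain_unbounded[vs vs01 Hvs]; exists vs => // Kp Kq cKp Kp0 cKq Kq0 A C.
have [s [+ Bs Cs]] := Hvs Kp Kq cKp Kp0 cKq Kq0 A C.
by rewrite /= in_itv/= andbT => s0; exists s; rewrite gtr0_norm in Bs.
Qed.

Lemma gain_positive : positive_definite_high_gain f -> gain_condition (fun s => - s).
Proof.
move=> /high_gain_unbounded[vs vs01 Hvs]; exists vs => // Kp Kq cKp Kp0 cKq Kq0 A C.
have [s [+ Bs Cs]] := Hvs Kp Kq cKp Kp0 cKq Kq0 A C.
by rewrite /= in_itv/= => s0; exists (- s); rewrite opprK; rewrite ltr0_norm in Bs.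
Qed.

End HighGain.

Theorem theorem1p9 (R : realType) (m r p q : nat) (h : R)
  (d : R -> 'rV[R]_p)
  (f : 'rV[R]_p * 'rV[R]_q * 'rV[R]_m -> 'rV[R]_m)
  (T : (R -> 'rV[R]_(r * m)) -> (R -> 'rV[R]_q))
  (y0 : nat -> R -> 'rV[R]_m) (yref : R -> 'rV[R]_m) (rhat : nat)
  (alpha N phi : R -> R)
  (m_gt0 : (0 < m)%N) (r_gt0 : (0 < r)%N)
  (system : system_class h d f T)
  (init : initial_data (r := r) h y0)
  (* y_ref is an element of W^(r,oo), given by its continuous representative *)
  (ref_sobolev : Sobolev_infty `[0, +oo[ r yref)
  (ref_continuous : {within `[0, +oo[, continuous yref})
  (rhat_range : (1 <= rhat <= r)%N)
  (design : design_parameters r rhat alpha N phi)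
  (init_funnel : initially_in_funnel (r := r) y0 yref rhat alpha phi) :
  let works gain :=
    funnel_control_works h d f T y0 yref rhat alpha gain phi in
  [/\ works N,
      negative_definite_high_gain f -> works (fun s => s) &
      positive_definite_high_gain f -> works (fun s => - s)].
Proof.
move=> works; have [_ h0 Ld [f_cont hgf] TT] := system.
have [fphi bphi [cN sN] [calpha balpha]] := design.
have [rc rd rb rl] := reference_facts r_gt0 ref_sobolev ref_continuous.
have mk gain : {within `[(0:R)%R, +oo[, continuous gain} -> gain_condition f gain -> works gain.
  move=> cg hg; apply: works_of_setup; split => //.
  - exact: funnel_continuous.
  - by have [] := fphi.
  - exact: funnel_growth.
  - exact: funnel_low.
  - exact: alpha_ge1.
  - exact: alpha_continuous.
  - exact: alpha_surjective.
  - exact: gamma_lipschitz.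
split.
- by apply: mk => //; exact: gain_surjective.
- move=> hg; apply: mk; last exact: gain_negative.
  by apply: continuous_subspaceT => x; exact: cvg_id.
- move=> hg; apply: mk; last exact: gain_positive.
  by apply: continuous_subspaceT => x; apply: cvgN; exact: cvg_id.
Qed.
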